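(* Let $k\neq 0$ be real, let $n\ge 2$, and let $K\subset\mathbb{R}^n$ be an $n$-dimensional rectangle. Suppose that (i) $m=\chi_K\varphi$ with $\varphi\in C^\infty(\mathbb{R}^n)$ and $\varphi(x_0)\neq 0$, where $x_0$ is a corner of $K$ and $\chi_K$ is the characteristic function of $K$; (ii) the pair $(u^+,v^0)$ are interior transmission eigenfunctions of $m$ (at wavenumber $k$) in $\Omega=\operatorname{supp} m$. Then $v^0$ cannot be extended as an incident wave, i.e. as a solution of $(\Delta+k^2)v^0=0$, to any open neighborhood of the corner $x_0$.
   Context: An $n$-dimensional rectangle is a (possibly rotated and translated) product of $n$ compact intervals of positive length; its corners are its vertices. Interior transmission eigenfunctions of $m$ in $\Omega$ at wavenumber $k$ are nontrivial $u^+$ and $v^0$ satisfying $$(\Delta+k^2)v^0=0\ \text{ in }\Omega,\qquad (\Delta+k^2(1-m))u^+=k^2 m v^0\ \text{ in }\Omega,\qquad u^+|_{\partial\Omega}=0,\quad \tfrac{\partial u^+}{\partial\nu}\big|_{\partial\Omega}=0.$$ Here $u^+\in H^2_0(\Omega)$ (so $u^+$ extends by zero to all of $\mathbb{R}^n$), and $v^0\in L^2(\Omega)$, $\Delta v^0\in L^2(\Omega)$.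
   Formalization: ''Nontrivial'' is required of both u^+ and v^0 on every connected component of the interior of supp m; if that interior is disconnected, the literal claim fails (eigenfunctions living on a piece away from x_0 and vanishing near x_0). *)

(* Defs.v *)
From HB Require Import structures.
From mathcomp Require Export all_boot all_order all_algebra.
From mathcomp Require Export all_classical all_reals all_analysis.
From mathcomp Require Export complex.
Set Implicit Arguments.
Unset Strict Implicit.
Unset Printing Implicit Defensive.
Import Order.TTheory GRing.Theory Num.Theory.
Import numFieldNormedType.Exports.
Local Open Scope classical_set_scope.
Local Open Scope ring_scope.

Section measurable_row.
Context {d} {T : measurableType d} {n : nat}.

Let coors : 'I_n -> 'rV[T]_n -> T := fun i x => x ord0 i.

Let row_set0 : g_sigma_preimage coors set0.
Proof. exact: sigma_algebra0. Qed.

Let row_setC A : g_sigma_preimage coors A -> g_sigma_preimage coors (~` A).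
Proof. exact: sigma_algebraC. Qed.

Let row_bigcup (F : _^nat) : (forall i, g_sigma_preimage coors (F i)) ->
  g_sigma_preimage coors (\bigcup_i (F i)).
Proof. exact: sigma_algebra_bigcup. Qed.

(* The product sigma-algebra; for T = R it is the Borel sigma-algebra of R^n. *)
HB.instance Definition _ := @isMeasurable.Build (measure_tuple_display d)
  'rV[T]_n (g_sigma_preimage coors) row_set0 row_setC row_bigcup.

End measurable_row.

Lemma measurable_rVP d1 d2 (T1 : measurableType d1) (T2 : measurableType d2) n
    (f : T1 -> 'rV[T2]_n) :
  (forall i, measurable_fun [set: T1] (fun x => f x ord0 i)) ->
  measurable_fun [set: T1] f.
Proof.
move=> mf _ A mA; rewrite setTI.
suff: g_sigma_preimage (fun i (x : 'rV[T2]_n) => x ord0 i) `<=`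
  [set B | measurable (f @^-1` B)] by apply.
apply: smallest_sub.
  split=> [|B mB|F mF] /=.
  - by rewrite preimage_set0.
  - by rewrite setTD -preimage_setC; exact: measurableC.
  - by rewrite preimage_bigcup; exact: bigcupT_measurable.
case: n => [|n] in f mf {A mA} *; first by rewrite big_ord0.
rewrite -bigcup_mkord_ord; apply: bigcup_sub => i _ _ [B mB <-] /=.
by rewrite setTI -comp_preimage -[X in measurable X]setTI; exact: mf.
Qed.

Lemma measurable_rV_coord d (T : measurableType d) n (i : 'I_n) :
  measurable_fun [set: 'rV[T]_n] (fun x => x ord0 i).
Proof.
move=> _ Y mY; rewrite setTI; apply: sub_sigma_algebra => /=.
rewrite -bigcup_seq/=; exists i => /=; first by rewrite mem_index_enum.
by exists Y => //; rewrite setTI.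
Qed.

Section lebesgue_rV.
Context {R : realType}.

Definition rV_cons n (p : measurableTypeR R * 'rV[R]_n) : 'rV[R]_n.+1 :=
  row_mx (const_mx p.1 : 'rV_1) p.2.

Definition rV_uncons n (x : 'rV[R]_n.+1) : measurableTypeR R * 'rV[R]_n :=
  (x ord0 ord0, \row_i x ord0 (lift ord0 i)).

Lemma rV_cons0 n (p : measurableTypeR R * 'rV[R]_n) : rV_cons p ord0 ord0 = p.1.
Proof.
rewrite /rV_cons (_ : ord0 = lshift n (ord0 : 'I_1)); last exact: val_inj.
by rewrite (@row_mxEl _ 1 1 n) mxE.
Qed.

Lemma rV_consS n (p : measurableTypeR R * 'rV[R]_n) i :
  rV_cons p ord0 (lift ord0 i) = p.2 ord0 i.
Proof.
rewrite /rV_cons (_ : lift ord0 i = rshift 1 i); last exact: val_inj.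
by rewrite (@row_mxEr _ 1 1 n).
Qed.

Lemma rV_consK n : cancel (@rV_cons n) (@rV_uncons n).
Proof.
move=> p; rewrite /rV_uncons rV_cons0 [RHS]surjective_pairing.
by congr (_, _); apply/rowP => i; rewrite mxE rV_consS.
Qed.

Lemma measurable_rV_cons n : measurable_fun setT (@rV_cons n).
Proof.
apply: measurable_rVP => i; case: (unliftP ord0 i) => [j|] ->.
- rewrite (_ : (fun _ => _) =
    (fun x : 'rV[R]_n => x ord0 j) \o snd); last first.
    by apply/funext => p /=; rewrite rV_consS.
  by apply: measurableT_comp => //; exact: measurable_rV_coord.
- rewrite (_ : (fun _ => _) = fst) //.
  by apply/funext => p /=; rewrite rV_cons0.
Qed.

Lemma measurable_rV_uncons n : measurable_fun setT (@rV_uncons n).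
Proof.
apply: measurable_fun_pair; first exact: measurable_rV_coord.
apply: measurable_rVP => i.
rewrite (_ : (fun _ => _) = (fun x : 'rV[R]_n.+1 => x ord0 (lift ord0 i))).
  exact: measurable_rV_coord.
by apply/funext => x; rewrite mxE.
Qed.

Section step.
Context n (mu : {sigma_finite_measure set 'rV[R]_n -> \bar R}).

Definition lebesgue_rV_step : set 'rV[R]_n.+1 -> \bar R :=
  pushforward ((@lebesgue_measure R) \x mu)%E (@rV_cons n).

Let leb_prod :
    {measure set (measurableTypeR R * 'rV[R]_n)%type -> \bar R} :=
  ((@lebesgue_measure R) \x mu)%E.

Let step_leb_prod : lebesgue_rV_step = pushforward leb_prod (@rV_cons n).
Proof. by []. Qed.

Let step0 : lebesgue_rV_step set0 = 0%E.
Proof. by rewrite step_leb_prod /pushforward preimage_set0 measure0. Qed.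

Let step_ge0 A : (0 <= lebesgue_rV_step A)%E.
Proof. by rewrite step_leb_prod /pushforward measure_ge0. Qed.

Let step_sigma_additive : semi_sigma_additive lebesgue_rV_step.
Proof.
exact: (@measure_semi_sigma_additive _ _ _
  (measure_function_pushforward__canonical__measure_function_Measure
     leb_prod (@measurable_rV_cons n))).
Qed.

HB.instance Definition _ := isMeasure.Build _ _ _ lebesgue_rV_step
  step0 step_ge0 step_sigma_additive.

Let sigma_finite_step : sigma_finite setT lebesgue_rV_step.
Proof.
have /sigma_finiteP[F [TF ndF Foo]] := sigma_finiteT (@lebesgue_measure R).
have /sigma_finiteP[G [TG ndG Goo]] := sigma_finiteT mu.
exists (fun i => @rV_uncons n @^-1` (F i `*` G i)).
  rewrite -preimage_bigcup -[LHS](preimage_setT (@rV_uncons n)).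
  congr (_ @^-1` _); rewrite -setXTT TF TG predeqE => -[x y]; split.
    move=> [/= [i _ Fix] [j _ Gjy]]; exists (maxn i j) => //; split.
    - by move: x Fix; exact/subsetPset/ndF/leq_maxl.
    - by move: y Gjy; exact/subsetPset/ndG/leq_maxr.
  by move=> [i _ []/= ? ?]; split; exists i.
move=> i; have [mF Fi] := Foo i; have [mG Gi] := Goo i; split.
  rewrite -[X in measurable X]setTI; apply: measurable_rV_uncons => //.
  exact: measurableX.
rewrite step_leb_prod /pushforward -comp_preimage.
rewrite (_ : _ \o _ = id) ?preimage_id; last first.
  by apply/funext => x; exact: rV_consK.
by rewrite /leb_prod /= product_measure1E// lte_mul_pinfty// ge0_fin_numE.
Qed.

HB.instance Definition _ := Measure_isSigmaFinite.Build _ _ _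
  lebesgue_rV_step sigma_finite_step.

End step.

(* n-dimensional Lebesgue measure, on Borel sets.                             *)
Fixpoint lebesgue_rV n : {sigma_finite_measure set 'rV[R]_n -> \bar R} :=
  match n with
  | 0%N => \d_(0 : 'rV[R]_0)
  | n'.+1 => lebesgue_rV_step (lebesgue_rV n')
  end.

End lebesgue_rV.

Lemma lebesgue_rV_box (R : realType) n (a b : 'I_n -> R) :
  (forall i, a i <= b i) ->
  lebesgue_rV n [set x : 'rV[R]_n | forall i, a i <= x ord0 i <= b i] =
  (\prod_(i < n) (b i - a i))%:E.
Proof.
elim: n a b => [|n IHn] a b ab /=.
  rewrite big_ord0 diracE mem_set//= => -[]//.
rewrite /lebesgue_rV_step /pushforward.
rewrite (_ : _ @^-1` _ = `[a ord0, b ord0] `*`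
  [set x : 'rV[R]_n | forall i : 'I_n, a (lift ord0 i) <= x ord0 i <= b (lift ord0 i)]).
  rewrite product_measure1E; last 2 first.
  - exact: measurable_itv.
  - rewrite (_ : [set _ | _] = \bigcap_(i in [set: 'I_n])
      ((fun x : 'rV[R]_n => x ord0 i) @^-1` `[a (lift ord0 i), b (lift ord0 i)])).
      apply: fin_bigcap_measurable => // i _.
      rewrite -[X in measurable X]setTI.
      by apply: measurable_rV_coord => //; exact: measurable_itv.
    apply/seteqP; split => x /= xab i; first by move=> _; rewrite /= in_itv/=.
    by have := xab i I; rewrite /= in_itv/=.
  have leb_itv : lebesgue_measure (`[a ord0, b ord0] : set (measurableTypeR R))
      = (b ord0 - a ord0)%:E.
    rewrite lebesgue_measure_itv/= lte_fin; case: ltP => // ba.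
    by congr (_%:E); apply/esym/eqP; rewrite subr_eq0 eq_le ba ab.
  by rewrite IHn// big_ord_recl EFinM; congr (_ * _)%E; exact: leb_itv.
apply/seteqP; split => p /=.
- move=> pab; split => [|i]; first by have := pab ord0; rewrite rV_cons0 in_itv/=.
  by have := pab (lift ord0 i); rewrite rV_consS.
- move=> [p1 p2] i; case: (unliftP ord0 i) => [j|] ->; first by rewrite rV_consS.
  by move: p1; rewrite rV_cons0 in_itv/=.
Qed.

Section smooth_functions.
Context {R : realType} {n : nat}.
Implicit Types (f : 'rV[R]_n -> R) (D : set 'rV[R]_n) (s : seq 'I_n).

(* dpart [:: i1; ...; ir] f = d_{i1} ... d_{ir} f                             *)
Definition dpart s f : 'rV[R]_n -> R :=
  foldr (fun i g => fun x => 'D_(delta_mx ord0 i) g x) f s.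

Definition smooth f := forall s,
  continuous (dpart s f) /\
  forall (i : 'I_n) x, derivable (dpart s f) x (delta_mx ord0 i).

Definition laplacian f : 'rV[R]_n -> R :=
  fun x => \sum_(i < n) dpart [:: i; i] f x.

Definition supp (V : nmodType) (f : 'rV[R]_n -> V) : set 'rV[R]_n :=
  closure [set x | f x != 0].

Definition test_function D f :=
  [/\ smooth f, compact (supp f) & supp f `<=` D].

End smooth_functions.

Section distributions.
Context {R : realType} {n : nat}.
Implicit Types (f g : 'rV[R]_n -> R) (D : set 'rV[R]_n) (s : seq 'I_n).
Local Notation leb := (lebesgue_rV n : {measure set 'rV[R]_n -> \bar R}).

Definition locally_integrable_rV D f := [/\ open D, measurable_fun D f &
  forall A, A `<=` D -> compact A -> leb.-integrable A (EFin \o f)].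

Definition L2 D f := f \_ D \in Lfun leb 2%:E.

Definition weak_partial D s f g :=
  [/\ locally_integrable_rV D f, locally_integrable_rV D g &
    forall psi, test_function D psi ->
      \int[leb]_(x in D) (f x * dpart s psi x) =
      (-1) ^+ size s * \int[leb]_(x in D) (g x * psi x)].

Definition weak_laplacian D f g :=
  [/\ locally_integrable_rV D f, locally_integrable_rV D g &
    forall psi, test_function D psi ->
      \int[leb]_(x in D) (f x * laplacian psi x) =
      \int[leb]_(x in D) (g x * psi x)].

(* H^2_0(D): the closure of C^oo_c(D) in H^2(D); g s is the weak derivative   *)
(* of f along the multi-index s, of order at most 2.                          *)
Definition H20 D f := exists g : seq 'I_n -> 'rV[R]_n -> R,
  (forall s, (size s <= 2)%N -> L2 D (g s) /\ weak_partial D s f (g s)) /\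
  exists psi : nat -> 'rV[R]_n -> R,
    (forall j, test_function D (psi j)) /\
    forall s, (size s <= 2)%N ->
      (fun j => Lnorm leb 2%:E (EFin \o ((dpart s (psi j) \- g s) \_ D)))
        @ \oo --> 0%E.

End distributions.

Local Open Scope complex_scope.

Section complex_valued.
Context {R : realType} {n : nat}.
Implicit Types (D : set 'rV[R]_n) (f g : 'rV[R]_n -> R[i]).

(* Complex-valued functions are handled through their real and imaginary      *)
(* parts; testing against real test functions is enough for linear equations. *)
Definition smoothC f :=
  smooth (fun x => complex.Re (f x)) /\ smooth (fun x => complex.Im (f x)).

Definition L2C D f :=
  L2 D (fun x => complex.Re (f x)) /\ L2 D (fun x => complex.Im (f x)).

Definition H20C D f :=
  H20 D (fun x => complex.Re (f x)) /\ H20 D (fun x => complex.Im (f x)).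

Definition weak_laplacianC D f g :=
  weak_laplacian D (fun x => complex.Re (f x)) (fun x => complex.Re (g x)) /\
  weak_laplacian D (fun x => complex.Im (f x)) (fun x => complex.Im (g x)).

Definition ae_eq_on D f g :=
  {ae (lebesgue_rV n : {measure set 'rV[R]_n -> \bar R}),
    forall x, D x -> f x = g x}.

(* (Delta + k^2 q) f = h in D, in the sense of distributions                  *)
Definition helmholtz D (k : R) (q f h : 'rV[R]_n -> R[i]) :=
  weak_laplacianC D f (fun x => h x - (k ^+ 2)%:C * q x * f x).

(* An eigenvalue problem on a disconnected open set splits into independent   *)
(* problems on the connected components, so "nontrivial" is read on each of   *)
(* them; on a connected D it is the usual condition (nontrivial_connected).   *)
(* Nontriviality on the union only would not do: if m has one piece of its    *)
(* support at a corner and another one, elsewhere, carrying a compactly       *)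
(* supported u and a plane wave v, then extending both by 0 to the first      *)
(* piece gives a pair for which v = 0 near the corner.                        *)
Definition nontrivial_on D f := forall x, D x ->
  ~ ae_eq_on (connected_component D x) f (fun=> 0).

Lemma nontrivial_connected D f : connected D -> D !=set0 ->
  nontrivial_on D f <-> ~ ae_eq_on D f (fun=> 0).
Proof.
move=> cO [x0 Ox0]; split=> [/(_ _ Ox0)|nf x Ox].
  by rewrite connected_component_id.
by rewrite connected_component_id.
Qed.

(* Omega is a closed set (it will be supp m); the equations are posed in its  *)
(* interior. The two boundary conditions on u are those built in H^2_0.       *)
Definition transmission_eigenfunctions (k : R) (m : 'rV[R]_n -> R[i])
    (Omega : set 'rV[R]_n) (u v : 'rV[R]_n -> R[i]) :=
  let D := interior Omega in
  [/\ H20C D u,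
      L2C D v /\ (exists2 lap_v, L2C D lap_v & weak_laplacianC D v lap_v),
      helmholtz D k (fun=> 1) v (fun=> 0),
      helmholtz D k (fun x => 1 - m x) u (fun x => (k ^+ 2)%:C * m x * v x) &
      nontrivial_on D u /\ nontrivial_on D v].

End complex_valued.

Record rectangle (R : realType) (n : nat) := Rectangle {
  rect_rot : 'M[R]_n;
  rect_trans : 'rV[R]_n;
  rect_lo : 'rV[R]_n;
  rect_hi : 'rV[R]_n;
  rect_rot_orth : rect_rot *m rect_rot^T = 1%:M;
  rect_rot_det : \det rect_rot = 1;
  rect_lo_lt_hi : forall i, rect_lo ord0 i < rect_hi ord0 i }.

Definition rect_set (R : realType) n (K : rectangle R n) : set 'rV[R]_n :=
  [set y *m rect_rot K + rect_trans K | y in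
    [set y : 'rV[R]_n | forall i,
      rect_lo K ord0 i <= y ord0 i <= rect_hi K ord0 i]].

Definition corner (R : realType) n (K : rectangle R n) : set 'rV[R]_n :=
  [set y *m rect_rot K + rect_trans K | y in
    [set y : 'rV[R]_n | forall i, y ord0 i = rect_lo K ord0 i \/
                       y ord0 i = rect_hi K ord0 i]].

(* Main.v *)
(** Zero Cauchy data allow u to be extended by zero, so that the equation for u
holds across the boundary of the support of m. If v extended to a solution w
near the corner, w would be smooth there (Weyl's lemma; e^{k s} w(x) is harmonic
in (s, x)). In coordinates where the support is the orthant {z_i > 0}, test the
equation with f e, for a cut-off f and the harmonic exponential
e = exp (- l1 z_0 - l2 z_1), l1 = t (1 + i s), l2 = t (1 - i s), s = +-1, which
decays inside the orthant as t tends to infinity. A bootstrap in powers of 1/t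
bounds the terms containing u, and hence the integral of phi w f e over the
orthant, by one power of 1/t more than the order that the first nonvanishing
derivatives of w on the edge {z_0 = z_1 = 0} would produce. By the Helmholtz
equation these derivatives are, up to sign, only two functions on the edge, and
the two choices of s make both vanish: w is flat on the edge, so w = 0 near
the corner. Unique continuation then kills v on a whole component of the interior of
supp m. *)

From HB Require Import structures.
Require Import Defs.
From mathcomp Require Import ring lra zify measurable_realfun.
Set Implicit Arguments.
Unset Strict Implicit.
Unset Printing Implicit Defensive.
Import Order.TTheory GRing.Theory Num.Theory.
Import numFieldNormedType.Exports.
Local Open Scope classical_set_scope.
Local Open Scope complex_scope.
Local Open Scope ring_scope.

(** The extended [u] is merely integrable, so its pairing with [e] is a priori only O(1), while the
    corner integral of a factor vanishing to order N on the edge is already of size t^-(N+2); the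
    bootstrap has to close this gap. It can because l1^2 + l2^2 = 2 t^2 (1 - s^2) = 0: the Laplacian
    of [f e] grows only like t, through the product of the two gradients. A weight z_0^m on [f] is
    worth t^-m against [e], and differentiating it in that product isolates the pairing with
    z_0^(m-1) f; on the other side a factor z_0 raises the order of vanishing by one, so weighted
    test functions already satisfy the wanted bound there. [e] is constant along the other n - 2
    coordinates: localisation along the edge comes from [f], which is arbitrary there. In the
    leading coefficient the transverse derivatives of order N carry weights in geometric progression
    of ratio - i s, and [phi] factors out, being nonzero near the corner. Passing from the edge to
    an open set uses real analyticity along coordinate lines only, with constants independent of the
    solution; these come from a mean value formula with smooth kernels. *)

(* Locked: unifying iterated derivatives by unfolding is very expensive. *)
HB.lock Definition pd (R : realType) n (i : 'I_n) (f : 'rV[R]_n -> R) : 'rV[R]_n -> R :=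
  fun x => 'D_(delta_mx ord0 i) f x.
Canonical pd_unlockable := Unlockable pd.unlock.

(** * Smooth functions *)

Section calculus.
Context {R : realType}.

Lemma pdE n (i : 'I_n) (f : 'rV[R]_n -> R) x : pd i f x = 'D_(delta_mx ord0 i) f x.
Proof. by rewrite unlock. Qed.

Definition C1 n (f : 'rV[R]_n -> R) := continuous f /\
  forall i : 'I_n, (forall x, derivable f x (delta_mx ord0 i)) /\
    continuous (pd i f).

Lemma is_derive_line (V : normedModType R) (f : V -> R) (x v : V) t :
  derivable f (x + t *: v) v ->
  is_derive t (1 : R) (fun s : R => f (x + s *: v)) ('D_v f (x + t *: v)).
Proof.
move=> df.
have E : (fun h : R => h^-1 *: (((fun s : R => f (x + s *: v)) \o shift t) (h *: (1 : R)) -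
    f (x + t *: v))) =
  (fun h : R => h^-1 *: ((f \o shift (x + t *: v)) (h *: v) - f (x + t *: v))).
  apply/funext => h; congr (_ *: (f _ - _)) => /=.
  by rewrite [h *: 1]mulr1 scalerDl addrCA.
split; first by rewrite /derivable E.
by rewrite /derive E.
Qed.

Lemma derivable_lineP (V : normedModType R) (f : V -> R) (x v : V) (a : R) :
  is_derive (0 : R) (1 : R) (fun s : R => f (x + s *: v)) a ->
  is_derive x v f a.
Proof.
have E : (fun h : R => h^-1 *: (((fun s : R => f (x + s *: v)) \o shift 0) (h *: (1 : R)) -
    f (x + 0 *: v))) =
  (fun h : R => h^-1 *: ((f \o shift x) (h *: v) - f x)).
  apply/funext => h; rewrite scale0r addr0; congr (_ *: (f _ - _)) => /=.
  by rewrite [h *: 1]mulr1 addr0 addrC.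
move=> [d1 d2]; split; first by move: d1; rewrite /derivable E.
by move: d2; rewrite /derive E.
Qed.

Lemma mvt_dir n (f : 'rV[R]_n -> R) (i : 'I_n) (y : 'rV[R]_n) (h : R) :
  (forall y, derivable f y (delta_mx ord0 i)) ->
  exists2 t : R, `|t| <= `|h| & f (y + h *: delta_mx ord0 i) - f y =
  pd i f (y + t *: delta_mx ord0 i) * h.
Proof.
move=> df; set ei := delta_mx ord0 i.
have dg s : is_derive s (1 : R) (fun s : R => f (y + s *: ei)) (pd i f (y + s *: ei)).
  by rewrite pdE; exact/is_derive_line/df.
have cg : continuous (fun s : R => f (y + s *: ei)).
  by move=> s; apply/differentiable_continuous/derivable1_diffP; have [] := dg s.
have [h0|h0] := leP 0 h.
- have [t /itvP tI] := @MVT_segment R _ _ 0 h h0 (fun s _ => dg s) (continuous_subspaceT cg).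
  rewrite scale0r addr0 subr0 => ->; exists t => //.
  by rewrite !ger0_norm ?tI.
- have [t /itvP tI] := @MVT_segment R _ _ h 0 (ltW h0) (fun s _ => dg s) (continuous_subspaceT cg).
  rewrite scale0r addr0 sub0r => E; exists t.
    by rewrite !ler0_norm ?tI ?(ltW h0)// lerN2 tI.
  by rewrite -[LHS]opprB E mulrN opprK.
Qed.

(** Builds the derivative along an arbitrary vector one coordinate at a time, from coordinate
    derivatives alone: the extra increment along [e_i] is evaluated by the mean value theorem at an
    intermediate point that tends to [x], where [pd i f] is continuous. *)
Lemma is_derive_add_dir n (f : 'rV[R]_n -> R) (x v : 'rV[R]_n) (i : 'I_n) (a c : R) :
  (forall y, derivable f y (delta_mx ord0 i)) -> {for x, continuous (pd i f)} ->
  is_derive x v f a -> is_derive x (v + c *: delta_mx ord0 i) f (a + c * pd i f x).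
Proof.
move=> df cf [dfv fva].
set ei := delta_mx ord0 i.
have mvt y h := mvt_dir y h df; rewrite -/ei in mvt.
have lim : (fun h : R => h^-1 *: ((f \o shift x) (h *: (v + c *: ei)) - f x)) @ 0^'
    --> a + c * pd i f x.
  apply/cvgrPdist_le => e e0.
  move: dfv; rewrite /derivable => /cvg_ex[b lb].
  have ba : b = a by rewrite -fva; apply/esym/cvg_lim.
  rewrite {}ba in lb.
  have e2 : 0 < e / 2 by rewrite divr_gt0.
  have e3 : 0 < e / 2 / (1 + `|c|) by rewrite divr_gt0// ltr_pwDl.
  move/cvgrPdist_le: lb => /(_ _ e2) lb.
  move: cf => /cvgrPdist_le /(_ _ e3)/nbhs_ballP[d /= d0 dcf].
  have M0 : 0 < 1 + `|v| + `|c| * `|ei| by rewrite -addrA ltr_pwDl// addr_ge0// mulr_ge0.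
  near=> h.
  have h0 : h != 0 by near: h; exact: nbhs_dnbhs_neq.
  have [t th E] := mvt (x + h *: v) (h * c).
  have Ex : h *: (v + c *: ei) + x = x + h *: v + (h * c) *: ei.
    by rewrite scalerDr scalerA addrC addrA.
  rewrite /= Ex.
  have -> : h^-1 *: (f (x + h *: v + (h * c) *: ei) - f x) =
      h^-1 *: (f (x + h *: v) - f x) + c * pd i f (x + h *: v + t *: ei).
    rewrite -(subrKA (f (x + h *: v))) [h^-1 *: (_ + _)]scalerDr E [LHS]addrC.
    suff -> : h^-1 *: (pd i f (x + h *: v + t *: ei) * (h * c)) =
      c * pd i f (x + h *: v + t *: ei) by [].
    move: (pd i f _) => p; transitivity (h^-1 * (p * (h * c))); first by [].
    by field.
  rewrite opprD addrACA.
  apply: (le_trans (ler_normD _ _)); rewrite [leRHS]splitr; apply: lerD.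
    by have := near lb h; rewrite /= (addrC _ x); apply.
  rewrite -mulrBr normrM.
  apply: (@le_trans _ _ (`|c| * (e / 2 / (1 + `|c|)))); last first.
    rewrite mulrCA ler_piMr ?(ltW e2)// ler_pdivrMr ?mul1r ?lerDr//.
  apply: ler_wpM2l => //; apply: dcf.
  rewrite -ball_normE /ball_/= -addrA opprD addNKr normrN.
  apply: (@le_lt_trans _ _ (`|h| * (1 + `|v| + `|c| * `|ei|))).
    apply: (le_trans (ler_normD _ _)); rewrite !normrZ mulrDr lerD//.
      by rewrite ler_wpM2l// lerDr.
    by rewrite mulrA ler_wpM2r// -normrM.
  rewrite -ltr_pdivlMr//.
  near: h; apply: dnbhs0_lt; exact: divr_gt0.
split; first by rewrite /derivable; apply/cvg_ex; eexists; exact: lim.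
exact/cvg_lim.
Unshelve. all: by end_near. Qed.

Lemma C1_is_derive n (f : 'rV[R]_n -> R) (x v : 'rV[R]_n) : C1 f ->
  is_derive x v f (\sum_i v ord0 i * pd i f x).
Proof.
move=> [_ cf]; rewrite [in X in is_derive _ X](row_sum_delta v).
elim: (index_enum _) => [|i r IH].
  by rewrite !big_nil; exact: is_derive0.
rewrite !big_cons addrC [X in is_derive _ _ _ X]addrC.
by apply: is_derive_add_dir => //; [have [] := cf i|have [_] := cf i; exact].
Qed.

Lemma C1_affine m n (f : 'rV[R]_n -> R) (M : 'M[R]_(m, n)) (b : 'rV[R]_n) i x :
  C1 f -> is_derive x (delta_mx ord0 i) (fun x : 'rV[R]_m => f (x *m M + b))
    (\sum_j M i j * pd j f (x *m M + b)).
Proof.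
move=> cf; have [d1 d2] := @C1_is_derive n f (x *m M + b) (row i M) cf.
have E : (fun h : R => h^-1 *: (((fun x : 'rV[R]_m => f (x *m M + b)) \o shift x) (h *: delta_mx ord0 i) -
    f (x *m M + b))) =
  (fun h : R => h^-1 *: ((f \o shift (x *m M + b)) (h *: row i M) - f (x *m M + b))).
  apply/funext => h; congr (_ *: (f _ - _)) => /=.
  by rewrite mulmxDl -scalemxAl -rowE addrA.
split; first by rewrite /derivable E.
rewrite /derive E; rewrite [LHS]d2; apply: eq_bigr => j _.
by rewrite mxE.
Qed.

Lemma dpart_cons n s (i : 'I_n) (f : 'rV[R]_n -> R) : dpart (i :: s) f = pd i (dpart s f).
Proof. by rewrite unlock. Qed.

Lemma dpart_cat n (s1 s2 : seq 'I_n) (f : 'rV[R]_n -> R) : dpart (s1 ++ s2) f = dpart s1 (dpart s2 f).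
Proof. by rewrite /dpart foldr_cat. Qed.

Lemma dpart_rcons n s (i : 'I_n) (f : 'rV[R]_n -> R) : dpart (rcons s i) f = dpart s (pd i f).
Proof. by rewrite /dpart foldr_rcons unlock. Qed.

Lemma smooth_continuous n (f : 'rV[R]_n -> R) : smooth f -> continuous f.
Proof. by move=> /(_ [::])[]. Qed.

Lemma smooth_derivable n (f : 'rV[R]_n -> R) i x : smooth f -> derivable f x (delta_mx ord0 i).
Proof. by move=> /(_ [::])[_]; exact. Qed.

Lemma smooth_pd n (f : 'rV[R]_n -> R) i : smooth f -> smooth (pd i f).
Proof. by move=> sf s; rewrite -dpart_rcons; exact: sf. Qed.

Lemma smooth_dpart n (f : 'rV[R]_n -> R) s : smooth f -> smooth (dpart s f).
Proof. by move=> sf; elim: s => [|i s IH]; [exact: sf|rewrite dpart_cons; exact: smooth_pd]. Qed.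

Lemma smooth_C1 n (f : 'rV[R]_n -> R) : smooth f -> C1 f.
Proof.
move=> sf; split; first exact: smooth_continuous.
by move=> i; split; [move=> x; exact: smooth_derivable|exact/smooth_continuous/smooth_pd].
Qed.

(** Coinduction for smoothness: a class of continuous functions that is stable under partial
    derivatives is made of smooth functions. The closure properties and the regularity of
    convolutions are both obtained by exhibiting such a class. *)
Lemma smooth_class n (S : ('rV[R]_n -> R) -> Prop) :
  (forall f, S f -> continuous f /\
    forall i, (forall x, derivable f x (delta_mx ord0 i)) /\ S (pd i f)) ->
  forall f, S f -> smooth f.
Proof.
move=> SS f Sf s.
have Ss : S (dpart s f) by elim: s => // i s /SS[_ /(_ i)[_]]; rewrite dpart_cons.
have [cs ds] := SS _ Ss.
by split=> // i x; have [] := ds i.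
Qed.

(** The successive derivatives are part of the witness, so that composition can read off the next
    one without any statement about iterated derivatives. *)
Definition smooth1 (h : R -> R) := exists hs : nat -> R -> R,
  hs 0%N = h /\ forall k x, is_derive x (1 : R) (hs k) (hs k.+1 x).

Lemma smooth1_derive h : smooth1 h -> exists h', smooth1 h' /\
  forall x, is_derive x (1 : R) h (h' x).
Proof.
move=> [hs [h0 dh]]; exists (hs 1%N); split; last by rewrite -h0.
by exists (fun k => hs k.+1); split => // k x; exact: dh.
Qed.

Lemma smooth1_continuous h : smooth1 h -> continuous h.
Proof.
move=> /smooth1_derive[h' [_ dh]] x.
by apply/differentiable_continuous/derivable1_diffP; have [] := dh x.
Qed.

Lemma is_derive_comp1 n (h : R -> R) (f : 'rV[R]_n -> R) (x v : 'rV[R]_n) (a b : R) :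
  is_derive (f x) (1 : R) h a -> is_derive x v f b ->
  is_derive x v (h \o f) (a * b).
Proof.
move=> dh df; apply: derivable_lineP.
have df0 : is_derive (0 : R) (1 : R) (fun s : R => f (x + s *: v)) b.
  have [d1 d2] := df.
  rewrite -d2 -[in 'D_v f x](addr0 x) -(scale0r v); apply: is_derive_line.
  by rewrite scale0r addr0.
rewrite -[_ * _]/(a *: b); apply: is_derive1_comp => //.
by rewrite scale0r addr0.
Qed.

(** Closing the smooth functions syntactically under all operations at once gives a class stable
    under [pd] by the Leibniz and chain rules, which is all that [smooth_class] asks: no formula for
    higher derivatives of a product or a composite arises. In the affine case [f] itself is smooth,
    so that its partial derivatives at the image point are again of that form. *)
Inductive sgen : forall n, ('rV[R]_n -> R) -> Prop :=
| sgen_smooth n (f : 'rV[R]_n -> R) : smooth f -> sgen f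
| sgen_cst n (c : R) : sgen (fun _ : 'rV[R]_n => c)
| sgen_coord n i : sgen (fun x : 'rV[R]_n => x ord0 i)
| sgen_comp n h (f : 'rV[R]_n -> R) : smooth1 h -> sgen f -> sgen (h \o f)
| sgen_add n (f g : 'rV[R]_n -> R) : sgen f -> sgen g -> sgen (fun x => f x + g x)
| sgen_mul n (f g : 'rV[R]_n -> R) : sgen f -> sgen g -> sgen (fun x => f x * g x)
| sgen_affine m n (f : 'rV[R]_n -> R) (M : 'M[R]_(m, n)) b : smooth f ->
    sgen (fun x => f (x *m M + b)).

Lemma is_derive_coord n (i j : 'I_n) (x : 'rV[R]_n) :
  is_derive x (delta_mx ord0 i) (fun x : 'rV[R]_n => x ord0 j) (i == j)%:R.
Proof.
apply: derivable_lineP.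
rewrite (_ : (fun _ => _) = (fun s : R => x ord0 j + s * (i == j)%:R)).
  by apply: is_derive_eq; rewrite scaler0 !add0r mul1r [_%:A]mulr1.
by apply/funext => s; rewrite !mxE eqxx/= eq_sym.
Qed.

Lemma continuous_rV (T : topologicalType) n (f : T -> 'rV[R]_n) :
  (forall j, continuous (fun t => f t ord0 j)) -> continuous f.
Proof.
move=> cf x A [P xP PA].
have : \forall t \near x, forall j, P ord0 j (f t ord0 j).
  apply: filter_forall => j; apply: (cf j x); exact: xP.
by apply: filterS => t Pt; apply: PA => i j; rewrite ord1.
Qed.

Lemma affine_continuous m n (M : 'M[R]_(m, n)) b : continuous (fun x : 'rV[R]_m => x *m M + b).
Proof.
apply: continuous_rV => j x.
rewrite (_ : (fun _ => _) = (fun t : 'rV[R]_m => (\sum_k t ord0 k * M k j) + b ord0 j)); last first.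
  by apply/funext => t; rewrite !mxE.
apply: continuousD; last exact: cst_continuous.
elim: (index_enum _) => [|k r IH].
  by rewrite (_ : (fun _ => _) = fun=> 0); [exact: cst_continuous|apply/funext => y; rewrite big_nil].
rewrite (_ : (fun _ => _) = (fun t : 'rV[R]_m => t ord0 k * M k j +
  \sum_(k <- r) t ord0 k * M k j)); last by apply/funext => y; rewrite big_cons.
apply: continuousD => //; apply: continuousM; last exact: cst_continuous.
exact: coord_continuous.
Qed.

Lemma sgen_class n (f : 'rV[R]_n -> R) : sgen f -> continuous f /\
    forall i, (forall x, derivable f x (delta_mx ord0 i)) /\ sgen (pd i f).
Proof.
elim=> {n f} [n f sf|n c|n i|n h f sh sf [cf IH]|n f g sf [cf IHf] sg [cg IHg]|n f g sf [cf IHf] sg [cg IHg]|m n f M b sf].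
- split; first exact: smooth_continuous.
  by move=> i; split => [x|]; [exact: smooth_derivable|exact/sgen_smooth/smooth_pd].
- split; first exact: cst_continuous.
  move=> i; split => [x|]; first exact: derivable_cst.
  rewrite (_ : pd _ _ = fun=> 0); first exact: sgen_cst.
  by apply/funext => x; rewrite pdE; exact: derive_cst.
- split; first exact: coord_continuous.
  move=> j; split => [x|]; first by have [] := is_derive_coord j i x.
  rewrite (_ : pd _ _ = fun=> (j == i)%:R); first exact: sgen_cst.
  by apply/funext => x; rewrite pdE; have [] := is_derive_coord j i x.
- split; first by move=> x; apply: continuous_comp; [exact: cf|exact: smooth1_continuous].
  have [h' [sh' dh]] := smooth1_derive sh.
  move=> i; have [dfi sfi] := IH i.
  have D x : is_derive x (delta_mx ord0 i) (h \o f) (h' (f x) * pd i f x).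
    by rewrite pdE; apply: is_derive_comp1 => //; exact: derivableP.
  split => [x|]; first by have [] := D x.
  rewrite (_ : pd _ _ = fun x => (h' \o f) x * pd i f x).
    by apply: sgen_mul => //; exact: sgen_comp.
  by apply/funext => x; rewrite pdE; have [] := D x.
- split; first by move=> x; apply: continuousD; [exact: cf|exact: cg].
  move=> i; have [dfi sfi] := IHf i; have [dgi sgi] := IHg i; split => [x|].
    exact: derivableD.
  rewrite (_ : pd _ _ = fun x => pd i f x + pd i g x); first exact: sgen_add.
  by apply/funext => x; rewrite !pdE; exact: deriveD.
- split; first by move=> x; apply: continuousM; [exact: cf|exact: cg].
  move=> i; have [dfi sfi] := IHf i; have [dgi sgi] := IHg i; split => [x|].
    exact: derivableM.
  rewrite (_ : pd _ _ = fun x => f x * pd i g x + g x * pd i f x).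
    by apply: sgen_add; exact: sgen_mul.
  by apply/funext => x; rewrite !pdE; exact: deriveM.
- have c1 := smooth_C1 sf.
  split.
    move=> x; apply: (@continuous_comp _ _ _ (fun x : 'rV[R]_m => x *m M + b)); first exact: affine_continuous.
    exact: smooth_continuous.
  move=> i; split => [x|]; first by have [] := C1_affine M b i x c1.
  rewrite (_ : pd _ _ = fun x => \sum_j M i j * pd j f (x *m M + b)); last first.
    by apply/funext => x; rewrite pdE; have [] := C1_affine M b i x c1.
  elim: (index_enum _) => [|j r IH].
    by rewrite (_ : (fun _ => _) = fun=> 0); [exact: sgen_cst|apply/funext => x; rewrite big_nil].
  rewrite (_ : (fun _ => _) = (fun x => M i j * pd j f (x *m M + b) +
    \sum_(j <- r) M i j * pd j f (x *m M + b))); last by apply/funext => x; rewrite big_cons.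
  apply: sgen_add => //; apply: sgen_mul; first exact: sgen_cst.
  by apply: sgen_affine; exact: smooth_pd.
Qed.

Lemma sgenP n (f : 'rV[R]_n -> R) : sgen f -> smooth f.
Proof. by apply: smooth_class => g; exact: sgen_class. Qed.

(* A box around [smooth]: the unfolding of the latter is expensive to try. *)
Variant cinf n (f : 'rV[R]_n -> R) : Prop := Cinf of smooth f.

Lemma cinf_continuous n (f : 'rV[R]_n -> R) : cinf f -> continuous f.
Proof. by move=> [/smooth_continuous]. Qed.

Lemma cinf_derivable n (f : 'rV[R]_n -> R) i x : cinf f -> derivable f x (delta_mx ord0 i).
Proof. by move=> [sf]; exact: smooth_derivable. Qed.

Lemma cinf_pd n (f : 'rV[R]_n -> R) i : cinf f -> cinf (pd i f).
Proof. by move=> [/(smooth_pd i)/Cinf]. Qed.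

Lemma cinf_dpart n (f : 'rV[R]_n -> R) s : cinf f -> cinf (dpart s f).
Proof. by move=> [/(smooth_dpart s)/Cinf]. Qed.

Lemma cinf_C1 n (f : 'rV[R]_n -> R) : cinf f -> C1 f.
Proof. by move=> [/smooth_C1]. Qed.

Lemma cinf_sgen n (f : 'rV[R]_n -> R) : cinf f -> sgen f.
Proof. by move=> [/sgen_smooth]. Qed.

Lemma sgen_cinf n (f : 'rV[R]_n -> R) : sgen f -> cinf f.
Proof. by move=> /sgenP/Cinf. Qed.

Section closure.
Variable n : nat.
Implicit Types (f g : 'rV[R]_n -> R) (i : 'I_n).

Lemma smooth_cst (c : R) : cinf (fun _ : 'rV[R]_n => c).
Proof. exact/sgen_cinf/sgen_cst. Qed.

Lemma smooth_coord i : cinf (fun x : 'rV[R]_n => x ord0 i).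
Proof. exact/sgen_cinf/sgen_coord. Qed.

Lemma smooth_comp h f : smooth1 h -> cinf f -> cinf (fun x => h (f x)).
Proof. by move=> sh sf; apply/sgen_cinf/sgen_comp => //; exact: cinf_sgen. Qed.

Lemma smoothD f g : cinf f -> cinf g -> cinf (fun x => f x + g x).
Proof. by move=> sf sg; apply/sgen_cinf/sgen_add; exact: cinf_sgen. Qed.

Lemma smoothM f g : cinf f -> cinf g -> cinf (fun x => f x * g x).
Proof. by move=> sf sg; apply/sgen_cinf/sgen_mul; exact: cinf_sgen. Qed.

Lemma smoothZ (c : R) f : cinf f -> cinf (fun x => c * f x).
Proof. by move=> sf; apply: smoothM => //; exact: smooth_cst. Qed.

Lemma smoothN f : cinf f -> cinf (fun x => - f x).
Proof.
by move=> /(smoothZ (-1)); congr cinf; apply/funext => x; rewrite mulN1r.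
Qed.

Lemma smoothB f g : cinf f -> cinf g -> cinf (fun x => f x - g x).
Proof. by move=> sf sg; exact: (smoothD sf (smoothN sg)). Qed.

Lemma smooth_sum (I : Type) (r : seq I) (F : I -> 'rV[R]_n -> R) :
  (forall j, cinf (F j)) -> cinf (fun x => \sum_(j <- r) F j x).
Proof.
move=> sF; elim: r => [|j r IH].
  by under eq_fun do rewrite big_nil; exact: smooth_cst.
by under eq_fun do rewrite big_cons; exact: smoothD.
Qed.

Lemma smooth_prod (I : Type) (r : seq I) (F : I -> 'rV[R]_n -> R) :
  (forall j, cinf (F j)) -> cinf (fun x => \prod_(j <- r) F j x).
Proof.
move=> sF; elim: r => [|j r IH].
  by under eq_fun do rewrite big_nil; exact: smooth_cst.
by under eq_fun do rewrite big_cons; exact: smoothM.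
Qed.

Lemma smoothX f k : cinf f -> cinf (fun x => f x ^+ k).
Proof.
move=> sf; elim: k => [|k IH].
  by under eq_fun do rewrite expr0; exact: smooth_cst.
by under eq_fun do rewrite exprS; exact: smoothM.
Qed.

Lemma smooth_affine m f (M : 'M[R]_(m, n)) b :
  cinf f -> cinf (fun x => f (x *m M + b)).
Proof. by move=> [sf]; exact/sgen_cinf/sgen_affine. Qed.

Lemma pd_cst i (c : R) : pd i (fun _ : 'rV[R]_n => c) = fun=> 0.
Proof. by apply/funext => x; rewrite pdE; exact: derive_cst. Qed.

Lemma pd_coord i j : pd i (fun x : 'rV[R]_n => x ord0 j) = fun=> (i == j)%:R.
Proof. by apply/funext => x; rewrite pdE; have [] := is_derive_coord i j x. Qed.

Lemma pdD i f g : cinf f -> cinf g ->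
  pd i (fun x => f x + g x) = fun x => pd i f x + pd i g x.
Proof. by move=> sf sg; apply/funext => x; rewrite !pdE; apply: deriveD; exact: cinf_derivable. Qed.

Lemma pdM i f g : cinf f -> cinf g ->
  pd i (fun x => f x * g x) = fun x => pd i f x * g x + f x * pd i g x.
Proof.
move=> sf sg; apply/funext => x; rewrite !pdE [LHS](@deriveM _ _ f g); try exact: cinf_derivable.
by rewrite addrC mulrC.
Qed.

Lemma pdZ i (c : R) f : cinf f -> pd i (fun x => c * f x) = fun x => c * pd i f x.
Proof.
move=> sf; rewrite pdM//; last exact: smooth_cst.
by rewrite pd_cst; apply/funext => x; rewrite mul0r add0r.
Qed.

Lemma pdN i f : cinf f -> pd i (fun x => - f x) = fun x => - pd i f x.
Proof.
move=> sf; rewrite (_ : (fun x => - f x) = fun x => -1 * f x).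
  by rewrite pdZ//; apply/funext => x; rewrite mulN1r.
by apply/funext => x; rewrite mulN1r.
Qed.

Lemma pdB i f g : cinf f -> cinf g ->
  pd i (fun x => f x - g x) = fun x => pd i f x - pd i g x.
Proof. by move=> sf sg; rewrite (pdD i sf (smoothN sg)) (pdN i sg). Qed.

Lemma pd_sum i (I : Type) (r : seq I) (F : I -> 'rV[R]_n -> R) :
  (forall j, cinf (F j)) ->
  pd i (fun x => \sum_(j <- r) F j x) = fun x => \sum_(j <- r) pd i (F j) x.
Proof.
move=> sF; elim: r => [|j r IH].
  under eq_fun do rewrite big_nil; rewrite pd_cst.
  by apply/funext => x; rewrite big_nil.
under eq_fun do rewrite big_cons; rewrite pdD//; last exact: smooth_sum.
by rewrite IH; apply/funext => x; rewrite big_cons.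
Qed.

Lemma pd_comp i h h' f : (forall x, is_derive x (1 : R) h (h' x)) -> cinf f ->
  pd i (fun x => h (f x)) = fun x => h' (f x) * pd i f x.
Proof.
move=> dh sf; apply/funext => x.
have df : is_derive x (delta_mx ord0 i) f (pd i f x).
  by rewrite pdE; apply: derivableP; exact: cinf_derivable.
by have [_ E] := is_derive_comp1 (dh (f x)) df; rewrite pdE -E.
Qed.

Lemma pd_affine m (i : 'I_m) f (M : 'M[R]_(m, n)) b : cinf f ->
  pd i (fun x => f (x *m M + b)) = fun x => \sum_j M i j * pd j f (x *m M + b).
Proof.
by move=> sf; apply/funext => x; rewrite pdE; have [] := C1_affine M b i x (cinf_C1 sf).
Qed.

Lemma smooth_shift f b : cinf f -> cinf (fun x => f (x + b)).
Proof.
move=> /(@smooth_affine n _ 1%:M b); congr cinf.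
by apply/funext => x; rewrite mulmx1.
Qed.

Lemma pd_shift i f b : pd i (fun x => f (x + b)) = fun x => pd i f (x + b).
Proof.
apply/funext => x; rewrite !pdE /derive.
set F1 := (X in X @ _); set F2 := (X in _ = lim (X @ _)).
suff -> : F1 = F2 by [].
by apply/funext => h; rewrite /F1 /F2 /= addrA.
Qed.

Lemma continuous_norm f x e : continuous f -> 0 < e ->
  exists2 d : R, 0 < d & forall y, `|y - x| < d -> `|f y - f x| <= e.
Proof.
move=> cf e0; have /cvgrPdist_le /(_ _ e0)/nbhs_ballP[d /= d0 B] := cf x.
exists d => // y yd; rewrite distrC; apply: B.
by rewrite -ball_normE /ball_/= distrC.
Qed.

(** Schwarz's theorem: the second difference with steps [h e_k] and [h e_l] is symmetric in [k] and
    [l], and two mean value steps turn it into h^2 times a mixed derivative at a point within 2|h|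
    of [x]. Continuity of both mixed derivatives at [x] concludes. *)
Lemma pdC i j f : cinf f -> pd i (pd j f) = pd j (pd i f).
Proof.
move=> sf; apply/funext => x.
have key (k l : 'I_n) (h : R) : exists2 y : 'rV[R]_n, `|y - x| <= `|h| *+ 2 &
   f (x + h *: delta_mx ord0 k + h *: delta_mx ord0 l) - f (x + h *: delta_mx ord0 k)
   - f (x + h *: delta_mx ord0 l) + f x = pd l (pd k f) y * h ^+ 2.
  have sF : cinf (fun y => f (y + h *: delta_mx ord0 l) - f y).
    by apply: smoothB => //; exact: smooth_shift.
  have [t th E] := @mvt_dir n _ k x h (fun y => @cinf_derivable n _ k y sF).
  have [s sh E'] := @mvt_dir n _ l (x + t *: delta_mx ord0 k) h
    (fun y => @cinf_derivable n _ l y (cinf_pd k sf)).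
  exists (x + t *: delta_mx ord0 k + s *: delta_mx ord0 l).
    have -> : x + t *: delta_mx ord0 k + s *: delta_mx ord0 l - x =
      t *: delta_mx ord0 k + s *: delta_mx ord0 l by apply/eqP; rewrite subr_eq -addrA addrC.
    rewrite (le_trans (ler_normD _ _))// !normrZ mulr2n.
    have dn (p : 'I_n) : `|delta_mx ord0 p : 'rV[R]_n| <= 1.
      rewrite [leLHS]mx_normrE; apply/bigmax_leP; split => //= q _.
      by rewrite mxE; case: (_ && _); rewrite ?normr1 ?normr0.
    by apply: lerD; [apply: (le_trans _ th)|apply: (le_trans _ sh)]; rewrite ler_piMr.
  rewrite pdB ?pd_shift// in E; last exact: smooth_shift.
  rewrite E' in E; rewrite expr2 mulrA -E; ring.
apply/eqP; rewrite -subr_eq0 -normr_le0; apply/ler_addgt0Pl => e e0; rewrite addr0.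
have e2 : 0 < e / 2 by rewrite divr_gt0.
have [d1 d10 B1] := continuous_norm x (cinf_continuous (cinf_pd i (cinf_pd j sf))) e2.
have [d2 d20 B2] := continuous_norm x (cinf_continuous (cinf_pd j (cinf_pd i sf))) e2.
pose h := Num.min d1 d2 / 4.
have m0 : 0 < Num.min d1 d2 by rewrite lt_min d10.
have h0 : 0 < h by rewrite divr_gt0.
have hm : `|h| *+ 2 < Num.min d1 d2.
  by rewrite gtr0_norm// mulr2n /h; clear -m0; lra.
have hm1 : `|h| *+ 2 < d1 by rewrite (lt_le_trans hm)// ge_min lexx.
have hm2 : `|h| *+ 2 < d2 by rewrite (lt_le_trans hm)// ge_min lexx orbT.
have [y1 y1h E1] := key j i h; have [y2 y2h E2] := key i j h.
have b1 := B1 _ (le_lt_trans y1h hm1); have b2 := B2 _ (le_lt_trans y2h hm2).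
have E : pd i (pd j f) y1 = pd j (pd i f) y2.
  apply: (@mulIf _ (h ^+ 2)); first by rewrite expf_neq0// gt_eqF.
  apply: (etrans (esym E1)); apply: etrans E2.
  have -> : x + h *: delta_mx ord0 j + h *: delta_mx ord0 i =
    x + h *: delta_mx ord0 i + h *: delta_mx ord0 j by rewrite addrAC.
  by congr (_ + _); rewrite addrAC.
rewrite -(subrKA (pd i (pd j f) y1)) {2}E (splitr e).
by apply: (le_trans (ler_normD _ _)); apply: lerD => //; rewrite distrC.
Qed.

Lemma dpart_pd i s f : cinf f -> pd i (dpart s f) = dpart s (pd i f).
Proof.
move=> sf; elim: s => [|j s IH]; first by [].
rewrite !dpart_cons -IH.
by apply: pdC; exact: cinf_dpart.
Qed.

Lemma dpart_perm s1 s2 f : cinf f -> perm_eq s1 s2 -> dpart s1 f = dpart s2 f.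
Proof.
move=> sf; elim: s1 s2 => [|i s1 IH] s2.
  by move=> /perm_size/esym/size0nil ->.
move=> p; have i2 : i \in s2 by rewrite -(perm_mem p) mem_head.
have [p1 [p2 E]] : exists p1 p2, s2 = p1 ++ i :: p2.
  by move/splitPr: i2 => [p1 p2]; exists p1, p2.
subst s2.
move: p; rewrite perm_sym -cat1s perm_catCA [cat _ _]/= perm_cons perm_sym => /IH h.
rewrite dpart_cons h !dpart_cat dpart_cons.
by rewrite dpart_pd//; exact: cinf_dpart.
Qed.

End closure.

(** * Smooth functions of one variable and the flat function exp (- 1/t) *)

Lemma smooth1_affine h (a b : R) : smooth1 h -> smooth1 (fun s => h (a * s + b)).
Proof.
move=> [hs [h0 dh]]; exists (fun k s => a ^+ k * hs k (a * s + b)); split.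
  by apply/funext => s; rewrite expr0 mul1r h0.
move=> k x.
have d1 : is_derive x (1 : R) (fun s : R => a * s + b) a.
  apply: (is_derive_eq (is_deriveD (is_deriveZ a (is_derive_id x (1 : R))) (is_derive_cst b x (1 : R)))).
  by rewrite addr0 [_%:A]mulr1.
have d2 : is_derive x (1 : R) (hs k \o (fun s : R => a * s + b)) (hs k.+1 (a * x + b) *: a).
  exact: is_derive1_comp.
have d3 := is_deriveZ (a ^+ k) d2.
apply: (is_derive_eq d3).
by rewrite exprSr -mulrA [X in _ = _ * X]mulrC.
Qed.

(** In the variable y = 1/t one has d/dt = - y^2 d/dy; hence the k-th derivative of exp (- 1/t) is
    P_k(1/t) exp (- 1/t) with P_(k+1) = X^2 (P_k - P_k'). *)
Fixpoint flat_poly k : {poly R} :=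
  if k is k'.+1 then 'X^2 * (flat_poly k' - (flat_poly k')^`()) else 1.

Definition flat_step k (t : R) : R :=
  if 0 < t then (flat_poly k).[t^-1] * expR (- t^-1) else 0.

Lemma horner_le_expR (p : {poly R}) :
  exists C : R, forall y, 0 <= y -> `|p.[y]| <= C * expR y.
Proof.
have Xk k : exists C : R, 0 <= C /\ forall y, 0 <= y -> y ^+ k <= C * expR y.
  case: k => [|k].
    by exists 1; split => // y y0; rewrite expr0 mul1r -expR0 ler_expR.
  (* From y/(k+1) <= exp (y/(k+1)), raised to the power k+1. *)
  exists (k.+1%:R ^+ k.+1); split; first by rewrite exprn_ge0.
  move=> y y0; rewrite -[y in expR y](@divfK _ k.+1%:R) ?pnatr_eq0//.
  rewrite expRM_natr -exprMn lerXn2r ?nnegrE// ?mulr_ge0 ?expR_ge0//.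
  rewrite mulrC -ler_pdivrMr// (le_trans _ (expR_ge1Dx _))// lerDr//.
(* The factor y^k is what the induction on [q X + c] hands over to [q], as y^(k+1). *)
suff H (q : {poly R}) k : exists C : R, forall y, 0 <= y -> `|y ^+ k * q.[y]| <= C * expR y.
  by have [C hC] := H p 0%N; exists C => y y0; rewrite -[p.[y]]mul1r -(expr0 y) hC.
elim/poly_ind: q k => [|q c IH] k.
  by exists 0 => y _; rewrite horner0 mulr0 normr0 mul0r.
have [C1 h1] := IH k.+1; have [C2 [C20 h2]] := Xk k.
exists (C1 + `|c| * C2) => y y0.
rewrite hornerD hornerMX hornerC mulrDr mulrA mulrAC -exprSr mulrDl.
apply: (le_trans (ler_normD _ _)); apply: lerD; first exact: h1.
rewrite normrM mulrC -mulrA ler_wpM2l// ger0_norm ?exprn_ge0// h2//.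
Qed.

Lemma is_derive_flat0 (g : R -> R) (C : R) : (forall s, `|g s| <= C * s ^+ 2) ->
  is_derive (0 : R) (1 : R) g 0.
Proof.
move=> gC; have g0 : g 0 = 0.
  by apply/eqP; rewrite -normr_le0 (le_trans (gC 0))// expr0n mulr0.
have C0 : 0 <= C by have := le_trans (normr_ge0 _) (gC 1); rewrite expr1n mulr1.
have lim : (fun h : R => h^-1 *: ((g \o shift 0) (h *: (1 : R)) - g 0)) @ 0^' --> (0 : R).
  apply/cvgrPdist_le => e e0; near=> h.
  have h0 : h != 0 by near: h; exact: nbhs_dnbhs_neq.
  rewrite /= g0 subr0 addr0 sub0r normrN [h *: 1]mulr1 normrZ normfV.
  rewrite ler_pdivrMl ?normr_gt0// (le_trans (gC h))// -real_normK ?num_real// expr2 mulrA mulrC ler_wpM2l//.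
  apply: (@le_trans _ _ ((1 + C) * `|h|)); first by rewrite ler_wpM2r// lerDr.
  rewrite -ler_pdivlMl ?ltr_pwDl//; apply: ltW.
  near: h; apply: dnbhs0_lt; rewrite mulr_gt0// invr_gt0 ltr_pwDl//.
split; first by apply/cvg_ex; exists 0; exact: lim.
exact/cvg_lim.
Unshelve. all: by end_near. Qed.

Lemma flat_stepP k x : is_derive x (1 : R) (flat_step k) (flat_step k.+1 x).
Proof.
have [x0|x0|x0] := ltgtP x 0.
- rewrite {2}/flat_step ltNge (ltW x0)/=.
  apply: (@near_eq_is_derive _ _ _ (cst 0)).
  + near=> y; rewrite /flat_step/= ltNge (ltW (_ : y < 0))//.
    near: y; exact: lt_nbhsl.
- rewrite {2}/flat_step x0.
  pose p := flat_poly k.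
  apply: (@near_eq_is_derive _ _ _ (fun t : R => p.[t^-1] * expR (- t^-1))).
  + near=> y; rewrite /flat_step/= (_ : 0 < y)//.
    near: y; exact: lt_nbhsr.
  + have xn0 : x != 0 by rewrite gt_eqF.
    have dV : is_derive x (1 : R) (fun t : R => t^-1) (- x ^- 2).
      by apply: (is_derive_eq (is_deriveV xn0 (is_derive_id x (1 : R)))); rewrite [_%:A]mulr1.
    have dp : is_derive x^-1 (1 : R) (horner p) (p^`()).[x^-1].
      by rewrite derivE derive1E; apply: derivableP; exact: derivable_horner.
    have d1 := is_derive1_comp dp dV.
    have dN : is_derive x (1 : R) (fun t : R => - t^-1) (x ^- 2).
      by apply: (is_derive_eq (is_deriveN dV)); rewrite opprK.
    have d2 : is_derive x (1 : R) (expR \o (fun t : R => - t^-1)) (expR (- x^-1) *: x ^- 2).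
      by apply: is_derive1_comp; exact: is_derive_expR.
    apply: (is_derive_eq (is_deriveM d1 d2)).
    rewrite /= hornerM hornerXn hornerD hornerN -/p /GRing.scale /= -exprVn; ring.
- rewrite x0 {2}/flat_step ltxx.
  (* The extra ['X^2], evaluated at 1/s, turns the bound into |flat_step k s| <= C s^2, which gives
     the derivative 0 at the origin. *)
  have [C hC] := horner_le_expR (flat_poly k * 'X^2).
  apply: (@is_derive_flat0 _ `|C|) => s; rewrite /flat_step.
  case: ifPn => s0; last by rewrite normr0 mulr_ge0// sqr_ge0.
  have := hC s^-1; rewrite invr_ge0 (ltW s0) => /(_ isT).
  rewrite hornerM hornerXn normrM => h.
  rewrite normrM expRN normfV (ger0_norm (expR_ge0 _)) ler_pdivrMr ?expR_gt0//.
  apply: (@le_trans _ _ (C * expR s^-1 * s ^+ 2)); last first.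
    rewrite mulrAC ler_wpM2r ?expR_ge0// ler_wpM2r ?sqr_ge0// ler_norm//.
  rewrite -ler_pdivrMr ?exprn_gt0// (le_trans _ h)//.
  by rewrite (ger0_norm (sqr_ge0 s^-1)) exprVn.
Unshelve. all: by end_near. Qed.

Lemma smooth1_flat k : smooth1 (flat_step k).
Proof. by exists (fun j => flat_step (j + k)); split => // j x; exact: flat_stepP. Qed.

Lemma smooth1_expR : smooth1 expR.
Proof. by exists (fun=> expR); split => // k x; exact: is_derive_expR. Qed.

Lemma smooth1_cos_sin : smooth1 (@cos R) /\ smooth1 (@sin R).
Proof.
pose cs k := iter k (fun p : (R -> R) * (R -> R) => (fun t => - p.2 t, p.1)) (@cos R, @sin R).
have H k x : is_derive x (1 : R) (cs k).1 (- (cs k).2 x) /\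
             is_derive x (1 : R) (cs k).2 ((cs k).1 x).
  elim: k => [|k [IH1 IH2]]; first by split; [exact: is_derive_cos|exact: is_derive_sin].
  by split => //=; exact: is_deriveN.
split.
- by exists (fun k => (cs k).1); split => // k x; have [] := H k x.
- exists (fun k => (cs k).2); split => // k x; by have [_] := H k x.
Qed.

End calculus.

(** * Lebesgue measure on row vectors *)

Section borel.
Context {R : realType} {n : nat}.
Implicit Types (x y c : 'rV[R]_n) (A D : set 'rV[R]_n).

Definition cube c (r : R) : set 'rV[R]_n :=
  [set x | forall i, `|x ord0 i - c ord0 i| < r].

Lemma ball_cube c r : 0 < r -> ball c r = cube c r.
Proof.
move=> r0; apply/seteqP; split => x.
  by move=> [_ cx] i; rewrite distrC; have := cx ord0 i; rewrite -ball_normE.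
by move=> cx; split => // i j; rewrite -ball_normE /ball_/= distrC !ord1; exact: cx.
Qed.

Lemma open_cube c r : open (cube c r).
Proof.
have [r0|r0] := ltP 0 r; first by rewrite -ball_cube//; exact: ball_open.
have [n0|n0] := posnP n.
  rewrite (_ : cube c r = setT); first exact: openT.
  by apply/seteqP; split => // x _ i; move: (ltn_ord i); rewrite [X in (_ < X)%N]n0.
rewrite (_ : cube c r = set0); first exact: open0.
apply/seteqP; split => // x /(_ (Ordinal n0)); rewrite ltNge.
by rewrite (le_trans r0).
Qed.

Lemma nbhs_cube x A : nbhs x A -> exists2 e : R, 0 < e & cube x e `<=` A.
Proof. by move/nbhs_ballP => [e /= e0 xA]; exists e => //; rewrite -ball_cube. Qed.

Lemma open_nbhs_cube x A : open A -> A x -> exists2 e : R, 0 < e & cube x e `<=` A.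
Proof. by move=> oA Ax; apply: nbhs_cube; exact: open_nbhs_nbhs. Qed.

Lemma cube_center x r : 0 < r -> cube x r x.
Proof. by move=> r0 i; rewrite subrr normr0. Qed.

Lemma measurable_coords (P : 'I_n -> set R) : (forall i, measurable (P i)) ->
  measurable [set x : 'rV[R]_n | forall i, P i (x ord0 i)].
Proof.
move=> mP; rewrite (_ : [set _ | _] = \bigcap_(i in [set: 'I_n])
    ((fun x : 'rV[R]_n => x ord0 i) @^-1` (P i))).
  apply: fin_bigcap_measurable => // i _.
  rewrite -[X in measurable X]setTI.
  by apply: measurable_rV_coord.
by apply/seteqP; split => x /= xP i; [move=> _; exact: xP|exact: xP].
Qed.

Lemma measurable_cube c r : measurable (cube c r).
Proof.
apply: (@measurable_coords (fun i => [set t : R | `|t - c ord0 i| < r])) => i.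
rewrite (_ : [set _ | _] = `](c ord0 i - r), (c ord0 i + r)[%classic).
  exact: measurable_itv.
by apply/seteqP; split => t /=; rewrite in_itv/= ltr_distl.
Qed.

Lemma rat_cube x (e : R) : 0 < e -> exists (c : 'rV[rat]_n) (k : nat),
  cube (map_mx ratr c) (k.+1%:R^-1) x /\ cube (map_mx ratr c) (k.+1%:R^-1) `<=` cube x e.
Proof.
move=> e0.
have [k ke] : exists k, k.+1%:R^-1 < e / 2.
  have e2 : 0 < e / 2 by rewrite divr_gt0.
  exists (Num.truncn (e / 2)^-1).
  by rewrite invf_plt ?posrE// truncnS_gt.
have /choice[q qx] : forall i, exists q : rat, `|x ord0 i - ratr q| < k.+1%:R^-1.
  move=> i.
  have h : x ord0 i - k.+1%:R^-1 < x ord0 i + k.+1%:R^-1 by rewrite ltrBlDr -addrA ltrDl addr_gt0.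
  have [q] := rat_in_itvoo h; rewrite in_itv/= => /andP[q1 q2].
  by exists q; rewrite distrC ltr_distl q1.
have Fx : cube (map_mx ratr (\row_i q i)) (k.+1%:R^-1) x.
  by move=> i; rewrite !mxE.
exists (\row_i q i), k; split => // y qy i.
have := Fx i; have := qy i; rewrite !mxE => h1 h2.
rewrite -(subrKA (ratr (q i))) (splitr e) (le_lt_trans (ler_normD _ _))//.
by rewrite ltrD// (lt_trans _ ke)// distrC.
Qed.

(** The sigma-algebra is generated by the coordinates and not by the topology: an open set is
    recovered as the countable union of the cubes with rational centre and half-side 1/(k+1) that it
    contains. *)
Lemma open_measurable_rV A : open A -> measurable A.
Proof.
move=> oA.
pose F (p : 'rV[rat]_n * nat) : set 'rV[R]_n :=
  let B := cube (map_mx ratr p.1) (p.2.+1%:R^-1) in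
  if `[< B `<=` A >] then B else set0.
rewrite (_ : A = \bigcup_p F p).
  apply: countable_bigcupT_measurable; first exact: countableP.
  by move=> p; rewrite /F; case: ifP => // _; exact: measurable_cube.
apply/seteqP; split => [x Ax|x [p _]]; last first.
  by rewrite /F; case: ifPn => // /asboolP; exact.
have [e e0 xe] := open_nbhs_cube oA Ax.
have [c [k [cx ce]]] := rat_cube x e0.
exists (c, k) => //; rewrite /F/=; case: asboolP => //; case.
exact: subset_trans xe.
Qed.

Lemma closed_measurable_rV A : closed A -> measurable A.
Proof. by move=> cA; rewrite -(setCK A); apply: measurableC; apply: open_measurable_rV; rewrite openC. Qed.

Lemma compact_measurable_rV A : compact A -> measurable A.
Proof. by move=> cA; apply: closed_measurable_rV; apply: compact_closed => //; exact: norm_hausdorff. Qed.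

Lemma continuous_measurable_rV (f : 'rV[R]_n -> R) : continuous f -> measurable_fun setT f.
Proof.
move=> cf; apply: (measurability _ (RGenOpens.measurableE R)) => //.
move=> _ [_ [a [b ->]] <-]; rewrite setTI; apply: open_measurable_rV.
by move/continuousP : cf; apply; exact: interval_open.
Qed.

End borel.

(** * Invariance of Lebesgue measure under translations and orthogonal maps *)

Section shift.
Context {R : realType}.
Notation leb n := (lebesgue_rV n : {measure set 'rV[R]_n -> \bar R}).
Notation leb1 := (@lebesgue_measure R).

Lemma lebesgue1_shift (a : R) (A : set (measurableTypeR R)) : measurable A ->
  leb1 ((fun x => x + a) @^-1` A) = leb1 A.
Proof.
move=> mA.
have mf : measurable_fun setT ((fun x => x + a) : measurableTypeR R -> measurableTypeR R).
  exact: measurable_funD.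
apply/esym.
apply: (@lebesgue_measure_unique R
  (measure_function_pushforward__canonical__measure_function_Measure leb1 mf)) => //.
move=> X /ocitvP[->|[[b c]/= bc ->]].
  by rewrite measure0; apply/esym; exact: measure0.
rewrite /pushforward (_ : _ @^-1` _ = `](b - a), (c - a)]%classic); last first.
  by apply/seteqP; split => t /=; rewrite !in_itv/= ltrBlDr lerBrDr.
rewrite !lebesgue_measure_itv/= !lte_fin ltrD2r.
by case: ifP => // _; congr (_%:E); ring.
Qed.

Lemma lebesgue_rVSE n (A : set 'rV[R]_n.+1) :
  leb n.+1 A = (leb1 \x leb n)%E (@rV_cons R n @^-1` A).
Proof. by []. Qed.

Lemma measurable_fun_rV d (T : measurableType d) n (f : T -> 'rV[R]_n) :
  (forall i, measurable_fun [set: T] (fun x => f x ord0 i)) ->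
  measurable_fun [set: T] f.
Proof. exact: measurable_rVP. Qed.

Lemma measurable_shift n (b : 'rV[R]_n) : measurable_fun setT (fun x : 'rV[R]_n => x + b).
Proof.
apply: measurable_fun_rV => i; under eq_fun do rewrite mxE.
by apply: measurable_funD => //; exact: measurable_rV_coord.
Qed.

(** By uniqueness of product measures it is enough to compare on measurable rectangles, where the
    first factor is the one-dimensional case and the second the induction hypothesis. *)
Lemma lebesgue_rV_shift n (b : 'rV[R]_n) (A : set 'rV[R]_n) : measurable A ->
  leb n ((fun x => x + b) @^-1` A) = leb n A.
Proof.
elim: n b A => [|n IH] b A mA.
  congr (leb 0 _); apply/seteqP; split => x /=;
  by rewrite (_ : x + b = x)//; apply/rowP => -[].
rewrite !lebesgue_rVSE.
pose T (p : measurableTypeR R * 'rV[R]_n) := (p.1 + b ord0 ord0, p.2 + \row_i b ord0 (lift ord0 i)) : measurableTypeR R * 'rV[R]_n.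
have mT : measurable_fun setT T.
  apply: measurable_fun_pair; first exact: measurable_funD.
  exact: (measurableT_comp (measurable_shift _) measurable_snd).
have E : @rV_cons R n @^-1` ((fun x => x + b) @^-1` A) = T @^-1` (@rV_cons R n @^-1` A).
  apply/seteqP; split => p /=;
  rewrite (_ : rV_cons p + b = rV_cons (T p))//; apply/rowP => i; rewrite mxE;
  case: (unliftP ord0 i) => [j|] ->; rewrite ?rV_consS ?rV_cons0 ?mxE//.
rewrite E.
have mB : measurable (@rV_cons R n @^-1` A).
  by rewrite -[X in measurable X]setTI; exact: measurable_rV_cons.
apply/esym.
apply: (product_measure_unique
  (m' := measure_function_pushforward__canonical__measure_function_Measure (leb1 \x leb n)%E mT)) => //.
move=> X Y mX mY; rewrite /= /pushforward.
rewrite (_ : T @^-1` (X `*` Y) = ((fun t : measurableTypeR R => t + b ord0 ord0) @^-1` X) `*`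
   ((fun x => x + \row_i b ord0 (lift ord0 i)) @^-1` Y))//.
rewrite product_measure1E.
- by congr (_ * _)%E; [exact: lebesgue1_shift|exact: IH].
- by rewrite -[X in measurable X]setTI; exact: measurable_funD.
- by rewrite -[X in measurable X]setTI; exact: measurable_shift.
Qed.

Definition L1 n (F : 'rV[R]_n -> R) := (leb n).-integrable setT (EFin \o F).

Definition preserving n (T : 'rV[R]_n -> 'rV[R]_n) := measurable_fun setT T /\
  forall A, measurable A -> leb n (T @^-1` A) = leb n A.

Lemma ge0_integral_preserving n (T : 'rV[R]_n -> 'rV[R]_n) (f : 'rV[R]_n -> \bar R) :
  preserving T -> measurable_fun setT f -> (forall x, 0 <= f x)%E ->
  (\int[leb n]_x f (T x) = \int[leb n]_x f x)%E.
Proof.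
move=> [mT pT] mf f0.
have := @ge0_integral_pushforward _ _ _ _ R T mT (leb n) setT f measurableT mf (fun y _ => f0 y).
rewrite preimage_setT => <-.
by apply: eq_measure_integral => A mA _; exact: pT.
Qed.

Lemma integrable_preserving n (T : 'rV[R]_n -> 'rV[R]_n) (F : 'rV[R]_n -> R) :
  preserving T -> L1 F -> L1 (fun x => F (T x)).
Proof.
move=> pT /integrableP[mF iF]; apply/integrableP; split.
  by apply: (measurableT_comp mF); case: pT.
rewrite [X in (X < _)%E](_ : _ = \int[leb n]_x (abse \o (EFin \o F)) x)%E//.
rewrite -(ge0_integral_preserving pT)//.
  by apply: measurableT_comp.
by move=> x; exact: abse_ge0.
Qed.

Lemma Rintegral_preserving n (T : 'rV[R]_n -> 'rV[R]_n) (F : 'rV[R]_n -> R) :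
  preserving T -> L1 F -> \int[leb n]_x F (T x) = \int[leb n]_x F x.
Proof.
move=> pT iF; have mF := measurable_int _ iF; rewrite /Rintegral; congr fine.
have [mT pT'] := pT.
have := @integral_pushforward _ _ _ _ R T mT (leb n) setT (EFin \o F) mF.
rewrite preimage_setT => /(_ (integrable_preserving pT iF) measurableT) <-.
by apply: eq_measure_integral => A mA _; exact: pT'.
Qed.

Lemma preserving_shift n (b : 'rV[R]_n) : preserving (fun x => x + b).
Proof. by split; [exact: measurable_shift|exact: lebesgue_rV_shift]. Qed.

Lemma preserving_comp n (S T : 'rV[R]_n -> 'rV[R]_n) :
  preserving S -> preserving T -> preserving (fun x => S (T x)).
Proof.
move=> [mS pS] [mT pT]; split; first exact: measurableT_comp.
move=> A mA; rewrite -(pS A)// -(pT (S @^-1` A))//.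
by rewrite -[X in measurable X]setTI; exact: mS.
Qed.

Lemma ge0_integral_rVS n (F : 'rV[R]_n.+1 -> \bar R) :
  measurable_fun setT F -> (forall x, 0 <= F x)%E ->
  (\int[leb n.+1]_x F x = \int[leb1]_t \int[leb n]_x F (rV_cons (t, x)))%E.
Proof.
move=> mF F0.
rewrite -(@fubini_tonelli1 _ _ _ _ R leb1 (leb n) (fun p => F (rV_cons p)))//; last first.
  exact: (measurableT_comp mF (@measurable_rV_cons R n)).
have := @ge0_integral_pushforward _ _ _ _ R _ (@measurable_rV_cons R n) (leb1 \x leb n)%E setT F measurableT mF (fun y _ => F0 y).
rewrite preimage_setT => <-.
pose m' := measure_function_pushforward__canonical__measure_function_Measure (leb1 \x leb n)%E (@measurable_rV_cons R n).
by apply: (@eq_measure_integral _ _ _ _ m').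
Qed.

Lemma integrable_rVS n (F : 'rV[R]_n.+1 -> R) : L1 F ->
  (leb1 \x leb n)%E.-integrable setT (fun p => (F (rV_cons p))%:E).
Proof.
move=> /integrableP[mF iF]; apply/integrableP; split.
  exact: (measurableT_comp mF (@measurable_rV_cons R n)).
have mabs : measurable_fun setT (abse \o (EFin \o F)) by apply: measurableT_comp.
have := @ge0_integral_pushforward _ _ _ _ R _ (@measurable_rV_cons R n) (leb1 \x leb n)%E setT (abse \o (EFin \o F)) measurableT mabs (fun y _ => abse_ge0 _).
rewrite preimage_setT => <-.
by rewrite (le_lt_trans _ iF)//; apply/eqe_le; by apply: eq_measure_integral.
Qed.

Lemma integral_rVS n (F : 'rV[R]_n.+1 -> R) : L1 F ->
  (\int[leb n.+1]_x (F x)%:E = \int[leb1]_t \int[leb n]_x (F (rV_cons (t, x)))%:E)%E.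
Proof.
move=> iF; have mF := measurable_int _ iF.
rewrite [RHS](integral12_prod_meas1 (integrable_rVS iF)).
have := @integral_pushforward _ _ _ _ R _ (@measurable_rV_cons R n) (leb1 \x leb n)%E setT (EFin \o F) mF.
rewrite preimage_setT => /(_ (integrable_rVS iF) measurableT) <-.
pose m' := measure_function_pushforward__canonical__measure_function_Measure (leb1 \x leb n)%E (@measurable_rV_cons R n).
by apply: (@eq_measure_integral _ _ _ _ m').
Qed.

Lemma integral_rVS_swap n (F : 'rV[R]_n.+1 -> R) : L1 F ->
  (\int[leb n.+1]_x (F x)%:E = \int[leb n]_x \int[leb1]_t (F (rV_cons (t, x)))%:E)%E.
Proof.
move=> iF; rewrite integral_rVS// (integral12_prod_meas1 (integrable_rVS iF)).
by rewrite -(integral21_prod_meas1 (integrable_rVS iF)).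
Qed.

(** [r] is the squared radius. The Euclidean unit ball is the reference set of finite positive
    measure that every orthogonal map preserves. *)
Definition eball n (r : R) : set 'rV[R]_n := [set x | \sum_i x ord0 i ^+ 2 < r].

Lemma measurable_mulmx m n (M : 'M[R]_(m, n)) : measurable_fun setT (fun x : 'rV[R]_m => x *m M).
Proof.
apply: measurable_fun_rV => i.
apply: continuous_measurable_rV => x.
have := @affine_continuous R m n M 0.
move=> /(_ x) c; apply: (@continuous_comp _ _ _ (fun x : 'rV[R]_m => x *m M) (fun y => y ord0 i)); last exact: coord_continuous.
by move: c; under eq_fun do rewrite addr0.
Qed.

Lemma open_eball n r : open (@eball n r).
Proof.
rewrite (_ : eball r = (fun x : 'rV[R]_n => \sum_i x ord0 i ^+ 2) @^-1` [set t | t < r])//.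
apply: open_comp; last exact: open_lt.
move=> x _; apply: cinf_continuous.
by apply: smooth_sum => i; apply: smoothX; exact: smooth_coord.
Qed.

Lemma eball_finite n : (0 < leb n (eball 1) < +oo)%E.
Proof.
have mB : measurable (@eball n 1) by apply: open_measurable_rV; exact: open_eball.
apply/andP; split.
(* The cube of half-side 1/(n+1) fits in the ball since n/(n+1)^2 < 1. *)
- pose r : R := n.+1%:R^-1.
  have r0 : 0 < r by rewrite invr_gt0.
  have h := @lebesgue_rV_box R n (fun=> - r) (fun=> r) (fun=> (ge0_cp (ltW r0)).2).
  apply: (@lt_le_trans _ _ (\prod_(i < n) (r - - r))%:E).
    by rewrite lte_fin prodr_gt0// => i _; rewrite opprK addr_gt0.
  rewrite -h le_measure ?inE//.
    exact: (@measurable_coords _ _ (fun=> `[- r, r]%classic)).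
  move=> x /= xr; rewrite /eball/=.
  apply: (@le_lt_trans _ _ (\sum_(i < n) r ^+ 2)).
    apply: ler_sum => i _; have := xr i; rewrite -ler_norml => xi.
    by rewrite -real_normK ?num_real// lerXn2r ?nnegrE// ltW.
  rewrite sumr_const card_ord -mulr_natl expr2 mulrA.
  rewrite -[X in _ < X](@mulfV _ n.+1%:R)// ltr_pM2r//.
  rewrite ltr_pdivrMr// mulr_natr.
  by rewrite -mulrnA ltr_nat mulnS addSn ltnS leq_addr.
- have h := @lebesgue_rV_box R n (fun=> - 1) (fun=> 1) (fun=> (ge0_cp (ler01)).2).
  apply: (@le_lt_trans _ _ (\prod_(i < n) (1 - - 1))%:E); last exact: ltry.
  rewrite -h le_measure ?inE//.
    exact: (@measurable_coords _ _ (fun=> `[- 1, 1]%classic)).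
  move=> x /= xB i; rewrite -ler_norml -(@ler_pXn2r _ 2)// ?nnegrE// expr1n real_normK ?num_real//.
  apply/ltW/(le_lt_trans _ xB); rewrite (bigD1 i)//= lerDl sumr_ge0// => j _.
  exact: sqr_ge0.
Qed.

(* Uniqueness of the translation-invariant measure, in the form
   mu(A) nu(B) = mu(-B) nu(A), which is Tonelli for 1_A(x) 1_B(y - x). *)
Lemma preserving_orthogonal n (Q : 'M[R]_n) : Q *m Q^T = 1%:M -> preserving (fun x => x *m Q).
Proof.
move=> QQ; split; first exact: measurable_mulmx.
move=> A mA.
have QQ' : Q^T *m Q = 1%:M by exact: mulmx1C.
set T := fun x => x *m Q.
have mT : measurable_fun setT T by exact: measurable_mulmx.
pose B := @eball n 1.
have mB : measurable B by apply: open_measurable_rV; exact: open_eball.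
have TB : T @^-1` B = B.
  have E (x : 'rV[R]_n) : \sum_i x ord0 i ^+ 2 = (x *m x^T) ord0 ord0.
    by rewrite !mxE; apply: eq_bigr => i _; rewrite mxE expr2.
  apply/seteqP; split => x;
  by rewrite /B /eball /T /= !E trmx_mul mulmxA -(mulmxA x) QQ mulmx1.
have mu2 (D : set 'rV[R]_n) : measurable D -> measurable (T @^-1` D).
  by move=> mD; rewrite -[X in measurable X]setTI; exact: mT.
have msh (b : 'rV[R]_n) (D : set 'rV[R]_n) : measurable D -> measurable ((fun x => x + b) @^-1` D).
  by move=> mD; rewrite -[X in measurable X]setTI; exact: measurable_shift.
have mi (D : set 'rV[R]_n) (mD : measurable D) : measurable_fun setT (\1_D : 'rV[R]_n -> R).
  exact: measurable_indic.
have intI (D : set 'rV[R]_n) : measurable D -> (\int[leb n]_x (\1_D x)%:E = leb n D)%E.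
  by move=> mD; rewrite integral_indic// setIT.
have ge0I (D : set 'rV[R]_n) x : 0 <= (\1_D x : R) by [].
(* [B] is the unit ball, so T^-1 B = B and integrating [f] in its second variable first yields leb A
   times leb B. The shift by [T y] in the first variable turns [f] into [g], whose integral is leb B
   times leb (T^-1 A); dividing by the finite positive leb B concludes. *)
pose f (p : 'rV[R]_n * 'rV[R]_n) : \bar R := (\1_A p.1 * \1_B (T p.2 - p.1))%:E.
pose g (p : 'rV[R]_n * 'rV[R]_n) : \bar R := (\1_B (- p.1) * \1_A (T p.2 + p.1))%:E.
have m1 i : measurable_fun setT (fun p : 'rV[R]_n * 'rV[R]_n => p.1 ord0 i).
  exact: (measurableT_comp (@measurable_rV_coord _ _ n i) measurable_fst).
have m2 i : measurable_fun setT (fun p : 'rV[R]_n * 'rV[R]_n => (T p.2) ord0 i).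
  apply: (measurableT_comp (@measurable_rV_coord _ _ n i)).
  exact: (measurableT_comp mT measurable_snd).
have mf : measurable_fun setT f.
  apply/measurable_EFinP; apply: measurable_funM.
    exact: (measurableT_comp (mi _ mA) measurable_fst).
  apply: (measurableT_comp (mi _ mB)).
  apply: measurable_fun_rV => i.
  rewrite (_ : (fun _ => _) = (fun p : 'rV[R]_n * 'rV[R]_n => T p.2 ord0 i - p.1 ord0 i)); last first.
    by apply/funext => p; rewrite mxE [X in _ + X]mxE.
  exact: measurable_funB.
have mg : measurable_fun setT g.
  apply/measurable_EFinP; apply: measurable_funM.
    apply: (measurableT_comp (mi _ mB)).
    apply: measurable_fun_rV => i; under eq_fun do rewrite mxE.
    exact: measurableT_comp.
  apply: (measurableT_comp (mi _ mA)).
  apply: measurable_fun_rV => i; under eq_fun do rewrite mxE.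
  exact: measurable_funD.
have sliceL (h : 'rV[R]_n * 'rV[R]_n -> \bar R) y : measurable_fun setT h -> measurable_fun setT (fun x => h (x, y)).
  by move=> mh; apply: (measurableT_comp mh); exact: measurable_pair2.
have f0 p : (0 <= f p)%E by rewrite lee_fin mulr_ge0.
have g0 p : (0 <= g p)%E by rewrite lee_fin mulr_ge0.
have Ef : (\int[leb n]_x \int[leb n]_y f (x, y) = leb n A * leb n B)%E.
  rewrite -(intI A mA) -ge0_integralZr//.
  - apply: eq_integral => x _; rewrite /f /=.
    under eq_integral do rewrite EFinM.
    rewrite ge0_integralZl//; last first.
      apply/measurable_EFinP.
      apply: (measurableT_comp (mi _ mB)).
      apply: measurable_fun_rV => i.
      rewrite (_ : (fun _ => _) = (fun y => T y ord0 i - x ord0 i)); last first.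
        by apply/funext => y; rewrite mxE [X in _ + X]mxE.
      apply: measurable_funB => //.
      exact: (measurableT_comp (@measurable_rV_coord _ _ n i) mT).
    congr (_ * _)%E.
    rewrite (_ : (fun y => _) = (fun y => (\1_((fun y => y + - (x *m Q^T)) @^-1` B) y)%:E)).
      by rewrite intI ?lebesgue_rV_shift//; exact: msh.
    apply/funext => y; rewrite -{2}TB !indicE; congr (_%:R%:E); congr (nat_of_bool _).
    by apply/idP/idP; rewrite !inE /= /T mulmxDl mulNmx -mulmxA QQ' mulmx1.
  - by apply/measurable_EFinP; exact: mi.
have Eg : (\int[leb n]_x \int[leb n]_y g (x, y) = leb n B * leb n (T @^-1` A))%E.
  rewrite -(intI B mB) -ge0_integralZr//.
  - apply: eq_integral => x _; rewrite /g /=.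
    under eq_integral do rewrite EFinM.
    rewrite ge0_integralZl//; last first.
      apply/measurable_EFinP.
      apply: (measurableT_comp (mi _ mA)).
      apply: measurable_fun_rV => i; under eq_fun do rewrite mxE.
      apply: measurable_funD => //.
      exact: (measurableT_comp (@measurable_rV_coord _ _ n i) mT).
    congr (_ * _)%E.
      congr (_%:E); rewrite !indicE; congr (_%:R); congr (nat_of_bool _).
      have BN : \sum_i (- x) ord0 i ^+ 2 = \sum_i x ord0 i ^+ 2.
        by apply: eq_bigr => i _; rewrite mxE sqrrN.
      by apply/idP/idP; rewrite !inE /B /eball /= BN.
    rewrite (_ : (fun y => _) = (fun y => (\1_((fun y => y + (x *m Q^T)) @^-1` (T @^-1` A)) y)%:E)).
      have mTA := mu2 _ mA; rewrite intI; first exact: lebesgue_rV_shift.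
      exact: msh.
    apply/funext => y; rewrite !indicE; congr (_%:R%:E); congr (nat_of_bool _).
    by apply/idP/idP; rewrite !inE /= /T mulmxDl -mulmxA QQ' mulmx1.
  - by apply/measurable_EFinP; exact: mi.
have Efg : (\int[leb n]_x \int[leb n]_y f (x, y) = \int[leb n]_x \int[leb n]_y g (x, y))%E.
  rewrite (@fubini_tonelli _ _ _ _ R (leb n) (leb n) f mf f0).
  rewrite (@fubini_tonelli _ _ _ _ R (leb n) (leb n) g mg g0).
  apply: eq_integral => y _.
  rewrite -(ge0_integral_preserving (preserving_shift (T y)) (sliceL f y mf))//.
  apply: eq_integral => x _; rewrite /f /g /= opprD addrCA subrr addr0 mulrC.
  by rewrite (addrC (T y)).
have /andP[B0 Boo] := eball_finite n; rewrite -/B in B0 Boo.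
have Bfin : leb n B \is a fin_num by rewrite ge0_fin_numE// ltW.
move: Efg; rewrite Ef Eg -(fineK Bfin) muleC => E.
have c0 : fine (leb n B) != 0 by rewrite gt_eqF// fine_gt0// B0.
rewrite -[LHS]mul1e -[RHS]mul1e -[1%:E]/((1 : R)%:E) -(mulVf c0) EFinM -!muleA.
by congr (_ * _)%E; rewrite E.
Qed.

End shift.

(** * Integrals and test functions *)

Section L1.
Context {R : realType} {n : nat}.
Notation leb := (lebesgue_rV n : {measure set 'rV[R]_n -> \bar R}).
Notation Rint F := (Rintegral leb setT F).
Implicit Types (F G f g : 'rV[R]_n -> R).

Lemma L1_measurable F : L1 F -> measurable_fun setT F.
Proof. by move=> /measurable_int/measurable_EFinP. Qed.

Lemma L1_0 : L1 (fun _ : 'rV[R]_n => 0).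
Proof. exact: integrable0. Qed.

Lemma L1D F G : L1 F -> L1 G -> L1 (fun x => F x + G x).
Proof. by move=> iF iG; have := integrableD measurableT iF iG. Qed.

Lemma L1B F G : L1 F -> L1 G -> L1 (fun x => F x - G x).
Proof. by move=> iF iG; have := integrableB measurableT iF iG. Qed.

Lemma L1Z (c : R) F : L1 F -> L1 (fun x => c * F x).
Proof. by move=> iF; have := integrableZl measurableT c iF. Qed.

Lemma L1_sum (I : Type) (r : seq I) (F : I -> 'rV[R]_n -> R) :
  (forall j, L1 (F j)) -> L1 (fun x => \sum_(j <- r) F j x).
Proof.
move=> sF; elim: r => [|j r IH].
  by under eq_fun do rewrite big_nil; exact: L1_0.
by under eq_fun do rewrite big_cons; exact: L1D.
Qed.

Lemma le_L1 F G : measurable_fun setT F -> L1 G -> (forall x, `|F x| <= `|G x|) -> L1 F.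
Proof.
move=> mF iG FG; apply: (le_integrable measurableT _ _ iG).
  exact/measurable_EFinP.
by move=> x _ /=; rewrite lee_fin.
Qed.

Lemma L1_norm F : L1 F -> L1 (fun x => `|F x|).
Proof.
move=> iF; apply: (le_L1 _ iF); last by move=> x; rewrite normr_id.
by apply: measurableT_comp => //; exact: L1_measurable.
Qed.

Lemma L1_mul F g (M : R) : L1 F -> measurable_fun setT g -> (forall x, `|g x| <= M) ->
  L1 (fun x => F x * g x).
Proof.
move=> iF mg gM; apply: (@le_L1 _ (fun x => M * F x)); last 2 first.
- exact: L1Z.
- move=> x; rewrite !normrM mulrC ler_wpM2r// (le_trans (gM x))// ler_norm//.
by apply: measurable_funM => //; exact: L1_measurable.
Qed.

Lemma RintD F G : L1 F -> L1 G -> Rint (fun x => F x + G x) = Rint F + Rint G.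
Proof. by move=> iF iG; exact: RintegralD. Qed.

Lemma RintB F G : L1 F -> L1 G -> Rint (fun x => F x - G x) = Rint F - Rint G.
Proof. by move=> iF iG; exact: RintegralB. Qed.

Lemma RintZ (c : R) F : L1 F -> Rint (fun x => c * F x) = c * Rint F.
Proof. by move=> iF; exact: RintegralZl. Qed.

Lemma RintN F : L1 F -> Rint (fun x => - F x) = - Rint F.
Proof.
by move=> iF; under eq_Rintegral do rewrite -mulN1r; rewrite RintZ// mulN1r.
Qed.

Lemma Rint0 : Rint (fun=> 0) = 0.
Proof. by rewrite Rintegral_cst// mul0r. Qed.

Lemma Rint_sum (I : Type) (r : seq I) (F : I -> 'rV[R]_n -> R) :
  (forall j, L1 (F j)) -> Rint (fun x => \sum_(j <- r) F j x) = \sum_(j <- r) Rint (F j).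
Proof.
move=> sF; elim: r => [|j r IH].
  by under eq_Rintegral do rewrite big_nil; rewrite Rint0 big_nil.
under eq_Rintegral do rewrite big_cons; rewrite RintD// ?IH ?big_cons//.
exact: L1_sum.
Qed.

Lemma le_Rint F G : L1 F -> L1 G -> (forall x, F x <= G x) -> Rint F <= Rint G.
Proof. by move=> iF iG FG; apply: le_Rintegral. Qed.

Lemma norm_Rint F : L1 F -> `|Rint F| <= Rint (fun x => `|F x|).
Proof. by move=> iF; exact: le_normr_Rintegral. Qed.

Lemma norm_Rint_mul F g (M : R) : L1 F -> measurable_fun setT g -> (forall x, `|g x| <= M) ->
  `|Rint (fun x => F x * g x)| <= M * Rint (fun x => `|F x|).
Proof.
move=> iF mg gM; have iFg := L1_mul iF mg gM.
apply: (le_trans (norm_Rint iFg)); rewrite -RintZ; last exact: L1_norm.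
apply: le_Rint; [exact: L1_norm|exact/L1Z/L1_norm|].
by move=> x; rewrite normrM mulrC ler_wpM2r.
Qed.

Lemma cube_lt_pinfty c r : (leb (cube c r) < +oo)%E.
Proof.
have [r0|r0] := leP 0 r.
  have h := @lebesgue_rV_box R n (fun i => c ord0 i - r) (fun i => c ord0 i + r).
  apply: (@le_lt_trans _ _ (\prod_(i < n) (c ord0 i + r - (c ord0 i - r)))%:E); last exact: ltry.
  rewrite -h; last by move=> i; rewrite lerBlDr -addrA lerDl addr_ge0.
  rewrite le_measure ?inE//; first exact: measurable_cube.
    exact: (@measurable_coords _ _ (fun i => `[c ord0 i - r, c ord0 i + r]%classic)).
  by move=> x cx i; have /ltW := cx i; rewrite ler_distl.
apply: (@le_lt_trans _ _ (leb (cube c 1))).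
  rewrite le_measure ?inE//; try exact: measurable_cube.
  by move=> x cx i; apply: (lt_trans (cx i)); apply: (lt_trans r0).
have h := @lebesgue_rV_box R n (fun i => c ord0 i - 1) (fun i => c ord0 i + 1).
apply: (@le_lt_trans _ _ (\prod_(i < n) (c ord0 i + 1 - (c ord0 i - 1)))%:E); last exact: ltry.
rewrite -h; last by move=> i; rewrite lerBlDr -addrA lerDl addr_ge0.
rewrite le_measure ?inE//; first exact: measurable_cube.
  exact: (@measurable_coords _ _ (fun i => `[c ord0 i - 1, c ord0 i + 1]%classic)).
by move=> x cx i; have /ltW := cx i; rewrite ler_distl.
Qed.

Lemma L1_indic (A : set 'rV[R]_n) : measurable A -> (leb A < +oo)%E -> L1 (\1_A : 'rV[R]_n -> R).
Proof.
move=> mA Aoo; apply/integrableP; split; first exact/measurable_EFinP/measurable_indic.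
rewrite (_ : (fun _ => _) = (fun x => (\1_A x)%:E)).
  by rewrite integral_indic// setIT.
by apply/funext => x /=; rewrite ger0_norm.
Qed.

Lemma compact_cube (A : set 'rV[R]_n) : compact A -> exists2 r : R, 0 < r & A `<=` cube 0 r.
Proof.
move=> /compact_bounded[M [Mr MA]].
exists (`|M| + 2) => [|x Ax i]; first by rewrite ltr_wpDl.
rewrite mxE subr0.
have h : `|x| <= `|M| + 1 by apply: MA => //; rewrite (le_lt_trans (ler_norm M))// ltrDl.
apply: (@le_lt_trans _ _ `|x|); last by rewrite (le_lt_trans h)// ltrD2l ltr1n.
rewrite [leRHS]mx_normrE; apply/bigmax_geP; right; exists (ord0, i) => //=.
Qed.

Lemma compact_lt_pinfty (A : set 'rV[R]_n) : compact A -> (leb A < +oo)%E.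
Proof.
move=> cA; have [r r0 Ar] := compact_cube cA.
apply: (@le_lt_trans _ _ (leb (cube 0 r))); last exact: cube_lt_pinfty.
by rewrite le_measure ?inE//; [exact: compact_measurable_rV|exact: measurable_cube].
Qed.

Lemma supp_out f x : ~ supp f x -> f x = 0.
Proof. by move=> fx; apply/eqP; apply: contra_notT fx => fx; exact: subset_closure. Qed.

Lemma supp_sub f (A : set 'rV[R]_n) : closed A -> (forall x, ~ A x -> f x = 0) -> supp f `<=` A.
Proof.
move=> cA fA.
have h : [set x | f x != 0] `<=` A.
  by move=> x /= fx; apply: contrapT => /fA /eqP; rewrite (negbTE fx).
by have := closure_subset h; rewrite -(closure_id A).1.
Qed.

Lemma csupp_bounded f : continuous f -> compact (supp f) -> exists2 M : R, 0 <= M & forall x, `|f x| <= M.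
Proof.
move=> cf cs.
have := @continuous_compact _ _ f (supp f) (continuous_subspaceT cf) cs.
move=> /compact_bounded[M [Mr MA]]; exists (`|M| + 1); first by rewrite addr_ge0.
move=> x; have [fx|fx] := pselect (supp f x); last by rewrite supp_out// normr0 addr_ge0.
apply: MA; last by exists x.
by rewrite (le_lt_trans (ler_norm M))// ltrDl.
Qed.

Lemma csupp_L1 f : continuous f -> compact (supp f) -> L1 f.
Proof.
move=> cf cs; have [M M0 fM] := csupp_bounded cf cs.
apply: (@le_L1 _ (fun x => M * \1_(supp f) x)).
- exact: continuous_measurable_rV.
- apply: L1Z; apply: L1_indic; first exact: compact_measurable_rV.
  exact: compact_lt_pinfty.
- move=> x; rewrite indicE normrM; case: (boolP (x \in supp f)) => fx.
    by rewrite normr1 mulr1 (le_trans (fM x))// ler_norm.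
  rewrite supp_out ?normr0 ?mulr0//.
  by move=> /mem_set; rewrite (negbTE fx).
Qed.

Lemma C1_lipschitz f M : C1 f -> (forall i x, `|pd i f x| <= M) ->
  forall x y, `|f y - f x| <= (\sum_i `|y ord0 i - x ord0 i|) * M.
Proof.
move=> cf fM x y; pose v := y - x.
have dg s : is_derive s (1 : R) (fun s : R => f (x + s *: v)) (\sum_i v ord0 i * pd i f (x + s *: v)).
  have [d1 d2] := C1_is_derive (x + s *: v) v cf.
  by rewrite -d2; exact: is_derive_line.
have cg : continuous (fun s : R => f (x + s *: v)).
  by move=> s; apply/differentiable_continuous/derivable1_diffP; have [] := dg s.
have [t _] := @MVT_segment R _ _ 0 1 ler01 (fun s _ => dg s) (continuous_subspaceT cg).
have -> : x + 1 *: v = y by rewrite scale1r addrC subrK.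
rewrite scale0r addr0 subr0 mulr1 => ->.
apply: (le_trans (ler_norm_sum _ _ _)); rewrite mulr_suml; apply: ler_sum => i _.
by rewrite normrM !mxE ler_wpM2l.
Qed.

(** The parameter ranges over an open interval only, so that kernels singular at an end, such as
    mollifiers at radius 0, are covered. The dominating function is |M| |F|. *)
Lemma is_derive_under F (K K' : R -> 'rV[R]_n -> R) (a u v M : R) :
  L1 F -> u < a < v ->
  (forall t, u < t < v -> measurable_fun setT (K t)) ->
  (forall t, u < t < v -> exists C : R, forall y, `|K t y| <= C) ->
  (forall t y, u < t < v -> is_derive t (1 : R) (K ^~ y) (K' t y)) ->
  (forall t y, u < t < v -> `|K' t y| <= M) ->
  is_derive a (1 : R) (fun t => Rint (fun y => F y * K t y)) (Rint (fun y => F y * K' a y)).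
Proof.
move=> iF ia mK bK dK bK'.
have uva t : (`]u, v[%classic : set R) t -> u < t < v by rewrite /= in_itv.
pose f t y := F y * K t y.
have intf t : (`]u, v[%classic : set R) t -> leb.-integrable setT (EFin \o f t).
  by move=> /uva uv; have [C hC] := bK t uv; apply: (L1_mul iF (mK _ uv) hC).
have df t y : u < t < v -> is_derive t (1 : R) (f ^~ y) (F y * K' t y).
  by move=> uv; have := is_deriveZ (F y) (dK t y uv).
have derf t y : (`]u, v[%classic : set R) t -> setT y -> derivable (f ^~ y) t 1.
  by move=> /uva uv _; have [] := df t y uv.
have D1 t y : u < t < v -> partial1of2 f t y = F y * K' t y.
  by move=> uv; rewrite partial1of2E; have [] := df t y uv.
have Ia : (`]u, v[%classic : set R) a by rewrite /= in_itv.
have H1 := @derivable_under_integral R _ _ leb f setT measurableT a u v Ia intf derf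
  (fun y => `|M| * `|F y|) (fun y => mulr_ge0 (normr_ge0 _) (normr_ge0 _)) (L1Z _ (L1_norm iF)).
have H2 := @differentiation_under_integral R _ _ leb f setT measurableT a u v Ia intf derf
  (fun y => `|M| * `|F y|) (fun y => mulr_ge0 (normr_ge0 _) (normr_ge0 _)) (L1Z _ (L1_norm iF)).
have bnd t y : (`]u, v[%classic : set R) t -> setT y -> `|partial1of2 f t y| <= `|M| * `|F y|.
  move=> /uva uv _; rewrite D1// normrM mulrC ler_wpM2r// (le_trans (bK' _ _ uv))// ler_norm//.
split; first exact: (H1 bnd).
rewrite -derive1E (H2 bnd); apply: eq_Rintegral => y _.
by rewrite D1.
Qed.

(** [test_function] with its smoothness boxed as [cinf], so that unification does not unfold
    [smooth]. *)
Record tst (D : set 'rV[R]_n) f : Prop := Tst {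
  tst_cinf : cinf f; tst_compact : compact (supp f); tst_sub : supp f `<=` D }.

Lemma tstP D f : test_function D f <-> tst D f.
Proof. by split => [[/Cinf]|[[]]]; split. Qed.

Lemma compact_closed_rV (K : set 'rV[R]_n) : compact K -> closed K.
Proof. by move=> cK; apply: compact_closed => //; exact: norm_hausdorff. Qed.

Lemma closed_supp f : closed (supp f).
Proof. exact: closed_closure. Qed.

Lemma tstI D f (K : set 'rV[R]_n) : cinf f -> compact K -> K `<=` D ->
  (forall x, ~ K x -> f x = 0) -> tst D f.
Proof.
move=> sf cK KD fK; have fs := supp_sub (compact_closed_rV cK) fK.
split => //; last exact: subset_trans KD.
by apply: (subclosed_compact _ cK fs); exact: closed_supp.
Qed.

Lemma tst_weaken D D' f : D `<=` D' -> tst D f -> tst D' f.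
Proof. by move=> DD [sf cf fD]; split => //; exact: subset_trans DD. Qed.

Lemma tst_out D f x : tst D f -> ~ D x -> f x = 0.
Proof. by move=> [_ _ fD] Dx; apply: supp_out => /fD. Qed.

Lemma pd_out f i x : ~ supp f x -> pd i f x = 0.
Proof.
move=> fx; rewrite pdE.
have [d <-] : is_derive x (delta_mx ord0 i) f 0; last by [].
apply: (@near_eq_is_derive _ _ _ (cst 0)).
have o : open (~` supp f) by rewrite openC; exact: closed_supp.
have : nbhs x (~` supp f) by exact: open_nbhs_nbhs.
by move=> nb; apply: (filterS _ nb) => y fy /=; rewrite supp_out.
Qed.

Lemma tst_pd D f i : tst D f -> tst D (pd i f).
Proof.
move=> [sf cf fD]; apply: (tstI _ cf fD); first exact: cinf_pd.
by move=> x; exact: pd_out.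
Qed.

Lemma tst_dpart D f s : tst D f -> tst D (dpart s f).
Proof. by elim: s => // i s IH /IH; rewrite dpart_cons; exact: tst_pd. Qed.

Lemma tst_mul D f g : tst D f -> cinf g -> tst D (fun x => f x * g x).
Proof.
move=> [sf cf fD] sg; apply: (tstI _ cf fD); first exact: smoothM.
by move=> x fx; rewrite supp_out// mul0r.
Qed.

Lemma tst_cst0 D : tst D (fun=> 0).
Proof.
apply: (@tstI _ _ set0) => //; first exact: smooth_cst.
exact: compact0.
Qed.

Lemma tstD D f g : tst D f -> tst D g -> tst D (fun x => f x + g x).
Proof.
move=> [sf cf fD] [sg cg gD]; apply: (@tstI _ _ (supp f `|` supp g)).
- exact: smoothD.
- exact: compactU.
- by move=> x [/fD|/gD].
- by move=> x /not_orP[fx gx]; rewrite !supp_out// addr0.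
Qed.

Lemma tstZ D f c : tst D f -> tst D (fun x => c * f x).
Proof.
move=> tf; have := tst_mul tf (@smooth_cst R n c); congr tst.
by apply/funext => x; rewrite mulrC.
Qed.

Lemma tst_sum D (I : Type) (r : seq I) (F : I -> 'rV[R]_n -> R) :
  (forall j, tst D (F j)) -> tst D (fun x => \sum_(j <- r) F j x).
Proof.
move=> sF; elim: r => [|j r IH].
  by under eq_fun do rewrite big_nil; exact: tst_cst0.
by under eq_fun do rewrite big_cons; exact: tstD.
Qed.

Lemma tst_L1 D f : tst D f -> L1 f.
Proof. by move=> [/cinf_continuous cf]; move=> + _; exact: csupp_L1. Qed.

Lemma tst_bounded D f : tst D f -> exists2 M : R, 0 <= M & forall x, `|f x| <= M.
Proof. by move=> [/cinf_continuous cf]; move=> + _; exact: csupp_bounded. Qed.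

Lemma cinf_measurable f : cinf f -> measurable_fun setT f.
Proof. by move=> /cinf_continuous; exact: continuous_measurable_rV. Qed.

Lemma tst_measurable D f : tst D f -> measurable_fun setT f.
Proof. by move=> [/cinf_measurable]. Qed.

Lemma L1_tst D f psi : L1 f -> tst D psi -> L1 (fun x => f x * psi x).
Proof.
move=> i_f tp; have [M _ hM] := tst_bounded tp.
exact: L1_mul i_f (tst_measurable tp) hM.
Qed.

Lemma is_derive_pd f i x t : cinf f ->
  is_derive t (1 : R) (fun t : R => f (x + t *: delta_mx ord0 i)) (pd i f (x + t *: delta_mx ord0 i)).
Proof. by move=> sf; rewrite pdE; apply: is_derive_line; exact: cinf_derivable. Qed.

(** By translation invariance the integral of f (y + t e_i) is constant in t; differentiating under
    the integral sign at t = 0 gives the integral of [pd i f]. *)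
Lemma Rint_pd D f i : tst D f -> Rint (pd i f) = 0.
Proof.
move=> tf; have sf := tst_cinf tf.
have [r r0 fr] := compact_cube (tst_compact tf).
have [M M0 fM] := tst_bounded tf.
have [M' M'0 fM'] := tst_bounded (tst_pd i tf).
(* The unit margin keeps the supports of all translates with |t| < 1 inside [A], whose indicator
   plays the part of the integrable factor. *)
pose A := @cube R n 0 (r + 1).
have iA : L1 (\1_A : 'rV[R]_n -> R).
  by apply: L1_indic; [exact: measurable_cube|exact: cube_lt_pinfty].
have sh t : cinf (fun y => f (y + t *: delta_mx ord0 i)) by exact: smooth_shift.
have out g t y : -1 < t < 1 -> (forall x, ~ supp f x -> g x = 0) ->
    \1_A y * g (y + t *: delta_mx ord0 i) = g (y + t *: delta_mx ord0 i).
  move=> t1 g0; rewrite indicE; case: (boolP (y \in A)) => [|yA]; first by rewrite mul1r.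
  rewrite mul0r g0// => /fr yr; move/negP: yA; apply; apply/mem_set => j.
  have := yr j; rewrite !mxE !subr0 eqxx/= => h.
  rewrite -[y ord0 j](addrK (t * (j == i)%:R)) (le_lt_trans (ler_normB _ _))//.
  apply: ltr_leD => //; rewrite normrM; case: (j == i); rewrite ?normr0 ?mulr0// normr1 mulr1.
  by rewrite ltW// ltr_norml.
have := @is_derive_under \1_A (fun t y => f (y + t *: delta_mx ord0 i))
  (fun t y => pd i f (y + t *: delta_mx ord0 i)) 0 (-1) 1 M' iA.
have m01 : -1 < (0 : R) < 1 by lra.
move=> /(_ m01 (fun t _ => cinf_measurable (sh t)))[].
- by move=> t _; exists M => y.
- by move=> t y _; exact: is_derive_pd.
- by move=> t y _; exact: fM'.
set F := (fun t : R => _); move=> dF E.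
have F0 t : -1 < t < 1 -> F t = Rint f.
  move=> t1; rewrite /F; under eq_Rintegral do rewrite (out f t _ t1 (@supp_out f)).
  by apply: (Rintegral_preserving (preserving_shift _)); exact: tst_L1 tf.
rewrite -(Rintegral_preserving (preserving_shift ((0 : R) *: delta_mx ord0 i)) (tst_L1 (tst_pd i tf))).
under eq_Rintegral do rewrite -(out _ 0 _ m01 (fun x => @pd_out f i x)).
suff dF0 : is_derive (0 : R) (1 : R) F 0 by have [_ E0] := dF0; rewrite E in E0.
apply: (@near_eq_is_derive _ _ _ (cst (Rint f))).
near=> t; rewrite /= F0//.
by apply/andP; split; near: t; [apply: lt_nbhsr; rewrite ltrN10|exact: lt_nbhsl].
Unshelve. all: by end_near. Qed.

Lemma Rint_ibp D f g i : tst D f -> cinf g ->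
  Rint (fun x => pd i f x * g x) = - Rint (fun x => f x * pd i g x).
Proof.
move=> tf sg; have := Rint_pd i (tst_mul tf sg).
rewrite pdM//; last exact: tst_cinf tf.
have t1 := tst_mul (tst_pd i tf) sg; have t2 := tst_mul tf (cinf_pd i sg).
by rewrite (RintD (tst_L1 t1) (tst_L1 t2)) => /eqP; rewrite addr_eq0 => /eqP.
Qed.

Lemma laplacianE f x : laplacian f x = \sum_(i < n) pd i (pd i f) x.
Proof. by apply: eq_bigr => i _; rewrite !dpart_cons. Qed.

Lemma cinf_laplacian f : cinf f -> cinf (laplacian f).
Proof. by move=> sf; apply: (@smooth_sum R n _ _ (fun i => dpart [:: i; i] f)) => i; exact: cinf_dpart. Qed.

Lemma tst_laplacian D f : tst D f -> tst D (laplacian f).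
Proof. by move=> tf; apply: (@tst_sum D _ _ (fun i => dpart [:: i; i] f)) => i; exact: tst_dpart. Qed.

Lemma Rint_laplacian D f g : tst D f -> cinf g ->
  Rint (fun x => laplacian f x * g x) = Rint (fun x => f x * laplacian g x).
Proof.
move=> tf sg.
under eq_Rintegral do rewrite laplacianE mulr_suml.
under [RHS]eq_Rintegral do rewrite laplacianE mulr_sumr.
rewrite !Rint_sum; last 2 first.
- by move=> i; apply: (@tst_L1 D); apply: tst_mul => //; do 2 apply: cinf_pd.
- by move=> i; apply: (@tst_L1 D); apply: tst_mul => //; do 2 apply: tst_pd.
apply: eq_bigr => i _.
rewrite (Rint_ibp i (tst_pd i tf) sg).
have := Rint_ibp i tf (cinf_pd i sg) => /eqP; rewrite -eqr_oppLR => /eqP <-.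
by [].
Qed.

Lemma loc_int_L1 D f (S : set 'rV[R]_n) : locally_integrable_rV D f -> compact S ->
  S `<=` D -> L1 (f \_ S).
Proof.
move=> [oD mf fA] cS SD; have := fA S SD cS.
move=> /(integrable_mkcond (EFin \o f) (compact_measurable_rV cS)).
by rewrite /L1 restrict_EFin.
Qed.

Lemma Rint_restrict D S f g : S `<=` D -> (forall x, ~ S x -> g x = 0) ->
  Rintegral leb D (fun x => f x * g x) = Rint (fun x => (f \_ S) x * g x).
Proof.
move=> SD gS; rewrite Rintegral_mkcond; apply: eq_Rintegral => x _.
rewrite /patch; case: ifPn => xD; case: ifPn => xS //.
- by rewrite gS ?mulr0// => /mem_set; rewrite (negbTE xS).
- by move: xD; rewrite mem_set//; apply: SD; exact: set_mem.
- by rewrite mul0r.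
Qed.

Definition conv F g : 'rV[R]_n -> R := fun x => Rint (fun y => F y * g (x - y)).

Lemma cinf_reflect g x : cinf g -> cinf (fun y => g (x - y)).
Proof.
move=> /(@smooth_affine R n _ _ (- 1%:M) x); congr cinf.
by apply/funext => y; rewrite mulmxN mulmx1 addrC.
Qed.

Lemma continuous_cube f x : (forall e, 0 < e -> exists2 d : R, 0 < d &
  forall z, cube x d z -> `|f x - f z| <= e) -> {for x, continuous f}.
Proof.
move=> H A /nbhs_ballP[e /= e0 fA].
have e2 : 0 < e / 2 by rewrite divr_gt0.
have [d d0 hd] := H (e / 2) e2.
apply/nbhs_ballP; exists d => //= z; rewrite ball_cube// => xz.
apply: fA; rewrite -ball_normE /ball_/= (le_lt_trans (hd z xz))//.
by rewrite ltr_pdivrMr// ltr_pMr// ltr1n.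
Qed.

Lemma conv_continuous F D g : L1 F -> tst D g -> continuous (conv F g).
Proof.
move=> iF tg x.
have /choice[M hM] : forall i, exists M, forall x, `|pd i g x| <= M.
  by move=> i; have [M _ hM] := tst_bounded (tst_pd i tg); exists M.
pose M0 := \sum_i `|M i|.
have hM0 i y : `|pd i g y| <= M0.
  rewrite (le_trans (hM i y))// /M0 (bigD1 i)//= (le_trans (ler_norm _))//.
  by rewrite lerDl sumr_ge0.
have M00 : 0 <= M0 by rewrite sumr_ge0.
have lip := C1_lipschitz (cinf_C1 (tst_cinf tg)) hM0.
have [C C0 gC] := tst_bounded tg.
have iFg z : L1 (fun y => F y * g (z - y)).
  by apply: (L1_mul iF _ (fun y => gC _)); apply: cinf_measurable; apply: cinf_reflect; exact: tst_cinf tg.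
have I0 : 0 <= Rint (fun x => `|F x|) by apply: Rintegral_ge0.
apply: continuous_cube => e e0.
have N0 : 0 < n%:R * M0 * Rint (fun x => `|F x|) + 1 by rewrite ltr_wpDl// !mulr_ge0.
exists (e / (n%:R * M0 * Rint (fun x => `|F x|) + 1)) => [|z zx]; first by rewrite divr_gt0.
rewrite -RintB//.
under eq_Rintegral do rewrite -mulrBr.
have bd y : `|g (x - y) - g (z - y)| <= n%:R * (e / (n%:R * M0 * Rint (fun x => `|F x|) + 1)) * M0.
  apply: (le_trans (lip _ _)); rewrite ler_wpM2r//.
  set E := (e / _); apply: (@le_trans _ _ (\sum_(i < n) E)).
    apply: ler_sum => i _; rewrite !mxE opprD addrACA subrr addr0 distrC; apply: ltW; exact: zx.
  by rewrite sumr_const card_ord mulr_natl.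
have mm : measurable_fun setT (fun y : 'rV[R]_n => g (x - y) - g (z - y)).
  by apply: measurable_funB; apply: cinf_measurable; apply: cinf_reflect; exact: tst_cinf tg.
apply: (le_trans (norm_Rint_mul iF mm bd)).
have final (a b c d : R) : 0 <= a -> 0 <= b -> 0 <= c -> 0 < d -> a * (d / (a * b * c + 1)) * b * c <= d.
  move=> a0 b0 c0 d0; rewrite (_ : _ * b * c = d * ((a * b * c) / (a * b * c + 1))); last by ring.
  have abc : 0 < a * b * c + 1 by rewrite ltr_wpDl// !mulr_ge0.
  by rewrite ler_piMr ?(ltW d0)// ler_pdivrMr// mul1r lerDl.
exact: final.
Qed.

Lemma is_derive_conv F D g i x : L1 F -> tst D g ->
  is_derive x (delta_mx ord0 i) (conv F g) (conv F (pd i g) x).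
Proof.
move=> iF tg; apply: derivable_lineP.
have [C C0 gC] := tst_bounded tg.
have [M M0 gM] := tst_bounded (tst_pd i tg).
have mg t : measurable_fun setT (fun y : 'rV[R]_n => g (x + t *: delta_mx ord0 i - y)).
  by apply: cinf_measurable; apply: cinf_reflect; exact: tst_cinf tg.
have m01 : -1 < (0 : R) < 1 by lra.
have := @is_derive_under F (fun t y => g (x + t *: delta_mx ord0 i - y))
  (fun t y => pd i g (x + t *: delta_mx ord0 i - y)) 0 (-1) 1 M iF m01 (fun t _ => mg t).
have -> : conv F (pd i g) x = Rint (fun y => F y * pd i g (x + (0 : R) *: delta_mx ord0 i - y)).
  by apply: eq_Rintegral => y _; rewrite scale0r addr0.
apply.
- by move=> t _; exists C.
- move=> t y _; have := is_derive_pd i (x - y) t (tst_cinf tg).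
  rewrite (_ : (fun t : R => _) = (fun t : R => g (x + t *: delta_mx ord0 i - y))).
    by rewrite addrAC.
  by apply/funext => s; rewrite addrAC.
- by [].
Qed.

Lemma pd_conv F D g i : L1 F -> tst D g -> pd i (conv F g) = conv F (pd i g).
Proof.
move=> iF tg; apply/funext => x; rewrite pdE.
by have [] := is_derive_conv i x iF tg.
Qed.

(** The functions [conv F h] with [h] a test function are continuous and stable under [pd], which
    falls on [h]. *)
Lemma cinf_conv F D g : L1 F -> tst D g -> cinf (conv F g).
Proof.
move=> iF tg; apply: Cinf.
apply: (smooth_class (S := fun h => exists2 g, tst D g & h = conv F g)); last by exists g.
move=> _ [{tg}g tg ->]; split; first exact: conv_continuous tg.
move=> i; split => [x|]; first by have [] := is_derive_conv i x iF tg.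
by exists (pd i g); [exact: tst_pd|exact: pd_conv tg].
Qed.

End L1.

(** * The fundamental lemma of the calculus of variations *)

Section fundamental_lemma.
Context {R : realType} {n : nat}.
Notation leb := (lebesgue_rV n : {measure set 'rV[R]_n -> \bar R}).
Notation Rint F := (Rintegral leb setT F).
Implicit Types (F G f g : 'rV[R]_n -> R) (a b : 'I_n -> R).

Definition obox a b : set 'rV[R]_n := [set x | forall i, a i < x ord0 i < b i].
Definition cbox a b : set 'rV[R]_n := [set x | forall i, a i <= x ord0 i <= b i].

Lemma obox_cbox a b : obox a b `<=` cbox a b.
Proof. by move=> x h i; have /andP[/ltW -> /ltW ->] := h i. Qed.

Lemma cbox_compact a b : compact (cbox a b).
Proof.
have := @rV_compact R n (fun i => `[a i, b i]%classic) (fun i => @segment_compact R (a i) (b i)).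
congr compact; apply/seteqP; split => x h i; have := h i; by rewrite /= in_itv.
Qed.

Lemma measurable_obox a b : measurable (obox a b).
Proof.
rewrite (_ : obox a b = [set x | forall i, `]a i, b i[%classic (x ord0 i)]).
  by apply: (@measurable_coords _ _ (fun i => `]a i, b i[%classic)).
by apply/seteqP; split => x h i; have := h i; rewrite /= in_itv.
Qed.

Lemma setI_obox a b a' b' :
  obox a b `&` obox a' b' = obox (fun i => Num.max (a i) (a' i)) (fun i => Num.min (b i) (b' i)).
Proof.
apply/seteqP; split => x.
  by move=> [h h'] i; rewrite gt_max lt_min; have /andP[-> ->] := h i; have /andP[-> ->] := h' i.
by move=> h; split => i; have := h i; rewrite gt_max lt_min => /andP[/andP[h1 h2] /andP[h3 h4]]; rewrite ?h1 ?h2 ?h3 ?h4.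
Qed.

Definition oboxes : set (set 'rV[R]_n) := [set A | exists a b, A = obox a b].

(** Boxes, unlike the coordinate cylinders that define the sigma-algebra, are stable under
    intersection: they are the pi-system of the Dynkin argument in [ae0_of_oboxes]. *)
Lemma measurable_rVE : @measurable _ 'rV[R]_n = <<s oboxes >>.
Proof.
apply/seteqP; split; last first.
  apply: smallest_sub; first exact: sigma_algebra_measurable.
  by move=> _ [a [b ->]]; exact: measurable_obox.
have mc i : measurable_fun (setT : set (g_sigma_algebraType oboxes)) (fun x : 'rV[R]_n => x ord0 i).
  apply: (measurability _ (RGenOpens.measurableE R)) => //.
  move=> _ [_ [x [y ->]] <-]; rewrite setTI.
  rewrite (_ : _ @^-1` _ = \bigcup_k obox (fun j => if j == i then x else - k%:R)
     (fun j => if j == i then y else k%:R)).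
    by apply: bigcupT_measurable => k; apply: sub_sigma_algebra; eexists; eexists.
  apply/seteqP; split => z /=.
    rewrite in_itv/= => xzy.
    have [k hk] : exists k : nat, forall j : 'I_n, `|z ord0 j| < k%:R.
      exists (Num.truncn (\sum_j `|z ord0 j|)).+1 => j.
      apply: le_lt_trans (truncnS_gt _); rewrite (bigD1 j)//= lerDl sumr_ge0//.
    exists k => // j; case: eqP => [->//|_].
    by have := hk j; rewrite ltr_norml.
  by move=> [k _] /(_ i); rewrite eqxx in_itv.
apply: smallest_sub; first exact: smallest_sigma_algebra.
move=> A; rewrite -bigcup_seq/= => -[i _ [B mB <-]].
exact: (mc i measurableT B mB).
Qed.

Lemma setI_closed_oboxes : setI_closed oboxes.
Proof. by move=> _ _ [a [b ->]] [a' [b' ->]]; rewrite setI_obox; eexists; eexists. Qed.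

Definition bump a b : 'rV[R]_n -> R :=
  fun x => \prod_i (flat_step 0 (x ord0 i - a i) * flat_step 0 (b i - x ord0 i)).

Lemma flat0_ge0 (t : R) : 0 <= flat_step 0 t.
Proof. by rewrite /flat_step; case: ifP => // _; rewrite hornerC mul1r expR_ge0. Qed.

Lemma flat0_gt0 (t : R) : 0 < t -> 0 < flat_step 0 t.
Proof. by move=> t0; rewrite /flat_step t0 hornerC mul1r expR_gt0. Qed.

Lemma flat0_eq0 (t : R) : t <= 0 -> flat_step 0 t = 0.
Proof. by move=> t0; rewrite /flat_step ltNge t0. Qed.

Lemma flat0_le1 (t : R) : flat_step 0 t <= 1.
Proof.
rewrite /flat_step; case: ifP => // t0; rewrite hornerC mul1r -expR0 ler_expR oppr_le0.
by rewrite invr_ge0 ltW.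
Qed.

Lemma bump_cinf a b : cinf (bump a b).
Proof.
apply: smooth_prod => i; apply: smoothM; apply: smooth_comp; try exact: smooth1_flat.
- by apply: smoothB; [exact: smooth_coord|exact: smooth_cst].
- by apply: smoothB; [exact: smooth_cst|exact: smooth_coord].
Qed.

Lemma bump_ge0 a b x : 0 <= bump a b x.
Proof. by apply: prodr_ge0 => i _; apply: mulr_ge0; exact: flat0_ge0. Qed.

Lemma bump_le1 a b x : bump a b x <= 1.
Proof.
apply: prodr_ile1 => i _.
by rewrite mulr_ge0 ?flat0_ge0//= mulr_ile1 ?flat0_ge0 ?flat0_le1.
Qed.

Lemma bump_gt0 a b x : obox a b x -> 0 < bump a b x.
Proof.
move=> h; apply: prodr_gt0 => i _; have /andP[h1 h2] := h i.
by apply: mulr_gt0; apply: flat0_gt0; rewrite subr_gt0.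
Qed.

Lemma bump_eq0 a b x : ~ obox a b x -> bump a b x = 0.
Proof.
move=> /existsNP[i /negP]; rewrite negb_and -!leNgt => h.
rewrite /bump (bigD1 i)//=; case/orP: h => h.
  by rewrite (@flat0_eq0 (x ord0 i - a i)) ?subr_le0// !mul0r.
by rewrite (@flat0_eq0 (b i - x ord0 i)) ?subr_le0// mulr0 mul0r.
Qed.

(* Test functions converging to the indicator of the open box, where bump is positive. *)
Definition bump_approx a b k x := 1 - (1 - bump a b x) ^+ k.

Lemma bump_approx_tst a b D k : cbox a b `<=` D -> tst D (bump_approx a b k).
Proof.
move=> abD; apply: (tstI _ (@cbox_compact a b) abD).
  apply: smoothB; first exact: smooth_cst.
  apply: smoothX; apply: smoothB; [exact: smooth_cst|exact: bump_cinf].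
move=> x nx; rewrite /bump_approx bump_eq0; last by move=> /obox_cbox.
by rewrite subr0 expr1n subrr.
Qed.

Lemma bump_approx_bound a b k x : 0 <= bump_approx a b k x <= 1.
Proof.
have h0 : 0 <= 1 - bump a b x by rewrite subr_ge0 bump_le1.
have h1 : 1 - bump a b x <= 1 by rewrite lerBlDr lerDl bump_ge0.
by rewrite /bump_approx subr_ge0 exprn_ile1//= lerBlDr lerDl exprn_ge0.
Qed.

Lemma bump_approx_cvg a b x : bump_approx a b ^~ x @ \oo --> (\1_(obox a b) x : R).
Proof.
rewrite indicE; case: (boolP (x \in obox a b)) => [/set_mem|] xab.
  have h0 : 0 <= 1 - bump a b x by rewrite subr_ge0 bump_le1.
  have h1 : 1 - bump a b x < 1 by rewrite ltrBlDr ltrDl bump_gt0.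
  rewrite -[X in _ --> X]subr0; apply: cvgB; first exact: cvg_cst.
  by apply: cvg_expr; rewrite ger0_norm.
rewrite (_ : (fun _ => _) = cst 0); first exact: cvg_cst.
apply/funext => k; rewrite /bump_approx bump_eq0 ?subr0 ?expr1n ?subrr//.
by move=> /mem_set; rewrite (negbTE xab).
Qed.

Lemma Rint_dct (f_ : nat -> 'rV[R]_n -> R) f G :
  (forall k, measurable_fun setT (f_ k)) -> measurable_fun setT f ->
  (forall x, f_ ^~ x @ \oo --> f x) -> L1 G -> (forall k x, `|f_ k x| <= G x) ->
  L1 f /\ (fun k => Rint (f_ k)) @ \oo --> Rint f.
Proof.
move=> mf_ mf cf iG fG.
have [|||||i1 _ i3] := @dominated_convergence _ _ R leb setT measurableT
  (fun k x => (f_ k x)%:E) (fun x => (f x)%:E) (fun x => (G x)%:E).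
- by move=> k; apply/measurable_EFinP.
- exact/measurable_EFinP.
- by apply: aeW => x _; apply: cvg_EFin; [exact: nearW|exact: cf].
- exact: iG.
- by apply: aeW => x k _; rewrite lee_fin.
split; first exact: i1.
apply: fine_cvg; rewrite fineK; first exact: i3.
exact: integrable_fin_num.
Qed.

Lemma Rint_obox_eq0 F a b : L1 F ->
  (forall k, Rint (fun x => F x * bump_approx a b k x) = 0) ->
  Rint (fun x => F x * \1_(obox a b) x) = 0.
Proof.
move=> iF h.
have mF := L1_measurable iF.
have mb k : measurable_fun setT (bump_approx a b k).
  by apply: tst_measurable (@bump_approx_tst a b setT k _).
have := @Rint_dct (fun k x => F x * bump_approx a b k x) (fun x => F x * \1_(obox a b) x)
  (fun x => `|F x|) _ _ _ (L1_norm iF) _.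
case.
- by move=> k; apply: measurable_funM.
- by apply: measurable_funM => //; apply: measurable_indic; exact: measurable_obox.
- by move=> x; apply: cvgMr; exact: bump_approx_cvg.
- move=> k x; rewrite normrM ler_piMr// ger0_norm; first by have /andP[] := bump_approx_bound a b k x.
  by have /andP[] := bump_approx_bound a b k x.
move=> _; rewrite (_ : (fun k => _) = cst 0); last by apply/funext => k; exact: h.
by move=> /cvg_lim => <- //; rewrite lim_cst.
Qed.

(** The sets over which [F] has zero integral form a Dynkin system containing the boxes; the
    hypothesis on the full integral supplies the whole space and the complements. *)
Lemma ae0_of_oboxes F : L1 F -> (forall a b, Rint (fun x => F x * \1_(obox a b) x) = 0) ->
  Rint F = 0 -> {ae leb, forall x, F x = 0}.
Proof.
move=> iF h hT.
have IE A : measurable A -> (\int[leb]_(x in A) (F x)%:E)%E = (Rint (fun x => F x * \1_A x))%:E.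
  move=> mA; rewrite integral_mkcond /Rintegral fineK.
    apply: eq_integral => x _; rewrite /patch indicE.
    by case: ifPn => _; rewrite ?mulr1 ?mulr0.
  apply: integrable_fin_num => //.
  apply: (@L1_mul _ _ _ _ 1 iF); first exact: measurable_indic.
  by move=> x; rewrite indicE; case: (_ \in _); rewrite ?normr1 ?normr0.
have L1A A : measurable A -> L1 (fun x => F x * \1_A x).
  move=> mA; apply: (@L1_mul _ _ _ _ 1 iF); first exact: measurable_indic.
  by move=> x; rewrite indicE; case: (_ \in _); rewrite ?normr1 ?normr0.
have all0 A : measurable A -> Rint (fun x => F x * \1_A x) = 0.
  move=> mA; apply: (@dynkin_induction _ _ oboxes (fun A => Rint (fun x => F x * \1_A x) = 0)
    measurable_rVE setI_closed_oboxes).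
  - by rewrite -[RHS]hT; apply: eq_Rintegral => x _; rewrite indicT mulr1.
  - by move=> _ [a [b ->]].
  - move=> S mS IS; rewrite -[RHS](subr0 0) -{1}hT -IS -RintB//; last exact: L1A.
    apply: eq_Rintegral => x _; rewrite !indicE in_setC.
    by case: (_ \in _); rewrite ?mulr0 ?mulr1 ?subrr ?subr0.
  - move=> S mS tS IS.
    have mU : measurable (\bigcup_k S k) by exact: bigcupT_measurable.
    apply: (@EFin_inj R); rewrite -IE//.
    rewrite integral_bigcup//; last by apply: (integrableS measurableT).
    by rewrite eseries0// => k _ _; rewrite IE// IS.
  - by rewrite -measurable_rVE.
have := @integral_ae_eq _ _ R leb setT measurableT (cst 0%E) (EFin \o F) iF (@measurable_cst _ _ _ _ _ _).
move=> /(_ _); case.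
  by move=> A _ mA; rewrite integral0 IE// all0.
by move=> N [mN N0 NF]; exists N; split => // x /= Fx; apply: NF => /= /(_ I) [].
Qed.

(** The rational cubes are countable, and those on which [P] holds almost everywhere cover [D];
    their exceptional sets add up to a null set. *)
Lemma ae_local (D : set 'rV[R]_n) (P : 'rV[R]_n -> Prop) :
  (forall x, D x -> exists2 r : R, 0 < r & {ae leb, forall y, cube x r y -> P y}) ->
  {ae leb, forall x, D x -> P x}.
Proof.
move=> H.
pose B (p : 'rV[rat]_n * nat) : set 'rV[R]_n := cube (map_mx ratr p.1) (p.2.+1%:R^-1).
(* Vacuous for the cubes on which [P] does not hold almost everywhere, so that only the good cubes
   contribute exceptional sets. *)
pose Q k y := if unpickle k is Some p then
   {ae leb, forall y, B p y -> P y} -> B p y -> P y else True.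
have aeQ : {ae leb, forall y, forall k, Q k y}.
  apply: ae_foralln => k; rewrite /Q; case: unpickle => [p|]; last exact: aeW.
  have [h|h] := pselect {ae leb, forall y, B p y -> P y}; last by apply: aeW => y /h.
  by apply: filterS h => y hy _.
apply: filterS aeQ => x Qx Dx; have [r r0 hr] := H x Dx.
have [c [k [cx cr]]] := rat_cube x r0.
have := Qx (pickle (c, k)); rewrite /Q pickleK; apply => //.
by apply: filterS hr => y hy /cr; exact: hy.
Qed.

(** Around each point [g] is cut down to a box, where it is integrable, and [bump_approx] tests it
    against the indicators of all smaller boxes. *)
Lemma fundamental_lemma (D : set 'rV[R]_n) g : open D ->
  (forall S, compact S -> S `<=` D -> L1 (g \_ S)) ->
  (forall psi, tst D psi -> Rintegral leb D (fun x => g x * psi x) = 0) ->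
  {ae leb, forall x, D x -> g x = 0}.
Proof.
move=> oD gS gpsi; apply: ae_local => x Dx.
have [r r0 xr] := open_nbhs_cube oD Dx.
pose a0 i := x ord0 i - r / 2; pose b0 i := x ord0 i + r / 2.
have r20 : 0 < r / 2 by rewrite divr_gt0.
have SD : cbox a0 b0 `<=` D.
  move=> y xy; apply: xr => i; have := xy i; rewrite -ler_distl => /le_lt_trans; apply.
  by rewrite ltr_pdivrMr// ltr_pMr// ltr1n.
have iG := gS _ (@cbox_compact a0 b0) SD.
set G := g \_ _ in iG.
pose G0 y := G y * \1_(obox a0 b0) y.
have b1 A y : `|\1_A y : R| <= 1.
  by rewrite indicE; case: (_ \in _); rewrite ?normr1 ?normr0.
have iG0 : L1 G0.
  apply: (@L1_mul _ _ G (\1_(obox a0 b0)) 1 iG); last exact: b1.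
  by apply: measurable_indic; exact: measurable_obox.
have Gtest a b : Rint (fun y => G0 y * \1_(obox a b) y) = 0.
  under eq_Rintegral do rewrite /G0 -mulrA -[X in _ * X]/((\1_(obox a0 b0) \* \1_(obox a b)) _) -indicI setI_obox.
  apply: Rint_obox_eq0 => // k.
  pose a' i := Num.max (a0 i) (a i); pose b' i := Num.min (b0 i) (b i).
  have sub : cbox a' b' `<=` cbox a0 b0.
    move=> y yab i; have := yab i; rewrite /a' /b' ge_max le_min.
    by move=> /andP[/andP[-> _] /andP[-> _]].
  have tk := bump_approx_tst k (subset_trans sub SD).
  rewrite -(gpsi _ tk); apply/esym; apply: Rint_restrict => // y ny.
  rewrite /bump_approx bump_eq0 ?subr0 ?expr1n ?subrr//.
  by move=> /obox_cbox/sub.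
have h0 : {ae leb, forall y, G0 y = 0}.
  apply: ae0_of_oboxes => //.
  rewrite -[RHS](Gtest a0 b0); apply: eq_Rintegral => y _.
  by rewrite /G0 -mulrA indicE; case: (_ \in _); rewrite ?mulr1 ?mulr0.
exists (r / 2) => //; apply: filterS h0 => y Gy xy.
have oy : obox a0 b0 y by move=> i; have := xy i; rewrite ltr_distl.
move: Gy; rewrite /G0 indicE mem_set// mulr1 /G /patch mem_set//.
exact: obox_cbox.
Qed.

End fundamental_lemma.

(** * Mean values and Weyl's lemma *)

Section kernel.
Context {R : realType} {n : nat}.
Notation leb := (lebesgue_rV n : {measure set 'rV[R]_n -> \bar R}).
Notation Rint F := (Rintegral leb setT F).
Implicit Types (F G f g : 'rV[R]_n -> R) (x y z p : 'rV[R]_n) (e r : R).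

Definition sqn z : R := \sum_i z ord0 i ^+ 2.

Lemma sqn_cinf : cinf sqn.
Proof. by apply: smooth_sum => i; apply: smoothX; exact: smooth_coord. Qed.

Lemma sqn_ge0 z : 0 <= sqn z.
Proof. by apply: sumr_ge0 => i _; exact: sqr_ge0. Qed.

Lemma sqnN z : sqn (- z) = sqn z.
Proof. by apply: eq_bigr => i _; rewrite mxE sqrrN. Qed.

Lemma pd_sqn i : pd i sqn = fun z => z ord0 i *+ 2.
Proof.
rewrite [sqn](_ : _ = fun z => \sum_j z ord0 j ^+ 2)//.
rewrite pd_sum; last by move=> j; apply: smoothX; exact: smooth_coord.
apply/funext => z; rewrite (bigD1 i)//= big1 => [|j ji].
  by rewrite (_ : (fun z => z ord0 i ^+ 2) = (fun z => z ord0 i * z ord0 i))//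
    pdM ?pd_coord ?eqxx ?mul1r ?mulr1 ?addr0//; exact: smooth_coord.
by rewrite (_ : (fun z => z ord0 j ^+ 2) = (fun z => z ord0 j * z ord0 j))//
    pdM ?pd_coord 1?eq_sym ?(negbTE ji) ?mul0r ?mulr0 ?addr0//; exact: smooth_coord.
Qed.

(** (-1)^k times the k-th derivative of exp (- 1/(1 - s)), extended by 0 to s >= 1. Composed with
    |z|^2 / e^2 it is supported in the Euclidean ball of radius e. *)
Definition prof k (s : R) : R := flat_step k (1 - s).

Lemma prof_derive k s : is_derive s (1 : R) (prof k) (- prof k.+1 s).
Proof.
have d1 : is_derive s (1 : R) (fun s : R => 1 - s) (-1).
  apply: (is_derive_eq (is_deriveB (is_derive_cst (1 : R) s (1 : R)) (is_derive_id s (1 : R)))).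
  by rewrite sub0r.
have d2 : is_derive s (1 : R) (flat_step k \o (fun s : R => 1 - s)) (flat_step k.+1 (1 - s) *: (-1)).
  by apply: is_derive1_comp => //; exact: flat_stepP.
by apply: (is_derive_eq d2); rewrite [_ *: _]mulrN1.
Qed.

Lemma smooth1_prof k : smooth1 (prof k).
Proof.
have := @smooth1_affine R _ (-1) 1 (smooth1_flat k); congr smooth1.
by apply/funext => s; rewrite /prof mulN1r addrC.
Qed.

Lemma prof_out k s : 1 <= s -> prof k s = 0.
Proof. by move=> s1; rewrite /prof /flat_step ltNge subr_le0 s1. Qed.

Lemma prof_bounded k : exists2 M : R, 0 <= M & forall s : R, 0 <= s -> `|prof k s| <= M.
Proof.
have c : {within `[0, 1], continuous (prof k)}.
  by apply: continuous_subspaceT; apply: smooth1_continuous; exact: smooth1_prof.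
have [a _ ha] := EVT_max ler01 c.
have [b _ hb] := EVT_min ler01 c.
exists (`|prof k a| + `|prof k b|); first by rewrite addr_ge0.
move=> s s0; have [s1|s1] := leP s 1; last first.
  by rewrite prof_out ?(ltW s1)// normr0 addr_ge0.
have sI : s \in `[0, 1] by rewrite in_itv/= s0.
rewrite ler_norml; apply/andP; split.
  rewrite (le_trans _ (hb s sI))// opprD -[leRHS]add0r lerD ?oppr_le0//.
  by rewrite lerNl -normrN ler_norm.
by rewrite (le_trans (ha s sI))// (le_trans (ler_norm _))// lerDl.
Qed.

Lemma prof1_ge0 s : 0 <= prof 1 s.
Proof.
rewrite /prof /flat_step; case: ifP => // _; rewrite mulr_ge0 ?expR_ge0//.
by rewrite /= derivC subr0 mulr1 hornerXn sqr_ge0.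
Qed.

Lemma prof1_gt0 s : 0 <= s <= 2^-1 -> expR (-2) <= prof 1 s.
Proof.
move=> /andP[s0 s1]; have s2 : 2^-1 <= 1 - s by lra.
have s3 : 0 < 1 - s by apply: lt_le_trans s2; rewrite invr_gt0.
rewrite /prof /flat_step s3 /= derivC subr0 mulr1 hornerXn.
apply: (@le_trans _ _ (1 * expR (- (1 - s)^-1))).
  by rewrite mul1r ler_expR lerN2 invf_ple ?posrE.
rewrite ler_wpM2r ?expR_ge0// -[leLHS](expr1n _ 2) lerXn2r ?nnegrE ?invr_ge0 ?(ltW s3)//.
by rewrite invf_pge ?posrE// invr1 lerBlDr lerDl.
Qed.

(** The profile of [eta] is minus the derivative of that of [Phi]. This makes the derivative of
    [eta e] in the radius equal to e^(1-n)/2 times the Laplacian of [Phi e], a test function on the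
    same ball: a smooth substitute for mean values over spheres. *)
Definition eta (e : R) z : R := e ^- n * prof 1 (e ^- 2 * sqn z).
Definition Phi (e : R) z : R := prof 0 (e ^- 2 * sqn z).

Lemma prof_cinf k (c : R) : cinf (fun z => prof k (c * sqn z)).
Proof.
apply: (@smooth_comp R n (prof k)); first exact: smooth1_prof.
by apply: smoothZ; exact: sqn_cinf.
Qed.

Lemma pd_prof k (c : R) i : pd i (fun z => prof k (c * sqn z)) =
  fun z => - (2 * c) * (z ord0 i * prof k.+1 (c * sqn z)).
Proof.
rewrite (pd_comp i (prof_derive k)); last by apply: smoothZ; exact: sqn_cinf.
apply/funext => z; rewrite pdZ ?pd_sqn; last exact: sqn_cinf.
by rewrite -mulr_natl; ring.
Qed.

Lemma sqn_ge_coord z i : z ord0 i ^+ 2 <= sqn z.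
Proof. by rewrite /sqn (bigD1 i)//= lerDl sumr_ge0// => j _; exact: sqr_ge0. Qed.

Lemma prof_cube_out k e z : 0 < e -> ~ cube 0 e z -> prof k (e ^- 2 * sqn z) = 0.
Proof.
move=> e0 /existsNP[i /negP]; rewrite -leNgt mxE subr0 => ze.
apply: prof_out; rewrite -ler_pdivrMl ?invr_gt0 ?exprn_gt0// invrK mulr1.
apply: le_trans (sqn_ge_coord z i).
by rewrite -(real_normK (num_real (z ord0 i))) lerXn2r ?nnegrE ?(ltW e0).
Qed.

Lemma laplacian_Phi e z : 0 < e ->
  laplacian (Phi e) z = 4 * e ^- 2 * (e ^- 2 * sqn z) * prof 2 (e ^- 2 * sqn z)
    - 2 * n%:R * e ^- 2 * prof 1 (e ^- 2 * sqn z).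
Proof.
move=> e0; rewrite laplacianE; set c := e ^- 2.
transitivity (\sum_(i < n) (4 * c ^+ 2 * prof 2 (c * sqn z) * z ord0 i ^+ 2
   - 2 * c * prof 1 (c * sqn z))).
  apply: eq_bigr => i _; rewrite /Phi -/c pd_prof pdZ; last first.
    by apply: smoothM; [exact: smooth_coord|exact: prof_cinf].
  rewrite pdM; [|exact: smooth_coord|exact: prof_cinf].
  by rewrite pd_coord eqxx pd_prof (_ : true%:R = 1 :> R)//; ring.
rewrite big_split /= -mulr_sumr -/(sqn z) sumrN sumr_const card_ord -mulr_natl; ring.
Qed.

Lemma is_derive_pow k e : is_derive e (1 : R) (fun e : R => e ^+ k) (k%:R * e ^+ k.-1).
Proof.
elim: k => [|k IH].
  rewrite (_ : (fun e : R => e ^+ 0) = cst 1); last by apply/funext => t; rewrite expr0.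
  by apply: (is_derive_eq (is_derive_cst (1 : R) e (1 : R))); rewrite mul0r.
rewrite (_ : (fun e : R => e ^+ k.+1) = (fun e : R => e * e ^+ k)); last by apply/funext => t; rewrite exprS.
apply: (is_derive_eq (is_deriveM (is_derive_id e (1 : R)) IH)).
rewrite /GRing.scale /= -[in RHS]addn1 natrD.
by case: k {IH} => [|k]; rewrite ?expr0 ?exprS; ring.
Qed.

Lemma is_derive_eta (e : R) z : 0 < e ->
  is_derive e (1 : R) (fun e => eta e z) (2^-1 * (e ^- n * e) * laplacian (Phi e) z).
Proof.
move=> e0; have en0 : e != 0 by rewrite gt_eqF.
have dX k : is_derive e (1 : R) (fun e : R => e ^- k) (- (k%:R * e ^- k.+1)).
  have xn0 : e ^+ k != 0 by rewrite expf_neq0.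
  have dV (t : R) : t != 0 -> is_derive t (1 : R) (fun t : R => t^-1) (- t ^- 2).
    by move=> t0; apply: (is_derive_eq (is_deriveV t0 (is_derive_id t (1 : R)))); rewrite [_%:A]mulr1.
  have d : is_derive e (1 : R) ((fun t : R => t^-1) \o (fun e : R => e ^+ k)) (- (e ^+ k) ^- 2 *: (k%:R * e ^+ k.-1)).
    by apply: is_derive1_comp; [exact: dV|exact: is_derive_pow].
  apply: (is_derive_eq d).
  clear d; case: k xn0 => [|k] xn0; first by rewrite !mulr0n !mul0r scaler0 oppr0.
  by rewrite /GRing.scale /= !exprS; field; rewrite en0 -?exprS ?expf_neq0.
have d2 : is_derive e (1 : R) (fun e : R => e ^- 2 * sqn z) (- 2 * e ^- 3 * sqn z).
  apply: (is_derive_eq (is_deriveM (dX 2%N) (is_derive_cst (sqn z) e (1 : R)))).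
  rewrite /GRing.scale /=; ring.
have d3 : is_derive e (1 : R) (prof 1 \o (fun e : R => e ^- 2 * sqn z))
    (- prof 2 (e ^- 2 * sqn z) *: (- 2 * e ^- 3 * sqn z)).
  by apply: is_derive1_comp; exact: prof_derive.
apply: (is_derive_eq (is_deriveM (dX n) d3)).
rewrite (laplacian_Phi z e0) (exprS e n) /GRing.scale /=.
set P1 := prof 1 _; set P2 := prof 2 _.
move: (e ^+ n) (expf_neq0 n en0) => a a0; field; rewrite en0; exact: a0.
Qed.

(** [F] is a function on the whole space and only the test functions are confined to [A], so that
    truncations of a local solution qualify. *)
Definition weak_sol (A : set 'rV[R]_n) (c : R) F := forall psi, tst A psi ->
  Rint (fun x => F x * (laplacian psi x + c * psi x)) = 0.

Lemma etaN e z : eta e (- z) = eta e z.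
Proof. by rewrite /eta sqnN. Qed.

Lemma laplacian_shift f b x : laplacian (fun x => f (x + b)) x = laplacian f (x + b).
Proof. by rewrite !laplacianE; apply: eq_bigr => i _; rewrite !pd_shift. Qed.

Lemma ccube_compact x e : compact [set y : 'rV[R]_n | forall i, `|y ord0 i - x ord0 i| <= e].
Proof.
rewrite [X in compact X](_ : _ = cbox (fun i => x ord0 i - e) (fun i => x ord0 i + e)); first exact: cbox_compact.
by apply/seteqP; split => y h i; have := h i; rewrite ler_distl.
Qed.

Lemma prof_shift_tst k e r x A : 0 < e < r -> cube x r `<=` A ->
  tst A (fun y => prof k (e ^- 2 * sqn (y - x))).
Proof.
move=> /andP[e0 er] xA.
apply: (@tstI R n A _ [set y : 'rV[R]_n | forall i, `|y ord0 i - x ord0 i| <= e]).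
- by apply: (@smooth_shift R n (fun z => prof k (e ^- 2 * sqn z))); exact: prof_cinf.
- exact: ccube_compact.
- by apply: subset_trans xA => y ye i; exact: le_lt_trans (ye i) er.
- move=> y ny; apply: prof_cube_out => // h; apply: ny => i.
  by have := h i; rewrite !mxE subr0 => /ltW.
Qed.

Lemma eta_shift_tst e r x A : 0 < e < r -> cube x r `<=` A ->
  tst A (fun y => eta e (x - y)).
Proof.
move=> er xA; rewrite [X in tst _ X](_ : _ = fun y => eta e (y - x)).
  by apply: tstZ; exact: prof_shift_tst xA.
by apply/funext => y; rewrite -opprB etaN.
Qed.

Lemma laplacian_Phi_bound : exists2 M : R, 0 <= M & forall e z, 0 < e ->
  `|2^-1 * (e ^- n * e) * laplacian (Phi e) z| <= e ^- n.+1 * M.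
Proof.
have [M1 M10 h1] := prof_bounded 1; have [M2 M20 h2] := prof_bounded 2.
exists (2 * M2 + n%:R * M1); first by rewrite addr_ge0// mulr_ge0.
move=> e z e0; rewrite laplacian_Phi//; set s := _ * sqn z.
have s0 : 0 <= s by rewrite mulr_ge0 ?sqn_ge0// invr_ge0 exprn_ge0// ltW.
have -> : 2^-1 * (e ^- n * e) * (4 * e ^- 2 * s * prof 2 s - 2 * n%:R * e ^- 2 * prof 1 s) =
  e ^- n.+1 * (2 * (s * prof 2 s) - n%:R * prof 1 s).
  rewrite (_ : e ^+ 2 = e * e)// (exprS e n) !(invfM e); set a := e ^- n.
  transitivity ((e * e^-1) * (e^-1 * a * (2 * (s * prof 2 s) - n%:R * prof 1 s))); first by field; rewrite gt_eqF.
  by rewrite divff ?mul1r ?gt_eqF.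
rewrite normrM ger0_norm ?invr_ge0 ?exprn_ge0 ?(ltW e0)//.
rewrite ler_wpM2l ?invr_ge0 ?exprn_ge0 ?(ltW e0)//.
rewrite (le_trans (ler_normB _ _))// lerD// normrM ger0_norm//; last by rewrite ler_wpM2l// h1.
rewrite ler_wpM2l// normrM (ger0_norm s0).
have [s1|s1] := leP s 1; last by rewrite prof_out ?normr0 ?mulr0 ?(ltW s1).
by rewrite -[leRHS]mul1r ler_pM// h2.
Qed.

(* The derivative of eta in e is a multiple of the Laplacian of Phi. *)
Lemma conv_eta_derive F A r x e : L1 F -> weak_sol A 0 F -> cube x r `<=` A -> 0 < e < r ->
  is_derive e (1 : R) (fun e => conv F (eta e) x) 0.
Proof.
move=> iF wF xA /andP[e0 er].
have [M M0 hM] := laplacian_Phi_bound; have [M1 M10 h1] := prof_bounded 1.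
have e20 : 0 < e / 2 by rewrite divr_gt0.
have tpos t : e / 2 < t < r -> 0 < t by move=> /andP[h _]; exact: lt_trans h.
(* Only radii above e/2 are considered, where the bound t^-(n+1) M is uniform. *)
have := @is_derive_under R n F (fun t y => eta t (x - y))
  (fun t y => 2^-1 * (t ^- n * t) * laplacian (Phi t) (x - y)) e (e / 2) r ((e / 2) ^- n.+1 * M) iF.
have -> : e / 2 < e < r by rewrite er andbT ltr_pdivrMr// ltr_pMr// ltr1n.
move=> /(_ isT) H.
have Z : Rint (fun y => F y * (2^-1 * (e ^- n * e) * laplacian (Phi e) (x - y))) = 0.
  have t1 : tst A (fun y => Phi e (y - x)) by apply: prof_shift_tst xA; rewrite e0.
  have EL : laplacian (fun y => Phi e (y - x)) = fun y => laplacian (Phi e) (y - x).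
    by apply/funext => y; exact: (laplacian_shift (Phi e)).
  have tL := tst_laplacian t1; rewrite EL in tL.
  have Z : Rint (fun y => F y * laplacian (Phi e) (y - x)) = 0.
    by rewrite -(wF _ t1); apply: eq_Rintegral => y _; rewrite mul0r addr0 EL.
  transitivity (2^-1 * (e ^- n * e) * Rint (fun y => F y * laplacian (Phi e) (y - x))); last by rewrite Z mulr0.
  have [C C0 hC] := tst_bounded tL.
  rewrite -RintZ.
    apply: eq_Rintegral => y _; rewrite mulrCA (laplacian_Phi (x - y) e0) (laplacian_Phi (y - x) e0).
    by rewrite -(sqnN (x - y)) opprB.
  exact: L1_mul iF (tst_measurable tL) hC.
rewrite -[0]Z; apply: H => t.
- move=> tr; apply: (tst_measurable (D := setT)); apply: (@eta_shift_tst t (t + 1)) => //.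
  by rewrite (tpos t tr) ltrDl ltr01.
- move=> tr; exists (t ^- n * M1) => y; have t0 := tpos t tr.
  have tn : 0 <= t ^- n by rewrite invr_ge0 exprn_ge0// ltW.
  rewrite /eta normrM ger0_norm// ler_wpM2l// h1// mulr_ge0 ?sqn_ge0//.
  by rewrite invr_ge0 exprn_ge0// ltW.
- by move=> y tr; apply: is_derive_eta; exact: tpos tr.
- move=> y tr; have t0 := tpos t tr; apply: le_trans (hM _ _ t0) _.
  rewrite ler_wpM2r// lef_pV2 ?posrE ?exprn_gt0// lerXn2r ?nnegrE ?(ltW t0) ?(ltW e20)//.
  by case/andP: tr => /ltW.
Qed.

Lemma derive0_const (g : R -> R) (a b : R) : a <= b ->
  (forall t, t \in `[a, b] -> is_derive t (1 : R) g 0) -> g a = g b.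
Proof.
move=> ab dg.
have cg : {within `[a, b], continuous g} by apply: derivable_within_continuous => t /dg[].
have dg' t : t \in `]a, b[ -> is_derive t (1 : R) g ((fun=> 0) t) by move=> /subset_itv_oo_cc; exact: dg.
have [c _] := @MVT_segment R _ _ a b ab dg' cg.
by rewrite mul0r => /eqP; rewrite subr_eq0 => /eqP.
Qed.

Lemma conv_eta_const F A r x e e' : L1 F -> weak_sol A 0 F -> cube x r `<=` A ->
  0 < e < r -> 0 < e' < r -> conv F (eta e) x = conv F (eta e') x.
Proof.
move=> iF wF xA; wlog ee : e e' / e <= e'.
  move=> H h h'; have [ee|/ltW ee] := leP e e'; first exact: H.
  by rewrite (H e' e).
move=> h h'; have dI t : t \in `[e, e'] -> is_derive t (1 : R) (fun e => conv F (eta e) x) 0.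
  rewrite in_itv /= => /andP[t1 t2]; apply: (conv_eta_derive iF wF xA).
  case/andP: h h' => e0 _ /andP[_ e'r].
  by rewrite (lt_le_trans e0 t1) (le_lt_trans t2 e'r).
exact: (derive0_const ee dI).
Qed.

Definition eta_mass : R := Rint (eta 1).

Lemma eta_tst e : 0 < e -> tst setT (eta e).
Proof.
move=> e0; have := @eta_shift_tst e (e + 1) 0 setT; rewrite e0 ltrDl ltr01 => /(_ isT).
under eq_fun do rewrite sub0r etaN.
exact.
Qed.

Lemma eta_ge0 e z : 0 < e -> 0 <= eta e z.
Proof. by move=> e0; rewrite mulr_ge0 ?prof1_ge0// invr_ge0 exprn_ge0// ltW. Qed.

(** No change of variables: the constant 1 is harmonic, so its mean against [eta e] does not depend
    on the radius. The indicator of a cube wider than both radii stands in for it, to remain in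
    [L1]. *)
Lemma Rint_eta e : 0 < e -> Rint (eta e) = eta_mass.
Proof.
move=> e0; pose r := e + 1 + 1.
have r0 : 0 < r by rewrite !addr_gt0.
have iF : L1 (\1_(cube 0 r) : 'rV[R]_n -> R) by apply: L1_indic; [exact: measurable_cube|exact: cube_lt_pinfty].
have wF : weak_sol (cube 0 r) 0 (\1_(cube 0 r) : 'rV[R]_n -> R).
  move=> psi tp; rewrite (_ : (fun _ => _) = laplacian psi); last first.
    apply/funext => x; rewrite mul0r addr0 indicE; case: (asboolP (cube 0 r x)) => [?|nx].
      by rewrite mem_set// mul1r.
    by rewrite memNset// mul0r (tst_out (tst_laplacian tp)).
  rewrite (_ : laplacian psi = fun x => \sum_(i < n) pd i (pd i psi) x); last first.
    by apply/funext => x; rewrite laplacianE.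
  rewrite Rint_sum; first by rewrite big1// => i _; apply: Rint_pd; exact: tst_pd tp.
  by move=> i; apply: tst_L1; apply: tst_pd; exact: tst_pd tp.
have E t : 0 < t < r -> conv (\1_(cube 0 r) : 'rV[R]_n -> R) (eta t) 0 = Rint (eta t).
  move=> /andP[t0 tr]; apply: eq_Rintegral => y _; rewrite sub0r etaN indicE.
  case: (asboolP (cube 0 r y)) => [?|ny]; first by rewrite mem_set// mul1r.
  rewrite memNset// mul0r /eta prof_cube_out ?mulr0// => h; apply: ny => i.
  exact: lt_trans (h i) tr.
have h1 : 0 < e < r by rewrite e0 /r -addrA ltrDl addr_gt0.
have h2 : 0 < (1 : R) < r by rewrite ltr01 /r -addrA addrCA ltrDl addr_gt0.
by rewrite -(E e h1) (conv_eta_const iF wF (@subset_refl _ _) h1 h2) E.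
Qed.

Lemma eta_mass_gt0 : 0 < eta_mass.
Proof.
(* Half-side 1/(n+1): as n/(n+1)^2 <= 1/2, this box lies where [prof 1] is at least exp (-2). *)
pose s : R := n.+1%:R^-1; have s0 : 0 < s by rewrite invr_gt0.
pose B : set 'rV[R]_n := cbox (fun=> - s) (fun=> s).
have mB : measurable B by apply: compact_measurable_rV; exact: cbox_compact.
have lB : leb B = (\prod_(i < n) (s - - s))%:E.
  by apply: (@lebesgue_rV_box R n (fun=> - s) (fun=> s)) => _; rewrite ge0_cp// ltW.
have B0 : 0 < \prod_(i < n) (s - - s) by apply: prodr_gt0 => _ _; rewrite opprK addr_gt0.
apply: (@lt_le_trans _ _ (expR (-2) * Rint (\1_B : 'rV[R]_n -> R))).
  by rewrite mulr_gt0 ?expR_gt0// /Rintegral integral_indic// setIT lB.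
have i1 : L1 (\1_B : 'rV[R]_n -> R) by apply: L1_indic => //; rewrite lB ltry.
rewrite -RintZ//; apply: le_Rint.
- exact: L1Z.
- exact: tst_L1 (eta_tst ltr01).
move=> z; rewrite indicE; case: (asboolP (B z)) => [Bz|nB]; last first.
  by rewrite memNset// mulr0 eta_ge0.
rewrite mem_set// mulr1 /eta !expr1n !invr1 !mul1r; apply: prof1_gt0.
rewrite sqn_ge0 /=; apply: (@le_trans _ _ (\sum_(i < n) s ^+ 2)).
  apply: ler_sum => i _; have := Bz i; rewrite -ler_norml => h.
  by rewrite -(real_normK (num_real (z ord0 i))) lerXn2r ?nnegrE// ltW.
rewrite sumr_const card_ord -[X in X <= _]mulr_natl expr2 mulrA.
have [->|n0] := posnP n; first by rewrite !mul0r.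
have h : (2 * n <= n.+1 * n.+1)%N by nia.
rewrite -(ler_nat R) !natrM in h.
by rewrite -mulrA -invfM ler_pdivrMr ?mulr_gt0//; lra.
Qed.

End kernel.

(** * Fubini's theorem for real-valued integrals *)

Section fubini_real.
Context d1 d2 (T1 : measurableType d1) (T2 : measurableType d2) (R : realType).
Variables (m1 : {sigma_finite_measure set T1 -> \bar R}) (m2 : {sigma_finite_measure set T2 -> \bar R}).

Lemma integral_prod_lty (a : T1 -> R) (b : T2 -> R) :
  m1.-integrable setT (EFin \o a) -> m2.-integrable setT (EFin \o b) ->
  (\int[m1]_x \int[m2]_y `|(a x * b y)%:E| < +oo)%E.
Proof.
move=> /integrableP[ma ia] /integrableP[mb ib].
have mb' : measurable_fun setT (fun y => `|(b y)%:E|)%E by exact: measurableT_comp.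
have ma' : measurable_fun setT (fun y => `|(a y)%:E|)%E by exact: measurableT_comp.
under eq_integral => x _.
  under eq_integral => y _ do rewrite EFinM abseM.
  rewrite ge0_integralZl//; over.
rewrite ge0_integralZr//; last by apply: integral_ge0.
by apply: lte_mul_pinfty => //; [exact: integral_ge0|rewrite ge0_fin_numE// integral_ge0].
Qed.

Lemma integrable_prod (a : T1 -> R) (b : T2 -> R) :
  m1.-integrable setT (EFin \o a) -> m2.-integrable setT (EFin \o b) ->
  (m1 \x m2)%E.-integrable setT (fun p => (a p.1 * b p.2)%:E).
Proof.
move=> ia ib; have /integrableP[/measurable_EFinP ma _] := ia.
have /integrableP[/measurable_EFinP mb _] := ib.
have mab : measurable_fun setT (fun p : T1 * T2 => (a p.1 * b p.2)%:E); last first.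
  have [_ h] := integrable12ltyP m1 m2 mab.
  by apply: h; have := integral_prod_lty ia ib.
apply/measurable_EFinP; apply: measurable_funM.
  by apply: measurableT_comp => //; exact: measurable_fst.
by apply: measurableT_comp => //; exact: measurable_snd.
Qed.

Lemma EFin_Rintegral d (T : measurableType d) (m : {measure set T -> \bar R}) (f : T -> R) :
  m.-integrable setT (EFin \o f) -> (\int[m]_x (f x)%:E)%E = (\int[m]_x f x)%:E.
Proof. by move=> h; rewrite /Rintegral fineK//; exact: integrable_fin_num. Qed.

Lemma Rintegral_swap (H : T1 * T2 -> R) : (m1 \x m2)%E.-integrable setT (EFin \o H) ->
  (forall x, m2.-integrable setT (EFin \o (fun y => H (x, y)))) ->
  (forall y, m1.-integrable setT (EFin \o (fun x => H (x, y)))) ->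
  \int[m1]_x (\int[m2]_y H (x, y)) = \int[m2]_y (\int[m1]_x H (x, y)).
Proof.
move=> iH i1 i2; have := Fubini iH; rewrite /= => E.
rewrite /Rintegral; congr fine.
under eq_integral => x _ do rewrite -[(fine _)%:E](EFin_Rintegral (i1 x)).
by rewrite E; apply: eq_integral => y _; rewrite -(EFin_Rintegral (i2 y)).
Qed.

End fubini_real.

(** * Smoothness of weakly harmonic functions *)

Section weyl.
Context {R : realType} {n : nat}.
Notation leb := (lebesgue_rV n : {measure set 'rV[R]_n -> \bar R}).
Notation Rint F := (Rintegral leb setT F).
Notation mass := (@eta_mass R n).
Implicit Types (F G f g : 'rV[R]_n -> R) (x y z p : 'rV[R]_n) (e r : R).

Lemma Rint_conv_swap F f g (C : R) : L1 F -> L1 f -> measurable_fun setT g ->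
  (forall x, `|g x| <= C) ->
  Rint (fun x => f x * conv F g x) = Rint (fun y => F y * Rint (fun x => f x * g (x - y))).
Proof.
move=> iF jf mg gC; have mF := L1_measurable iF; have mf := L1_measurable jf.
have mgx x : measurable_fun setT (fun y => g (x - y)).
  apply: measurableT_comp => //; apply: measurable_fun_rV => i.
  rewrite (_ : (fun _ => _) = fun y : 'rV[R]_n => x ord0 i - y ord0 i); last by apply/funext => y; rewrite !mxE.
  by apply: measurable_funB => //; exact: measurable_rV_coord.
have mgy y : measurable_fun setT (fun x => g (x - y)).
  by apply: measurableT_comp => //; exact: measurable_shift.
have mG : measurable_fun setT (fun q : 'rV[R]_n * 'rV[R]_n => g (q.1 - q.2)).
  apply: measurableT_comp => //; apply: measurable_fun_rV => i.
  rewrite (_ : (fun _ => _) = fun q : 'rV[R]_n * 'rV[R]_n => q.1 ord0 i - q.2 ord0 i); last by apply/funext => y; rewrite !mxE.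
  apply: measurable_funB.
    by apply: (measurableT_comp (measurable_rV_coord i)); exact: measurable_fst.
  by apply: (measurableT_comp (measurable_rV_coord i)); exact: measurable_snd.
pose H (q : 'rV[R]_n * 'rV[R]_n) := f q.1 * F q.2 * g (q.1 - q.2).
have S1 x : L1 (fun y => H (x, y)).
  rewrite (_ : (fun _ => _) = fun y => f x * (F y * g (x - y))); last by apply/funext => y; rewrite /H mulrA.
  by apply: L1Z; apply: (@L1_mul _ _ _ _ C).
have S2 y : L1 (fun x => H (x, y)).
  rewrite (_ : (fun _ => _) = fun x => F y * (f x * g (x - y))); last by apply/funext => x; rewrite /H; ring.
  by apply: L1Z; apply: (@L1_mul _ _ _ _ C).
have iH : (lebesgue_rV n \x lebesgue_rV n)%E.-integrable setT (EFin \o H).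
  have ip := integrable_prod jf iF.
  apply: (@le_integrable _ _ _ _ _ _ _ (fun q => (C * (f q.1 * F q.2))%:E)) => //.
  - apply/measurable_EFinP; apply: measurable_funM => //; apply: measurable_funM.
      by apply: measurableT_comp => //; exact: measurable_fst.
    by apply: measurableT_comp => //; exact: measurable_snd.
  - move=> q _; rewrite lee_fin /H normrM [in leRHS]normrM [leRHS]mulrC ler_wpM2l//.
    by rewrite (le_trans (gC _))// ler_norm.
  - under eq_fun do rewrite EFinM; exact: integrableZl.
transitivity (Rint (fun x => Rint (fun y => H (x, y)))).
  apply: eq_Rintegral => x _; rewrite /conv -RintZ; last exact: (@L1_mul _ _ _ _ C).
  by apply: eq_Rintegral => y _; rewrite /H mulrA.
rewrite (Rintegral_swap iH S1 S2); apply: eq_Rintegral => y _.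
rewrite -RintZ; last exact: (@L1_mul _ _ _ _ C).
by apply: eq_Rintegral => x _; rewrite /H; ring.
Qed.

(** An approximate identity with a linear rate, from the Lipschitz bound on [f]. The rate is uniform
    in [y], which allows integration against a merely integrable function. *)
Lemma eta_approx D f : tst D f -> exists2 C : R, 0 <= C & forall e y, 0 < e ->
  `|Rint (fun x => f x * eta e (x - y)) - mass * f y| <= C * e.
Proof.
move=> tf; have [C C0 hC] := tst_bounded tf.
have /choice[M hM] : forall i, exists M : R, forall x, `|pd i f x| <= M.
  by move=> i; have [M _ h] := tst_bounded (tst_pd i tf); exists M.
pose M0 := \sum_i `|M i|; have M00 : 0 <= M0 by exact: sumr_ge0.
have hM0 i y : `|pd i f y| <= M0.
  by rewrite (le_trans (hM i y))// (le_trans (ler_norm _))// /M0 (bigD1 i)//= lerDl sumr_ge0.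
have m0 := ltW (@eta_mass_gt0 R n).
exists (n%:R * M0 * mass); first by rewrite !mulr_ge0.
move=> e y e0; have te := @eta_tst R n e e0; have ie := tst_L1 te.
have [E0 _ hE0] := tst_bounded te.
have mf := tst_measurable tf.
have i1 : L1 (fun x => f x * eta e (x - y)).
  apply: (@L1_mul _ _ _ _ E0); first exact: tst_L1 tf.
    by apply: measurableT_comp; [exact: tst_measurable te|exact: measurable_shift].
  by move=> x; exact: hE0.
have mfy : measurable_fun setT (fun z => f (z + y)) by apply: measurableT_comp => //; exact: measurable_shift.
rewrite -(Rintegral_preserving (preserving_shift y) i1).
under eq_Rintegral do rewrite addrK mulrC.
have j1 : L1 (fun z => eta e z * f (z + y)) by apply: (@L1_mul _ _ _ _ C).
rewrite -(Rint_eta e0) mulrC -RintZ// -RintB//; last exact: L1Z.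
have -> : n%:R * M0 * Rint (eta e) * e = Rint (fun z => n%:R * M0 * e * eta e z).
  by rewrite (RintZ (n%:R * M0 * e) ie) mulrAC.
apply: le_trans (norm_Rint _) _; first by apply: L1B => //; exact: L1Z.
apply: le_Rint.
- by apply: L1_norm; apply: L1B => //; exact: L1Z.
- exact: L1Z.
move=> z; rewrite mulrC -mulrBl normrM (ger0_norm (eta_ge0 z e0)).
case: (asboolP (cube 0 e z)) => [ze|nz]; last by rewrite /eta prof_cube_out// !mulr0.
rewrite ler_wpM2r ?eta_ge0//.
apply: le_trans (C1_lipschitz (cinf_C1 (tst_cinf tf)) hM0 y (z + y)) _.
rewrite mulrAC ler_wpM2r//; apply: (@le_trans _ _ (\sum_(i < n) e)).
  by apply: ler_sum => i _; rewrite mxE addrK; have := ze i; rewrite mxE subr0 => /ltW.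
by rewrite sumr_const card_ord -[X in X <= _]mulr_natl.
Qed.

Lemma continuous_compact_L1 f (S : set 'rV[R]_n) : continuous f -> compact S -> L1 (f \_ S).
Proof.
move=> cf cS; have mS := compact_measurable_rV cS.
have := @continuous_compact _ _ f S (continuous_subspaceT cf) cS.
move=> /compact_bounded[M [Mr MA]].
apply: (@le_L1 _ _ _ (fun x => (`|M| + 1) * \1_S x)).
- apply/(measurable_restrictT _ mS); apply: measurable_funTS; exact: continuous_measurable_rV.
- by apply: L1Z; apply: L1_indic => //; exact: compact_lt_pinfty.
move=> x; rewrite patchE indicE; case: (boolP (x \in S)) => Sx; last by rewrite normr0 normr_ge0.
rewrite mulr1 (le_trans _ (ler_norm _))//; apply: MA; last by exists x => //; exact: set_mem.
by rewrite (le_lt_trans (ler_norm M))// ltrDl.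
Qed.

Lemma le_eps0 (a C : R) : 0 <= a -> (forall e, 0 < e < 1 -> a <= C * e) -> a = 0.
Proof.
move=> a0 h; apply/eqP; rewrite eq_le a0 andbT leNgt; apply/negP => ap.
pose e := a / (2 * (`|C| + a + 1)).
have D0 : 0 < `|C| + a + 1 by rewrite ltr_wpDl// addr_ge0.
have e0 : 0 < e by rewrite divr_gt0// mulr_gt0.
have e1 : e < 1 by rewrite /e ltr_pdivrMr ?mulr_gt0// mul1r; have := normr_ge0 C; lra.
have := h e; rewrite e0 e1 => /(_ isT).
have : C * e <= `|C| * e by rewrite ler_wpM2r ?(ltW e0)// ler_norm.
have E : e * (`|C| + a + 1) = a / 2 by rewrite /e invfM mulrA mulfVK// gt_eqF.
have ap2 : 0 <= e * (a + 1) by rewrite mulr_ge0 ?(ltW e0)// addr_ge0.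
move=> h1 h2; have : a <= a / 2 by rewrite -E; lra.
by rewrite ler_pdivlMr// ger_pMr// lern1.
Qed.

(** The representative is the mollification of [F] at radius r/2, divided by the mass. On [cube p r]
    it does not depend on the radius, so testing it and letting the radius tend to 0 returns [F]
    tested; the fundamental lemma then identifies the two almost everywhere. *)
Lemma weyl F A p r : 0 < r -> L1 F -> weak_sol A 0 F -> cube p (r + r) `<=` A ->
  exists2 W, cinf W & {ae leb, forall x, cube p r x -> F x = W x}.
Proof.
move=> r0 iF wF pA; have m0 := @eta_mass_gt0 R n.
have r20 : 0 < r / 2 by rewrite divr_gt0.
have r2r : r / 2 < r by rewrite ltr_pdivrMr// ltr_pMr// ltr1n.
have te := @eta_tst R n _ r20.
pose W := conv F (eta (r / 2)); have cW : cinf W by exact: cinf_conv te.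
exists (fun x => (mass)^-1 * W x); first exact: smoothZ.
have xA x : cube p r x -> cube x r `<=` A.
  move=> px; apply: subset_trans pA => y xy i.
  have -> : y ord0 i - p ord0 i = (y ord0 i - x ord0 i) + (x ord0 i - p ord0 i) by ring.
  by rewrite (le_lt_trans (ler_normD _ _))// ltrD.
have mW := cinf_measurable cW.
have key psi : tst (cube p r) psi -> Rint (fun x => psi x * W x) = mass * Rint (fun y => F y * psi y).
  move=> tp; have [C C0 hC] := eta_approx tp; have [B B0 hB] := tst_bounded tp.
  have ip := tst_L1 tp; have mp := tst_measurable tp.
  apply/eqP; rewrite -subr_eq0 -normr_eq0; apply/eqP.
  apply: (@le_eps0 _ (C * r * Rint (fun y => `|F y|))) => // e /andP[e0 e1].
  have er : 0 < e * r < r by rewrite mulr_gt0//= gtr_pMl.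
  have [E0 _ hE0] := tst_bounded (@eta_tst R n _ (andP er).1).
  (* Means over different radii agree at points of the cube, so r/2 may be replaced by e r with e
     arbitrarily small. *)
  have -> : Rint (fun x => psi x * W x) = Rint (fun x => psi x * conv F (eta (e * r)) x).
    apply: eq_Rintegral => x _; case: (asboolP (cube p r x)) => [px|npx].
      by rewrite /W (conv_eta_const iF wF (xA x px) (e' := e * r)) ?r20.
    by rewrite (tst_out tp npx) !mul0r.
  rewrite (Rint_conv_swap iF ip (tst_measurable (@eta_tst R n _ (andP er).1)) hE0).
  have iFp : L1 (fun y => F y * psi y) by apply: (@L1_mul _ _ _ _ B).
  pose G y := Rint (fun x => psi x * eta (e * r) (x - y)).
  have mG : measurable_fun setT G.
    rewrite (_ : G = conv psi (eta (e * r))); first exact: cinf_measurable (cinf_conv ip (@eta_tst R n _ (andP er).1)).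
    by apply/funext => y; apply: eq_Rintegral => x _; rewrite -etaN opprB.
  have hG y : `|G y - mass * psi y| <= C * (e * r) by apply: hC; exact: (andP er).1.
  have mGp : measurable_fun setT (fun y => G y - mass * psi y).
    by apply: measurable_funB => //; apply: measurable_funM.
  have iFG : L1 (fun y => F y * (G y - mass * psi y)) by exact: L1_mul hG.
  have -> : Rint (fun y => F y * G y) = Rint (fun y => F y * (G y - mass * psi y) + mass * (F y * psi y)).
    by apply: eq_Rintegral => y _; ring.
  rewrite RintD//; last exact: L1Z.
  rewrite (RintZ _ iFp) addrK [leRHS]mulrAC -(mulrA C r e) (mulrC r e).
  exact: norm_Rint_mul.
have iS S f : L1 f -> measurable S -> L1 (f \_ S).
  move=> jf mS; apply: (le_L1 _ jf).
    by apply/(measurable_restrictT _ mS); apply: measurable_funTS; exact: L1_measurable.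
  by move=> x; rewrite patchE; case: ifP => // _; rewrite normr0.
have h : {ae leb, forall x, cube p r x -> F x - mass^-1 * W x = 0}.
  apply: fundamental_lemma; first exact: open_cube.
    move=> S cS Sp; have mS := compact_measurable_rV cS.
    rewrite (_ : _ \_ S = fun x => (F \_ S) x - (fun x => mass^-1 * W x) \_ S x).
      apply: L1B; first exact: iS.
      exact: (continuous_compact_L1 (cinf_continuous (smoothZ _ cW)) cS).
    by apply/funext => x; rewrite !patchE; case: ifP => // _; rewrite subr0.
  move=> psi tp; rewrite (@Rint_restrict R n (cube p r) (cube p r))//; last by move=> x; exact: tst_out tp.
  have [B B0 hB] := tst_bounded tp; have mp := tst_measurable tp.
  have iFp : L1 (fun y => F y * psi y) by apply: (@L1_mul _ _ _ _ B).
  have iWp : L1 (fun y => psi y * W y) by apply: tst_L1; exact: tst_mul tp cW.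
  have -> : Rint (fun x => ((fun x => F x - mass^-1 * W x) \_ (cube p r)) x * psi x) =
      Rint (fun x => F x * psi x - mass^-1 * (psi x * W x)).
    apply: eq_Rintegral => x _; rewrite patchE; case: ifPn => [_|]; first by ring.
    by rewrite notin_setE => /(tst_out tp) ->; rewrite !(mulr0, mul0r) subr0.
  by rewrite RintB ?RintZ ?key ?mulKf ?subrr ?gt_eqF//; exact: L1Z.
by apply: filterS h => x h /h /eqP; rewrite subr_eq0 => /eqP.
Qed.

End weyl.

(** * Unique continuation for harmonic functions *)

Section harmonic.
Context {R : realType} {n : nat}.
Notation leb := (lebesgue_rV n : {measure set 'rV[R]_n -> \bar R}).
Notation Rint F := (Rintegral leb setT F).
Notation mass := (@eta_mass R n).
Implicit Types (A S : set 'rV[R]_n) (F G f g W : 'rV[R]_n -> R) (x y z p : 'rV[R]_n) (c e r t : R) (i : 'I_n).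

Definition csol A c W := forall x, A x -> laplacian W x = - (c * W x).

Lemma pd_zero_on A f i : open A -> (forall x, A x -> f x = 0) -> forall x, A x -> pd i f x = 0.
Proof.
move=> oA f0 x Ax; apply: pd_out => sx.
have : supp f `<=` ~` A.
  apply: supp_sub; first exact: open_closedC.
  by move=> y /contrapT /f0.
by move=> /(_ _ sx); exact.
Qed.

Lemma dpart_zero_on A f s : open A -> (forall x, A x -> f x = 0) -> forall x, A x -> dpart s f x = 0.
Proof.
move=> oA f0; elim: s => [//|i s IH] x Ax; rewrite dpart_cons.
exact: (pd_zero_on i oA IH).
Qed.

Lemma csol_pd A c W i : open A -> cinf W -> csol A c W -> csol A c (pd i W).
Proof.
move=> oA cW sW x Ax.
have cL := cinf_laplacian cW.
have := @pd_zero_on A (fun x => laplacian W x + c * W x) i oA.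
have -> : pd i (fun x => laplacian W x + c * W x) = fun x => laplacian (pd i W) x + c * pd i W x.
  rewrite pdD ?pdZ//; last exact: smoothZ.
  apply/funext => y; congr (_ + _); rewrite laplacianE.
  rewrite (_ : laplacian W = fun x => \sum_(j < n) pd j (pd j W) x); last by apply/funext => z; rewrite laplacianE.
  rewrite pd_sum; last by move=> j; do 2 apply: cinf_pd.
  by apply: eq_bigr => j _; rewrite (pdC i j (cinf_pd j cW)) (pdC i j cW).
move=> /(_ _ x Ax) h; apply/eqP; rewrite -addr_eq0; apply/eqP; apply: h.
by move=> y Ay; rewrite (sW _ Ay) addNr.
Qed.

Lemma csol_dpart A c W s : open A -> cinf W -> csol A c W -> csol A c (dpart s W).
Proof.
move=> oA cW sW; elim: s => [//|i s IH]; rewrite dpart_cons.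
by apply: csol_pd => //; exact: cinf_dpart.
Qed.

Lemma csol_sub A A' c W : A' `<=` A -> csol A c W -> csol A' c W.
Proof. by move=> sA sW x /sA /sW. Qed.

Lemma csol_weak A c F W : cinf W -> csol A c W -> (forall x, A x -> F x = W x) -> weak_sol A c F.
Proof.
move=> cW sW FW psi tp.
have tL := tst_laplacian tp; have t1 := tst_mul tL cW; have t2 := tst_mul tp (cinf_laplacian cW).
have t3 := tst_mul tp cW.
transitivity (Rint (fun x => laplacian psi x * W x + c * (psi x * W x))).
  apply: eq_Rintegral => x _; case: (asboolP (A x)) => [Ax|nA]; first by rewrite FW//; ring.
  by rewrite (tst_out tp nA) (tst_out tL nA); ring.
rewrite (RintD (tst_L1 t1)); last exact: L1Z (tst_L1 t3).
rewrite (Rint_laplacian tp cW) -(RintD (tst_L1 t2)); last exact: L1Z (tst_L1 t3).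
rewrite -[RHS](@Rint0 R n); apply: eq_Rintegral => x _.
case: (asboolP (A x)) => [Ax|nA]; first by rewrite (sW _ Ax); ring.
by rewrite (tst_out tp nA); ring.
Qed.

Lemma conv_eta_near F x e (w eps : R) : L1 F -> 0 < e ->
  (forall y, cube x e y -> `|F y - w| <= eps) -> `|conv F (eta e) x - mass * w| <= eps * mass.
Proof.
move=> iF e0 h; have te := @eta_tst R n e e0.
have [E0 _ hE0] := tst_bounded te.
have er : 0 < e < e + 1 by rewrite e0 ltrDl ltr01.
have ts : tst setT (fun y => eta e (x - y)) by exact: (@eta_shift_tst R n e (e + 1) x).
have is_ := tst_L1 ts.
have Ei : Rint (fun y => eta e (x - y)) = mass.
  rewrite -(Rint_eta e0) -(Rintegral_preserving (preserving_shift (- x)) (tst_L1 te)).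
  by apply: eq_Rintegral => y _; rewrite -etaN opprB.
have i1 : L1 (fun y => F y * eta e (x - y)).
  by apply: (L1_mul iF (tst_measurable ts)) => y; exact: hE0.
rewrite -Ei mulrC -!RintZ// -RintB//; last exact: L1Z.
apply: le_trans (norm_Rint _) _; first by apply: L1B => //; exact: L1Z.
apply: le_Rint; first by apply: L1_norm; apply: L1B => //; exact: L1Z.
  exact: L1Z.
move=> y; rewrite -mulrBl normrM (ger0_norm (eta_ge0 _ e0)).
case: (asboolP (cube x e y)) => [xy|nxy]; first by rewrite ler_wpM2r ?eta_ge0// h.
rewrite /eta prof_cube_out ?mulr0// => h'; apply: nxy => j.
by have := h' j; rewrite !mxE subr0 distrC.
Qed.

(** Truncating [W] to a compact cube makes it integrable without changing it near [x]; its mean is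
    then independent of the radius, and tends to mass times W x as the radius shrinks. *)
Lemma csol_mvp W x r e : cinf W -> csol (cube x r) 0 W -> 0 < e < r ->
  Rint (fun y => W y * eta e (x - y)) = mass * W x.
Proof.
move=> cW sW /andP[e0 er]; have m0 := @eta_mass_gt0 R n.
pose r1 := (e + r) / 2.
have er1 : e < r1 by rewrite midf_lt.
have r1r : r1 < r by rewrite midf_lt.
pose S : set 'rV[R]_n := [set y : 'rV[R]_n | forall i, `|y ord0 i - x ord0 i| <= r1].
pose F := W \_ S.
have iF : L1 F by apply: continuous_compact_L1; [exact: cinf_continuous|exact: ccube_compact].
have FW y : cube x r1 y -> F y = W y.
  by move=> xy; rewrite /F patchE mem_set// => i; exact: ltW (xy i).
have wF : weak_sol (cube x r1) 0 F.
  apply: csol_weak cW _ FW; apply: csol_sub sW => y xy i; exact: lt_trans (xy i) r1r.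
have -> : Rint (fun y => W y * eta e (x - y)) = conv F (eta e) x.
  apply: eq_Rintegral => y _; case: (asboolP (cube x r1 y)) => [xy|nxy]; first by rewrite FW.
  rewrite /eta prof_cube_out ?mulr0// => h; apply: nxy => j.
  by have := h j; rewrite !mxE subr0 distrC => /lt_trans; exact.
apply/eqP; rewrite -subr_eq0 -normr_eq0; apply/eqP.
apply: (@le_eps0 R _ mass) => // eps /andP[eps0 _].
have [d d0 hd] := continuous_norm x (cinf_continuous cW) eps0.
pose t := Num.min (d / 2) (e / 2).
have t0 : 0 < t by rewrite lt_min !divr_gt0.
have td : t < d by rewrite gt_min ltr_pdivrMr// ltr_pMr// ltr1n.
have tr1 : t < r1.
  apply: le_lt_trans er1; rewrite ge_min; apply/orP; right.
  by rewrite ler_pdivrMr// ler_pMr// ler1n.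
rewrite (@conv_eta_const R n F (cube x r1) r1 x e t iF wF (@subset_refl _ _)) ?e0 ?t0//.
rewrite [leRHS]mulrC; apply: conv_eta_near => // y xy.
rewrite FW; last by move=> i; exact: lt_trans (xy i) tr1.
apply: hd; rewrite -normrN opprB; have : ball x t y by rewrite ball_cube.
by rewrite -ball_normE /= => h; exact: lt_trans h td.
Qed.

(** Interior gradient estimate: the mean value formula for [pd i W] is integrated by parts, so that
    the derivative falls on [eta]. The constant depends on the dimension alone. *)
Lemma csol_gradient : exists2 K : R, 0 <= K & forall W x r (B : R) i, 0 < r -> cinf W ->
  csol (cube x r) 0 W -> (forall y, cube x r y -> `|W y| <= B) -> `|pd i W x| <= K / r * B.
Proof.
have [M M0 hM] := @prof_bounded R 2; have m0 := @eta_mass_gt0 R n.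
(* With e = r/2: the derivative of [eta e] is at most e^-n times 2 M / e, on a cube of volume (2
   e)^n. *)
exists (mass^-1 * (4 * 2 ^+ n * M)); first by rewrite mulr_ge0 ?invr_ge0 ?(ltW m0)// !mulr_ge0// exprn_ge0.
move=> W x r B i r0 cW sW hB.
pose e := r / 2; have e0 : 0 < e by rewrite divr_gt0.
have er : 0 < e < r by rewrite e0 ltr_pdivrMr// ltr_pMr// ltr1n.
have B0 : 0 <= B by apply: le_trans (normr_ge0 _) (hB x (cube_center x r0)).
have := csol_mvp (cinf_pd i cW) (csol_pd i (@open_cube _ _ x r) cW sW) er.
have ts : tst setT (fun y => eta e (x - y)) by exact: (@eta_shift_tst R n e r x).
have -> : Rint (fun y => pd i W y * eta e (x - y)) = - Rint (fun y => W y * pd i (eta e) (y - x)).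
  have Es : (fun y => eta e (x - y)) = fun y => eta e (y - x) by apply/funext => y; rewrite -etaN opprB.
  have EP : pd i (fun y => eta e (x - y)) = fun y => pd i (eta e) (y - x) by rewrite Es; exact: pd_shift.
  have I := Rint_ibp i ts cW; rewrite EP in I.
  transitivity (Rint (fun y => eta e (x - y) * pd i W y)); first by apply: eq_Rintegral => y _; rewrite mulrC.
  apply: oppr_inj; rewrite -I opprK; by apply: eq_Rintegral => y _; rewrite mulrC.
move=> E.
pose S : set 'rV[R]_n := [set y : 'rV[R]_n | forall i, x ord0 i - e <= y ord0 i <= x ord0 i + e].
have mS : measurable S by apply: compact_measurable_rV; exact: (@cbox_compact R n (fun i => x ord0 i - e) (fun i => x ord0 i + e)).
have lS : leb S = ((2 * e) ^+ n)%:E.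
  apply: etrans (@lebesgue_rV_box R n (fun i => x ord0 i - e) (fun i => x ord0 i + e) _) _.
    by move=> j; rewrite lerD2l ge0_cp// ltW.
  by rewrite (eq_bigr (fun=> 2 * e)) ?prodr_const ?card_ord// => j _; ring.
pose Q := e ^- n * (2 * e^-1 * M).
have Q0 : 0 <= Q by rewrite mulr_ge0 ?invr_ge0 ?exprn_ge0 ?(ltW e0)// !mulr_ge0 ?invr_ge0 ?(ltW e0).
have bd y : `|W y * pd i (eta e) (y - x)| <= B * Q * \1_S y.
  rewrite /eta pdZ; last exact: prof_cinf.
  rewrite pd_prof indicE; case: (asboolP (cube x e y)) => [xy|nxy]; last first.
    have nz : ~ cube 0 e (y - x) by move=> h; apply: nxy => j; have := h j; rewrite !mxE subr0.
    rewrite (prof_cube_out 2 e0 nz) !(mulr0, normr0).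
    exact: (mulr_ge0 (mulr_ge0 B0 Q0) (ler0n _ _)).
  have Sy : S y by move=> j; rewrite -ler_distl; exact: ltW (xy j).
  rewrite mem_set// mulr1 normrM ler_pM//.
    by apply: hB => j; apply: lt_trans (xy j) (andP er).2.
  rewrite normrM ger0_norm ?invr_ge0 ?exprn_ge0 ?(ltW e0)//.
  rewrite ler_wpM2l ?invr_ge0 ?exprn_ge0 ?(ltW e0)//.
  have ha : `|(y - x) ord0 i| <= e by rewrite !mxE; exact: ltW (xy i).
  have hP : `|prof 2 (e ^- 2 * sqn (y - x))| <= M.
    by rewrite hM// mulr_ge0 ?sqn_ge0// invr_ge0 exprn_ge0// ltW.
  have c0 : 0 <= 2 / e ^+ 2 by rewrite divr_ge0// exprn_ge0// ltW.
  rewrite mulNr normrN normrM (ger0_norm c0) normrM.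
  have -> : 2 / e * M = 2 / e ^+ 2 * (e * M) by field; rewrite gt_eqF.
  by rewrite (ler_wpM2l c0)// ler_pM.
have i1 : L1 (\1_S : 'rV[R]_n -> R) by apply: L1_indic => //; rewrite lS ltry.
have tE : tst setT (fun y => pd i (eta e) (y - x)).
  have := tst_pd i ts; congr tst.
  rewrite -(pd_shift i (eta e)); congr pd; apply/funext => y.
  by rewrite -etaN opprB.
have iW : L1 (fun y => W y * pd i (eta e) (y - x)).
  have := tst_L1 (tst_mul tE cW); congr L1; apply/funext => y; exact: mulrC.
have : `|mass * pd i W x| <= B * Q * (2 * e) ^+ n.
  rewrite -E normrN; apply: le_trans (norm_Rint iW) _.
  have -> : (2 * e) ^+ n = Rint (\1_S : 'rV[R]_n -> R) by rewrite /Rintegral integral_indic// setIT lS.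
  by rewrite -RintZ//; apply: le_Rint => //; [exact: L1_norm|exact: L1Z].
rewrite normrM (gtr0_norm m0) -ler_pdivlMl// => h; apply: le_trans h _.
rewrite le_eqVlt; apply/orP; left; apply/eqP.
have -> : r = 2 * e by rewrite /e mulrC mulfVK.
have fid (a b c d : R) : a != 0 -> d != 0 -> c != 0 ->
  c^-1 * (B * (a^-1 * (2 / d * M)) * (b * a)) = c^-1 * (4 * b * M) / (2 * d) * B.
  by move=> a0 d0 c0; field; rewrite a0 d0 c0.
by rewrite /Q (exprMn n 2 e) fid// ?expf_neq0// gt_eqF.
Qed.

(** The gradient estimate is applied m times on cubes shrinking by [h]; for [h] of order r/m this is
    the m^m growth of derivatives that characterises analyticity. *)
Lemma csol_derivs : exists2 K : R, 0 <= K & forall W p r (B : R) i, cinf W ->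
  csol (cube p r) 0 W -> (forall y, cube p r y -> `|W y| <= B) ->
  forall h m, 0 < h -> forall x, cube p (r - m%:R * h) x ->
  `|dpart (nseq m i) W x| <= (K / h) ^+ m * B.
Proof.
have [K K0 hK] := csol_gradient; exists K => // W p r B i cW sW hB h m h0.
elim: m => [|m IH] x.
  by rewrite mul0r subr0 expr0 mul1r; exact: hB.
move=> px; rewrite [nseq _ _]/= dpart_cons exprS -mulrA.
have sub : cube x h `<=` cube p (r - m%:R * h).
  move=> y xy j.
  have -> : y ord0 j - p ord0 j = (y ord0 j - x ord0 j) + (x ord0 j - p ord0 j) by ring.
  rewrite (le_lt_trans (ler_normD _ _))//.
  have -> : r - m%:R * h = h + (r - m.+1%:R * h) by rewrite -(natr1 m); ring.
  by rewrite ltrD.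
apply: hK => //; first exact: cinf_dpart.
- apply: (csol_sub sub); apply: (@csol_sub (cube p r)).
    by move=> y py j; rewrite (lt_le_trans (py j))// lerBlDr lerDl mulr_ge0// ltW.
  by apply: csol_dpart => //; exact: open_cube.
- by move=> y /sub; exact: IH.
Qed.

Lemma le_deriv (u u' : R -> R) t : 0 <= t -> (forall s : R, 0 <= s <= t -> is_derive s (1 : R) u (u' s)) ->
  (forall s : R, 0 <= s <= t -> 0 <= u' s) -> u 0 <= u t.
Proof.
move=> t0 du u'0.
have cu : {within `[0, t], continuous u}.
  by apply: derivable_within_continuous => s; rewrite in_itv/= => /du[].
have du' s : s \in `]0, t[ -> is_derive s (1 : R) u (u' s).
  by move=> /subset_itv_oo_cc; rewrite in_itv/= => /du.
have [c + E] := @MVT_segment R _ _ 0 t t0 du' cu.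
rewrite in_itv/= => /u'0 c0; rewrite -subr_ge0 E subr0.
exact: mulr_ge0.
Qed.

Lemma is_derive_monomial k s : is_derive s (1 : R) (fun s : R => s ^+ k.+1 / k.+1`!%:R) (s ^+ k / k`!%:R).
Proof.
have -> : (fun s : R => s ^+ k.+1 / k.+1`!%:R) = (fun s : R => k.+1`!%:R^-1 * s ^+ k.+1).
  by apply/funext => u; rewrite mulrC.
apply: (is_derive_eq (is_deriveZ (k.+1`!%:R^-1 : R) (is_derive_pow k.+1 s))).
rewrite /GRing.scale /= factS natrM; field.
by rewrite pnatr_eq0 -lt0n fact_gt0 /= addrC natr1 pnatr_eq0.
Qed.

(** The bound on g_j is integrated j times from 0, where all lower derivatives vanish. Each
    integration is a monotonicity statement: b + g and b - g increase, [b] being the next monomial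
    bound. *)
Lemma taylor_bound (g : nat -> R -> R) j (B : R) t : 0 <= t -> 0 <= B ->
  (forall k (s : R), 0 <= s <= t -> is_derive s (1 : R) (g k) (g k.+1 s)) ->
  (forall k, (k < j)%N -> g k 0 = 0) -> (forall s : R, 0 <= s <= t -> `|g j s| <= B) ->
  `|g 0%N t| <= B * (t ^+ j / j`!%:R).
Proof.
move=> t0 B0 dg g0 gB.
have H k : (k <= j)%N -> forall s : R, 0 <= s <= t -> `|g (j - k)%N s| <= B * (s ^+ k / k`!%:R).
  elim: k => [_ s st|k IH kj s st].
    by rewrite subn0 expr0 fact0 divr1 mulr1; exact: gB.
  have /andP[s0 sT] := st.
  have E : (j - k = (j - k.+1).+1)%N by lia.
  have z : g (j - k.+1)%N 0 = 0 by apply: g0; lia.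
  have sub u : 0 <= u <= s -> 0 <= u <= t by move=> /andP[-> /le_trans -> //].
  have dm u : is_derive u (1 : R) (fun u : R => B * (u ^+ k.+1 / k.+1`!%:R)) (B * (u ^+ k / k`!%:R)).
    exact: (is_deriveZ B (is_derive_monomial k u)).
  have m0 : B * (0 ^+ k.+1 / k.+1`!%:R) = 0 :> R by rewrite expr0n mul0r mulr0.
  have IHu u : 0 <= u <= s -> `|g (j - k.+1).+1 u| <= B * (u ^+ k / k`!%:R).
    by move=> us; rewrite -E; exact: IH (ltnW kj) u (sub u us).
  pose b u : R := B * (u ^+ k.+1 / k.+1`!%:R).
  have h1 : b 0 + g (j - k.+1)%N 0 <= b s + g (j - k.+1)%N s.
    apply: (@le_deriv (fun u => b u + g (j - k.+1)%N u) (fun u => B * (u ^+ k / k`!%:R) + g (j - k.+1).+1 u) s s0) => u us.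
      exact: is_deriveD (dm u) (dg _ _ (sub _ us)).
    by have := IHu u us; rewrite ler_norml => /andP[h _]; lra.
  have h2 : b 0 - g (j - k.+1)%N 0 <= b s - g (j - k.+1)%N s.
    apply: (@le_deriv (fun u => b u - g (j - k.+1)%N u) (fun u => B * (u ^+ k / k`!%:R) - g (j - k.+1).+1 u) s s0) => u us.
      exact: is_deriveB (dm u) (dg _ _ (sub _ us)).
    by have := IHu u us; rewrite ler_norml => /andP[_ h]; lra.
  rewrite z /b m0 in h1 h2; rewrite -/(b s) ler_norml; apply/andP.
  by split; rewrite /b; lra.
by have := H j (leqnn j) t; rewrite subnn lexx t0; exact.
Qed.

(** One term of the exponential series at j, in place of Stirling's formula. *)
Lemma pow_le_fact j : j%:R ^+ j <= expR j%:R * j`!%:R :> R.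
Proof.
case: j => [|j]; first by rewrite expr0 fact0 mulr1 expR0.
rewrite -ler_pdivrMr ?ltr0n ?fact_gt0//.
by have := @expR_ge1Dxn R j.+1%:R j (ler0n _ _); apply: le_trans; rewrite lerDr.
Qed.

Lemma geometric_le0 (a B q : R) : 0 <= a -> 0 <= q < 1 -> (forall j, (0 < j)%N -> a <= B * q ^+ j) -> a = 0.
Proof.
move=> a0 /andP[q0 q1] h; apply/eqP; rewrite eq_le a0 andbT.
have c : (fun j => B * q ^+ j) @ \oo --> B * 0.
  by apply: cvgM; [exact: cvg_cst|apply: cvg_expr; rewrite ger0_norm].
rewrite mulr0 in c.
rewrite -(cvg_lim (@Rhausdorff R) c); apply: limr_ge; first exact: cvgP c.
by near=> j; apply: h; near: j; exists 1%N.
Unshelve. all: by end_near. Qed.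

(** Real analyticity on a coordinate line: with all derivatives along it zero at [p], Taylor's
    formula of order j and the bounds of [csol_derivs] give |W| <= B q^j for every j > 0, with q <
    1. The constant [kap] depends on neither [W] nor [p] nor [r]. *)
Lemma csol_axis : exists2 kap : R, 0 < kap < 1 & forall W p r i, 0 < r -> cinf W ->
  csol (cube p r) 0 W -> (forall j, dpart (nseq j i) W p = 0) ->
  forall t, `|t| < kap * r -> W (p + t *: delta_mx ord0 i) = 0.
Proof.
have [K K0 hK] := csol_derivs; pose E : R := expR 1.
have E0 : 0 < E by exact: expR_gt0.
have KE0 : 0 <= K * E by rewrite mulr_ge0// ltW.
have D1 : 1 < 4 + 8 * (K * E) by lra.
have D0 : 0 < 4 + 8 * (K * E) by apply: lt_trans D1.
(* The 4 keeps |t| below r/4, within reach of the derivative bounds; the 8 K e makes the ratio 4 K e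
   |t| / r less than 1/2. *)
exists (4 + 8 * (K * E))^-1; first by rewrite invr_gt0 D0 invf_lt1.
move=> W p r i r0 cW sW z t; rewrite mulrC ltr_pdivlMr// => ht.
have t4 : `|t| < r / 4.
  rewrite ltr_pdivlMr//; apply: le_lt_trans ht; rewrite ler_wpM2l//; lra.
pose r1 := r / 2; have r10 : 0 < r1 by rewrite divr_gt0.
have r1r : r1 < r by rewrite ltr_pdivrMr// ltr_pMr// ltr1n.
have [B hB] : exists B : R, forall y, cube p r1 y -> `|W y| <= B.
  have := @continuous_compact _ _ W _ (continuous_subspaceT (cinf_continuous cW)) (@ccube_compact R n p r1).
  move=> /compact_bounded[M [Mr MA]]; exists (`|M| + 1) => y py.
  apply: MA; first by rewrite (le_lt_trans (ler_norm M))// ltrDl.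
  by exists y => // j; exact: ltW (py j).
have B0 : 0 <= B by apply: le_trans (normr_ge0 _) (hB p (cube_center p r10)).
have sW1 : csol (cube p r1) 0 W by apply: csol_sub sW => y py j; exact: lt_trans (py j) r1r.
have q0 : 0 <= 4 * (K * E) * `|t| / r.
  apply: divr_ge0 (ltW r0); exact: mulr_ge0 (mulr_ge0 (ler0n R 4) KE0) (normr_ge0 t).
have q1 : 4 * (K * E) * `|t| / r < 1.
  rewrite ltr_pdivrMr// mul1r; have := normr_ge0 t; have : 0 <= `|t| * (K * E) by rewrite mulr_ge0.
  move: ht; rewrite mulrDr; set a := `|t|; rewrite mulrCA; set b := a * (K * E).
  by rewrite -mulrA (mulrC _ a) -/b; lra.
apply/eqP; rewrite -normr_eq0; apply/eqP.
apply: (@geometric_le0 _ B (4 * (K * E) * `|t| / r)) => //; first by rewrite q0.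
move=> j j0; have jR : 0 < j%:R :> R by rewrite ltr0n.
(* The j steps of size [h] use up half of [r1] and leave a cube of half-side r/4. The resulting j^j
   is at most e^j j!. *)
pose h := r1 / (2 * j%:R); have h0 : 0 < h by rewrite divr_gt0// mulr_gt0.
pose sg : R := if 0 <= t then 1 else -1.
have sgt : sg * `|t| = t.
  rewrite /sg; case: ifPn => [/ger0_norm ->|]; first by rewrite mul1r.
  by rewrite -ltNge => /ltr0_norm ->; rewrite mulN1r opprK.
have sg1 : `|sg| = 1 by rewrite /sg; case: ifP; rewrite ?normrN normr1.
pose g k s := sg ^+ k * dpart (nseq k i) W (p + (s * sg) *: delta_mx ord0 i).
have := @taylor_bound g j ((K / h) ^+ j * B) `|t| (normr_ge0 t).
have C0 : 0 <= (K / h) ^+ j * B by rewrite mulr_ge0// exprn_ge0// divr_ge0// ltW.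
move=> /(_ C0) H.
have : `|g 0%N `|t| | <= (K / h) ^+ j * B * (`|t| ^+ j / j`!%:R).
  apply: H.
  - move=> k s _; have cd := cinf_dpart (nseq k i) cW.
    have d1 : is_derive s (1 : R) (fun s : R => s * sg) sg.
      apply: (is_derive_eq (is_deriveM (is_derive_id s (1 : R)) (is_derive_cst sg s (1 : R)))).
      by rewrite scaler0 add0r [_%:A]mulr1.
    have d2 : is_derive s (1 : R) ((fun t : R => dpart (nseq k i) W (p + t *: delta_mx ord0 i)) \o (fun s : R => s * sg))
        (pd i (dpart (nseq k i) W) (p + (s * sg) *: delta_mx ord0 i) *: sg).
      by apply: is_derive1_comp; exact: is_derive_pd.
    apply: (is_derive_eq (is_deriveZ (sg ^+ k) d2)).
    by rewrite /g [nseq k.+1 i]/= dpart_cons exprS /GRing.scale /=; ring.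
  - by move=> k _; rewrite /g mul0r scale0r addr0 z mulr0.
  - move=> s /andP[s0 st]; rewrite /g normrM normrX sg1 expr1n mul1r.
    apply: (hK _ _ _ _ _ cW sW1 hB) => // l.
    have -> : r1 - j%:R * h = r / 4 by rewrite /h /r1; field; rewrite gt_eqF.
    rewrite !mxE addrAC subrr add0r normrM.
    apply: le_lt_trans t4; rewrite normrM sg1 mulr1 (ger0_norm s0).
    apply: le_trans st; rewrite ler_piMr// eqxx /=.
    by case: (l == i); rewrite ?normr1 ?normr0.
rewrite /g expr0 mul1r mulrC sgt => /le_trans; apply.
have -> : (K / h) ^+ j * B * (`|t| ^+ j / j`!%:R) = B * ((4 * K * `|t| / r) ^+ j * (j%:R ^+ j / j`!%:R)).
  have -> : K / h = 4 * K / r * j%:R by rewrite /h /r1; field; rewrite !gt_eqF.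
  by rewrite !exprMn; ring.
rewrite ler_wpM2l//.
have -> : 4 * (K * E) * `|t| / r = 4 * K * `|t| / r * E by ring.
rewrite (exprMn j _ E) ler_wpM2l//.
  by rewrite exprn_ge0// divr_ge0 ?(ltW r0)// !mulr_ge0.
rewrite ler_pdivrMr ?ltr0n ?fact_gt0//.
by rewrite /E -expRM_natl mulr1; exact: pow_le_fact.
Qed.

Lemma open_coords (P : 'I_n -> set R) : (forall i, open (P i)) -> open [set x : 'rV[R]_n | forall i, P i (x ord0 i)].
Proof.
move=> oP; rewrite openE => x Px.
have h i : nbhs x (fun y : 'rV[R]_n => P i (y ord0 i)).
  have c : {for x, continuous (fun y : 'rV[R]_n => y ord0 i)} by have /(_ x) := cinf_continuous (@smooth_coord R n i).
  by apply: (c (P i)); apply: open_nbhs_nbhs; split; [exact: oP|exact: Px].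
exact: (@filter_forall _ _ (fun i (y : 'rV[R]_n) => P i (y ord0 i)) (nbhs x) _ h).
Qed.

Lemma open_dist (a b : R) : open [set u : R | `|u - a| < b].
Proof.
have [b0|b0] := ltP 0 b.
  rewrite (_ : [set _ | _] = ball a b); first exact: ball_open.
  by rewrite -ball_normE; apply/seteqP; split => u /=; rewrite distrC.
rewrite (_ : [set _ | _] = set0); first exact: open0.
by apply/seteqP; split => // u /=; rewrite ltNge (le_trans b0).
Qed.

(** The zero set is widened one coordinate at a time: at stage m the first m coordinates range up to
    [rho] while the others keep the small initial width. The final size kap r is independent of the
    initial width [d], as propagation through a connected set requires. *)
Lemma csol_uc : exists2 kap : R, 0 < kap < 1 & forall W p r (d : R), 0 < r -> 0 < d -> cinf W ->
  csol (cube p r) 0 W -> (forall x, cube p d x -> W x = 0) -> forall x, cube p (kap * r) x -> W x = 0.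
Proof.
have [k /andP[k0 k1] hk] := csol_axis.
have k2 : 0 < k / 2 by rewrite divr_gt0.
have k2k : k / 2 < k by rewrite ltr_pdivrMr// ltr_pMr// ltr1n.
(* Half of the axis constant, because the axis lemma is applied on cubes of half-side r/2 about
   points less than r/2 away from [p]. *)
exists (k / 2); first by rewrite k2 (lt_trans k2k).
move=> W p r d r0 d0 cW sW W0.
pose rho := k / 2 * r; have rho0 : 0 < rho by rewrite mulr_gt0.
have rr : rho < r / 2 by rewrite /rho mulrAC ltr_pM2r ?invr_gt0// gtr_pMl.
pose A m : set 'rV[R]_n := [set x | forall i, `|x ord0 i - p ord0 i| < if (i < m)%N then rho else Num.min d rho].
have oA m : open (A m).
  apply: (@open_coords (fun i => [set u | `|u - p ord0 i| < if (i < m)%N then rho else Num.min d rho])) => i.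
  exact: open_dist.
have H m : forall x, A m x -> W x = 0.
  elim: m => [|m IH] x Ax.
    by apply: W0 => i; have := Ax i; rewrite ltn0 lt_min => /andP[].
  have [mn|mn] := ltnP m n; last first.
    apply: IH => i; have := Ax i; rewrite ltnS !(leq_trans (ltnW (ltn_ord i)) mn).
    by rewrite (leq_trans (ltn_ord i) mn).
  pose i0 := Ordinal mn.
  pose t := x ord0 i0 - p ord0 i0.
  (* [q] is [x] with coordinate [i0] reset to that of [p]. It lies in the open set of stage m, so
     all derivatives vanish there, and [x] is reached from it along one axis. *)
  pose q := x - t *: delta_mx ord0 i0.
  have qE j : q ord0 j = if j == i0 then p ord0 i0 else x ord0 j.
    rewrite !mxE eqxx /=; case: eqP => [->|_]; last by rewrite mulr0 subr0.
    by rewrite mulr1 /t opprB addrC subrK.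
  have Aq : A m q.
    move=> j; rewrite qE; case: (j =P i0) => [->|/eqP ji].
      by rewrite subrr normr0; case: ifP => // _; rewrite lt_min d0.
    have := Ax j; rewrite ltnS leq_eqVlt; case: ltngtP => //= jm _.
    by move: ji; rewrite -val_eqE /= jm eqxx.
  have -> : x = q + t *: delta_mx ord0 i0 by rewrite subrK.
  have r20 : 0 < r / 2 by rewrite divr_gt0.
  have cq : cube q (r / 2) `<=` cube p r.
    move=> y qy j.
    have -> : y ord0 j - p ord0 j = (y ord0 j - q ord0 j) + (q ord0 j - p ord0 j) by ring.
    rewrite (le_lt_trans (ler_normD _ _))// (splitr r) ltrD//.
    by apply: lt_trans rr; apply: lt_le_trans (Aq j) _; case: ifP => // _; rewrite ge_min lexx orbT.
  apply: (hk W q (r / 2) i0 r20 cW (csol_sub cq sW)).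
    by move=> j; exact: (dpart_zero_on (nseq j i0) (oA m) IH Aq).
  have := Ax i0; rewrite /= ltnSn => ht; apply: lt_le_trans ht _.
  by rewrite /rho mulrAC mulrA.
by move=> x px; apply: (H n) => i; rewrite ltn_ord; exact: px.
Qed.

End harmonic.

(** * Integrals over a line and a half-line *)

Section line.
Context {R : realType}.
Notation leb1 := (@lebesgue_measure R).
Implicit Types (g : R -> R) (a M t : R).

Lemma csupp_integrable1 g M : continuous g -> (forall t, M <= `|t| -> g t = 0) ->
  leb1.-integrable setT (EFin \o g).
Proof.
move=> cg gM.
have h := @continuous_compact_integrable R g _ (@segment_compact R (- M) M) (continuous_subspaceT cg).
have := (integrable_mkcond (mu := leb1) (EFin \o g) (measurable_itv `[- M, M])).1 h.
rewrite restrict_EFin (_ : g \_ _ = g)//; apply/funext => t; rewrite patchE; case: ifPn => //.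
rewrite notin_setE /= in_itv/= => /negP; rewrite -ler_norml -ltNge => /ltW /gM -> //.
Qed.

Lemma Rint_half_line g g' a M : (forall t, is_derive t (1 : R) g (g' t)) -> continuous g' ->
  (forall t, M <= `|t| -> g t = 0) -> (forall t, M <= `|t| -> g' t = 0) ->
  \int[leb1]_t ((a < (t : R))%R%:R * g' t) = - g a.
Proof.
move=> dg cg' gM g'M; pose b := `|a| + `|M| + 1.
have ab : a < b by rewrite /b (le_lt_trans (ler_norm a))// -addrA ltrDl ltr_wpDl.
have bM t : b <= t -> M <= `|t|.
  move=> bt; rewrite (le_trans (ler_norm M))// (le_trans _ (ler_norm t))// (le_trans _ bt)//.
  by rewrite /b -addrA addrCA lerDl addr_ge0.
have cg : continuous g.
  by move=> t; apply: differentiable_continuous; apply/derivable1_diffP; have [] := dg t.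
transitivity (\int[leb1]_(t in `[a, b]) g' t).
  rewrite -Rintegral_itv_obnd_cbnd; last first.
    by apply: (@integrableS _ _ _ leb1 setT) => //; exact: csupp_integrable1 g'M.
  rewrite [RHS]Rintegral_mkcond; apply: eq_Rintegral => t _; rewrite patchE mem_setE in_itv/=.
  case: (ltP a t) => [at_|] /=; last by rewrite mul0r.
  by rewrite mul1r; case: leP => // /ltW /bM /g'M.
have := @continuous_FTC2 R g' g a b ab (continuous_subspaceT cg').
have -> : g b = 0 by apply: gM; exact: bM.
rewrite sub0e => /(_ _ _) E; rewrite /Rintegral E//.
  split => [t _||]; first by have [] := dg t.
    exact/cvg_at_right_filter/cg.
  exact/cvg_at_left_filter/cg.
by move=> t _; rewrite derive1E; have [] := dg t.
Qed.

Lemma Rint_line g g' M : (forall t, is_derive t (1 : R) g (g' t)) -> continuous g' ->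
  (forall t, M <= `|t| -> g t = 0) -> (forall t, M <= `|t| -> g' t = 0) ->
  \int[leb1]_t (g' t) = 0.
Proof.
move=> dg cg' gM g'M; pose a := - `|M|.
have Ma t : t <= a -> M <= `|t|.
  rewrite lerNr => h; rewrite (le_trans (ler_norm M))// (le_trans h)// -normrN; exact: ler_norm.
have := Rint_half_line a dg cg' gM g'M; rewrite (gM a (Ma _ (lexx _))) oppr0 => <-.
by apply: eq_Rintegral => t _; case: ltP => [_|/Ma /g'M ->]; rewrite ?mul1r ?mulr0.
Qed.

End line.

(** * The Helmholtz equation *)

Section slices.
Context {R : realType} {n : nat}.
Implicit Types (F : 'rV[R]_n.+1 -> R) (W : 'rV[R]_n -> R) (z : 'rV[R]_n.+1) (x : 'rV[R]_n) (t k : R) (i : 'I_n).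

Definition rtail z : 'rV[R]_n := \row_i z ord0 (lift ord0 i).

Lemma rtail_cons t x : rtail (rV_cons (t, x)) = x.
Proof. by apply/rowP => i; rewrite mxE rV_consS. Qed.

Lemma rtailE z : rtail z = z *m \matrix_(i, j) (i == lift ord0 j)%:R + 0.
Proof.
apply/rowP => j; rewrite addr0 !mxE (bigD1 (lift ord0 j))//= big1 => [|l lj].
  by rewrite mxE eqxx mulr1 addr0.
by rewrite mxE (negbTE lj) mulr0.
Qed.

Lemma rV_consE t x : rV_cons (t, x) = x *m \matrix_(i, j) (j == lift ord0 i)%:R + rV_cons (t, 0).
Proof.
apply/rowP => j; case: (unliftP ord0 j) => [i ->|->]; last first.
  by rewrite [RHS]mxE !rV_cons0 mxE big1 ?add0r// => l _; rewrite mxE mulr0.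
rewrite [RHS]mxE !rV_consS !mxE addr0 (bigD1 i)//= big1 => [|l lj]; first by rewrite mxE eqxx mulr1 addr0.
by rewrite mxE (inj_eq lift_inj) eq_sym (negbTE lj) mulr0.
Qed.

Lemma cinf_tail W : cinf W -> cinf (fun z => W (rtail z)).
Proof. by move=> cW; under eq_fun do rewrite rtailE; exact: smooth_affine. Qed.

Lemma cinf_slice F t : cinf F -> cinf (fun x => F (rV_cons (t, x))).
Proof. by move=> cF; under eq_fun do rewrite rV_consE; exact: smooth_affine. Qed.

Lemma pd_tail0 W : cinf W -> pd ord0 (fun z => W (rtail z)) = fun=> 0.
Proof.
move=> cW; under eq_fun do rewrite rtailE; rewrite pd_affine//.
by apply/funext => z; rewrite big1// => j _; rewrite mxE (negbTE (neq_lift _ _)) mul0r.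
Qed.

Lemma pd_tailS W i : cinf W -> pd (lift ord0 i) (fun z => W (rtail z)) = fun z => pd i W (rtail z).
Proof.
move=> cW; under eq_fun do rewrite rtailE; rewrite pd_affine//.
apply/funext => z; rewrite -rtailE (bigD1 i)//= big1 => [|l li]; first by rewrite mxE eqxx mul1r addr0.
by rewrite mxE (inj_eq lift_inj) eq_sym (negbTE li) mul0r.
Qed.

Lemma pd_slice F t i : cinf F -> pd i (fun x => F (rV_cons (t, x))) = fun x => pd (lift ord0 i) F (rV_cons (t, x)).
Proof.
move=> cF; under eq_fun do rewrite rV_consE; rewrite pd_affine//.
apply/funext => x; rewrite -rV_consE (bigD1 (lift ord0 i))//= big1 => [|l li]; first by rewrite mxE eqxx mul1r addr0.
by rewrite mxE (negbTE li) mul0r.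
Qed.

Lemma is_derive_slice F t x : cinf F ->
  is_derive t (1 : R) (fun t => F (rV_cons (t, x))) (pd ord0 F (rV_cons (t, x))).
Proof.
move=> cF; have E s : rV_cons (s, x) = rV_cons (0, x) + s *: delta_mx ord0 ord0.
  apply/rowP => j; case: (unliftP ord0 j) => [i ->|->].
    have nl : (lift ord0 i == ord0) = false by rewrite eq_sym (negbTE (neq_lift _ _)).
    by rewrite [RHS]mxE !rV_consS !mxE nl andbF mulr0 addr0.
  by rewrite [RHS]mxE !rV_cons0 !mxE eqxx mulr1 add0r.
rewrite (_ : (fun t => _) = fun t => F (rV_cons (0, x) + t *: delta_mx ord0 ord0)); last first.
  by apply/funext => s; rewrite E.
rewrite (E t); exact: (@is_derive_pd R n.+1 F ord0 (rV_cons (0, x)) t cF).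
Qed.

Lemma laplacianS F z : laplacian F z = pd ord0 (pd ord0 F) z + \sum_i pd (lift ord0 i) (pd (lift ord0 i) F) z.
Proof. by rewrite laplacianE big_ord_recl. Qed.

(* Turns solutions of the Helmholtz equation into harmonic functions of one more variable. *)
Definition expext k W z := expR (k * z ord0 ord0) * W (rtail z).

Lemma exp0_cinf k : cinf (fun z => expR (k * z ord0 ord0)).
Proof. by apply: smooth_comp; [exact: smooth1_expR|apply: smoothZ; exact: smooth_coord]. Qed.

Lemma expext_cinf k W : cinf W -> cinf (expext k W).
Proof. by move=> cW; apply: smoothM; [exact: exp0_cinf|exact: cinf_tail]. Qed.

Lemma pd_exp0 k j : pd j (fun z => expR (k * z ord0 ord0)) = fun z => k * (j == ord0)%:R * expR (k * z ord0 ord0).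
Proof.
have cz : cinf (fun z => k * z ord0 ord0) by apply: smoothZ; exact: smooth_coord.
rewrite (pd_comp j (@is_derive_expR R) cz).
apply/funext => z; rewrite pdZ ?pd_coord; last exact: smooth_coord.
by rewrite mulrC.
Qed.

Lemma pd_expext0 k W : cinf W -> pd ord0 (expext k W) = fun z => k * expext k W z.
Proof.
move=> cW; rewrite pdM; [|exact: exp0_cinf|exact: cinf_tail].
by apply/funext => z; rewrite pd_exp0 pd_tail0// eqxx mulr1 mulr0 addr0 mulrA.
Qed.

Lemma pd_expextS k W i : cinf W -> pd (lift ord0 i) (expext k W) = expext k (pd i W).
Proof.
move=> cW; rewrite pdM; [|exact: exp0_cinf|exact: cinf_tail].
apply/funext => z; rewrite pd_exp0 pd_tailS// eq_sym (negbTE (neq_lift _ _)) mulr0 !mul0r add0r.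
by [].
Qed.

Lemma csol_expext (A : set 'rV[R]_n) k W : cinf W -> csol A (k ^+ 2) W ->
  csol [set z | A (rtail z)] 0 (expext k W).
Proof.
move=> cW sW z /= /sW; rewrite laplacianE => h.
rewrite laplacianS pd_expext0// pdZ ?pd_expext0//; last exact: expext_cinf.
rewrite (eq_bigr (fun i => expR (k * z ord0 ord0) * pd i (pd i W) (rtail z))); last first.
  by move=> i _; rewrite pd_expextS// pd_expextS//; exact: cinf_pd.
by rewrite -mulr_sumr h /expext; ring.
Qed.

Lemma dpart_expext k W i j : cinf W ->
  dpart (nseq j (lift ord0 i)) (expext k W) = expext k (dpart (nseq j i) W).
Proof.
move=> cW; elim: j => [//|j IH]; rewrite [nseq _ (lift _ _)]/= dpart_cons IH pd_expextS; last exact: cinf_dpart.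
by rewrite [nseq _ i]/= dpart_cons.
Qed.

Lemma cube_tail t x r : cube (rV_cons (t, x)) r `<=` [set z | cube x r (rtail z)].
Proof. by move=> z h i; have := h (lift ord0 i); rewrite rV_consS mxE. Qed.

Lemma cube_cons t x r y : 0 < r -> cube x r y -> cube (rV_cons (t, x)) r (rV_cons (t, y)).
Proof.
move=> r0 h j; case: (unliftP ord0 j) => [i ->|->]; first by rewrite !rV_consS; exact: h.
by rewrite !rV_cons0 subrr normr0.
Qed.

(** [csol_axis] is applied to [expext k W] at height 0, where the exponential factor is 1;
    derivatives along the old coordinates act on [W] alone. *)
Lemma helm_axis : exists2 kap : R, 0 < kap < 1 & forall k W (p : 'rV[R]_n) (r : R) i, 0 < r -> cinf W ->
  csol (cube p r) (k ^+ 2) W -> (forall j, dpart (nseq j i) W p = 0) ->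
  forall t, `|t| < kap * r -> W (p + t *: delta_mx ord0 i) = 0.
Proof.
have [kap kap01 h] := @csol_axis R n.+1; exists kap => // k W p r i r0 cW sW W0 t ht.
have {h} := h (expext k W) (rV_cons (0, p)) r (lift ord0 i) r0 (expext_cinf k cW) _ _ t ht.
have -> : rV_cons (0, p) + t *: delta_mx ord0 (lift ord0 i) = rV_cons (0, p + t *: delta_mx ord0 i).
  apply/rowP => j; case: (unliftP ord0 j) => [l ->|->].
    by rewrite [LHS]mxE !rV_consS !mxE (inj_eq lift_inj).
  by rewrite [LHS]mxE !rV_cons0 !mxE (negbTE (neq_lift _ _)) andbF mulr0 addr0.
rewrite /expext rtail_cons rV_cons0 mulr0 expR0 mul1r; apply => //.
  apply: csol_sub (csol_expext cW sW); exact: cube_tail.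
by move=> j; have := dpart_expext k i j cW; rewrite /expext => ->; rewrite rtail_cons W0 mulr0.
Qed.

Lemma helm_uc : exists2 kap : R, 0 < kap < 1 & forall k W (p : 'rV[R]_n) (r d : R), 0 < r -> 0 < d -> cinf W ->
  csol (cube p r) (k ^+ 2) W -> (forall x, cube p d x -> W x = 0) -> forall x, cube p (kap * r) x -> W x = 0.
Proof.
have [kap /andP[k0 k1] h] := @csol_uc R n.+1; exists kap; rewrite ?k0// => k W p r d r0 d0 cW sW W0 x px.
have := h (expext k W) (rV_cons (0, p)) r d r0 d0 (expext_cinf k cW).
move=> /(_ _ _ (rV_cons (0, x))); rewrite /expext rtail_cons rV_cons0 mulr0 expR0 mul1r; apply.
- by apply: csol_sub (csol_expext cW sW); exact: cube_tail.
- by move=> z /cube_tail /= /W0 ->; rewrite mulr0.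
- by apply: cube_cons => //; rewrite mulr_gt0.
Qed.

End slices.

(** * Almost everywhere equality and classical solutions *)

Section ae.
Context {R : realType} {n : nat}.
Notation leb := (lebesgue_rV n : {measure set 'rV[R]_n -> \bar R}).
Notation Rint F := (Rintegral leb setT F).
Implicit Types (F G f : 'rV[R]_n -> R) (x : 'rV[R]_n) (A : set 'rV[R]_n).

Lemma cube_pos x (e : R) : 0 < e -> (0 < leb (cube x e))%E.
Proof.
move=> e0; pose d := e / 2; have d0 : 0 < d by rewrite divr_gt0.
have de : d < e by rewrite ltr_pdivrMr// ltr_pMr// ltr1n.
have lS : leb [set y : 'rV[R]_n | forall i, x ord0 i - d <= y ord0 i <= x ord0 i + d] = ((2 * d) ^+ n)%:E.
  apply: etrans (@lebesgue_rV_box R n (fun i => x ord0 i - d) (fun i => x ord0 i + d) _) _.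
    by move=> j; rewrite lerD2l ge0_cp// ltW.
  by rewrite (eq_bigr (fun=> 2 * d)) ?prodr_const ?card_ord// => j _; ring.
apply: (@lt_le_trans _ _ ((2 * d) ^+ n)%:E); first by rewrite lte_fin exprn_gt0// mulr_gt0.
rewrite -lS; apply: le_measure; rewrite ?inE; [|exact: measurable_cube|].
  apply: compact_measurable_rV; exact: (@cbox_compact R n (fun i => x ord0 i - d) (fun i => x ord0 i + d)).
by move=> y xy i; apply: le_lt_trans de; rewrite ler_distl.
Qed.

Lemma ae_continuous_eq0 A f : open A -> continuous f -> {ae leb, forall x, A x -> f x = 0} ->
  forall x, A x -> f x = 0.
Proof.
move=> oA cf [N [mN N0 NA]] x Ax; apply: contrapT => /eqP fx.
have [d1 d10 h1] := open_nbhs_cube oA Ax.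
have fx2 : 0 < `|f x| / 2 by rewrite divr_gt0// normr_gt0.
have [d2 d20 h2] := continuous_norm x cf fx2.
pose d := Num.min d1 d2; have d0 : 0 < d by rewrite lt_min d10.
have := cube_pos x d0; rewrite ltNge => /negP; apply; rewrite -N0.
apply: le_measure; rewrite ?inE//; first exact: measurable_cube.
move=> y xy; apply: NA => /= h.
have Ay : A y by apply: h1 => i; rewrite (lt_le_trans (xy i))// ge_min lexx.
have := h2 y; rewrite (h Ay) sub0r normrN => h3.
have : `|f x| <= `|f x| / 2.
  apply: h3; have : ball x d y by rewrite ball_cube.
  by rewrite -ball_normE /= distrC => /lt_le_trans; apply; rewrite ge_min lexx orbT.
by rewrite ler_pdivlMr// ger_pMr ?normr_gt0// lern1.
Qed.

Lemma ae_Rint F G : measurable_fun setT F -> measurable_fun setT G -> {ae leb, forall x, F x = G x} ->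
  Rint F = Rint G.
Proof.
move=> mF mG h; rewrite /Rintegral; congr fine; apply: ae_eq_integral => //.
- exact/measurable_EFinP.
- exact/measurable_EFinP.
- by apply: filterS h => x h _ /=; rewrite h.
Qed.

Lemma weak_sol_ae A c F W : L1 F -> cinf W -> {ae leb, forall x, A x -> F x = W x} ->
  weak_sol A c F -> weak_sol A c W.
Proof.
move=> iF cW h wF psi tp; rewrite -(wF psi tp); apply: ae_Rint.
- by apply: measurable_funM; [exact: cinf_measurable|apply: measurable_funD; [exact: tst_measurable (tst_laplacian tp)|apply: measurable_funM => //; exact: tst_measurable tp]].
- by apply: measurable_funM; [exact: L1_measurable|apply: measurable_funD; [exact: tst_measurable (tst_laplacian tp)|apply: measurable_funM => //; exact: tst_measurable tp]].
apply: filterS h => x h; case: (asboolP (A x)) => [/h ->//|nA].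
by rewrite (tst_out tp nA) (tst_out (tst_laplacian tp) nA) !mulr0 addr0 !mulr0.
Qed.

Lemma weak_csol A c W : open A -> cinf W -> weak_sol A c W -> csol A c W.
Proof.
move=> oA cW wW x Ax; apply/eqP; rewrite -addr_eq0; apply/eqP; move: x Ax.
have cf : cinf (fun x => laplacian W x + c * W x).
  by apply: smoothD; [exact: cinf_laplacian|exact: smoothZ].
apply: (ae_continuous_eq0 oA (cinf_continuous cf)).
apply: fundamental_lemma => //.
  by move=> S cS _; apply: continuous_compact_L1 => //; exact: cinf_continuous.
move=> psi tp; rewrite (@Rint_restrict R n A A)//; last by move=> x; exact: tst_out tp.
rewrite -(wW psi tp).
have t1 := tst_mul (tst_laplacian tp) cW; have t2 := tst_mul tp (cinf_laplacian cW).
have t3 := tst_mul tp cW.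
transitivity (Rint (fun x => psi x * laplacian W x + c * (psi x * W x))).
  apply: eq_Rintegral => x _; rewrite patchE; case: ifPn => [_|]; first by ring.
  by rewrite notin_setE => /(tst_out tp) ->; ring.
rewrite (RintD (tst_L1 t2)); last exact: L1Z (tst_L1 t3).
rewrite -(Rint_laplacian tp cW) -(RintD (tst_L1 t1)); last exact: L1Z (tst_L1 t3).
by apply: eq_Rintegral => x _; ring.
Qed.

End ae.

(** * Slicing, and Weyl's lemma for the Helmholtz equation *)

Section fubini_slices.
Context {R : realType} {n : nat}.
Notation leb n := (lebesgue_rV n : {measure set 'rV[R]_n -> \bar R}).
Notation leb1 := (@lebesgue_measure R).
Notation Rint F := (Rintegral (leb _) setT F).
Implicit Types (F : 'rV[R]_n.+1 -> R) (W : 'rV[R]_n -> R) (z : 'rV[R]_n.+1) (x : 'rV[R]_n) (t k : R) (i : 'I_n).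

Lemma measurable_rtail : measurable_fun setT (@rtail R n).
Proof.
apply: measurable_fun_rV => i.
rewrite (_ : (fun _ => _) = fun z : 'rV[R]_n.+1 => z ord0 (lift ord0 i)); last by apply/funext => z; rewrite mxE.
exact: measurable_rV_coord.
Qed.

Lemma L1_prod (a : R -> R) W : leb1.-integrable setT (EFin \o a) -> L1 W ->
  L1 (fun z => a (z ord0 ord0) * W (rtail z)).
Proof.
move=> ia iW; have /integrableP[/measurable_EFinP ma _] := ia.
have mW := L1_measurable iW.
have mF : measurable_fun setT (EFin \o (fun z => a (z ord0 ord0) * W (rtail z))).
  apply/measurable_EFinP; apply: measurable_funM.
    by apply: (measurableT_comp ma); exact: measurable_rV_coord.
  by apply: (measurableT_comp mW); exact: measurable_rtail.
apply/integrableP; split => //.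
have mabs : measurable_fun setT (fun z => `|(a (z ord0 ord0) * W (rtail z))%:E|)%E by exact: measurableT_comp mF.
rewrite (ge0_integral_rVS mabs)//; apply: le_lt_trans (integral_prod_lty ia iW).
rewrite le_eqVlt; apply/orP; left; apply/eqP.
apply: eq_integral => t _; apply: eq_integral => x _.
by rewrite rV_cons0 rtail_cons.
Qed.

Lemma Rint_rVS F : L1 F -> (forall t, L1 (fun x => F (rV_cons (t, x)))) ->
  Rint F = \int[leb1]_t (Rint (fun x => F (rV_cons (t, x)))).
Proof.
move=> iF h; rewrite {1}/Rintegral (integral_rVS iF) /Rintegral; congr fine.
by apply: eq_integral => t _; rewrite -EFin_Rintegral//; exact: h.
Qed.

Lemma Rint_rVS_swap F : L1 F -> (forall x, leb1.-integrable setT (EFin \o (fun t => F (rV_cons (t, x))))) ->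
  Rint F = Rint (fun x => \int[leb1]_t (F (rV_cons (t, x)))).
Proof.
move=> iF h; rewrite {1}/Rintegral (integral_rVS_swap iF) /Rintegral; congr fine.
by apply: eq_integral => x _; rewrite -EFin_Rintegral//; exact: h.
Qed.

Lemma tst_slice (A : set 'rV[R]_n.+1) F t : tst A F -> tst [set x | A (rV_cons (t, x))] (fun x => F (rV_cons (t, x))).
Proof.
move=> tF; have [r r0 rF] := compact_cube (tst_compact tF).
have cF := cinf_slice t (tst_cinf tF).
have c : continuous (fun x : 'rV[R]_n => rV_cons (t, x)).
  by under eq_fun do rewrite rV_consE; exact: affine_continuous.
apply: (@tstI R n _ _ [set x | supp F (rV_cons (t, x))]) => //.
- apply: (subclosed_compact _ (@ccube_compact R n 0 r)).
    apply: closed_comp => [x _|]; last exact: closed_supp.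
    exact: c.
  by move=> x /rF h i; have := h (lift ord0 i); rewrite rV_consS !mxE => /ltW.
- by move=> x; exact: (tst_sub tF).
- by move=> x h; exact: supp_out.
Qed.

Lemma slice_integrable1 (A : set 'rV[R]_n.+1) F x : tst A F ->
  exists M, [/\ continuous (fun t : R => F (rV_cons (t, x))),
   continuous (fun t : R => pd ord0 F (rV_cons (t, x))),
   forall t, M <= `|t| -> F (rV_cons (t, x)) = 0 & forall t, M <= `|t| -> pd ord0 F (rV_cons (t, x)) = 0].
Proof.
move=> tF; have [r r0 rF] := compact_cube (tst_compact tF); exists r.
have out t : r <= `|t| -> ~ supp F (rV_cons (t, x)).
  by move=> rt /rF /(_ ord0); rewrite rV_cons0 mxE subr0 ltNge rt.
have c G : cinf G -> continuous (fun t : R => G (rV_cons (t, x))).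
  move=> cG t; apply: differentiable_continuous; apply/derivable1_diffP.
  by have [] := is_derive_slice t x cG.
split.
- exact/c/tst_cinf/tF.
- exact/c/cinf_pd/tst_cinf/tF.
- by move=> t /out; exact: supp_out.
- by move=> t /out; exact: pd_out.
Qed.

Lemma Rint_slice_pd0 (A : set 'rV[R]_n.+1) F x : tst A F ->
  \int[leb1]_t (pd ord0 F (rV_cons (t, x))) = 0.
Proof.
move=> tF; have [M [c1 c2 h1 h2]] := slice_integrable1 x tF.
apply: (Rint_line (g := fun t => F (rV_cons (t, x))) _ c2 h1 h2) => t.
exact: is_derive_slice (tst_cinf tF).
Qed.

Lemma Rint_slice_half (A : set 'rV[R]_n.+1) F x : tst A F ->
  \int[leb1]_t ((0 < (t : R))%R%:R * pd ord0 F (rV_cons (t, x))) = - F (rV_cons (0, x)).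
Proof.
move=> tF; have [M [c1 c2 h1 h2]] := slice_integrable1 x tF.
apply: (Rint_half_line (g := fun t => F (rV_cons (t, x))) 0 _ c2 h1 h2) => t.
exact: is_derive_slice (tst_cinf tF).
Qed.

(** The Laplacian in (s, x) is split as P + L with P = d_s^2 - k^2 and L = Delta_x + k^2. Against
    exp (k s) the first part is an exact derivative on every line, and the second is the weak
    equation for [W] on every slice. The cut-off in s is there for integrability; the test functions
    are supported where it is 1. *)
Lemma weak_sol_expext (A : set 'rV[R]_n) k (rho : R) W : L1 W -> weak_sol A (k ^+ 2) W ->
  let V := fun z : 'rV[R]_n.+1 => (\1_(`]- rho, rho[%classic : set R) (z ord0 ord0) * expR (k * z ord0 ord0)) * W (rtail z) in
  L1 V /\ weak_sol [set z : 'rV[R]_n.+1 | `|z ord0 ord0| < rho /\ A (rtail z)] 0 V.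
Proof.
move=> iW wW V.
have iV : L1 V.
  apply: (@L1_prod (fun t : R => \1_(`]- rho, rho[%classic : set R) t * expR (k * t))) => //.
  have cE : continuous (fun t : R => expR (k * t)).
    move=> t; apply: (@continuous_comp R R R (fun t : R => k * t) expR); last exact: continuous_expR.
    exact: mulrl_continuous.
  have h := @continuous_compact_integrable R _ _ (@segment_compact R (- rho) rho) (continuous_subspaceT cE).
  have h' : leb1.-integrable `]- rho, rho[ (EFin \o (fun t : R => expR (k * t))).
    by apply: integrableS h => //; exact: subset_itv_oo_cc.
  have := (integrable_mkcond (mu := leb1) _ (measurable_itv `]- rho, rho[)).1 h'.
  rewrite restrict_EFin; congr (_.-integrable _ _); apply/funext => t /=.
  by rewrite patchE indicE; case: ifP => _; rewrite ?mul1r ?mul0r.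
split => // psi tp; set A' := [set z | _] in tp.
have cp := tst_cinf tp.
have VE z g : (~ A' z -> g = 0) -> V z * g = expR (k * z ord0 ord0) * W (rtail z) * g.
  case: (asboolP (A' z)) => [[z0 _] _|nA ->//]; last by rewrite !mulr0.
  by rewrite /V indicE mem_set ?mul1r//= in_itv/= -ltr_norml.
pose P z := pd ord0 (pd ord0 psi) z - k ^+ 2 * psi z.
pose L z := \sum_i pd (lift ord0 i) (pd (lift ord0 i) psi) z + k ^+ 2 * psi z.
have tpd s : tst A' (dpart s psi) by exact: tst_dpart.
have tP : tst A' P.
  rewrite (_ : P = fun z => pd ord0 (pd ord0 psi) z + (- (k ^+ 2)) * psi z); last by apply/funext => z; rewrite mulNr.
  by apply: tstD; [do 2 apply: tst_pd|exact: tstZ].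
have tL : tst A' L.
  by apply: tstD; [apply: tst_sum => i; do 2 apply: tst_pd|exact: tstZ].
have [BP _ hBP] := tst_bounded tP; have [BL _ hBL] := tst_bounded tL.
have iVP : L1 (fun z => V z * P z) by apply: (L1_mul iV (tst_measurable tP) hBP).
have iVL : L1 (fun z => V z * L z) by apply: (L1_mul iV (tst_measurable tL) hBL).
have -> : Rint (fun z => V z * (laplacian psi z + 0 * psi z)) = Rint (fun z => V z * P z + V z * L z).
  by apply: eq_Rintegral => z _; rewrite laplacianS /P /L; ring.
have VP z : V z * P z = expR (k * z ord0 ord0) * W (rtail z) * P z by apply: VE; exact: tst_out tP.
have VL z : V z * L z = expR (k * z ord0 ord0) * W (rtail z) * L z by apply: VE; exact: tst_out tL.
rewrite RintD//.
have -> : Rint (fun z => V z * P z) = 0.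
  (* exp (k s) (d_s^2 - k^2) psi is the s-derivative of exp (k s) (d_s psi - k psi). *)
  pose G z := expR (k * z ord0 ord0) * (pd ord0 psi z - k * psi z).
  have cG0 : cinf (fun z => pd ord0 psi z - k * psi z) by apply: smoothB; [exact: cinf_pd|exact: smoothZ].
  have tG : tst A' G.
    rewrite (_ : G = fun z => (pd ord0 psi z + (- k) * psi z) * expR (k * z ord0 ord0)); last first.
      by apply/funext => z; rewrite /G mulrC mulNr.
    apply: tst_mul; last exact: exp0_cinf.
    by apply: tstD; [exact: tst_pd|exact: tstZ].
  have pG z : pd ord0 G z = expR (k * z ord0 ord0) * P z.
    rewrite /G pdM; [|exact: exp0_cinf|exact: cG0].
    rewrite pd_exp0 eqxx pdB; [|exact: cinf_pd|exact: smoothZ].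
    by rewrite pdZ// /P (_ : true%:R = 1 :> R)//; ring.
  have E x t : V (rV_cons (t, x)) * P (rV_cons (t, x)) = W x * pd ord0 G (rV_cons (t, x)).
    by rewrite VP pG rtail_cons; ring.
  have ix x : leb1.-integrable setT (EFin \o (fun t => pd ord0 G (rV_cons (t, x)))).
    by have [M [_ c2 _ h2]] := slice_integrable1 x tG; exact: csupp_integrable1 c2 h2.
  rewrite Rint_rVS_swap//.
    rewrite -[RHS](@Rint0 R n); apply: eq_Rintegral => x _.
    under eq_Rintegral do rewrite E.
    by rewrite RintegralZl// (Rint_slice_pd0 x tG) mulr0.
  move=> x; rewrite (_ : EFin \o _ = (fun t => (W x)%:E * (EFin \o (fun t => pd ord0 G (rV_cons (t, x)))) t)%E).
    exact: integrableZl.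
  by apply/funext => t /=; rewrite E EFinM.
rewrite add0r.
have EL x t : V (rV_cons (t, x)) * L (rV_cons (t, x)) =
  expR (k * t) * (W x * (laplacian (fun x => psi (rV_cons (t, x))) x + k ^+ 2 * psi (rV_cons (t, x)))).
  rewrite VL rV_cons0 rtail_cons /L laplacianE mulrA; congr (_ * (_ + _)).
  by apply: eq_bigr => i _; rewrite pd_slice// pd_slice//; exact: cinf_pd.
have iT t : L1 (fun x => W x * (laplacian (fun x => psi (rV_cons (t, x))) x + k ^+ 2 * psi (rV_cons (t, x)))).
  have ts := tst_slice t tp.
  have tq := tstD (tst_laplacian ts) (tstZ (k ^+ 2) ts).
  by have [B _ hB] := tst_bounded tq; exact: (L1_mul iW (tst_measurable tq) hB).
rewrite Rint_rVS//; last first.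
  by move=> t; under eq_fun do rewrite EL; exact: L1Z.
rewrite (_ : (fun t => _) = fun=> 0); first by rewrite /Rintegral integral0.
apply/funext => t; under eq_Rintegral do rewrite EL.
rewrite RintZ// wW ?mulr0//.
by apply: tst_weaken (tst_slice t tp) => x [_]; rewrite rtail_cons.
Qed.

(** The extension by one variable has a smooth representative [U], and undoing the exponential on
    one slice gives the representative of [W]. The slice must meet the exceptional set of [U] in a
    null set. *)
Lemma helm_weyl (A : set 'rV[R]_n) k W p (r : R) : 0 < r -> L1 W -> weak_sol A (k ^+ 2) W -> cube p (r + r) `<=` A ->
  exists V, [/\ cinf V, csol (cube p r) (k ^+ 2) V & {ae leb n, forall x, cube p r x -> W x = V x}].
Proof.
move=> r0 iW wW pA.
have [iV wV] := weak_sol_expext (r + r) iW wW.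
set V := fun z => _ in iV wV; set A' := [set z | _] in wV.
have pA' : cube (rV_cons (0, p)) (r + r) `<=` A'.
  move=> z pz; split; last exact/pA/cube_tail/pz.
  by have := pz ord0; rewrite rV_cons0 subr0.
have [U cU [N [mN N0 NU]]] := weyl r0 iV wV pA'.
(* Otherwise every slice of [N] with |t| < r would have positive measure, and by Fubini so would
   [N]. *)
have [t [tr Nt]] : exists t : R, `|t| < r /\ leb n [set x | N (rV_cons (t, x))] = 0%E.
  apply: contrapT => hn.
  pose B := @rV_cons R n @^-1` N.
  have mB : measurable B by rewrite -[X in measurable X]setTI; exact: measurable_rV_cons.
  have mf : measurable_fun setT (fun t : R => leb n (xsection B t)) by exact: measurable_fun_xsection.
  have : (\int[leb1]_t `|leb n (xsection B t)| = 0)%E.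
    under eq_integral do rewrite gee0_abs//.
    by rewrite -[RHS]N0 lebesgue_rVSE.
  move=> /(ae_eq_integral_abs leb1 measurableT mf).1 [N1 [mN1 N10 hN1]].
  pose J : set R := `]- r, r[%classic.
  have sub : J `<=` N1.
    move=> t; rewrite /J /= in_itv/= -ltr_norml => tr; apply: hN1 => /= /(_ I) h.
    apply: hn; exists t; split => //; rewrite -h; congr (leb n _).
    by apply/seteqP; split => x; rewrite /xsection /= inE.
  have : (leb1 J <= leb1 N1)%E by apply: le_measure; rewrite ?inE//; exact: measurable_itv.
  rewrite N10 /J lebesgue_measure_itv/= lte_fin gtrN// -EFinD lee_fin leNgt opprK.
  by rewrite addr_gt0.
have mNt : measurable [set x | N (rV_cons (t, x))].
  have m : measurable_fun setT (fun x : 'rV[R]_n => rV_cons (t, x)).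
    by apply: (measurableT_comp (@measurable_rV_cons R n)); exact: measurable_pair1.
  by rewrite -[X in measurable X]setTI; exact: m.
pose X x := expR (- (k * t)) * U (rV_cons (t, x)).
have cX : cinf X by apply: smoothZ; exact: cinf_slice.
have hX : {ae leb n, forall x, cube p r x -> W x = X x}.
  exists [set x | N (rV_cons (t, x))]; split => // x hx; apply: NU => /= h; apply: hx => px.
  have cx : cube (rV_cons (0, p)) r (rV_cons (t, x)).
    move=> j; case: (unliftP ord0 j) => [i ->|->]; first by rewrite !rV_consS; exact: px.
    by rewrite !rV_cons0 subr0.
  rewrite /X -(h cx) /V rV_cons0 rtail_cons indicE mem_set; last first.
    by rewrite /= in_itv/= -ltr_norml (lt_trans tr)// ltrDl.
  by rewrite mul1r mulrA -expRD addNr expR0 mul1r.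
exists X; split => //; apply: weak_csol => //; first exact: open_cube.
apply: (weak_sol_ae iW cX hX) => psi tp; apply: wW; apply: tst_weaken tp.
by apply: subset_trans pA => x px i; rewrite (lt_trans (px i))// ltrDl.
Qed.

End fubini_slices.

(** * The corner *)

Section complex_numbers.
Context {R : realType}.
Implicit Types (x y : R[i]) (a b : R).
Notation Re := complex.Re.
Notation Im := complex.Im.

Lemma complex_ext x y : Re x = Re y -> Im x = Im y -> x = y.
Proof. by case: x => a b; case: y => c d /= -> ->. Qed.

Lemma cReM x y : Re (x * y) = Re x * Re y - Im x * Im y.
Proof. by case: x => a b; case: y. Qed.

Lemma cImM x y : Im (x * y) = Re x * Im y + Im x * Re y.
Proof. by case: x => a b; case: y. Qed.

Lemma cReD x y : Re (x + y) = Re x + Re y.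
Proof. by case: x => a b; case: y. Qed.

Lemma cImD x y : Im (x + y) = Im x + Im y.
Proof. by case: x => a b; case: y. Qed.

Lemma cReN x : Re (- x) = - Re x. Proof. by case: x. Qed.
Lemma cImN x : Im (- x) = - Im x. Proof. by case: x. Qed.

Definition reim := (cReM, cImM, cReD, cImD, cReN, cImN).

Lemma cRe_sum (I : Type) (r : seq I) (F : I -> R[i]) : Re (\sum_(i <- r) F i) = \sum_(i <- r) Re (F i).
Proof. by elim: r => [|i r IH]; rewrite ?big_nil// !big_cons cReD IH. Qed.

Lemma cIm_sum (I : Type) (r : seq I) (F : I -> R[i]) : Im (\sum_(i <- r) F i) = \sum_(i <- r) Im (F i).
Proof. by elim: r => [|i r IH]; rewrite ?big_nil// !big_cons cImD IH. Qed.

(** A norm with values in [R], where the norm of [R[i]] is itself a complex number; it is equivalent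
    to the modulus, hence as good for orders of magnitude. *)
Definition cn x : R := `|Re x| + `|Im x|.

Lemma cn_ge0 x : 0 <= cn x. Proof. by rewrite addr_ge0. Qed.

Lemma cnD x y : cn (x + y) <= cn x + cn y.
Proof.
rewrite /cn !reim; have := ler_normD (Re x) (Re y); have := ler_normD (Im x) (Im y); lra.
Qed.

Lemma cnN x : cn (- x) = cn x. Proof. by rewrite /cn !reim !normrN. Qed.

Lemma cnM x y : cn (x * y) <= cn x * cn y.
Proof.
rewrite /cn !reim; have := ler_normB (Re x * Re y) (Im x * Im y).
have := ler_normD (Re x * Im y) (Im x * Re y); rewrite !normrM; lra.
Qed.

Lemma cn_real a : cn a%:C = `|a|. Proof. by rewrite /cn /= normr0 addr0. Qed.

Lemma cn_eq0 x : cn x = 0 -> x = 0.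
Proof.
move=> h; have := normr_ge0 (Re x); have := normr_ge0 (Im x); move: h; rewrite /cn => h1 h2 h3.
have : `|Re x| = 0 by lra. have : `|Im x| = 0 by lra.
by move=> /normr0_eq0 i0 /normr0_eq0 r0; apply: complex_ext.
Qed.

Definition bigO (s : nat) (g : R -> R[i]) := exists C : R, forall t, 1 <= t -> cn (g t) <= C * t ^- s.

Lemma tn_gt0 (t : R) s : 1 <= t -> 0 < t ^- s.
Proof. by move=> t1; rewrite invr_gt0 exprn_gt0// (lt_le_trans ltr01). Qed.

Lemma bigO_C s g : bigO s g -> exists2 C : R, 0 <= C & forall t, 1 <= t -> cn (g t) <= C * t ^- s.
Proof.
move=> [C hC]; exists `|C| => // t t1; apply: le_trans (hC t t1) _.
by rewrite ler_wpM2r ?ler_norm// ltW// tn_gt0.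
Qed.

Lemma bigO_ext s g h : (forall t, 1 <= t -> g t = h t) -> bigO s g -> bigO s h.
Proof. by move=> gh [C hC]; exists C => t t1; rewrite -gh//; exact: hC. Qed.

Lemma bigO_mono s s' g : (s' <= s)%N -> bigO s g -> bigO s' g.
Proof.
move=> ss /bigO_C[C C0 hC]; exists C => t t1; apply: le_trans (hC t t1) _.
have t0 : 0 < t := lt_le_trans ltr01 t1.
by rewrite ler_wpM2l// lef_pV2 ?posrE ?exprn_gt0// ler_weXn2l.
Qed.

Lemma bigO_D s g h : bigO s g -> bigO s h -> bigO s (fun t => g t + h t).
Proof.
move=> [C hC] [D hD]; exists (C + D) => t t1; rewrite mulrDl.
by rewrite (le_trans (cnD _ _))// lerD ?hC ?hD.
Qed.

Lemma bigO_M s r g h : bigO s g -> bigO r h -> bigO (s + r) (fun t => g t * h t).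
Proof.
move=> /bigO_C[C C0 hC] /bigO_C[D D0 hD]; exists (C * D) => t t1.
rewrite (le_trans (cnM _ _))// exprD invfM mulrACA.
by rewrite ler_pM ?cn_ge0 ?hC ?hD.
Qed.

Lemma bigO_cst (x : R[i]) : bigO 0 (fun=> x).
Proof. by exists (cn x) => t _; rewrite expr0 invr1 mulr1. Qed.

Lemma bigO_Z s (x : R[i]) g : bigO s g -> bigO s (fun t => x * g t).
Proof. by move=> h; have := bigO_M (bigO_cst x) h. Qed.

Lemma bigO_N s g : bigO s g -> bigO s (fun t => - g t).
Proof. by move=> [C hC]; exists C => t t1; rewrite cnN; exact: hC. Qed.

Lemma bigO_B s g h : bigO s g -> bigO s h -> bigO s (fun t => g t - h t).
Proof. by move=> hg hh; apply: bigO_D => //; exact: bigO_N. Qed.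

Lemma bigO_pow s : bigO s (fun t => (t ^- s)%:C).
Proof.
by exists 1 => t t1; rewrite mul1r cn_real ger0_norm// ltW// tn_gt0.
Qed.

Lemma bigO_t s g : bigO s.+1 g -> bigO s (fun t => t%:C * g t).
Proof.
move=> /bigO_C[C C0 hC]; exists C => t t1; have t0 : 0 < t := lt_le_trans ltr01 t1.
rewrite (le_trans (cnM _ _))// cn_real gtr0_norm//.
rewrite -ler_pdivlMl// mulrCA -invfM mulrC [t * _]mulrC -exprSr mulrC; exact: hC.
Qed.

Lemma bigO_tV s g : bigO s (fun t => t%:C * g t) -> bigO s.+1 g.
Proof.
move=> h; have := bigO_M (@bigO_pow 1) h; apply: bigO_ext => t t1.
have t0 : t != 0 by rewrite gt_eqF// (lt_le_trans ltr01).
rewrite mulrA expr1; apply: complex_ext; rewrite !reim /= !mulr0 !mul0r ?subr0 ?addr0 ?add0r; by field.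
Qed.

(** Extracts a leading coefficient: after multiplication by t^s, put t = 1/e and let e tend to 0. *)
Lemma bigO_lead s (x : R[i]) : bigO s.+1 (fun t => (t ^- s)%:C * x) -> x = 0.
Proof.
move=> /bigO_C[C C0 hC]; apply: cn_eq0; apply: (@le_eps0 R _ C) => [|e /andP[e0 e1]]; first exact: cn_ge0.
have t1 : 1 <= e^-1 by rewrite invf_ge1// ltW.
have := hC _ t1; rewrite exprVn invrK.
have -> : cn ((e ^+ s)%:C * x) = e ^+ s * cn x.
  by rewrite /cn !reim /= !mul0r subr0 addr0 !normrM ger0_norm ?exprn_ge0 ?(ltW e0)// mulrDr.
by rewrite exprVn invrK exprSr mulrA [C * _]mulrC -mulrA ler_pM2l// exprn_gt0.
Qed.

End complex_numbers.

(** * Integration by parts over the orthant *)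

Section orthant.
Context {R : realType}.
Notation leb n := (lebesgue_rV n : {measure set 'rV[R]_n -> \bar R}).
Notation leb1 := (@lebesgue_measure R).
Notation Rint F := (Rintegral (leb _) setT F).

Definition pos n (z : 'rV[R]_n) : R := \1_[set z : 'rV[R]_n | forall i, 0 < z ord0 i] z.

Lemma measurable_pos n : measurable_fun setT (@pos n).
Proof.
apply: measurable_indic; apply: (measurable_coords (P := fun=> [set t : R | 0 < t])) => _.
rewrite (_ : [set t | _] = `]0, +oo[%classic); first exact: measurable_itv.
by apply/seteqP; split => t; rewrite /= in_itv/= andbT.
Qed.

Lemma pos01 n z : `|@pos n z| <= 1.
Proof. by rewrite /pos indicE; case: (_ \in _); rewrite ?normr1 ?normr0. Qed.

Lemma posS n t (x : 'rV[R]_n) : pos (rV_cons (t, x)) = (0 < t)%R%:R * pos x.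
Proof.
rewrite /pos !indicE; case: (ltP 0 t) => t0; last first.
  by rewrite mul0r memNset// => /(_ ord0); rewrite /= rV_cons0 ltNge t0.
rewrite mul1r; case: (asboolP (forall i, 0 < x ord0 i)) => hx.
  by rewrite !mem_set// => j; case: (unliftP ord0 j) => [i ->|->]; rewrite ?rV_cons0// rV_consS.
rewrite !memNset// => h; apply: hx => i; have := h (lift ord0 i); by rewrite rV_consS.
Qed.

Lemma pos_L1 n (D : set 'rV[R]_n) F : tst D F -> L1 (fun z => pos z * F z).
Proof.
move=> tF; have := @L1_mul _ _ _ (@pos n) 1 (tst_L1 tF) (@measurable_pos n) (@pos01 n).
by congr L1; apply/funext => z; rewrite mulrC.
Qed.

(** The indicator of the orthant factors as a half-line indicator in the first coordinate and [pos]
    of the others, so the fundamental theorem of calculus applies in the inner integral. *)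
Lemma Rint_pos_pd0 n (D : set 'rV[R]_n.+1) G : tst D G ->
  Rint (fun z => pos z * pd ord0 G z) = - Rint (fun x => pos x * G (rV_cons (0, x))).
Proof.
move=> tG; have tP := tst_pd ord0 tG.
have E x t : pos (rV_cons (t, x)) * pd ord0 G (rV_cons (t, x)) = pos x * ((0 < t)%R%:R * pd ord0 G (rV_cons (t, x))).
  by rewrite posS mulrCA mulrA.
have ix x : leb1.-integrable setT (EFin \o (fun t : R => (0 < t)%R%:R * pd ord0 G (rV_cons (t, x)))).
  have [M [_ c2 _ h2]] := slice_integrable1 x tG.
  have ii := csupp_integrable1 c2 h2.
  have mI : measurable_fun setT (fun t : R => (0 < t)%R%:R : R).
    rewrite (_ : (fun t => _) = \1_(`]0, +oo[%classic : set R)); first by apply: measurable_indic; exact: measurable_itv.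
    by apply/funext => t; rewrite indicE mem_setE in_itv/= andbT.
  have /integrableP[/measurable_EFinP mg _] := ii.
  apply: (le_integrable measurableT _ _ ii); first by apply/measurable_EFinP; exact: measurable_funM.
  move=> t _; rewrite lee_fin normrM; case: (0 < t); rewrite ?normr1 ?mul1r// normr0 mul0r.
  exact: normr_ge0.
rewrite Rint_rVS_swap; [|exact: pos_L1 tP|].
  rewrite -RintN; last exact: pos_L1 (tst_slice 0 tG).
  apply: eq_Rintegral => x _; under eq_Rintegral do rewrite E.
  by rewrite RintegralZl// (Rint_slice_half x tG) mulrN.
move=> x; pose H (t : R) : R := (0 < t)%R%:R * pd ord0 G (rV_cons (t, x)).
rewrite (_ : EFin \o _ = (fun t => (pos x)%:E * (EFin \o H) t)%E).
  by apply: integrableZl => //; exact: (ix x).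
by apply/funext => t /=; rewrite E EFinM.
Qed.

Definition oint n (E1 E2 F : 'rV[R]_n -> R) : R[i] :=
  (Rint (fun z => pos z * (F z * E1 z)) +i* Rint (fun z => pos z * (F z * E2 z))).

(** For E = E1 + i E2 the two assumptions read d_0 E = - (a + i b) E; integrating the derivative of
    F E over the orthant leaves the face z_0 = 0 as boundary. *)
Lemma oint_ibp n (D : set 'rV[R]_n.+1) E1 E2 F a b : cinf E1 -> cinf E2 -> tst D F ->
  pd ord0 E1 = (fun z => - (a * E1 z - b * E2 z)) -> pd ord0 E2 = (fun z => - (a * E2 z + b * E1 z)) ->
  (a +i* b) * oint E1 E2 F =
  oint (fun x => E1 (rV_cons (0, x))) (fun x => E2 (rV_cons (0, x))) (fun x => F (rV_cons (0, x))) + oint E1 E2 (pd ord0 F).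
Proof.
move=> c1 c2 tF p1 p2; have cF := tst_cinf tF; have tP := tst_pd ord0 tF.
have i1 := pos_L1 (tst_mul tF c1); have i2 := pos_L1 (tst_mul tF c2).
have j1 := pos_L1 (tst_mul tP c1); have j2 := pos_L1 (tst_mul tP c2).
have h1 := Rint_pos_pd0 (tst_mul tF c1); have h2 := Rint_pos_pd0 (tst_mul tF c2).
rewrite (_ : Rint (fun z => pos z * pd ord0 (fun z => F z * E1 z) z) =
   Rint (fun z => pos z * (pd ord0 F z * E1 z)) - (a * Rint (fun z => pos z * (F z * E1 z)) - b * Rint (fun z => pos z * (F z * E2 z)))) in h1; last first.
  rewrite -!RintZ// -RintB; [|exact: L1Z|exact: L1Z]. rewrite -RintB//; last by apply: L1B; exact: L1Z.
  by apply: eq_Rintegral => z _; rewrite pdM// p1; ring.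
rewrite (_ : Rint (fun z => pos z * pd ord0 (fun z => F z * E2 z) z) =
   Rint (fun z => pos z * (pd ord0 F z * E2 z)) - (a * Rint (fun z => pos z * (F z * E2 z)) + b * Rint (fun z => pos z * (F z * E1 z)))) in h2; last first.
  rewrite -!RintZ// -RintD; [|exact: L1Z|exact: L1Z]. rewrite -RintB//; last by apply: L1D; exact: L1Z.
  by apply: eq_Rintegral => z _; rewrite pdM// p2; ring.
by apply: complex_ext; rewrite !reim /=; lra.
Qed.

Lemma oint_bound n (D : set 'rV[R]_n) F : tst D F -> exists2 C : R, 0 <= C & forall E1 E2 (M : R), cinf E1 -> cinf E2 ->
  0 <= M -> (forall z : 'rV[R]_n, (forall i, 0 < z ord0 i) -> `|E1 z| <= M /\ `|E2 z| <= M) -> cn (oint E1 E2 F) <= C * M.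
Proof.
move=> tF; have iF := L1_norm (tst_L1 tF).
exists (2 * Rint (fun z => `|F z|)); first by rewrite mulr_ge0// Rintegral_ge0.
move=> E1 E2 M c1 c2 M0 h.
have key E : cinf E -> (forall z : 'rV[R]_n, (forall i, 0 < z ord0 i) -> `|E z| <= M) ->
   `|Rint (fun z => pos z * (F z * E z))| <= M * Rint (fun z => `|F z|).
  move=> cE hE; have iE := pos_L1 (tst_mul tF cE).
  apply: le_trans (norm_Rint iE) _; rewrite -RintZ//; apply: le_Rint; [exact: L1_norm|exact: L1Z|].
  move=> z; rewrite /pos indicE; case: (asboolP (forall i, 0 < z ord0 i)) => hz; last first.
    by rewrite memNset// mul0r normr0 mulr_ge0.
  by rewrite mem_set// mul1r normrM mulrC ler_wpM2r// hE.
have := key E1 c1 (fun z hz => (h z hz).1); have := key E2 c2 (fun z hz => (h z hz).2).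
rewrite /cn /=; lra.
Qed.

End orthant.

(** * The exponential adapted to the edge *)

Section corner_exponential.
Context {R : realType} {n : nat}.
Notation leb n := (lebesgue_rV n : {measure set 'rV[R]_n -> \bar R}).
Notation Rint F := (Rintegral (leb _) setT F).
Notation i0 := (ord0 : 'I_n.+2).
Notation i1 := (lift ord0 ord0 : 'I_n.+2).
Implicit Types (F G f : 'rV[R]_n.+2 -> R) (g : 'rV[R]_n.+1 -> R) (z : 'rV[R]_n.+2) (s t : R) (l : 'I_n.+2).

Definition lin (a b : R) z : R := a * z ord0 i0 + b * z ord0 i1.

Lemma lin_cinf a b : cinf (lin a b).
Proof. by apply: smoothD; apply: smoothZ; exact: smooth_coord. Qed.

Lemma pd_lin a b l : pd l (lin a b) = fun=> a * (l == i0)%:R + b * (l == i1)%:R.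
Proof.
rewrite pdD; [|by apply: smoothZ; exact: smooth_coord|by apply: smoothZ; exact: smooth_coord].
by apply/funext => z; rewrite !pdZ ?pd_coord//; exact: smooth_coord.
Qed.

(* The real and imaginary parts of exp (- l1 z1 - l2 z2), where l1 = t (1 + i s)
   and l2 = t (1 - i s); for s = 1 and s = -1 this is a harmonic function. *)
Definition E1 s t z : R := expR (lin (- t) (- t) z) * cos (lin (s * t) (- (s * t)) z).
Definition E2 s t z : R := - (expR (lin (- t) (- t) z) * sin (lin (s * t) (- (s * t)) z)).

Lemma explin_cinf a b : cinf (fun z => expR (lin a b z)).
Proof. by apply: smooth_comp; [exact: smooth1_expR|exact: lin_cinf]. Qed.

Lemma coslin_cinf a b : cinf (fun z => cos (lin a b z)).
Proof. by apply: smooth_comp; [exact: (@smooth1_cos_sin R).1|exact: lin_cinf]. Qed.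

Lemma sinlin_cinf a b : cinf (fun z => sin (lin a b z)).
Proof. by apply: smooth_comp; [exact: (@smooth1_cos_sin R).2|exact: lin_cinf]. Qed.

Lemma E1_cinf s t : cinf (E1 s t).
Proof. by apply: smoothM; [exact: explin_cinf|exact: coslin_cinf]. Qed.

Lemma E2_cinf s t : cinf (E2 s t).
Proof. by apply: smoothN; apply: smoothM; [exact: explin_cinf|exact: sinlin_cinf]. Qed.

Lemma pd_E1 s t l : pd l (E1 s t) = fun z =>
  - (t * ((l == i0)%:R + (l == i1)%:R) * E1 s t z - s * t * ((l == i0)%:R - (l == i1)%:R) * E2 s t z).
Proof.
rewrite pdM; [|exact: explin_cinf|exact: coslin_cinf].
rewrite (pd_comp l (@is_derive_expR R) (lin_cinf _ _)) (pd_comp l (@is_derive_cos R) (lin_cinf _ _)) !pd_lin.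
by apply/funext => z; rewrite /E1 /E2; ring.
Qed.

Lemma pd_E2 s t l : pd l (E2 s t) = fun z =>
  - (t * ((l == i0)%:R + (l == i1)%:R) * E2 s t z + s * t * ((l == i0)%:R - (l == i1)%:R) * E1 s t z).
Proof.
rewrite pdN; last by apply: smoothM; [exact: explin_cinf|exact: sinlin_cinf].
rewrite pdM; [|exact: explin_cinf|exact: sinlin_cinf].
rewrite (pd_comp l (@is_derive_expR R) (lin_cinf _ _)) (pd_comp l (@is_derive_sin R) (lin_cinf _ _)) !pd_lin.
by apply/funext => z; rewrite /E1 /E2; ring.
Qed.

Lemma eq_i0 : ((i0 == i0) = true) * ((i0 == i1) = false) * ((i1 == i0) = false) * ((i1 == i1) = true).
Proof. by []. Qed.

Lemma eq_ll (l : 'I_n) : ((lift ord0 (lift ord0 l) == i0) = false) * ((lift ord0 (lift ord0 l) == i1) = false).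
Proof. by rewrite (inj_eq lift_inj). Qed.

(** For s^2 = 1 the function E1 + i E2 is harmonic, so only the Laplacian of [f] and twice the
    product of the gradients survive: the term 2 t^2 (1 - s^2) f drops out and what remains is at
    most linear in t. *)
Lemma laplacian_mulE f s t : s ^+ 2 = 1 -> cinf f ->
  (laplacian (fun z => f z * E1 s t z) = fun z => laplacian f z * E1 s t z
    - 2 * (t * E1 s t z - s * t * E2 s t z) * pd i0 f z - 2 * (t * E1 s t z + s * t * E2 s t z) * pd i1 f z) /\
  (laplacian (fun z => f z * E2 s t z) = fun z => laplacian f z * E2 s t z
    - 2 * (t * E2 s t z + s * t * E1 s t z) * pd i0 f z - 2 * (t * E2 s t z - s * t * E1 s t z) * pd i1 f z).
Proof.
move=> s2 cf; have c1 := E1_cinf s t; have c2 := E2_cinf s t.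
have key E l : cinf E -> pd l (pd l (fun z => f z * E z)) =
    fun z => pd l (pd l f) z * E z + 2 * (pd l f z * pd l E z) + f z * pd l (pd l E) z.
  move=> cE; have cl := cinf_pd l cf; have cEl := cinf_pd l cE.
  rewrite pdM// pdD; [|exact: smoothM|exact: smoothM].
  by rewrite !pdM//; apply/funext => z; ring.
have dd1 l z : pd l (pd l (E1 s t)) z = ((t * ((l == i0)%:R + (l == i1)%:R)) ^+ 2 - (s * t * ((l == i0)%:R - (l == i1)%:R)) ^+ 2) * E1 s t z
    - 2 * (t * ((l == i0)%:R + (l == i1)%:R)) * (s * t * ((l == i0)%:R - (l == i1)%:R)) * E2 s t z.
  rewrite [pd l (E1 s t)]pd_E1 pdN; last by apply: smoothB; exact: smoothZ.
  rewrite pdB; [|exact: smoothZ|exact: smoothZ].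
  by rewrite !pdZ// pd_E1 pd_E2; ring.
have dd2 l z : pd l (pd l (E2 s t)) z = ((t * ((l == i0)%:R + (l == i1)%:R)) ^+ 2 - (s * t * ((l == i0)%:R - (l == i1)%:R)) ^+ 2) * E2 s t z
    + 2 * (t * ((l == i0)%:R + (l == i1)%:R)) * (s * t * ((l == i0)%:R - (l == i1)%:R)) * E1 s t z.
  rewrite [pd l (E2 s t)]pd_E2 pdN; last by apply: smoothD; exact: smoothZ.
  rewrite pdD; [|exact: smoothZ|exact: smoothZ].
  by rewrite !pdZ// pd_E1 pd_E2; ring.
have S (X : 'I_n.+2 -> R) : \sum_l X l = X i0 + X i1 + \sum_l X (lift ord0 (lift ord0 l)).
  by rewrite big_ord_recl big_ord_recl addrA.
have f0 : (false%:R = 0 :> R) by []. have f1 : (true%:R = 1 :> R) by [].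
split; apply/funext => z; rewrite laplacianE (laplacianE f) !S.
  rewrite (eq_bigr (fun l : 'I_n => pd (lift ord0 (lift ord0 l)) (pd (lift ord0 (lift ord0 l)) f) z * E1 s t z)); last first.
    by move=> l _; rewrite key// dd1 pd_E1 !eq_ll f0; ring.
  rewrite -mulr_suml !key// !dd1 !pd_E1 !eq_i0 /=.
  rewrite f0 f1.
  apply/eqP; rewrite -subr_eq0; apply/eqP.
  transitivity (2 * f z * t ^+ 2 * (1 - s ^+ 2) * E1 s t z); first by ring.
  by rewrite s2; ring.
rewrite (eq_bigr (fun l : 'I_n => pd (lift ord0 (lift ord0 l)) (pd (lift ord0 (lift ord0 l)) f) z * E2 s t z)); last first.
  by move=> l _; rewrite key// dd2 pd_E2 !eq_ll f0; ring.
rewrite -mulr_suml !key// !dd2 !pd_E2 !eq_i0 /=.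
rewrite f0 f1.
apply/eqP; rewrite -subr_eq0; apply/eqP.
transitivity (2 * f z * t ^+ 2 * (1 - s ^+ 2) * E2 s t z); first by ring.
by rewrite s2; ring.
Qed.

(** A single term of the exponential series is enough: (t z_0)^m <= m! exp (t z_0). *)
Lemma E_bound s t z m : 1 <= t -> 0 <= z ord0 i0 -> 0 <= z ord0 i1 ->
  `|z ord0 i0 ^+ m * E1 s t z| <= m`!%:R * t ^- m /\ `|z ord0 i0 ^+ m * E2 s t z| <= m`!%:R * t ^- m.
Proof.
move=> t1 z0 z1; have t0 : 0 < t := lt_le_trans ltr01 t1.
have key : z ord0 i0 ^+ m * expR (lin (- t) (- t) z) <= m`!%:R * t ^- m.
  have tz : 0 <= t * z ord0 i0 by rewrite mulr_ge0// ltW.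
  have h : (t * z ord0 i0) ^+ m <= m`!%:R * expR (t * z ord0 i0).
    case: m => [|m]; first by rewrite expr0 fact0 mul1r -expR0 ler_expR.
    have h := expR_ge1Dxn m tz; rewrite -ler_pdivrMl ?ltr0n ?fact_gt0//.
    by rewrite mulrC; apply: le_trans h; rewrite lerDr.
  rewrite ler_pdivlMr ?exprn_gt0// mulrAC -exprMn [_ * t]mulrC.
  apply: (@le_trans _ _ (m`!%:R * expR (t * z ord0 i0) * expR (lin (- t) (- t) z))).
    by rewrite ler_wpM2r// expR_ge0.
  rewrite -mulrA -expRD ler_piMr// -expR0 ler_expR /lin.
  by rewrite mulNr addrA subrr add0r mulNr oppr_le0 mulr_ge0// ltW.
have p : 0 <= z ord0 i0 ^+ m * expR (lin (- t) (- t) z) by rewrite mulr_ge0 ?exprn_ge0 ?expR_ge0.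
split.
  rewrite /E1 mulrA normrM (ger0_norm p) (le_trans _ key)// ler_piMr//.
  by rewrite ler_norml cos_geN1 cos_le1.
rewrite /E2 mulrN normrN mulrA normrM (ger0_norm p) (le_trans _ key)// ler_piMr//.
by rewrite ler_norml sin_geN1 sin_le1.
Qed.

Lemma E_le1 s t z : 1 <= t -> 0 <= z ord0 i0 -> 0 <= z ord0 i1 -> `|E1 s t z| <= 1 /\ `|E2 s t z| <= 1.
Proof.
move=> t1 z0 z1; have := @E_bound s t z 0%N t1 z0 z1; rewrite expr0 !mul1r => -[h1 h2].
by split; [apply: le_trans h1 _|apply: le_trans h2 _]; rewrite expr0 invr1.
Qed.

End corner_exponential.

(** * Expansion of orthant integrals in powers of 1/t *)

Section lead.
Context {R : realType} {n : nat}.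
Notation leb n := (lebesgue_rV n : {measure set 'rV[R]_n -> \bar R}).
Notation Rint F := (Rintegral (leb _) setT F).
Notation i0 := (ord0 : 'I_n.+2).
Notation i1 := (lift ord0 ord0 : 'I_n.+2).
Implicit Types (F G f : 'rV[R]_n.+2 -> R) (g : 'rV[R]_n.+1 -> R) (z : 'rV[R]_n.+2) (s t : R) (l : 'I_n.+2).

Notation e1 s t := (fun x : 'rV[R]_n.+1 => E1 s t (rV_cons (0, x))).
Notation e2 s t := (fun x : 'rV[R]_n.+1 => E2 s t (rV_cons (0, x))).

(** [Bint], [Aint] and [Eint] live on the orthant, on its face z_0 = 0 and on the edge z_0 = z_1 =
    0; each integration by parts passes from one to the next. On the edge the exponential is 1. *)
Definition Bint s t F := oint (E1 s t) (E2 s t) F.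
Definition Aint s t g := oint (e1 s t) (e2 s t) g.
Definition Eint (h : 'rV[R]_n -> R) := Rint (fun y => pos y * h y).
Definition edge (y : 'rV[R]_n) : 'rV[R]_n.+2 := rV_cons (0, rV_cons (0, y)).
(** With l1 = t (1 + i s) and l2 = t (1 - i s), these are t / l1 and t / l2, the coefficients that
    integration by parts produces. *)
Definition c1 s : R[i] := (1 +i* s)^-1.
Definition c2 s : R[i] := (1 +i* - s)^-1.

Lemma cxM s : (1 +i* s != 0 :> R[i]) /\ (1 +i* - s != 0 :> R[i]).
Proof. by split; apply/eqP => -[] /eqP; rewrite oner_eq0. Qed.

Lemma lamE s t : (t +i* (s * t) = t%:C * (1 +i* s)) /\ (t +i* - (s * t) = t%:C * (1 +i* - s)).
Proof. by split; apply: complex_ext; rewrite !reim /=; ring. Qed.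

Lemma Bint_ibp (D : set 'rV[R]_n.+2) s t F : tst D F ->
  t%:C * Bint s t F = c1 s * (Aint s t (fun x => F (rV_cons (0, x))) + Bint s t (pd i0 F)).
Proof.
move=> tF; have := oint_ibp (a := t) (b := s * t) (E1_cinf s t) (E2_cinf s t) tF.
rewrite !pd_E1 !pd_E2 !eq_i0 addr0 subr0 !mulr1 => /(_ erefl erefl).
rewrite (lamE s t).1 => E.
by rewrite /Bint /Aint -E -(mulrA t%:C) mulrCA /c1 mulKf// (cxM s).1.
Qed.

Lemma Aint_ibp (D : set 'rV[R]_n.+1) s t g : tst D g ->
  t%:C * Aint s t g = c2 s * ((Eint (fun y => g (rV_cons (0, y))))%:C + Aint s t (pd ord0 g)).
Proof.
move=> tg; have cE1 := cinf_slice 0 (E1_cinf (n := n) s t); have cE2 := cinf_slice 0 (E2_cinf (n := n) s t).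
have := oint_ibp (a := t) (b := - (s * t)) cE1 cE2 tg.
rewrite !pd_slice; [|exact: E2_cinf|exact: E1_cinf].
rewrite pd_E1 pd_E2 !eq_i0 add0r sub0r !mulr1 !mulrN1 => /(_ erefl erefl).
rewrite (lamE s t).2 => E.
have -> : (Eint (fun y => g (rV_cons (0, y))))%:C = oint (fun x => E1 s t (rV_cons (0, rV_cons (0, x))))
    (fun x => E2 s t (rV_cons (0, rV_cons (0, x)))) (fun x => g (rV_cons (0, x))).
  have l0 a b x : lin a b (rV_cons (0, rV_cons (0, x)) : 'rV[R]_n.+2) = 0.
    by rewrite /lin rV_cons0 rV_consS rV_cons0 !mulr0 addr0.
  apply: complex_ext => /=.
    by apply: eq_Rintegral => y _; rewrite /E1 !l0 expR0 cos0 !mulr1.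
  rewrite -[LHS](@Rint0 R n); apply: eq_Rintegral => y _.
  by rewrite /E2 !l0 expR0 sin0 mulr0 oppr0 !mulr0.
by rewrite /Aint -E -(mulrA t%:C) mulrCA /c2 mulKf// (cxM s).2.
Qed.

Lemma Bint_O0 (D : set 'rV[R]_n.+2) s F : tst D F -> bigO 0 (fun t => Bint s t F).
Proof.
move=> tF; have [C C0 hC] := oint_bound tF; exists C => t t1; rewrite expr0 invr1.
apply: hC => //; [exact: E1_cinf|exact: E2_cinf|] => z hz.
exact: E_le1 t1 (ltW (hz i0)) (ltW (hz i1)).
Qed.

Lemma Aint_O0 (D : set 'rV[R]_n.+1) s g : tst D g -> bigO 0 (fun t => Aint s t g).
Proof.
move=> tF; have [C C0 hC] := oint_bound tF; exists C => t t1; rewrite expr0 invr1.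
apply: hC => //; [exact/cinf_slice/E1_cinf|exact/cinf_slice/E2_cinf|] => z hz.
by apply: E_le1; rewrite // ?rV_cons0// rV_consS; exact: ltW (hz ord0).
Qed.

Lemma Aint_O1 (D : set 'rV[R]_n.+1) s g : tst D g -> bigO 1 (fun t => Aint s t g).
Proof.
move=> tg; apply: bigO_tV.
apply: (@bigO_ext _ _ (fun t => c2 s * ((Eint (fun y => g (rV_cons (0, y))))%:C + Aint s t (pd ord0 g)))).
  by move=> t _; rewrite (Aint_ibp s t tg).
by apply: bigO_Z; apply: bigO_D; [exact: bigO_cst|exact: Aint_O0 (tst_pd ord0 tg)].
Qed.

(** An integration by parts in [z_0] gains a power of t as long as the face term is no larger; the
    latter is O(1/t) after one integration by parts in [z_1]. Hence two powers in all. *)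
Lemma Bint_O2 (D : set 'rV[R]_n.+2) s F : tst D F -> bigO 2 (fun t => Bint s t F).
Proof.
have step (k : nat) (G : 'rV[R]_n.+2 -> R) : tst D G -> (k <= 1)%N -> bigO k (fun t => Bint s t (pd i0 G)) -> bigO k.+1 (fun t => Bint s t G).
  move=> tG k1 h; apply: bigO_tV.
  apply: (@bigO_ext _ _ (fun t => c1 s * (Aint s t (fun x => G (rV_cons (0, x))) + Bint s t (pd i0 G)))).
    by move=> t _; rewrite (Bint_ibp s t tG).
  apply: bigO_Z; apply: bigO_D => //; apply: (bigO_mono k1); exact: Aint_O1 (tst_slice 0 tG).
move=> tF; have tP := tst_pd i0 tF; apply: (step 1%N F tF) => //.
by apply: (step 0%N _ tP) => //; exact: Bint_O0 (tst_pd i0 tP).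
Qed.

Lemma dpart_slice j F : cinf F ->
  dpart (nseq j ord0) (fun x => F (rV_cons (0, x))) = fun x : 'rV[R]_n.+1 => dpart (nseq j i1) F (rV_cons (0, x)).
Proof.
move=> cF; elim: j => [//|j IH]; rewrite [nseq _ _]/= dpart_cons IH pd_slice; last exact: cinf_dpart.
by rewrite [nseq _ i1]/= dpart_cons.
Qed.

Lemma tC_pow k t : 1 <= t -> t%:C * (t ^- k.+1)%:C = (t ^- k)%:C.
Proof.
move=> t1; have t0 : t != 0 by rewrite gt_eqF// (lt_le_trans ltr01).
apply: complex_ext; rewrite !reim /= ?mulr0 ?mul0r ?subr0 ?addr0//.
by rewrite exprS invfM mulrA mulfV// mul1r.
Qed.

(** Iterates t A(g) = c2 (edge value of g + A(d g)): as long as the edge values vanish each round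
    gains a power of t, and the edge value of order M is the leading coefficient. *)
Lemma Aint_lead M (D : set 'rV[R]_n.+1) s g : tst D g ->
  (forall j, (j < M)%N -> Eint (fun y => dpart (nseq j ord0) g (rV_cons (0, y))) = 0) ->
  bigO M.+2 (fun t => Aint s t g - (t ^- M.+1)%:C * (c2 s ^+ M.+1 * (Eint (fun y => dpart (nseq M ord0) g (rV_cons (0, y))))%:C)).
Proof.
elim: M D g => [|M IH] D g tg h; apply: bigO_tV.
  apply: (@bigO_ext _ _ (fun t => c2 s * Aint s t (pd ord0 g))); last first.
    by apply: bigO_Z; exact: Aint_O1 (tst_pd ord0 tg).
  move=> t t1; rewrite [RHS]mulrBr (Aint_ibp s t tg) [in RHS](mulrA t%:C) (tC_pow _ t1) expr0 invr1 expr1; ring.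
have IHg := IH D (pd ord0 g) (tst_pd ord0 tg).
have E j : dpart (nseq j ord0) (pd ord0 g) = dpart (nseq j.+1 ord0) g.
  by rewrite -dpart_rcons; congr dpart; rewrite -cats1 -(nseqD j 1) addn1.
apply: (@bigO_ext _ _ _ _ _ (bigO_Z (c2 s) (IHg _))); last by move=> j jM; rewrite E h.
move=> t t1; rewrite [RHS]mulrBr (Aint_ibp s t tg) (h 0%N)// add0r [in RHS](mulrA t%:C) (tC_pow _ t1) E.
by rewrite (exprS (c2 s) M.+1); ring.
Qed.

(** The degree M Taylor part integrated over the quadrant against the exponential: z_0^i z_1^j / (i!
    j!) gives l1^-(i+1) l2^-(j+1), that is, t^-(M+2) times the weight in the sum when i + j = M. In
    [h j i] the order in [z_1] comes first. *)
Definition Tsum M s (h : nat -> nat -> R) : R[i] :=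
  \sum_(i < M.+1) c1 s ^+ i.+1 * c2 s ^+ (M - i).+1 * (h (M - i)%N i)%:C.

Definition Eder F j i := Eint (fun y => dpart (nseq j i1 ++ nseq i i0) F (edge y)).

Lemma Tsum0 s h : Tsum 0 s h = c1 s * (c2 s * (h 0%N 0%N)%:C).
Proof. by rewrite /Tsum big_ord_recl big_ord0 addr0 subn0 !expr1 mulrA. Qed.

Lemma TsumS M s h : Tsum M.+1 s h = c1 s * (c2 s ^+ M.+2 * (h M.+1 0%N)%:C) + c1 s * Tsum M s (fun j i => h j i.+1).
Proof.
rewrite /Tsum big_ord_recl subn0 expr1 mulrA; congr (_ + _).
by rewrite mulr_sumr; apply: eq_bigr => i _; rewrite lift0 subSS exprS !mulrA.
Qed.

(** Integrating by parts in [z_0] splits off the face term, expanded by [Aint_lead], and replaces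
    [F] by its [z_0] derivative, whose vanishing order is one less; [TsumS] is the matching
    recursion for the coefficient. *)
Lemma Bint_lead M (D : set 'rV[R]_n.+2) s F : tst D F ->
  (forall i j, (i + j < M)%N -> Eder F j i = 0) ->
  bigO M.+3 (fun t => Bint s t F - (t ^- M.+2)%:C * Tsum M s (Eder F)).
Proof.
have EA j G : cinf G -> Eint (fun y => dpart (nseq j ord0) (fun x => G (rV_cons (0, x))) (rV_cons (0, y))) = Eder G j 0.
  by move=> cG; rewrite dpart_slice// /Eder cats0.
elim: M D F => [|M IH] D F tF h; have cF := tst_cinf tF; have tS := tst_slice 0 tF; apply: bigO_tV.
  have hA : bigO 2 (fun t => Aint s t (fun x => F (rV_cons (0, x))) - (t ^- 1)%:C * (c2 s ^+ 1 * (Eder F 0 0)%:C)).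
    by rewrite -EA//; apply: (@Aint_lead 0%N _ s _ tS).
  apply: (@bigO_ext _ _ _ _ _ (bigO_D (bigO_Z (c1 s) hA) (bigO_Z (c1 s) (Bint_O2 s (tst_pd i0 tF))))).
  move=> t t1; rewrite [RHS]mulrBr (Bint_ibp s t tF) [in RHS](mulrA t%:C) (tC_pow _ t1) Tsum0 expr1; ring.
have E j i : Eder (pd i0 F) j i = Eder F j i.+1.
  rewrite /Eder; congr Eint; apply/funext => y; congr (_ _).
  by rewrite -dpart_rcons rcons_cat; congr (dpart (_ ++ _)); rewrite -cats1 -(nseqD i 1) addn1.
have hB : bigO M.+3 (fun t => Bint s t (pd i0 F) - (t ^- M.+2)%:C * Tsum M s (Eder (pd i0 F))).
  by apply: (IH D); [exact: tst_pd|move=> i j ij; rewrite E h// addSn].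
have hA : bigO M.+3 (fun t => Aint s t (fun x => F (rV_cons (0, x))) - (t ^- M.+2)%:C * (c2 s ^+ M.+2 * (Eder F M.+1 0)%:C)).
  by rewrite -EA//; apply: (Aint_lead s tS) => j jM; rewrite EA// h.
apply: (@bigO_ext _ _ _ _ _ (bigO_D (bigO_Z (c1 s) hA) (bigO_Z (c1 s) hB))).
move=> t t1; rewrite [RHS]mulrBr (Bint_ibp s t tF) [in RHS](mulrA t%:C) (tC_pow _ t1) TsumS.
have -> : Tsum M s (Eder (pd i0 F)) = Tsum M s (fun j i => Eder F j i.+1).
  by apply: eq_bigr => i _; rewrite E.
ring.
Qed.

End lead.

(** * The bootstrap *)

Section corner_orders.
Context {R : realType} {n : nat}.
Notation leb n := (lebesgue_rV n : {measure set 'rV[R]_n -> \bar R}).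
Notation Rint F := (Rintegral (leb _) setT F).
Notation i0 := (ord0 : 'I_n.+2).
Notation i1 := (lift ord0 ord0 : 'I_n.+2).
Notation im := (0 +i* 1 : R[i]).
Implicit Types (f g u : 'rV[R]_n.+2 -> R) (z : 'rV[R]_n.+2) (s t K : R) (D B : set 'rV[R]_n.+2).

Definition dual u f := Rint (fun z => u z * f z).

Lemma dualD D u f g : L1 u -> tst D f -> tst D g -> dual u (fun z => f z + g z) = dual u f + dual u g.
Proof.
move=> iu tf tg; rewrite /dual -RintD; [|exact: L1_tst iu tf|exact: L1_tst iu tg].
by apply: eq_Rintegral => z _; rewrite mulrDr.
Qed.

Lemma dualZ D u (a : R) f : L1 u -> tst D f -> dual u (fun z => a * f z) = a * dual u f.
Proof.
move=> iu tf; rewrite /dual -RintZ; last exact: L1_tst iu tf.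
by apply: eq_Rintegral => z _; rewrite mulrCA.
Qed.

(** Complex pairing, without conjugation, of u1 + i u2 with f (E1 + i E2); [Wint] is its analogue
    for w1 + i w2 restricted to the orthant. *)
Definition Iint u1 u2 s t f : R[i] :=
  (dual u1 (fun z => f z * E1 s t z) - dual u2 (fun z => f z * E2 s t z)) +i*
  (dual u1 (fun z => f z * E2 s t z) + dual u2 (fun z => f z * E1 s t z)).

Definition Wint w1 w2 s t f : R[i] :=
  Bint s t (fun z => w1 z * f z) + im * Bint s t (fun z => w2 z * f z).

Section functional.
Variables (u1 u2 : 'rV[R]_n.+2 -> R) (iu1 : L1 u1) (iu2 : L1 u2).
Notation I := (Iint u1 u2).

Lemma IintD D s t f g : tst D f -> tst D g -> I s t (fun z => f z + g z) = I s t f + I s t g.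
Proof.
move=> tf tg; have c1 := E1_cinf (n := n) s t; have c2 := E2_cinf (n := n) s t.
have key u E : L1 u -> cinf E -> dual u (fun z => (f z + g z) * E z) = dual u (fun z => f z * E z) + dual u (fun z => g z * E z).
  move=> iu cE; rewrite -(dualD iu (tst_mul tf cE) (tst_mul tg cE)).
  by congr dual; apply/funext => z; rewrite mulrDl.
by apply: complex_ext; rewrite reim /= !key//; ring.
Qed.

Lemma IintZ D s t (a : R) f : tst D f -> I s t (fun z => a * f z) = a%:C * I s t f.
Proof.
move=> tf; have c1 := E1_cinf (n := n) s t; have c2 := E2_cinf (n := n) s t.
have key u E : L1 u -> cinf E -> dual u (fun z => (a * f z) * E z) = a * dual u (fun z => f z * E z).
  move=> iu cE; rewrite -(dualZ a iu (tst_mul tf cE)).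
  by congr dual; apply/funext => z; rewrite mulrA.
by apply: complex_ext; rewrite reim /= !key//; ring.
Qed.

Definition fz m f z := z ord0 i0 ^+ m * f z.

Lemma fz_tst D m f : tst D f -> tst D (fz m f).
Proof.
move=> tf; rewrite (_ : fz m f = fun z => f z * z ord0 i0 ^+ m); last by apply/funext => z; rewrite /fz mulrC.
by apply: tst_mul tf _; apply: smoothX; exact: smooth_coord.
Qed.

(** The support of [u] enters here: only on the orthant is z_0^m e bounded by m! t^-m. *)
Lemma Iint_O D s m f : tst D f ->
  (forall z, ~ (forall i, 0 < z ord0 i) -> u1 z = 0 /\ u2 z = 0) ->
  bigO m (fun t => I s t (fz m f)).
Proof.
move=> tf u0; have [M M0 hM] := tst_bounded tf.
pose S := Rint (fun z => `|u1 z|) + Rint (fun z => `|u2 z|).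
exists (2 * (M * m`!%:R * S)) => t t1.
have b0 : 0 <= t ^- m by rewrite ltW// tn_gt0.
have key u E : L1 u -> cinf E -> (forall z, ~ (forall i, 0 < z ord0 i) -> u z = 0) ->
   (forall z, (forall i, 0 < z ord0 i) -> `|z ord0 i0 ^+ m * E z| <= m`!%:R * t ^- m) ->
   `|dual u (fun z => fz m f z * E z)| <= M * (m`!%:R * t ^- m) * Rint (fun z => `|u z|).
  move=> iu cE uz hE; have ts := tst_mul (fz_tst m tf) cE.
  apply: le_trans (norm_Rint (L1_tst iu ts)) _; rewrite -RintZ; last exact: L1_norm.
  apply: le_Rint; [exact: L1_norm (L1_tst iu ts)|exact: L1Z (L1_norm iu)|] => z.
  case: (pselect (forall i, 0 < z ord0 i)) => hz; last by rewrite (uz z hz) mul0r normr0 mulr0.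
  rewrite normrM mulrC ler_wpM2r// /fz mulrAC normrM mulrC ler_pM//; exact: hE.
have h1 z : (forall i, 0 < z ord0 i) -> `|z ord0 i0 ^+ m * E1 s t z| <= m`!%:R * t ^- m.
  by move=> hz; have [] := @E_bound R n s t z m t1 (ltW (hz i0)) (ltW (hz i1)).
have h2 z : (forall i, 0 < z ord0 i) -> `|z ord0 i0 ^+ m * E2 s t z| <= m`!%:R * t ^- m.
  by move=> hz; have [] := @E_bound R n s t z m t1 (ltW (hz i0)) (ltW (hz i1)).
have k11 := key u1 _ iu1 (E1_cinf s t) (fun z hz => (u0 z hz).1) h1.
have k12 := key u1 _ iu1 (E2_cinf s t) (fun z hz => (u0 z hz).1) h2.
have k21 := key u2 _ iu2 (E1_cinf s t) (fun z hz => (u0 z hz).2) h1.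
have k22 := key u2 _ iu2 (E2_cinf s t) (fun z hz => (u0 z hz).2) h2.
rewrite /cn /=; apply: (le_trans (lerD (ler_normB _ _) (ler_normD _ _))).
rewrite (_ : 2 * _ * _ = 2 * (M * (m`!%:R * t ^- m) * Rint (fun z => `|u1 z|)) + 2 * (M * (m`!%:R * t ^- m) * Rint (fun z => `|u2 z|))); last by rewrite /S; ring.
lra.
Qed.

Variables (p1 p2 w1 w2 : 'rV[R]_n.+2 -> R) (cp1 : cinf p1) (cp2 : cinf p2) (cw1 : cinf w1) (cw2 : cinf w2).
Variables (K : R) (B : set 'rV[R]_n.+2).
(** [H1] and [H2] are the real and imaginary parts of Delta u + K p u = K w 1_orthant in the sense
    of distributions on [B], for u = u1 + i u2, p = p1 + i p2, w = w1 + i w2. The test functions may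
    cross the faces of the orthant, which is how the zero Cauchy data are encoded. *)
Hypothesis H1 : forall psi, tst B psi ->
  dual u1 (laplacian psi) + K * (dual u1 (fun z => p1 z * psi z) - dual u2 (fun z => p2 z * psi z)) =
  K * Rint (fun z => pos z * (w1 z * psi z)).
Hypothesis H2 : forall psi, tst B psi ->
  dual u2 (laplacian psi) + K * (dual u2 (fun z => p1 z * psi z) + dual u1 (fun z => p2 z * psi z)) =
  K * Rint (fun z => pos z * (w2 z * psi z)).

Let pw (p f : 'rV[R]_n.+2 -> R) z := p z * f z.

Let pw_tst p f : cinf p -> tst B f -> tst B (pw p f).
Proof.
move=> cp tf; rewrite (_ : pw p f = fun z => f z * p z); last by apply/funext => z; rewrite /pw mulrC.
exact: tst_mul.
Qed.

(** The equation tested with psi = f e; the factors l1 and l2 come from the gradient of [e], and no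
    t^2 appears because [e] is harmonic. *)
Lemma corner_identity s t f : s ^+ 2 = 1 -> tst B f ->
  K%:C * Wint w1 w2 s t f = I s t (laplacian f) + K%:C * (I s t (pw p1 f) + im * I s t (pw p2 f))
   - 2%:R * (t +i* (s * t)) * I s t (pd i0 f) - 2%:R * (t +i* - (s * t)) * I s t (pd i1 f).
Proof.
move=> s2 tf; have cE1 := E1_cinf (n := n) s t; have cE2 := E2_cinf (n := n) s t.
have [L1f L2f] := laplacian_mulE t s2 (tst_cinf tf).
have tL := tst_laplacian tf; have t0 := tst_pd i0 tf; have t1 := tst_pd i1 tf.
have EL u : L1 u ->
   dual u (laplacian (fun z => f z * E1 s t z)) = dual u (fun z => laplacian f z * E1 s t z)
    - 2 * t * dual u (fun z => pd i0 f z * E1 s t z) + 2 * (s * t) * dual u (fun z => pd i0 f z * E2 s t z)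
    - 2 * t * dual u (fun z => pd i1 f z * E1 s t z) - 2 * (s * t) * dual u (fun z => pd i1 f z * E2 s t z).
  move=> iu; rewrite L1f.
  have a1 := tst_mul tL cE1; have a2 := tstZ (- (2 * t)) (tst_mul t0 cE1); have a3 := tstZ (2 * (s * t)) (tst_mul t0 cE2).
  have a4 := tstZ (- (2 * t)) (tst_mul t1 cE1); have a5 := tstZ (- (2 * (s * t))) (tst_mul t1 cE2).
  rewrite (_ : (fun z => _) = fun z => laplacian f z * E1 s t z + (- (2 * t)) * (pd i0 f z * E1 s t z) + (2 * (s * t)) * (pd i0 f z * E2 s t z) + (- (2 * t)) * (pd i1 f z * E1 s t z) + (- (2 * (s * t))) * (pd i1 f z * E2 s t z)); last by apply/funext => z; ring.
  rewrite (dualD iu (tstD (tstD (tstD a1 a2) a3) a4) a5) (dualD iu (tstD (tstD a1 a2) a3) a4) (dualD iu (tstD a1 a2) a3) (dualD iu a1 a2).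
  by rewrite !(dualZ _ iu (tst_mul t0 _))// !(dualZ _ iu (tst_mul t1 _))//; ring.
have EL2 u : L1 u ->
   dual u (laplacian (fun z => f z * E2 s t z)) = dual u (fun z => laplacian f z * E2 s t z)
    - 2 * t * dual u (fun z => pd i0 f z * E2 s t z) - 2 * (s * t) * dual u (fun z => pd i0 f z * E1 s t z)
    - 2 * t * dual u (fun z => pd i1 f z * E2 s t z) + 2 * (s * t) * dual u (fun z => pd i1 f z * E1 s t z).
  move=> iu; rewrite L2f.
  have a1 := tst_mul tL cE2; have a2 := tstZ (- (2 * t)) (tst_mul t0 cE2); have a3 := tstZ (- (2 * (s * t))) (tst_mul t0 cE1).
  have a4 := tstZ (- (2 * t)) (tst_mul t1 cE2); have a5 := tstZ (2 * (s * t)) (tst_mul t1 cE1).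
  rewrite (_ : (fun z => _) = fun z => laplacian f z * E2 s t z + (- (2 * t)) * (pd i0 f z * E2 s t z) + (- (2 * (s * t))) * (pd i0 f z * E1 s t z) + (- (2 * t)) * (pd i1 f z * E2 s t z) + (2 * (s * t)) * (pd i1 f z * E1 s t z)); last by apply/funext => z; ring.
  rewrite (dualD iu (tstD (tstD (tstD a1 a2) a3) a4) a5) (dualD iu (tstD (tstD a1 a2) a3) a4) (dualD iu (tstD a1 a2) a3) (dualD iu a1 a2).
  by rewrite !(dualZ _ iu (tst_mul t0 _))// !(dualZ _ iu (tst_mul t1 _))//; ring.
have HE (E : 'rV[R]_n.+2 -> R) : cinf E ->
    (dual u1 (laplacian (fun z => f z * E z)) + K * (dual u1 (fun z => p1 z * f z * E z) - dual u2 (fun z => p2 z * f z * E z)) =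
      K * Rint (fun z => pos z * (w1 z * f z * E z))) /\
    (dual u2 (laplacian (fun z => f z * E z)) + K * (dual u2 (fun z => p1 z * f z * E z) + dual u1 (fun z => p2 z * f z * E z)) =
      K * Rint (fun z => pos z * (w2 z * f z * E z))).
  move=> cE; have A (p : 'rV[R]_n.+2 -> R) : (fun z => p z * f z * E z) = fun z => p z * (f z * E z).
    by apply/funext => z; rewrite mulrA.
  have A' (w : 'rV[R]_n.+2 -> R) : (fun z => pos z * (w z * f z * E z)) = fun z => pos z * (w z * (f z * E z)).
    by apply/funext => z; rewrite (mulrA (w z)).
  rewrite (A p1) (A p2) (A' w1) (A' w2).
  by split; [exact: H1 (tst_mul tf cE)|exact: H2 (tst_mul tf cE)].
have [h11 h21] := HE _ cE1; have [h12 h22] := HE _ cE2.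
rewrite (EL u1 iu1) in h11; rewrite (EL2 u1 iu1) in h12.
rewrite (EL u2 iu2) in h21; rewrite (EL2 u2 iu2) in h22.
rewrite /pw /Wint /Bint /oint /Iint; apply: complex_ext; rewrite !reim /=; lra.
Qed.

Hypothesis K0 : K != 0.
Hypothesis u0 : forall z, ~ (forall i, 0 < z ord0 i) -> u1 z = 0 /\ u2 z = 0.

Lemma pd0_fz m f : cinf f -> pd i0 (fz m.+1 f) = fun z => m.+1%:R * fz m f z + fz m.+1 (pd i0 f) z.
Proof.
move=> cf; elim: m f cf => [|m IH] f cf.
  rewrite (_ : fz 1 f = fun z => z ord0 i0 * f z); last by apply/funext => z; rewrite /fz expr1.
  rewrite pdM//; last exact: smooth_coord.
  by apply/funext => z; rewrite pd_coord eqxx /fz expr0 expr1 !mul1r.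
have E g : fz m.+2 g = fun z => z ord0 i0 * fz m.+1 g z by apply/funext => z; rewrite /fz exprS mulrA.
have cz : cinf (fz m.+1 f) by apply: smoothM => //; apply: smoothX; exact: smooth_coord.
rewrite !E pdM//; last exact: smooth_coord.
have f1 : true%:R = 1 :> R by [].
apply/funext => z; rewrite pd_coord eqxx f1 IH// /fz !exprS -(natr1 m.+1); ring.
Qed.

Lemma pd1_fz m f : cinf f -> pd i1 (fz m f) = fz m (pd i1 f).
Proof.
move=> cf; elim: m f cf => [|m IH] f cf.
  rewrite (_ : fz 0 f = f); last by apply/funext => z; rewrite /fz expr0 mul1r.
  by apply/funext => z; rewrite /fz expr0 mul1r.
have E g : fz m.+1 g = fun z => z ord0 i0 * fz m g z by apply/funext => z; rewrite /fz exprS mulrA.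
have cz : cinf (fz m f) by apply: smoothM => //; apply: smoothX; exact: smooth_coord.
rewrite !E pdM//; last exact: smooth_coord.
by apply/funext => z; rewrite pd_coord IH// /= mul0r add0r.
Qed.

(* Bootstrap: [claim k] says that the pairing of u with f e is O(t^-k). Testing
   with z0^(m+1) f puts a factor t in front of the pairing with z0^m f, so that
   [claim k.+1] follows by descending induction on m from |z0^m e| <= m! t^-m. *)
Lemma corner_order N s : s ^+ 2 = 1 ->
  (forall f, tst B f -> bigO N.+3 (fun t => Wint w1 w2 s t (fz 1 f))) ->
  forall f, tst B f -> bigO N.+3 (fun t => Wint w1 w2 s t f).
Proof.
move=> s2 hW.
have hLI k : (forall f, tst B f -> bigO k (fun t => I s t f)) -> forall f, tst B f ->
   bigO k (fun t => I s t (laplacian f) + K%:C * (I s t (pw p1 f) + im * I s t (pw p2 f))).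
  move=> h f tf; apply: bigO_D; first exact: h (tst_laplacian tf).
  apply: bigO_Z; apply: bigO_D; first exact: h (pw_tst cp1 tf).
  by apply: bigO_Z; exact: h (pw_tst cp2 tf).
have claim k : (k <= N.+4)%N -> forall f, tst B f -> bigO k (fun t => I s t f).
  elim: k => [_ f tf|k IH kN].
    have := Iint_O s 0 tf u0; apply: bigO_ext => t _; congr Iint.
    by apply/funext => z; rewrite /fz expr0 mul1r.
  have {}IH := IH (ltnW kN).
  have down j : (j <= k.+1)%N -> forall f, tst B f -> bigO k.+1 (fun t => I s t (fz (k.+1 - j) f)).
    elim: j => [_ f tf|j IHj jk f tf]; first by rewrite subn0; exact: Iint_O tf u0.
    set m := (k.+1 - j.+1)%N; have Em : (k.+1 - j)%N = m.+1 by rewrite /m; lia.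
    have {}IHj := IHj (ltnW jk); rewrite Em in IHj.
    have tz := fz_tst m tf; have tzS := fz_tst m.+1 tf; have cf := tst_cinf tf.
    have t0 := fz_tst m.+1 (tst_pd i0 tf); have t1 := fz_tst m.+1 (tst_pd i1 tf).
    have ck : (2 * m.+1)%:R != 0 :> R[i] by rewrite pnatr_eq0.
    apply: bigO_tV.
    (* The Laplacian and the terms of order zero have only the bound of [claim k]; this is enough,
       since the pairing to be bounded appears with a factor t. *)
    have hX := hLI k IH _ tzS.
    (* The weight z_0^(m+1) is the one factor z_0 of the hypothesis times the test function z_0^m f,
       and k <= N + 3 at this stage. *)
    have hY : bigO k (fun t => K%:C * Wint w1 w2 s t (fz m.+1 f)).
      apply: bigO_Z; apply: (@bigO_mono _ N.+3); first by [].
      apply: (bigO_ext _ (hW _ tz)) => t _; congr Wint.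
      by apply/funext => z; rewrite /fz expr1 exprS mulrA.
    have hZ0 := bigO_Z (2%:R * (1 +i* s)) (bigO_t (IHj _ (tst_pd i0 tf))).
    have hZ1 := bigO_Z (2%:R * (1 +i* - s)) (bigO_t (IHj _ (tst_pd i1 tf))).
    have := bigO_Z (c1 s * ((2 * m.+1)%:R)^-1) (bigO_B (bigO_B (bigO_B hX hY) hZ0) hZ1).
    apply: bigO_ext => t t1'.
    rewrite (corner_identity t s2 tzS) pd0_fz// pd1_fz// (IintD s t (tstZ m.+1%:R tz) t0) (IintZ _ _ _ tz).
    rewrite (lamE s t).1 (lamE s t).2.
    set X := I s t (laplacian _) + _; set Y0 := I s t (fz m.+1 _); set Y1 := I s t (fz m.+1 _); set Z := I s t _.
    have E2 : 2%:R * m.+1%:R%:C = (2 * m.+1)%:R :> R[i].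
      by rewrite natrM; congr (_ * _); rewrite -[RHS](rmorph_nat (real_complex R)).
    have -> : X - (X - 2%:R * (t%:C * (1 +i* s)) * (m.+1%:R%:C * Z + Y0) - 2%:R * (t%:C * (1 +i* - s)) * Y1)
      - 2%:R * (1 +i* s) * (t%:C * Y0) - 2%:R * (1 +i* - s) * (t%:C * Y1) = (1 +i* s) * (2 * m.+1)%:R * (t%:C * Z).
      by rewrite -E2; ring.
    have E3 (a b c : R[i]) : a != 0 -> b != 0 -> a^-1 * b^-1 * (a * b * c) = c by move=> a0 b0; field; rewrite a0 b0.
    by rewrite /c1 E3// (cxM s).1.
  move=> f tf; have := down k.+1 (leqnn _) f tf; rewrite subnn; apply: bigO_ext => t _; congr Iint.
  by apply/funext => z; rewrite /fz expr0 mul1r.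
(* Order N + 4 is what the two gradient terms require, since they carry a factor t; the others need
   N + 3. *)
move=> f tf; have h3 := claim N.+3 (leqnSn _); have h4 := claim N.+4 (leqnn _).
have hX := hLI _ h3 f tf.
have hZ0 := bigO_Z (2%:R * (1 +i* s)) (bigO_t (h4 _ (tst_pd i0 tf))).
have hZ1 := bigO_Z (2%:R * (1 +i* - s)) (bigO_t (h4 _ (tst_pd i1 tf))).
have KC : K%:C != 0 by apply/eqP => -[] /eqP; rewrite (negbTE K0).
have := bigO_Z (K%:C^-1) (bigO_B (bigO_B hX hZ0) hZ1).
apply: bigO_ext => t t1; apply: (mulfI KC); rewrite mulVKf//.
rewrite (corner_identity t s2 tf) (lamE s t).1 (lamE s t).2; ring.
Qed.

End functional.
End corner_orders.

(** * Sums with alternating coefficients *)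

Section alternating.
Context {R : realType}.
Implicit Types (a : nat -> R[i]) (r x : R[i]).

(** Two steps multiply r^m by -1 and a_m by -1, so the product depends on the parity of m only. *)
Lemma alternating_terms N a r : r ^+ 2 = -1 -> (forall i, (i.+2 <= N)%N -> a i.+2 = - a i) ->
  forall m, (m <= N)%N -> r ^+ m * a m = if odd m then r * a 1%N else a 0%N.
Proof.
move=> r2 ha; elim/ltn_ind => -[|[|m]] IH mN; rewrite ?expr0 ?mul1r ?expr1//.
rewrite ha// -(addn2 m) exprD r2 mulrN1 mulrNN IH//; last by lia.
by rewrite addn2 /= negbK.
Qed.

(** [uphalf N.+1] and [(N.+1)./2] count the even and the odd indices up to N. *)
Lemma alternating_sum N a r : r ^+ 2 = -1 -> (forall i, (i.+2 <= N)%N -> a i.+2 = - a i) ->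
  \sum_(i < N.+1) r ^+ i * a i = (uphalf N.+1)%:R * a 0%N + (N.+1)./2%:R * (r * a 1%N).
Proof.
move=> r2 ha; have ht := alternating_terms r2 ha.
have H m : (m <= N.+1)%N -> \sum_(i < m) r ^+ i * a i = (uphalf m)%:R * a 0%N + m./2%:R * (r * a 1%N).
  elim: m => [|m IH] mN; first by rewrite big_ord0 !mul0r addr0.
  rewrite big_ord_recr /= IH; last exact: ltnW.
  rewrite ht// uphalf_half; case: (odd m); rewrite /= ?add0n ?add1n -?natr1; ring.
exact: H.
Qed.

(** s = 1 and s = -1 give r = i and r = - i. Adding the two sums isolates a_0; then a_1 follows from
    one of them, its multiplicity being nonzero as soon as N >= 1. *)
Lemma alternating_eq0 N a : (forall i, (i.+2 <= N)%N -> a i.+2 = - a i) ->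
  (forall s : R, s ^+ 2 = 1 -> \sum_(i < N.+1) (0 +i* s) ^+ i * a i = 0) -> forall i, (i <= N)%N -> a i = 0.
Proof.
move=> ha hs.
have r2 (s : R) : s ^+ 2 = 1 -> (0 +i* s) ^+ 2 = -1 :> R[i].
  by move=> s2; rewrite expr2; apply: complex_ext; rewrite !reim /= ?mulr0 ?mul0r ?addr0 ?oppr0// sub0r -expr2 s2.
have s1 : (1 : R) ^+ 2 = 1 by rewrite expr1n.
have sN1 : (-1 : R) ^+ 2 = 1 by rewrite sqrrN expr1n.
have h1 := hs _ s1; have h2 := hs _ sN1.
rewrite (alternating_sum (r2 _ s1) ha) in h1; rewrite (alternating_sum (r2 _ sN1) ha) in h2.
have E : (0 +i* -1) = - (0 +i* 1) :> R[i] by apply: complex_ext; rewrite !reim /= ?oppr0.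
rewrite E mulNr mulrN in h2.
have a0 : a 0%N = 0.
  have : (2 * uphalf N.+1)%:R * a 0%N = 0.
    by rewrite natrM -mulrA mulr_natl mulr2n -[RHS]addr0 -{1}h1 -[X in _ = _ + X]h2; ring.
  move/eqP; rewrite mulf_eq0 pnatr_eq0 => /orP[|/eqP//].
  by rewrite uphalf_half; lia.
have a1 : (1 <= N)%N -> a 1%N = 0.
  move=> N1; move: h1; rewrite a0 mulr0 add0r => /eqP; rewrite !mulf_eq0 pnatr_eq0.
  have -> : ((N.+1)./2 == 0)%N = false by apply/eqP; lia.
  have -> : (0 +i* 1 == 0 :> R[i]) = false by apply/eqP => -[] /eqP; rewrite oner_eq0.
  by move=> /= /eqP.
elim/ltn_ind => -[|[|m]] IH mN //; first exact: a1.
by rewrite ha// IH ?oppr0//; lia.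
Qed.

End alternating.

(** * Orders of vanishing along the edge *)

Section edge_orders.
Context {R : realType} {n : nat}.
Notation leb n := (lebesgue_rV n : {measure set 'rV[R]_n -> \bar R}).
Notation Rint F := (Rintegral (leb _) setT F).
Notation i0 := (ord0 : 'I_n.+2).
Notation i1 := (lift ord0 ord0 : 'I_n.+2).
Implicit Types (f g F G W : 'rV[R]_n.+2 -> R) (z : 'rV[R]_n.+2) (y : 'rV[R]_n) (d : R).

Definition edge_set d : set 'rV[R]_n := [set y | forall i, 0 < y ord0 i < d].

Definition cword (s : seq 'I_n.+2) := all (fun l => (l == i0) || (l == i1)) s.

(** Only derivatives transverse to the edge are prescribed: those along it follow by [pd_edge], the
    vanishing being on a relatively open part of the edge. *)
Definition vanish d M F := forall s, cword s -> (size s < M)%N -> forall y, edge_set d y -> dpart s F (edge y) = 0.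

Lemma dpartD s F G : cinf F -> cinf G -> dpart s (fun z => F z + G z) = fun z => dpart s F z + dpart s G z.
Proof.
move=> cF cG; elim: s => [//|i s IH]; rewrite dpart_cons IH pdD; [|exact: cinf_dpart|exact: cinf_dpart].
by rewrite !dpart_cons.
Qed.

Lemma dpartZ s (c : R) F : cinf F -> dpart s (fun z => c * F z) = fun z => c * dpart s F z.
Proof.
move=> cF; elim: s => [//|i s IH]; rewrite dpart_cons IH pdZ; last exact: cinf_dpart.
by rewrite !dpart_cons.
Qed.

Lemma vanish_mono d M M' F : (M' <= M)%N -> vanish d M F -> vanish d M' F.
Proof. by move=> MM h s cs sM; apply: h => //; exact: leq_trans MM. Qed.

Lemma vanish_pd d M F l : (l == i0) || (l == i1) -> vanish d M.+1 F -> vanish d M (pd l F).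
Proof.
move=> hl h s cs sM y ey; rewrite -dpart_rcons; apply: h => //; last by rewrite size_rcons.
by rewrite /cword all_rcons hl.
Qed.

Lemma vanishS d M F : (forall y, edge_set d y -> F (edge y) = 0) ->
  (forall l, (l == i0) || (l == i1) -> vanish d M (pd l F)) -> vanish d M.+1 F.
Proof.
move=> h0 hl s; case/lastP: s => [|s l]; first by move=> _ _; exact: h0.
rewrite /cword all_rcons size_rcons dpart_rcons => /andP[hl' cs] sM.
exact: hl.
Qed.

Lemma vanishD d M F G : cinf F -> cinf G -> vanish d M F -> vanish d M G -> vanish d M (fun z => F z + G z).
Proof. by move=> cF cG hF hG s cs sM y ey; rewrite dpartD// hF// hG// addr0. Qed.

Lemma vanishZ d M (c : R) F : cinf F -> vanish d M F -> vanish d M (fun z => c * F z).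
Proof. by move=> cF hF s cs sM y ey; rewrite dpartZ// hF// mulr0. Qed.

Lemma vanishM d M F G : cinf F -> cinf G -> vanish d M F -> vanish d M (fun z => G z * F z).
Proof.
elim: M F G => [|M IH] F G cF cG hF; first by move=> s _; rewrite ltn0.
apply: vanishS => [y ey|l hl].
  by have /= -> := hF [::] isT isT y ey; rewrite mulr0.
rewrite pdM//; apply: vanishD; [by apply: smoothM => //; exact: cinf_pd|by apply: smoothM => //; exact: cinf_pd| |].
  by apply: IH => //; [exact: cinf_pd|exact: vanish_mono hF].
by apply: IH => //; [exact: cinf_pd|exact: vanish_pd hF].
Qed.

Lemma vanish_z0 d M F : cinf F -> vanish d M F -> vanish d M.+1 (fun z => z ord0 i0 * F z).
Proof.
have cz : cinf (fun z => z ord0 i0) by exact: smooth_coord.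
elim: M F => [|M IH] F cF hF; apply: vanishS => [y ey|l hl]; rewrite ?rV_cons0 ?mul0r//.
rewrite pdM// pd_coord; apply: vanishD; [by apply: smoothZ|by apply: smoothM => //; exact: cinf_pd|exact: vanishZ|].
by apply: IH; [exact: cinf_pd|exact: vanish_pd hF].
Qed.

(** Leibniz rule at top order: a term that differentiates [G] leaves fewer than [size s] derivatives
    on [F], hence vanishes on the edge. *)
Lemma dpart_mul_top d s F G y : cinf F -> cinf G -> cword s -> vanish d (size s) F -> edge_set d y ->
  dpart s (fun z => G z * F z) (edge y) = G (edge y) * dpart s F (edge y).
Proof.
elim/last_ind: s F G => [//|s l IH] F G cF cG; rewrite /cword all_rcons size_rcons => /andP[hl cs] hF ey.
have c1 := cinf_pd l cF; have c2 := cinf_pd l cG.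
rewrite !dpart_rcons pdM// dpartD; [|exact: smoothM|exact: smoothM].
rewrite (IH _ _ cF c2 cs (vanish_mono (leqnSn _) hF) ey) (hF s cs)// mulr0 add0r.
exact: IH c1 cG cs (vanish_pd hl hF) ey.
Qed.

Lemma open_edge_set d : open (edge_set d).
Proof.
apply: (open_coords (P := fun=> [set t : R | 0 < t < d])) => _.
rewrite (_ : [set t | _] = `]0, d[%classic); first exact: interval_open.
by apply/seteqP; split => t; rewrite /= in_itv.
Qed.

Lemma edge_cube d y : 0 < d -> edge_set d y -> cube 0 d (edge y).
Proof.
move=> d0 ey j; rewrite [X in _ - X]mxE subr0; case: (unliftP ord0 j) => [l ->|->]; last first.
  by rewrite rV_cons0 normr0.
rewrite /edge rV_consS; case: (unliftP ord0 l) => [m ->|->]; last by rewrite rV_cons0 normr0.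
by rewrite rV_consS; have /andP[y0 yd] := ey m; rewrite gtr0_norm.
Qed.

Lemma pd_edge d F i y : cinf F -> (forall y, edge_set d y -> F (edge y) = 0) -> edge_set d y ->
  pd (lift ord0 (lift ord0 i)) F (edge y) = 0.
Proof.
move=> cF h ey.
have cS := cinf_slice 0 (cinf_slice 0 cF).
have <- : pd i (fun y => F (edge y)) y = pd (lift ord0 (lift ord0 i)) F (edge y).
  by rewrite /edge (pd_slice 0 i (cinf_slice 0 cF)) (pd_slice 0 (lift ord0 i) cF).
by apply: (pd_zero_on i (@open_edge_set d)).
Qed.

(* The derivatives along the edge of a flat W vanish, so that at top order the
   Helmholtz equation reads pd i0 (pd i0 W) = - pd i1 (pd i1 W). *)
Lemma edge_alternate d M k W y i : 0 < d -> cinf W -> csol (cube 0 d) (k ^+ 2) W -> vanish d M W -> edge_set d y ->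
  (i.+2 <= M)%N -> dpart (nseq (M - i.+2) i1 ++ nseq i.+2 i0) W (edge y) = - dpart (nseq (M - i) i1 ++ nseq i i0) W (edge y).
Proof.
move=> dpos cW sW vW ey iM.
pose s := nseq (M - i.+2) i1 ++ nseq i i0.
have cs : cword s by rewrite /cword all_cat !all_nseq /= orbT !orbT.
have ss : (size s < M)%N by rewrite size_cat !size_nseq; lia.
have d0 : cube 0 d (edge y).
  exact: edge_cube.
have := csol_dpart s (@open_cube _ _ _ _) cW sW d0.
rewrite (vW s cs ss y ey) mulr0 oppr0 laplacianE big_ord_recl big_ord_recl big1 => [|l _]; last first.
  have cd := cinf_dpart s cW.
  apply: (pd_edge l (cinf_pd _ cd)) => // y' ey'; apply: (pd_edge l cd) => // y2 ey2.
  exact: vW.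
rewrite addr0 => /eqP; rewrite addr_eq0 => /eqP.
have -> : pd i0 (pd i0 (dpart s W)) = dpart (nseq (M - i.+2) i1 ++ nseq i.+2 i0) W.
  rewrite -!dpart_cons; apply: dpart_perm => //.
  by rewrite /s -[i0 :: i0 :: _]/(nseq 2 i0 ++ _) perm_catCA.
have -> : pd i1 (pd i1 (dpart s W)) = dpart (nseq (M - i) i1 ++ nseq i i0) W.
  rewrite -!dpart_cons; congr dpart; rewrite /s; have -> : (M - i = (M - i.+2).+2)%N by lia.
  by [].
by [].
Qed.

Lemma word_canonical s : cword s -> perm_eq s (nseq (count_mem i1 s) i1 ++ nseq (size s - count_mem i1 s) i0).
Proof.
elim: s => [//|l s IH] /= /andP[/orP[] /eqP -> cs].
  rewrite add0n subSn ?count_size//.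
  rewrite -cat1s -[nseq (_ - _).+1 i0]/([:: i0] ++ _) perm_sym perm_catCA perm_cat2l perm_sym.
  exact: IH.
by rewrite eqxx add1n subSS /= perm_cons; exact: IH.
Qed.

Lemma vanish_next d M W : cinf W -> vanish d M W ->
  (forall i, (i <= M)%N -> forall y, edge_set d y -> dpart (nseq (M - i) i1 ++ nseq i i0) W (edge y) = 0) -> vanish d M.+1 W.
Proof.
move=> cW vW h s cs; rewrite ltnS leq_eqVlt => /orP[/eqP sM|sM] y ey; last exact: vW.
rewrite (dpart_perm cW (word_canonical cs)) sM.
have cM : (count_mem i1 s <= M)%N by rewrite -sM count_size.
by have := h (M - count_mem i1 s)%N (leq_subr _ _) y ey; rewrite subKn.
Qed.

(** On the positive part of the edge, leaving [edge_set d] means leaving the cube that contains the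
    supports of the test functions. *)
Lemma Eint_eq d (h1 h2 : 'rV[R]_n -> R) : (forall y, edge_set d y -> h1 y = h2 y) ->
  (forall y, ~ cube 0 d (edge y) -> h1 y = h2 y) -> Eint h1 = Eint h2.
Proof.
move=> h h'; apply: eq_Rintegral => y _; rewrite /pos indicE.
case: (pselect (forall i, 0 < y ord0 i)) => y0; last by rewrite memNset// !mul0r.
rewrite mem_set// !mul1r; case: (pselect (edge_set d y)) => [/h //|ny]; apply: h' => hc.
apply: ny => i; rewrite y0 /=; have := hc (lift ord0 (lift ord0 i)).
by rewrite [X in _ - X]mxE subr0 /edge !rV_consS => /(le_lt_trans (ler_norm _)).
Qed.

Lemma Eder_vanish d F M i j : tst (cube 0 d) F -> vanish d M F -> (i + j < M)%N -> Eder F j i = 0.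
Proof.
move=> tF vF ij; rewrite /Eder -(_ : Eint (fun _ : 'rV[R]_n => 0) = 0); last first.
  by rewrite -[RHS](@Rint0 R n); apply: eq_Rintegral => y _; rewrite mulr0.
apply: (@Eint_eq d) => y hy; last exact: tst_out (tst_dpart _ tF) hy.
apply: vF => //; first by rewrite /cword all_cat !all_nseq /= orbT !orbT.
by rewrite size_cat !size_nseq addnC.
Qed.

Lemma Eder_top d F f M i : cinf F -> tst (cube 0 d) f -> vanish d M F -> (i <= M)%N ->
  Eder (fun z => F z * f z) (M - i) i = Eint (fun y => f (edge y) * dpart (nseq (M - i) i1 ++ nseq i i0) F (edge y)).
Proof.
move=> cF tf vF iM.
have E : (fun z => F z * f z) = fun z => f z * F z by apply/funext => z; rewrite mulrC.
rewrite E /Eder; apply: (@Eint_eq d) => y hy.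
  apply: (dpart_mul_top (d := d)) => //; first exact: tst_cinf tf.
    by rewrite /cword all_cat !all_nseq /= orbT !orbT.
  by rewrite size_cat !size_nseq subnK.
by rewrite (tst_out tf hy) mul0r (tst_out (tst_dpart _ (tst_mul tf cF)) hy).
Qed.

Lemma cinf_edge F : cinf F -> cinf (fun y => F (edge y)).
Proof. by move=> cF; exact: cinf_slice 0 (cinf_slice 0 cF). Qed.

(** Cut-offs in the two transverse coordinates extend a function of the edge to a test function of
    the cube; [c] is the product of their values at 0, and being nonzero is normalisation enough. *)
Lemma edge_test d (psi : 'rV[R]_n -> R) : 0 < d -> tst (edge_set d) psi ->
  exists (c : R) f, [/\ c != 0, tst (cube 0 d) f & forall y, f (edge y) = c * psi y].
Proof.
move=> d0 tp; pose chi (t : R) := flat_step 0 (t + d / 2) * flat_step 0 (d / 2 - t).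
have d2 : 0 < d / 2 by rewrite divr_gt0.
have schi l : cinf (fun z : 'rV[R]_n.+2 => chi (z ord0 l)).
  apply: smoothM; apply: smooth_comp; [exact: smooth1_flat| |exact: smooth1_flat|].
    by apply: smoothD; [exact: smooth_coord|exact: smooth_cst].
  by apply: smoothB; [exact: smooth_cst|exact: smooth_coord].
have chi0 t : d / 2 <= `|t| -> chi t = 0.
  rewrite /chi ler_normr => /orP[h|h]; last by rewrite flat0_eq0 ?mul0r//; lra.
  by rewrite [X in _ * X]flat0_eq0 ?mulr0//; lra.
exists (chi 0 * chi 0), (fun z => chi (z ord0 i0) * chi (z ord0 i1) * psi (rtail (rtail z))); split.
- rewrite mulf_neq0// /chi add0r subr0 mulf_neq0// gt_eqF//; exact: flat0_gt0.
- apply: (@tstI R _ _ _ [set z : 'rV[R]_n.+2 | [/\ `|z ord0 i0| <= d / 2, `|z ord0 i1| <= d / 2 & supp psi (rtail (rtail z))]]).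
  + by apply: smoothM; [exact: smoothM|exact: (cinf_tail (cinf_tail (tst_cinf tp)))].
  + have [r r0 pr] := compact_cube (tst_compact tp).
    apply: (subclosed_compact _ (@ccube_compact R n.+2 0 (d + r))).
      have cl l : closed [set z : 'rV[R]_n.+2 | `|z ord0 l| <= d / 2].
        have -> : [set z : 'rV[R]_n.+2 | `|z ord0 l| <= d / 2] = (fun z : 'rV[R]_n.+2 => `|z ord0 l|) @^-1` [set t : R | t <= d / 2] by [].
        apply: closed_comp => [z _|]; last exact: closed_le.
        apply: continuous_comp; last exact: norm_continuous.
        by have /(_ z) := cinf_continuous (@smooth_coord R n.+2 l).
      have ct m : continuous (@rtail R m).
        have -> : @rtail R m = (fun x : 'rV[R]_m.+1 => x *m \matrix_(i, j) (i == lift ord0 j)%:R + 0) by apply/funext => x; exact: rtailE.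
        exact: affine_continuous.
      have cs : closed [set z : 'rV[R]_n.+2 | supp psi (rtail (rtail z))].
        have -> : [set z : 'rV[R]_n.+2 | supp psi (rtail (rtail z))] = (fun z => rtail (rtail z)) @^-1` supp psi by [].
        apply: closed_comp => [z _|]; last exact: closed_supp.
        by apply: continuous_comp; exact: ct.
      rewrite (_ : [set z | _] = [set z : 'rV[R]_n.+2 | `|z ord0 i0| <= d / 2] `&` [set z : 'rV[R]_n.+2 | `|z ord0 i1| <= d / 2] `&` [set z : 'rV[R]_n.+2 | supp psi (rtail (rtail z))]).
        by apply: closedI => //; exact: closedI.
      by apply/seteqP; split => z /= => [[? ? ?]|[[? ?] ?]].
    move=> z [z0 z1 /pr zr] j; rewrite mxE subr0; case: (unliftP ord0 j) => [l ->|->]; last by apply: le_trans z0 _; lra.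
    case: (unliftP ord0 l) => [m ->|->]; last by apply: le_trans z1 _; lra.
    by have := zr m; rewrite !mxE subr0 => h; lra.
  + move=> z [z0 z1 /(tst_sub tp) ze] j; rewrite mxE subr0; case: (unliftP ord0 j) => [l ->|->]; last by apply: le_lt_trans z0 _; lra.
    case: (unliftP ord0 l) => [m ->|->]; last by apply: le_lt_trans z1 _; lra.
    by have := ze m; rewrite !mxE => /andP[h1 h2]; rewrite gtr0_norm.
  + move=> z nz; apply: contrapT => h; apply: nz; split.
    * by rewrite leNgt; apply/negP => /ltW /chi0 h0; apply: h; rewrite h0 !mul0r.
    * by rewrite leNgt; apply/negP => /ltW /chi0 h0; apply: h; rewrite h0 mulr0 mul0r.
    * by apply: contrapT => h0; apply: h; rewrite (supp_out h0) mulr0.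
- by move=> y; rewrite /edge !(rtail_cons, rV_consS, rV_cons0).
Qed.

Lemma edge_fundamental d (h : 'rV[R]_n -> R) : 0 < d -> cinf h ->
  (forall f, tst (cube 0 d) f -> Eint (fun y => f (edge y) * h y) = 0) -> forall y, edge_set d y -> h y = 0.
Proof.
move=> d0 ch hf; apply: (ae_continuous_eq0 (@open_edge_set d) (cinf_continuous ch)).
apply: fundamental_lemma; first exact: open_edge_set.
  by move=> S cS _; apply: continuous_compact_L1 => //; exact: cinf_continuous.
move=> psi tp; rewrite (@Rint_restrict R n (edge_set d) (edge_set d))//; last by move=> x; exact: tst_out tp.
have [c [f [c0 tf fE]]] := edge_test d0 tp.
apply: (mulfI c0); rewrite mulr0 -(hf f tf) -RintZ.
  apply: eq_Rintegral => y _; rewrite fE patchE /pos indicE; case: (pselect (edge_set d y)) => ey; last first.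
    by rewrite memNset// (tst_out tp ey) !(mulr0, mul0r).
  rewrite mem_set// mem_set ?mul1r; first by ring.
  by move=> i; have /andP[] := ey i.
have := tst_L1 (tst_mul tp ch); congr L1; apply/funext => y.
rewrite patchE; case: ifPn => [_|]; first by rewrite mulrC.
by rewrite notin_setE => /(tst_out tp) ->; rewrite mulr0 mul0r.
Qed.

End edge_orders.

(** * Flatness on the edge and its consequence *)

Section corner.
Context {R : realType} {n : nat}.
Notation leb n := (lebesgue_rV n : {measure set 'rV[R]_n -> \bar R}).
Notation Rint F := (Rintegral (leb _) setT F).
Notation i0 := (ord0 : 'I_n.+2).
Notation i1 := (lift ord0 ord0 : 'I_n.+2).
Notation im := (0 +i* 1 : R[i]).
Implicit Types (f g F G W : 'rV[R]_n.+2 -> R) (z : 'rV[R]_n.+2) (y : 'rV[R]_n).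

Lemma Bint_order (d : R) M s F : tst (cube 0 d) F -> vanish d M F -> bigO M.+2 (fun t => Bint s t F).
Proof.
move=> tF vF; have h := Bint_lead s tF (fun i j ij => Eder_vanish tF vF ij).
have hT : bigO M.+2 (fun t => (t ^- M.+2)%:C * Tsum M s (Eder F)).
  by have := bigO_M (@bigO_pow R M.+2) (bigO_cst (Tsum M s (Eder F))); rewrite addn0.
apply: (bigO_ext _ (bigO_D (bigO_mono (leqnSn _) h) hT)) => t _.
by rewrite subrK.
Qed.

Lemma Tsum_reim M s (h1 h2 : nat -> nat -> R) :
  Tsum M s h1 + im * Tsum M s h2 = \sum_(i < M.+1) c1 s ^+ i.+1 * c2 s ^+ (M - i).+1 * (h1 (M - i)%N i +i* h2 (M - i)%N i).
Proof.
rewrite /Tsum mulr_sumr -big_split; apply: eq_bigr => i _ /=.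
rewrite mulrCA -mulrDr; congr (_ * _).
by apply: complex_ext; rewrite !reim /=; ring.
Qed.

(** (1 - i s)^2 = - 2 i s and (1 + i s)(1 - i s) = 2 when s^2 = 1. This is the ratio of consecutive
    weights in [Tsum]. *)
Lemma c12 s : s ^+ 2 = 1 -> c1 s = (0 +i* - s) * c2 s :> R[i].
Proof.
move=> s2; have [h1 h2] := @cxM R s; apply: (mulIf h1); rewrite /c1 /c2 mulVf//.
rewrite mulrAC; apply: (mulIf h2); rewrite mulfVK// mul1r.
apply: complex_ext; rewrite !reim /=; move: s2; rewrite expr2; lra.
Qed.

Section step.
Variables (d k : R) (u1 u2 q1 q2 W1 W2 : 'rV[R]_n.+2 -> R).
Hypotheses (d0 : 0 < d) (k0 : k != 0) (iu1 : L1 u1) (iu2 : L1 u2).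
Hypotheses (cq1 : cinf q1) (cq2 : cinf q2) (cW1 : cinf W1) (cW2 : cinf W2).
Hypotheses (sW1 : csol (cube 0 d) (k ^+ 2) W1) (sW2 : csol (cube 0 d) (k ^+ 2) W2).
Hypothesis u0 : forall z, ~ (forall i, 0 < z ord0 i) -> u1 z = 0 /\ u2 z = 0.
Hypothesis q0 : forall z, cube 0 d z -> (q1 z +i* q2 z) != 0.
Let p1 z := 1 - q1 z.
Let p2 z := - q2 z.
Let w1 z := q1 z * W1 z - q2 z * W2 z.
Let w2 z := q1 z * W2 z + q2 z * W1 z.
Hypothesis H1 : forall psi, tst (cube 0 d) psi ->
  dual u1 (laplacian psi) + k ^+ 2 * (dual u1 (fun z => p1 z * psi z) - dual u2 (fun z => p2 z * psi z)) =
  k ^+ 2 * Rint (fun z => pos z * (w1 z * psi z)).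
Hypothesis H2 : forall psi, tst (cube 0 d) psi ->
  dual u2 (laplacian psi) + k ^+ 2 * (dual u2 (fun z => p1 z * psi z) + dual u1 (fun z => p2 z * psi z)) =
  k ^+ 2 * Rint (fun z => pos z * (w2 z * psi z)).

Let cw1 : cinf w1. Proof. by apply: smoothB; exact: smoothM. Qed.
Let cw2 : cinf w2. Proof. by apply: smoothD; exact: smoothM. Qed.
Let cp1 : cinf p1. Proof. by apply: smoothB => //; exact: smooth_cst. Qed.
Let cp2 : cinf p2. Proof. exact: smoothN. Qed.

Let mulE w f : (fun z => w z * f z) = fun z => f z * w z.
Proof. by apply/funext => z; rewrite mulrC. Qed.

(** The expansion has the coefficient [Tsum] at t^-(N+2), while the bootstrap gives O(t^-(N+3)); so
    the coefficient is zero for both signs of s. Since the edge derivatives of order N alternate by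
    the Helmholtz equation, [alternating_eq0] kills all of them. *)
Lemma corner_step N : vanish d N W1 -> vanish d N W2 -> vanish d N.+1 W1 /\ vanish d N.+1 W2.
Proof.
move=> v1 v2.
have vw1 : vanish d N w1.
  rewrite (_ : w1 = fun z => q1 z * W1 z + (-1) * (q2 z * W2 z)); last by apply/funext => z; rewrite mulN1r.
  apply: vanishD; [exact: smoothM|by apply: smoothZ; exact: smoothM|exact: vanishM|].
  by apply: vanishZ; [exact: smoothM|exact: vanishM].
have vw2 : vanish d N w2 by apply: vanishD; [exact: smoothM|exact: smoothM|exact: vanishM|exact: vanishM].
have k20 : k ^+ 2 != 0 by rewrite expf_neq0.
have tw w f : cinf w -> tst (cube 0 d) f -> tst (cube 0 d) (fun z => w z * f z).
  by move=> cw tf; rewrite mulE; exact: tst_mul.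
have key s f : s ^+ 2 = 1 -> tst (cube 0 d) f -> bigO N.+3 (fun t => Wint w1 w2 s t f).
  move=> s2; apply: (corner_order iu1 iu2 cp1 cp2 H1 H2 k20 u0 s2) => {}f tf.
  (* The weight z_0 makes the integrand vanish to order N + 1 on the edge, hence the order N + 3
     that the bootstrap takes as input. *)
  have hz w : cinf w -> vanish d N w -> bigO N.+3 (fun t => Bint s t (fun z => w z * fz 1 f z)).
    move=> cw vw; rewrite (_ : (fun z => _) = fun z => z ord0 i0 * (f z * w z)); last first.
      by apply/funext => z; rewrite /fz expr1 mulrC mulrA.
    have tfw := tst_mul tf cw; apply: (@Bint_order d).
      by apply: tw => //; exact: smooth_coord.
    by apply: vanish_z0; [exact: tst_cinf tfw|apply: vanishM => //; exact: tst_cinf tf].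
  by apply: bigO_D; [exact: hz|apply: bigO_Z; exact: hz].
pose sg i := nseq (N - i) i1 ++ nseq i i0.
have cws i : cword (sg i) by rewrite /cword all_cat !all_nseq /= orbT !orbT.
have ssz i : (i <= N)%N -> size (sg i) = N by move=> iN; rewrite size_cat !size_nseq subnK.
pose X i y : R[i] := dpart (sg i) w1 (edge y) +i* dpart (sg i) w2 (edge y).
pose A i y : R[i] := dpart (sg i) W1 (edge y) +i* dpart (sg i) W2 (edge y).
have XA i y : (i <= N)%N -> edge_set d y -> X i y = (q1 (edge y) +i* q2 (edge y)) * A i y.
  move=> iN ey; have top q W : cinf q -> cinf W -> vanish d N W -> dpart (sg i) (fun z => q z * W z) (edge y) = q (edge y) * dpart (sg i) W (edge y).
    by move=> cq cW vW; apply: (dpart_mul_top (d := d)) => //; rewrite ssz.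
  have e1 : dpart (sg i) w1 (edge y) = q1 (edge y) * dpart (sg i) W1 (edge y) - q2 (edge y) * dpart (sg i) W2 (edge y).
    rewrite (_ : w1 = fun z => q1 z * W1 z + (-1) * (q2 z * W2 z)); last by apply/funext => z; rewrite mulN1r.
    rewrite dpartD; [|exact: smoothM|by apply: smoothZ; exact: smoothM].
    by rewrite dpartZ; [rewrite !top// mulN1r|exact: smoothM].
  have e2 : dpart (sg i) w2 (edge y) = q1 (edge y) * dpart (sg i) W2 (edge y) + q2 (edge y) * dpart (sg i) W1 (edge y).
    by rewrite dpartD; [rewrite !top|exact: smoothM|exact: smoothM].
  by apply: complex_ext; rewrite !reim /= ?e1 ?e2; ring.
(* The leading coefficient is an integral over the edge against an arbitrary function there; the
   fundamental lemma, applied to real and imaginary parts, makes its vanishing pointwise. *)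
have S s y : s ^+ 2 = 1 -> edge_set d y -> \sum_(i < N.+1) c1 s ^+ i.+1 * c2 s ^+ (N - i).+1 * X i y = 0.
  move=> s2; pose coef (i : 'I_N.+1) : R[i] := c1 s ^+ i.+1 * c2 s ^+ (N - i).+1.
  pose h1 y := complex.Re (\sum_(i < N.+1) coef i * X i y).
  pose h2 y := complex.Im (\sum_(i < N.+1) coef i * X i y).
  have h1E y' : h1 y' = \sum_(i < N.+1) (complex.Re (coef i) * dpart (sg i) w1 (edge y') - complex.Im (coef i) * dpart (sg i) w2 (edge y')).
    by rewrite /h1 cRe_sum; apply: eq_bigr => i _; rewrite reim.
  have h2E y' : h2 y' = \sum_(i < N.+1) (complex.Re (coef i) * dpart (sg i) w2 (edge y') + complex.Im (coef i) * dpart (sg i) w1 (edge y')).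
    by rewrite /h2 cIm_sum; apply: eq_bigr => i _; rewrite reim.
  have ce w i : cinf w -> cinf (fun y => dpart (sg i) w (edge y)) by move=> cw; apply: cinf_edge; exact: cinf_dpart.
  have ch1 : cinf h1.
    have -> := funext h1E.
    by apply: smooth_sum => i; apply: smoothB; apply: smoothZ; exact: ce.
  have ch2 : cinf h2.
    have -> := funext h2E.
    by apply: smooth_sum => i; apply: smoothD; apply: smoothZ; exact: ce.
  have T0 f : tst (cube 0 d) f -> Tsum N s (Eder (fun z => w1 z * f z)) + im * Tsum N s (Eder (fun z => w2 z * f z)) = 0.
    move=> tf; have t1 := tw _ _ cw1 tf; have t2 := tw _ _ cw2 tf.
    have vf w : cinf w -> vanish d N w -> vanish d N (fun z => w z * f z).
      by move=> cw vw; rewrite mulE; apply: vanishM => //; exact: tst_cinf tf.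
    have l1 := Bint_lead s t1 (fun i j ij => Eder_vanish t1 (vf _ cw1 vw1) ij).
    have l2 := Bint_lead s t2 (fun i j ij => Eder_vanish t2 (vf _ cw2 vw2) ij).
    apply: (@bigO_lead R N.+2).
    apply: (bigO_ext _ (bigO_B (key s f s2 tf) (bigO_D l1 (bigO_Z im l2)))) => t _.
    rewrite /Wint; ring.
  have pf f : tst (cube 0 d) f -> L1 (fun y => pos y * f (edge y)) by move=> tf; exact: pos_L1 (tst_slice 0 (tst_slice 0 tf)).
  have EX f (i : 'I_N.+1) : tst (cube 0 d) f ->
     (Eder (fun z => w1 z * f z) (N - i) i +i* Eder (fun z => w2 z * f z) (N - i) i) =
     (Eint (fun y => f (edge y) * dpart (sg i) w1 (edge y)) +i* Eint (fun y => f (edge y) * dpart (sg i) w2 (edge y))).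
    by move=> tf; rewrite (Eder_top cw1 tf vw1 (leq_ord i)) (Eder_top cw2 tf vw2 (leq_ord i)).
  have iE f w i : tst (cube 0 d) f -> cinf w -> L1 (fun y => pos y * (f (edge y) * dpart (sg i) w (edge y))).
    by move=> tf cw; exact: pos_L1 (tst_mul (tst_slice 0 (tst_slice 0 tf)) (ce w i cw)).
  have Z f : tst (cube 0 d) f -> Eint (fun y => f (edge y) * h1 y) = 0 /\ Eint (fun y => f (edge y) * h2 y) = 0.
    move=> tf; have := T0 f tf; rewrite Tsum_reim => E.
    have [E1' E2'] : Eint (fun y => f (edge y) * h1 y) = complex.Re 0 /\ Eint (fun y => f (edge y) * h2 y) = complex.Im 0.
      rewrite -E cRe_sum cIm_sum; split.
        rewrite /Eint (_ : (fun y => _) = fun y => \sum_(i < N.+1) (complex.Re (coef i) * (pos y * (f (edge y) * dpart (sg i) w1 (edge y)))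
            - complex.Im (coef i) * (pos y * (f (edge y) * dpart (sg i) w2 (edge y))))); last first.
          by apply/funext => y'; rewrite h1E !mulr_sumr; apply: eq_bigr => i _; ring.
        rewrite Rint_sum; last by move=> i; apply: L1B; apply: L1Z; exact: iE.
        apply: eq_bigr => i _; rewrite RintB; [|by apply: L1Z; exact: iE|by apply: L1Z; exact: iE].
        rewrite (RintZ _ (iE f w1 i tf cw1)) (RintZ _ (iE f w2 i tf cw2)) EX//.
        set A1 := Eint _; set A2 := Eint _.
        by have -> : complex.Re (c1 s ^+ i.+1 * c2 s ^+ (N - i).+1 * (A1 +i* A2)) = complex.Re (coef i) * A1 - complex.Im (coef i) * A2 by rewrite cReM.
      rewrite /Eint (_ : (fun y => _) = fun y => \sum_(i < N.+1) (complex.Re (coef i) * (pos y * (f (edge y) * dpart (sg i) w2 (edge y)))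
            + complex.Im (coef i) * (pos y * (f (edge y) * dpart (sg i) w1 (edge y))))); last first.
        by apply/funext => y'; rewrite h2E !mulr_sumr; apply: eq_bigr => i _; ring.
      rewrite Rint_sum; last by move=> i; apply: L1D; apply: L1Z; exact: iE.
      apply: eq_bigr => i _; rewrite RintD; [|by apply: L1Z; exact: iE|by apply: L1Z; exact: iE].
      rewrite (RintZ _ (iE f w2 i tf cw2)) (RintZ _ (iE f w1 i tf cw1)) EX//.
      set A1 := Eint _; set A2 := Eint _.
      by have -> : complex.Im (c1 s ^+ i.+1 * c2 s ^+ (N - i).+1 * (A1 +i* A2)) = complex.Re (coef i) * A2 + complex.Im (coef i) * A1 by rewrite cImM.
    by rewrite E1' E2'.
  move=> ey; apply: complex_ext.
    exact: (edge_fundamental d0 ch1 (fun f tf => (Z f tf).1) ey).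
  exact: (edge_fundamental d0 ch2 (fun f tf => (Z f tf).2) ey).
have A0 i y : (i <= N)%N -> edge_set d y -> A i y = 0.
  move=> iN ey; move: i iN; apply: alternating_eq0 => [i iN|s s2].
    rewrite /A /sg (edge_alternate d0 cW1 sW1 v1 ey iN) (edge_alternate d0 cW2 sW2 v2 ey iN).
    by apply: complex_ext; rewrite !reim.
  (* At - s the ratio c1/c2 is i s, as [alternating_eq0] expects. The common factor contains the
     value of q1 + i q2, nonzero in the cube. *)
  have sN : (- s) ^+ 2 = 1 by rewrite sqrrN.
  have := S (- s) y sN ey.
  have c20 : c2 (- s) != 0 :> R[i] by rewrite invr_eq0 (@cxM R (- s)).2.
  have c10 : c1 (- s) != 0 :> R[i] by rewrite invr_eq0 (@cxM R (- s)).1.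
  rewrite (eq_bigr (fun i : 'I_N.+1 => ((q1 (edge y) +i* q2 (edge y)) * (c1 (- s) * c2 (- s) ^+ N.+1)) * ((0 +i* s) ^+ i * A i y))); last first.
    move=> i _; have iN := leq_ord i; rewrite XA// [c1 _ ^+ i.+1]exprS c12// opprK exprMn.
    have -> : c2 (- s) ^+ N.+1 = c2 (- s) ^+ i * c2 (- s) ^+ (N - i).+1 by rewrite -exprD; congr (_ ^+ _); lia.
    ring.
  rewrite -mulr_sumr => /eqP; rewrite !mulf_eq0 expf_eq0 (negbTE c10) (negbTE c20) andbF !orbF.
  by rewrite (negbTE (q0 (edge_cube d0 ey))) => /eqP.
split; apply: vanish_next => // i iN y ey.
  by have /(congr1 (@complex.Re R)) := A0 i y iN ey.
by have /(congr1 (@complex.Im R)) := A0 i y iN ey.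
Qed.

Lemma corner_flat N : vanish d N W1 /\ vanish d N W2.
Proof. by elim: N => [|N [v1 v2]]; [split => s _|exact: corner_step]. Qed.

End step.
(** Two moves along axes lead from the edge to an open set: one along [z_0], made for every [z_1]
    derivative of [W] since mixed derivatives vanish on the edge too, then one along [z_1]. *)
Lemma flat_vanish (d : R) : 0 < d -> exists (c : 'rV[R]_n.+2) (r : R), [/\ 0 < r, forall z, cube c r z -> forall i, 0 < z ord0 i < d &
  forall k W, cinf W -> csol (cube 0 d) (k ^+ 2) W -> (forall M, vanish d M W) -> forall z, cube c r z -> W z = 0].
Proof.
move=> d0; have [kap /andP[k0 k1] hax] := @helm_axis R n.+2.
(* Points of the cube below have z_0 and z_1 less than 2 rho = kap d / 8, within reach of the axis
   lemma on cubes of half-side d/4 and d/8. *)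
pose rho := kap * d / 16; have rho0 : 0 < rho by rewrite divr_gt0// mulr_gt0.
have kd : kap * d < d by rewrite gtr_pMl.
have rho1 : 16 * rho = kap * d by rewrite /rho; field.
(* The edge coordinates sit at d/2 so as to stay in (d/4, 3 d/4); the cubes used then remain in
   [cube 0 d]. *)
pose c : 'rV[R]_n.+2 := rV_cons (rho, rV_cons (rho, const_mx (d / 2))).
exists c, (rho / 2).
have cz z : cube c (rho / 2) z -> [/\ 0 < z ord0 i0 < 2 * rho, 0 < z ord0 i1 < 2 * rho &
    forall i, d / 4 < z ord0 (lift ord0 (lift ord0 i)) < 3 * d / 4].
  move=> h; have := h i0; have := h i1; rewrite /c rV_consS !rV_cons0 /= !ltr_distl => /andP[a1 a2] /andP[b1 b2].
  split; [lra|lra|move=> i; have := h (lift ord0 (lift ord0 i))].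
  by rewrite /c !rV_consS mxE /= ltr_distl => /andP[e1 e2]; lra.
split; first by rewrite divr_gt0.
  move=> z /cz[/andP[a1 a2] /andP[b1 b2] e] j; case: (unliftP ord0 j) => [l ->|->]; last by lra.
  case: (unliftP ord0 l) => [m ->|->]; last by lra.
  by have /andP[e1 e2] := e m; lra.
move=> k W cW sW vW z /cz[/andP[a1 a2] /andP[b1 b2] e].
pose y := rtail (rtail z).
have yE i : y ord0 i = z ord0 (lift ord0 (lift ord0 i)) by rewrite !mxE.
have ey : edge_set d y by move=> i; rewrite yE; have /andP[e1 e2] := e i; lra.
pose q := rV_cons (z ord0 i0, rV_cons (0, y)) : 'rV[R]_n.+2.
have near (x : 'rV[R]_n.+2) (s : R) : 0 <= x ord0 i0 -> x ord0 i1 = 0 -> (forall i, x ord0 (lift ord0 (lift ord0 i)) = y ord0 i) ->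
    x ord0 i0 + s <= d -> s <= d / 4 -> cube x s `<=` cube 0 d.
  move=> x0 x1 xy xs sd w wx j; rewrite [X in _ - X]mxE subr0.
  case: (unliftP ord0 j) => [l ->|->].
    case: (unliftP ord0 l) => [m ->|->].
      have := wx (lift ord0 (lift ord0 m)); rewrite xy yE ltr_distl => /andP[h1 h2].
      by have /andP[e1 e2] := e m; rewrite ltr_norml; lra.
    by have := wx i1; rewrite x1 subr0 => h; lra.
  by have := wx i0; rewrite ltr_distl ltr_norml => /andP[h1 h2]; lra.
have Eq : q = edge y + z ord0 i0 *: delta_mx ord0 i0.
  apply/rowP => j; case: (unliftP ord0 j) => [l ->|->].
    have nl : (lift ord0 l == i0) = false by rewrite eq_sym (negbTE (neq_lift _ _)).
    by rewrite [RHS]mxE /q /edge !rV_consS !mxE nl andbF mulr0 addr0.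
  by rewrite [RHS]mxE /q /edge !rV_cons0 !mxE !eqxx mulr1 add0r.
have Ez : z = q + z ord0 i1 *: delta_mx ord0 i1.
  apply/rowP => j; case: (unliftP ord0 j) => [l ->|->]; last first.
    by rewrite [RHS]mxE /q rV_cons0 !mxE andbF mulr0 addr0.
  rewrite [RHS]mxE /q rV_consS; case: (unliftP ord0 l) => [m ->|->].
    have nm : (lift ord0 (lift ord0 m) == i1) = false by rewrite (inj_eq lift_inj) eq_sym (negbTE (neq_lift _ _)).
    by rewrite rV_consS yE !mxE nm andbF mulr0 addr0.
  by rewrite rV_cons0 !mxE !eqxx mulr1 add0r.
have edgeE : [/\ edge y ord0 i0 = 0, edge y ord0 i1 = 0 & forall i, edge y ord0 (lift ord0 (lift ord0 i)) = y ord0 i].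
  by rewrite /edge; split; rewrite ?rV_cons0 ?rV_consS ?rV_cons0// => i; rewrite !rV_consS.
have qE : [/\ q ord0 i0 = z ord0 i0, q ord0 i1 = 0 & forall i, q ord0 (lift ord0 (lift ord0 i)) = y ord0 i].
  by rewrite /q; split; rewrite ?rV_cons0 ?rV_consS ?rV_cons0// => i; rewrite !rV_consS.
have d4 : 0 < d / 4 by rewrite divr_gt0.
have d8 : 0 < d / 8 by rewrite divr_gt0.
have W1 j : dpart (nseq j i1) W q = 0.
  have cd := cinf_dpart (nseq j i1) cW.
  rewrite Eq; apply: (hax k (dpart (nseq j i1) W) (edge y) (d / 4) i0 d4 cd).
  - apply: csol_sub (csol_dpart (nseq j i1) (@open_cube _ _ _ _) cW sW).
    by have [x0 x1 xy] := edgeE; apply: near => //; rewrite x0 ?add0r; lra.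
  - move=> m; rewrite -dpart_cat; apply: (vW (m + j).+1) => //.
      by rewrite /cword all_cat !all_nseq /= orbT !orbT.
    by rewrite size_cat !size_nseq.
  - by rewrite gtr0_norm//; lra.
rewrite Ez; apply: (hax k W q (d / 8) i1 d8 cW _ W1).
- apply: csol_sub sW; have [x0 x1 xy] := qE; apply: near => //; rewrite ?x0; lra.
- by rewrite gtr0_norm//; lra.
Qed.

End corner.

(** * Reduction to the corner *)

Section sobolev.
Context {R : realType} {n : nat}.
Notation leb := (lebesgue_rV n : {measure set 'rV[R]_n -> \bar R}).
Notation Rint F := (Rintegral leb setT F).
Implicit Types (D : set 'rV[R]_n) (f g h F G psi theta : 'rV[R]_n -> R) (x y : 'rV[R]_n).

(** |f| <= 1 + f^2 on a set of finite measure. *)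
Lemma L2_L1 D f : measurable D -> (leb D < +oo)%E -> L2 D f -> L1 (f \_ D).
Proof.
move=> mD fD l2.
have mf : measurable_fun setT (f \_ D) by move: l2; rewrite /L2 inE => /andP[]; rewrite inE.
have iG : L1 (fun x => \1_D x + (f \_ D) x ^+ 2).
  by apply: L1D; [exact: L1_indic|exact: Lfun2_integrable_sqr].
apply: le_L1 mf iG _ => x.
have h0 : 0 <= (\1_D x : R) + (f \_ D) x ^+ 2.
  by rewrite addr_ge0 ?sqr_ge0// indicE ler0n.
rewrite (ger0_norm h0) indicE patchE; case: ifPn => [xD|xD].
  have f1 : true%:R = 1 :> R by [].
  rewrite f1 ler_norml; nra.
by rewrite normr0 addr_ge0 ?ler0n// sqr_ge0.
Qed.

Lemma tst_L2_norm D theta : tst D theta -> (Lnorm leb 2%:E (EFin \o theta) < +oo)%E.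
Proof.
move=> tt; have i2 : L1 (fun x => theta x ^+ 2).
  by apply: (@tst_L1 _ _ D); exact: (tst_mul tt (tst_cinf tt)).
rewrite unlock; apply: poweR_lty.
have [_] := integrableP _ _ _ i2; apply: le_lt_trans.
rewrite le_eqVlt; apply/orP; left; apply/eqP; apply: eq_integral => x _ /=.
by rewrite powR_mulrn ?normr_ge0// normrX.
Qed.

Lemma cvg_L2_pair D (e : nat -> 'rV[R]_n -> R) theta : tst D theta ->
  (forall j, L1 (e j)) -> (fun j => Lnorm leb 2%:E (EFin \o e j)) @ \oo --> 0%E ->
  Rint (fun x => e j x * theta x) @[j --> \oo] --> 0.
Proof.
move=> tt ie ce.
have [M M0 hM] := tst_bounded tt.
have mt := tst_measurable tt.
have ip j : L1 (fun x => e j x * theta x) by apply: L1_mul (ie j) mt hM.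
have c0 := Lnorm_ge0 leb 2%:E (EFin \o theta).
have cf := tst_L2_norm tt.
set c := Lnorm leb 2%:E (EFin \o theta) in c0 cf.
have cN : c \is a fin_num by rewrite ge0_fin_numE.
have bnd j : (`|Rint (fun x => e j x * theta x)|%:E <= Lnorm leb 2%:E (EFin \o e j) * c)%E.
  have h2 : (0 : R) < 2 by [].
  have h22 : (2^-1 + 2^-1 : R) = 1 by rewrite [RHS]splitr !div1r.
  have hh := @hoelder _ _ _ leb (e j) theta 2 2 (L1_measurable (ie j)) mt h2 h2 h22.
  apply: le_trans hh; rewrite Lnorm1.
  have := norm_Rint (ip j); rewrite -lee_fin => /le_trans; apply.
  by rewrite -EFin_Rintegral; [exact: lexx|exact: L1_norm (ip j)].
have cv : (fun j => Lnorm leb 2%:E (EFin \o e j) * c)%E @ \oo --> (0 : R)%:E.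
  by have := cvgeZr cN ce; rewrite mul0e.
apply: norm_cvg0.
suff /fine_cvgP[_] : (fun j => (`|Rint (fun x => e j x * theta x)|)%:E) @ \oo --> (0 : R)%:E by [].
apply: (squeeze_cvge (f := cst 0%E) _ _ cv); last exact: cvg_cst.
by apply: nearW => j; rewrite lee_fin normr_ge0 bnd.
Qed.

Lemma ae_eq_local D f h : locally_integrable_rV D f -> locally_integrable_rV D h ->
  (forall psi, tst D psi -> Rintegral leb D (fun x => f x * psi x) = Rintegral leb D (fun x => h x * psi x)) ->
  {ae leb, forall x, D x -> f x = h x}.
Proof.
move=> lf lh fh; have [oD _ _] := lf.
have rs f0 psi : locally_integrable_rV D f0 -> tst D psi ->
    Rintegral leb D (fun x => f0 x * psi x) = Rint (fun x => (f0 \_ (supp psi)) x * psi x) /\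
    L1 (fun x => (f0 \_ (supp psi)) x * psi x).
  move=> lf0 tp; split.
    by apply: Rint_restrict; [exact: tst_sub tp|move=> x; exact: supp_out].
  have [M M0 hM] := tst_bounded tp.
  exact: L1_mul (loc_int_L1 lf0 (tst_compact tp) (tst_sub tp)) (tst_measurable tp) hM.
have : {ae leb, forall x, D x -> f x - h x = 0}.
  apply: fundamental_lemma => //.
    move=> S cS SD; have := L1B (loc_int_L1 lf cS SD) (loc_int_L1 lh cS SD).
    suff -> : (fun x => f x - h x) \_ S = (fun x => (f \_ S) x - (h \_ S) x) by [].
    by apply/funext => x; rewrite !patchE; case: ifP => // _; rewrite subr0.
  move=> psi tp; have := fh psi tp.
  have [e1 i1] := rs f psi lf tp; have [e2 i2] := rs h psi lh tp.
  rewrite e1 e2 => e12.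
  rewrite (@Rint_restrict _ _ D (supp psi)); [|exact: tst_sub tp|by move=> x; exact: supp_out].
  have := RintB i1 i2; rewrite e12 subrr => <-; apply: eq_Rintegral => x _.
  by rewrite !patchE; case: (x \in supp psi); rewrite ?mul0r ?subr0 ?mulrBl.
apply: filterS => x h0 /h0 /eqP; rewrite subr_eq0 => /eqP e; exact: e.
Qed.

Lemma ae_L1_restrict D f h : measurable D -> measurable_fun D f -> L1 (h \_ D) ->
  {ae leb, forall x, D x -> f x = h x} -> L1 (f \_ D).
Proof.
move=> mD mf ih fh.
have m1 : measurable_fun setT (f \_ D) by apply/(measurable_restrictT f mD).
have [mh hh] := integrableP _ _ _ ih.
apply/integrableP; split; first exact/measurable_EFinP.
apply: le_lt_trans hh; rewrite le_eqVlt; apply/orP; left; apply/eqP.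
apply: ae_eq_integral => //.
- by apply: measurableT_comp => //; exact/measurable_EFinP.
- exact: measurableT_comp.
apply: filterS fh => x hx _ /=; rewrite !patchE; case: ifPn => // /set_mem /hx -> //.
Qed.

Lemma ae_Rint_restrict D f h theta : tst setT theta -> L1 (f \_ D) -> L1 (h \_ D) ->
  {ae leb, forall x, D x -> f x = h x} ->
  Rint (fun x => (f \_ D) x * theta x) = Rint (fun x => (h \_ D) x * theta x).
Proof.
move=> tt i1 i2 fh; have mt := tst_measurable tt.
apply: ae_Rint; [exact: measurable_funM (L1_measurable i1) mt|exact: measurable_funM (L1_measurable i2) mt|].
by apply: filterS fh => x hx; rewrite !patchE; case: ifPn => // /set_mem /hx ->.
Qed.

Lemma L1_locally_integrable D f : open D -> L1 (f \_ D) -> locally_integrable_rV D f.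
Proof.
move=> oD h; have mD := open_measurable_rV oD.
have iD : leb.-integrable D (EFin \o f).
  by apply/(integrable_mkcond (EFin \o f) mD); rewrite restrict_EFin.
split => //; first by have [/measurable_EFinP] := integrableP _ _ _ iD.
by move=> A AD cA; apply: integrableS AD iD => //; exact: compact_measurable_rV.
Qed.

Lemma restrict_dpart D psi s : tst D psi -> dpart s psi \_ D = dpart s psi.
Proof.
move=> tp; apply/funext => x; rewrite patchE; case: ifPn => //; rewrite notin_setE => nD.
by rewrite (tst_out (tst_dpart s tp) nD).
Qed.

Lemma H20_pair D g s (psi : nat -> 'rV[R]_n -> R) theta : (forall j, tst D (psi j)) ->
  tst setT theta -> L1 (g \_ D) ->
  (fun j => Lnorm leb 2%:E (EFin \o ((dpart s (psi j) \- g) \_ D))) @ \oo --> 0%E ->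
  Rint (fun x => dpart s (psi j) x * theta x) @[j --> \oo] --> Rint (fun x => (g \_ D) x * theta x).
Proof.
move=> tp tt ig cg.
have sp j : (dpart s (psi j) \- g) \_ D = fun x => dpart s (psi j) x - (g \_ D) x.
  apply/funext => x; rewrite -{2}(restrict_dpart s (tp j)) !patchE /=.
  by case: (x \in D); rewrite ?subr0.
have i1 j : L1 (fun x => dpart s (psi j) x - (g \_ D) x).
  exact: L1B (tst_L1 (tst_dpart s (tp j))) ig.
have i0 j : L1 ((dpart s (psi j) \- g) \_ D) by rewrite sp.
have c0 := cvg_L2_pair tt i0 cg.
apply/subr_cvg0; move: c0; apply: cvg_trans; apply: near_eq_cvg.
have [M M0 hM] := tst_bounded tt; have mt := tst_measurable tt.
apply: nearW => j /=; rewrite /GRing.sub_fun /= -RintB.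
- by apply: eq_Rintegral => x _; rewrite sp; ring.
- exact: L1_mul (tst_L1 (tst_dpart s (tp j))) mt hM.
- exact: L1_mul ig mt hM.
Qed.

Lemma cvg_sum_seq (I : Type) (r : seq I) (a : I -> nat -> R) (l : I -> R) :
  (forall i, a i j @[j --> \oo] --> l i) -> \sum_(i <- r) a i j @[j --> \oo] --> \sum_(i <- r) l i.
Proof.
move=> h; elim: r => [|i r IH].
  by rewrite big_nil; under eq_fun do rewrite big_nil; exact: cvg_cst.
by rewrite big_cons; under eq_fun do rewrite big_cons; exact: cvgD (h i) IH.
Qed.

(* The identity holds for the test functions psi j approximating f in H^2, and
   these can be paired with any theta, not only with those supported in D. *)
Lemma H20_extend D f G : open D -> (leb D < +oo)%E -> H20 D f -> weak_laplacian D f G ->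
  [/\ L1 (f \_ D), L1 (G \_ D) & forall theta, tst setT theta ->
    Rint (fun x => (f \_ D) x * laplacian theta x) = Rint (fun x => (G \_ D) x * theta x)].
Proof.
move=> oD fD [g [hg [psi [tpsi cpsi]]]] [lf lG fG].
have mD := open_measurable_rV oD.
have tp j : tst D (psi j) by apply/tstP; exact: tpsi.
have ig s : (size s <= 2)%N -> L1 (g s \_ D).
  by move=> /hg[l2 _]; exact: L2_L1 l2.
have ii i : L1 (g [:: i; i] \_ D) by apply: ig.
have i0 : L1 (g [::] \_ D) by apply: ig.
have SE : (fun x => \sum_i g [:: i; i] x) \_ D = fun x => \sum_i (g [:: i; i] \_ D) x.
  apply/funext => x; under eq_bigr do rewrite patchE.
  by rewrite patchE; case: (x \in D) => //; rewrite big1.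
have iS : L1 ((fun x => \sum_i g [:: i; i] x) \_ D) by rewrite SE; exact: L1_sum.
have key theta : tst setT theta -> Rint (fun x => (g [::] \_ D) x * laplacian theta x) =
    Rint (fun x => ((fun x => \sum_i g [:: i; i] x) \_ D) x * theta x).
  move=> tt; rewrite SE; have [M M0 hM] := tst_bounded tt; have mt := tst_measurable tt.
  have -> : Rint (fun x => (\sum_i (g [:: i; i] \_ D) x) * theta x) =
      \sum_i Rint (fun x => (g [:: i; i] \_ D) x * theta x).
    rewrite -Rint_sum; last by move=> i; exact: L1_mul (ii i) mt hM.
    by apply: eq_Rintegral => x _; rewrite mulr_suml.
  have c1 := H20_pair (s := [::]) tp (tst_laplacian tt) i0 (cpsi [::] isT).
  have c2 := cvg_sum_seq (r := index_enum 'I_n) (fun i => H20_pair (s := [:: i; i]) tp tt (ii i) (cpsi [:: i; i] isT)).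
  apply: (cvg_unique _ c1) => //; move: c2; apply: cvg_trans; apply: near_eq_cvg; apply: nearW => j.
  rewrite /= -(Rint_laplacian (tp j) (tst_cinf tt)) -Rint_sum; last first.
    by move=> i; exact: L1_mul (tst_L1 (tst_dpart [:: i; i] (tp j))) mt hM.
  by apply: eq_Rintegral => x _; rewrite /laplacian mulr_suml.
(* [g [::]], the weak derivative of order 0, is [f] almost everywhere. *)
have f0 : {ae leb, forall x, D x -> f x = g [::] x}.
  have [_ [_ lg0 hg0]] := hg [::] isT.
  apply: ae_eq_local => // psi' tp'; have := hg0 psi' ((tstP _ _).2 tp').
  by rewrite expr0 mul1r.
have [_ mf _] := lf; have [_ mG _] := lG.
have iF := ae_L1_restrict mD mf i0 f0.
have fE theta : tst setT theta -> Rint (fun x => (f \_ D) x * theta x) = Rint (fun x => (g [::] \_ D) x * theta x).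
  by move=> tt; exact: ae_Rint_restrict.
have lS : locally_integrable_rV D (fun x => \sum_i g [:: i; i] x) by exact: L1_locally_integrable.
(* Testing inside [D] identifies [G] with the sum of the second weak derivatives, for which the
   identity with arbitrary [theta] is already available. *)
have G0 : {ae leb, forall x, D x -> G x = \sum_i g [:: i; i] x}.
  apply: ae_eq_local => // theta tt; rewrite -(fG theta ((tstP _ _).2 tt)).
  rewrite (@Rint_restrict _ _ D D) // ; last by move=> x; exact: tst_out (tst_laplacian tt).
  rewrite (@Rint_restrict _ _ D D) // ; last by move=> x; exact: tst_out tt.
  have tT := tst_weaken (@subsetT _ D) tt.
  by rewrite (fE _ (tst_laplacian tT)) key.
have iG := ae_L1_restrict mD mG iS G0.
split => // theta tt; rewrite (fE _ (tst_laplacian tt)) key//.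
by apply/esym; exact: ae_Rint_restrict.
Qed.

End sobolev.

(** * Local representatives, unique continuation and rigid motions *)

Section continuation.
Context {R : realType} {n : nat}.
Notation leb := (lebesgue_rV n : {measure set 'rV[R]_n -> \bar R}).
Notation Rint F := (Rintegral leb setT F).
Implicit Types (A D : set 'rV[R]_n) (f g F G W psi theta : 'rV[R]_n -> R) (x y z b : 'rV[R]_n) (Q : 'M[R]_n).

Lemma cube_sub x y (r s : R) : (forall i, `|y ord0 i - x ord0 i| + s <= r) -> cube y s `<=` cube x r.
Proof.
move=> h z yz i; apply: lt_le_trans (h i); have := yz i.
have := ler_distD (y ord0 i) (z ord0 i) (x ord0 i); lra.
Qed.

(** Weyl's lemma on a cube around [x], after cutting [F] to a compact cube where it is
    integrable. *)
Lemma weak_laplacian_rep (k : R) A F x : weak_laplacian A F (fun y => - (k ^+ 2 * F y)) -> A x ->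
  exists2 r : R, 0 < r & exists W, [/\ cube x r `<=` A, cinf W, csol (cube x r) (k ^+ 2) W &
    {ae leb, forall y, cube x r y -> F y = W y}].
Proof.
move=> [lF lG wF] Ax; have [oA mF _] := lF.
have [e e0 he] := open_nbhs_cube oA Ax.
have e2 : 0 < e / 2 by rewrite divr_gt0.
have e4 : 0 < e / 4 by rewrite divr_gt0.
pose S : set 'rV[R]_n := [set y | forall i, `|y ord0 i - x ord0 i| <= e / 2].
have SA : S `<=` A.
  by move=> y Sy; apply: he => i; apply: le_lt_trans (Sy i) _; rewrite gtr_pMr// invf_lt1// ltr1n.
have cS : compact S by exact: ccube_compact.
have iF := loc_int_L1 lF cS SA.
have CS : cube x (e / 2) `<=` S by move=> y yx i; apply: ltW; exact: yx.
have w : weak_sol (cube x (e / 2)) (k ^+ 2) (F \_ S).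
  move=> psi tp; have tA := tst_weaken (subset_trans CS SA) tp.
  have out y : ~ S y -> psi y = 0 by move=> nS; apply: (tst_out tp) => /CS.
  have outl y : ~ S y -> laplacian psi y = 0.
    by move=> nS; apply: (tst_out (tst_laplacian tp)) => /CS.
  have := wF psi ((tstP _ _).2 tA).
  rewrite (Rint_restrict _ SA outl) (Rint_restrict _ SA out).
  have il : L1 (fun y => (F \_ S) y * laplacian psi y) := L1_tst iF (tst_laplacian tp).
  have ip : L1 (fun y => (F \_ S) y * psi y) := L1_tst iF tp.
  have -> : Rint (fun y => ((fun y => - (k ^+ 2 * F y)) \_ S) y * psi y) =
      - (k ^+ 2 * Rint (fun y => (F \_ S) y * psi y)).
    rewrite -RintZ// -RintN; last exact: L1Z.
    by apply: eq_Rintegral => y _; rewrite !patchE; case: (y \in S); [rewrite mulNr mulrA|rewrite !mul0r mulr0 oppr0].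
  move=> h; have -> : Rint (fun y => (F \_ S) y * (laplacian psi y + k ^+ 2 * psi y)) =
      Rint (fun y => (F \_ S) y * laplacian psi y) + k ^+ 2 * Rint (fun y => (F \_ S) y * psi y).
    rewrite -RintZ// -RintD//; last exact: L1Z.
    by apply: eq_Rintegral => y _; ring.
  by rewrite h; ring.
have e44 : cube x (e / 4 + e / 4) `<=` cube x (e / 2).
  by apply: cube_sub => i; rewrite subrr normr0; lra.
have [W [cW sW FW]] := helm_weyl e4 iF w e44.
have sub4 : cube x (e / 4) `<=` S.
  by apply: subset_trans CS; apply: cube_sub => i; rewrite subrr normr0; lra.
exists (e / 4) => //; exists W; split => //; first exact: subset_trans SA.
apply: filterS FW => y h xy; rewrite -(h xy) patchE; case: ifPn => //.
by rewrite notin_setE => /(_ (sub4 _ xy)).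
Qed.

(** The points near which [F] vanishes almost everywhere form an open set. It is relatively closed
    in [A] by [helm_uc], whose radius does not shrink with the initial zone of vanishing;
    connectedness does the rest. *)
Lemma weak_unique_continuation (k : R) A F x (r : R) : weak_laplacian A F (fun y => - (k ^+ 2 * F y)) ->
  0 < r -> {ae leb, forall y, cube x r y -> F y = 0} ->
  {ae leb, forall y, connected_component A x y -> F y = 0}.
Proof.
move=> wF r0 Fr; have [kap /andP[k0 k1] huc] := @helm_uc R n.
pose Z : set 'rV[R]_n := [set y | exists2 s : R, 0 < s & {ae leb, forall z, cube y s z -> F z = 0}].
have oZ : open Z.
  rewrite openE => y [s s0 hs]; have s2 : 0 < s / 2 by rewrite divr_gt0.
  apply/nbhs_ballP; exists (s / 2) => // z; rewrite (ball_cube y s2) => yz; exists (s / 2) => //.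
  apply: filterS hs => w hw zw; apply: hw; move: zw; apply: cube_sub => i.
  by have := yz i; lra.
have clZ : closure Z `&` A `<=` Z.
  move=> y [cy Ay]; have [s s0 [W [sA cW sW FW]]] := weak_laplacian_rep wF Ay.
  have s2 : 0 < s / 2 by rewrite divr_gt0.
  (* A point [z] of the zone lies within [q] of [y], and [W] vanishes on the cube of half-side kap s
     / 2 = 2 q about [z], which contains the cube of half-side [q] about [y]. *)
  pose q := kap * (s / 4); have q0 : 0 < q by rewrite mulr_gt0 ?divr_gt0.
  have nb : nbhs y (cube y q) by apply: open_nbhs_nbhs; split; [exact: open_cube|exact: cube_center].
  have [z [[t t0 zt] yz]] := cy _ nb.
  have qs : q <= s / 4 by rewrite ger_pMl ?divr_gt0// ltW.
  have zs : cube z (s / 2) `<=` cube y s by apply: cube_sub => i; have := yz i; lra.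
  pose d := Num.min t (s / 2).
  have d0 : 0 < d by rewrite lt_min t0.
  have W0 : forall w, cube z d w -> W w = 0.
    apply: (ae_continuous_eq0 (@open_cube R n z d) (cinf_continuous cW)).
    have dt : cube z d `<=` cube z t by apply: cube_sub => i; rewrite subrr normr0 add0r ge_min lexx.
    have ds : cube z d `<=` cube z (s / 2) by apply: cube_sub => i; rewrite subrr normr0 add0r ge_min lexx orbT.
    by apply: filterS2 zt FW => w h1 h2 zw; rewrite -h2 ?h1//; [exact: dt|exact/zs/ds].
  have WZ := huc k W z _ d s2 d0 cW (csol_sub zs sW) W0.
  exists q => //; apply: filterS FW => w hw yw; rewrite hw; last first.
    by move: yw; apply: cube_sub => i; rewrite subrr normr0; lra.
  apply: WZ; move: yw; apply: cube_sub => i; have := yz i; rewrite distrC /q; lra.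
apply: ae_local => y [C [Cx CA cC] Cy].
suff : C `&` Z = C by move=> CZ; move: Cy; rewrite -{1}CZ => -[].
apply: cC; first by exists x; split => //; exists r.
  by exists Z.
exists (closure Z); first exact: closed_closure.
apply/seteqP; split => w [Cw]; first by move=> Zw; split => //; exact: subset_closure.
by move=> cw; split => //; apply: clZ; split => //; exact: CA.
Qed.

Lemma orthogonal_sum Q i j : Q *m Q^T = 1%:M -> \sum_l Q l i * Q l j = (i == j)%:R.
Proof.
move=> /mulmx1C /matrixP /(_ i j); rewrite !mxE => <-.
by apply: eq_bigr => l _; rewrite mxE.
Qed.

(** After exchanging the sums, the Hessian is contracted with the Gram matrix of the columns of [Q],
    which is the identity. *)
Lemma laplacian_rigid f Q b : Q *m Q^T = 1%:M -> cinf f ->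
  laplacian (fun z => f (z *m Q + b)) = fun z => laplacian f (z *m Q + b).
Proof.
move=> oQ cf; apply/funext => z; rewrite !laplacianE.
have -> : \sum_(i < n) pd i (pd i (fun z => f (z *m Q + b))) z =
   \sum_i \sum_j \sum_l Q i j * Q i l * pd l (pd j f) (z *m Q + b).
  apply: eq_bigr => i _; rewrite (pd_affine i Q b cf) pd_sum; last first.
    by move=> j; apply: smoothZ; apply: smooth_affine; exact: cinf_pd.
  apply: eq_bigr => j _; rewrite pdZ; last by apply: smooth_affine; exact: cinf_pd.
  rewrite (pd_affine i Q b (cinf_pd j cf)) mulr_sumr.
  by apply: eq_bigr => l _; rewrite mulrA.
rewrite exchange_big /=; apply: eq_bigr => j _; rewrite exchange_big /= (bigD1 j)//= [X in _ + X]big1.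
  by rewrite -mulr_suml orthogonal_sum// eqxx mul1r addr0.
by move=> l lj; rewrite -mulr_suml orthogonal_sum// eq_sym (negbTE lj) mul0r.
Qed.

Lemma csol_rigid A (c : R) W Q b : Q *m Q^T = 1%:M -> cinf W -> csol A c W ->
  csol [set z | A (z *m Q + b)] c (fun z => W (z *m Q + b)).
Proof. by move=> oQ cW sW z Az; rewrite laplacian_rigid//; exact: sW. Qed.

Lemma rigidK Q b : Q *m Q^T = 1%:M -> cancel (fun z => z *m Q + b) (fun x => x *m Q^T - b *m Q^T).
Proof. by move=> oQ z; rewrite mulmxDl addrK -mulmxA oQ mulmx1. Qed.

Lemma rigidVK Q b : Q *m Q^T = 1%:M -> cancel (fun x => x *m Q^T - b *m Q^T) (fun z => z *m Q + b).
Proof. by move=> /mulmx1C oQ z; rewrite mulmxBl -!mulmxA oQ !mulmx1 subrK. Qed.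

Lemma preserving_rigid Q b : Q *m Q^T = 1%:M -> preserving (fun z => z *m Q + b).
Proof. by move=> oQ; apply: preserving_comp (preserving_shift b) (preserving_orthogonal oQ). Qed.

Lemma tst_rigid psi A Q b : Q *m Q^T = 1%:M -> tst A psi -> tst setT (fun x => psi (x *m Q^T - b *m Q^T)).
Proof.
move=> oQ tp; have cT := @affine_continuous R n n Q b.
apply: (@tstI _ _ _ _ ((fun z => z *m Q + b) @` supp psi)) => //.
- exact: (smooth_affine Q^T (- (b *m Q^T)) (tst_cinf tp)).
- apply: continuous_compact (tst_compact tp); exact: continuous_subspaceT.
move=> x nx; apply: supp_out => sx; apply: nx; exists (x *m Q^T - b *m Q^T) => //.
exact: rigidVK.
Qed.

Lemma weak_rigid f g psi A Q b : Q *m Q^T = 1%:M -> L1 f -> L1 g ->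
  (forall theta, tst setT theta -> Rint (fun x => f x * laplacian theta x) = Rint (fun x => g x * theta x)) ->
  tst A psi -> Rint (fun z => f (z *m Q + b) * laplacian psi z) = Rint (fun z => g (z *m Q + b) * psi z).
Proof.
move=> oQ i_f ig h tp; have pT := preserving_rigid b oQ.
pose theta x := psi (x *m Q^T - b *m Q^T).
have tt : tst setT theta by exact: tst_rigid tp.
have e z : theta (z *m Q + b) = psi z by rewrite /theta rigidK.
have el z : laplacian theta (z *m Q + b) = laplacian psi z.
  have := laplacian_rigid b oQ (tst_cinf tt).
  by move=> /(congr1 (fun h => h z)) <-; congr (laplacian _ z); apply/funext => w.
have e1 := Rintegral_preserving pT (L1_tst i_f (tst_laplacian tt)).
have e2 := Rintegral_preserving pT (L1_tst ig tt).
transitivity (Rint (fun z => f (z *m Q + b) * laplacian theta (z *m Q + b))).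
  by apply: eq_Rintegral => z _; rewrite el.
apply: etrans e1 _; apply: etrans (h theta tt) _; apply: etrans (esym e2) _.
by apply: eq_Rintegral => z _; rewrite e.
Qed.

Lemma ae_preserving (T : 'rV[R]_n -> 'rV[R]_n) (P : 'rV[R]_n -> Prop) : preserving T ->
  {ae leb, forall x, P x} -> {ae leb, forall z, P (T z)}.
Proof.
move=> [mT pT] [N [mN N0 PN]]; exists (T @^-1` N); split.
- by rewrite -[X in measurable X]setTI; exact: mT.
- by rewrite pT.
by move=> z /= nP; apply: PN.
Qed.

End continuation.

(** * The corner in normal form *)

Section chart.
Context {R : realType} {n : nat}.
Notation leb := (lebesgue_rV n : {measure set 'rV[R]_n -> \bar R}).
Implicit Types (K : rectangle R n) (Q : 'M[R]_n) (b z x : 'rV[R]_n) (m phi : 'rV[R]_n -> R[i]).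

(** The signs [s] flip the axes that point out of the rectangle at this corner, so that inward
    becomes positive; a diagonal matrix of signs times the rotation is still orthogonal. *)
Lemma corner_chart K b : corner K b -> exists Q (d : R), [/\ Q *m Q^T = 1%:M, 0 < d &
  forall z, cube 0 d z -> (rect_set K (z *m Q + b) <-> forall i, 0 <= z ord0 i)].
Proof.
move=> [y0 cy <-].
pose s : 'rV[R]_n := \row_i (if y0 ord0 i == rect_lo K ord0 i then 1 else -1).
pose E := diag_mx s; pose Q := E *m rect_rot K.
have EE : E *m E = 1%:M.
  rewrite /E mulmx_diag; apply/matrixP => i j; rewrite !mxE.
  by case: ifP => _; rewrite ?mulrNN mulr1.
(* The shortest side, capped by the neutral value 1: within [d] of the corner no opposite face is
   met. *)
pose d := \big[Order.min/1%R]_i (rect_hi K ord0 i - rect_lo K ord0 i).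
have d0 : 0 < d.
  apply: lt_bigmin => [|i _]; first exact: ltr01.
  by rewrite subr_gt0; exact: rect_lo_lt_hi.
exists Q, d; split => //.
  rewrite /Q trmx_mul tr_diag_mx -mulmxA (mulmxA (rect_rot K)) rect_rot_orth mul1mx.
  exact: EE.
move=> z zd; pose y := z *m E + y0.
have yE i : y ord0 i = z ord0 i * s ord0 i + y0 ord0 i by rewrite /y mul_mx_diag !mxE.
have -> : z *m Q + (y0 *m rect_rot K + rect_trans K) = y *m rect_rot K + rect_trans K.
  by rewrite addrA /Q mulmxA -mulmxDl.
have box : rect_set K (y *m rect_rot K + rect_trans K) <-> forall i, rect_lo K ord0 i <= y ord0 i <= rect_hi K ord0 i.
  split=> [[y' hy' /addIr /(congr1 (fun x => x *m (rect_rot K)^T))]|hy]; last by exists y.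
  by rewrite -!mulmxA rect_rot_orth !mulmx1 => <-.
have key i : (rect_lo K ord0 i <= y ord0 i <= rect_hi K ord0 i) <-> 0 <= z ord0 i.
  have di : d <= rect_hi K ord0 i - rect_lo K ord0 i by exact: bigmin_le.
  have := zd i; rewrite mxE subr0 ltr_norml => /andP[z1 z2].
  rewrite yE mxE; case: eqP => [->|ne].
    by rewrite mulr1; split => [/andP[h1 h2]|h]; [|apply/andP; split]; lra.
  have -> : y0 ord0 i = rect_hi K ord0 i by case: (cy i) => // /ne.
  by rewrite mulrN1; split => [/andP[h1 h2]|h]; [|apply/andP; split]; lra.
by split=> [/box h i|h]; [apply/key|apply/box => i; apply/key].
Qed.

Lemma rect_compact K : compact (rect_set K).
Proof.
apply: continuous_compact; last exact: (@cbox_compact R n (fun i => rect_lo K ord0 i) (fun i => rect_hi K ord0 i)).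
by apply: continuous_subspaceT; exact: affine_continuous.
Qed.

Lemma supp_rect K m phi : (forall x, m x = (\1_(rect_set K) x)%:C * phi x) -> supp m `<=` rect_set K.
Proof.
move=> hm x; have cK := compact_closed_rV (@rect_compact K).
rewrite /supp ((closure_id _).1 cK); apply: closure_subset => y /=.
by rewrite hm indicE; apply: contraNP => nK; rewrite memNset// mul0r.
Qed.

(** If a point with some z_i <= 0 were interior to supp m, so would be a neighbour with z_i < 0,
    around which [m] vanishes. Conversely [phi] is nonzero near the corner, so [m] is nonzero on the
    whole open orthant there. *)
Lemma interior_supp_corner K m phi Q b (d : R) : Q *m Q^T = 1%:M ->
  (forall x, m x = (\1_(rect_set K) x)%:C * phi x) ->
  (forall z, cube 0 d z -> (rect_set K (z *m Q + b) <-> forall i, 0 <= z ord0 i)) ->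
  (forall z, cube 0 d z -> phi (z *m Q + b) != 0) ->
  forall z, cube 0 d z -> (interior (supp m) (z *m Q + b) <-> forall i, 0 < z ord0 i).
Proof.
move=> oQ hm hK hphi z zd.
have cT : continuous (fun z => z *m Q + b) := @affine_continuous R n n Q b.
have cS : continuous (fun x => x *m Q^T - b *m Q^T) := @affine_continuous R n n Q^T (- (b *m Q^T)).
have TK := rigidK b oQ; have SK := rigidVK b oQ.
have pull A : open A -> open [set x : 'rV[R]_n | A (x *m Q^T - b *m Q^T)] by move=> oA; exact: (open_comp (fun x _ => cS x) oA).
have f1 : true%:R = 1 :> R by [].
split=> [zD i|z0].
  rewrite ltNge; apply/negP => zi.
  pose A : set 'rV[R]_n := [set z | interior (supp m) (z *m Q + b)] `&` cube 0 d.
  have oA : open A.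
    apply: openI; last exact: open_cube.
    by apply: (open_comp (fun x _ => cT x)); exact: open_interior.
  have [e e0 zA] := open_nbhs_cube oA (conj zD zd).
  pose z' := z - (e / 2) *: delta_mx ord0 i.
  have e2 : 0 < e / 2 by rewrite divr_gt0.
  have zz' : cube z e z'.
    move=> j; have -> : z' ord0 j - z ord0 j = - (e / 2 * (j == i)%:R) by rewrite /z' !mxE /=; ring.
    rewrite normrN normrM (gtr0_norm e2); case: (j == i); rewrite ?normr1 ?normr0; lra.
  have [z'D z'd] := zA _ zz'.
  have z'i : z' ord0 i < 0 by rewrite /z' !mxE !eqxx mulr1; lra.
  pose B := cube 0 d `&` cube z' (- z' ord0 i).
  have oB : open B by apply: openI; exact: open_cube.
  have nB : nbhs (z' *m Q + b) [set x : 'rV[R]_n | B (x *m Q^T - b *m Q^T)].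
    apply: open_nbhs_nbhs; split; first exact: pull.
    by rewrite /= TK; split => //; apply: cube_center; rewrite oppr_gt0.
  have [x [mx [xd xz]]] := interior_subset z'D _ nB.
  move: mx => /=; rewrite hm indicE memNset ?mul0r ?eqxx//.
  rewrite -(SK x) => /(hK _ xd) /(_ i) h.
  have := xz i; rewrite ltr_norml => /andP[_]; lra.
pose B : set 'rV[R]_n := cube 0 d `&` [set z | forall i, [set t : R | 0 < t] (z ord0 i)].
have oB : open B.
  apply: openI; first exact: open_cube.
  by apply: (@open_coords R n (fun=> [set t : R | 0 < t])) => _; exact: open_gt.
have nB : nbhs (z *m Q + b) [set x : 'rV[R]_n | B (x *m Q^T - b *m Q^T)].
  by apply: open_nbhs_nbhs; split; [exact: pull|rewrite /= TK].
apply: filterS nB => x [xd x0]; apply: subset_closure => /=.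
rewrite hm indicE mem_set; last by rewrite -(SK x); apply/hK => // i; apply: ltW; exact: x0.
by rewrite f1 mul1r -(SK x); exact: hphi.
Qed.

End chart.

(** * The transmission system at the corner *)

Section transmission.
Context {R : realType}.
Notation leb n := (lebesgue_rV n : {measure set 'rV[R]_n -> \bar R}).
Notation Rint F := (Rintegral (leb _) setT F).
Notation Re := complex.Re.
Notation Im := complex.Im.

Lemma helmholtz_real n (A : set 'rV[R]_n) (k : R) w : helmholtz A k (fun=> 1) w (fun=> 0) ->
  weak_laplacian A (fun x => Re (w x)) (fun x => - (k ^+ 2 * Re (w x))) /\
  weak_laplacian A (fun x => Im (w x)) (fun x => - (k ^+ 2 * Im (w x))).
Proof.
move=> [h1 h2].
have e1 : (fun x => - (k ^+ 2 * Re (w x))) = fun x => Re (0 - (k ^+ 2)%:C * 1 * w x).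
  by apply/funext => x; rewrite !reim /=; ring.
have e2 : (fun x => - (k ^+ 2 * Im (w x))) = fun x => Im (0 - (k ^+ 2)%:C * 1 * w x).
  by apply/funext => x; rewrite !reim /=; ring.
by rewrite e1 e2.
Qed.

(* u1 + i u2 is the extension by zero of u, in the coordinates of the corner. *)
Lemma corner_equations n (D : set 'rV[R]_n) (Q : 'M[R]_n) (b : 'rV[R]_n) (d k : R) (u v : 'rV[R]_n -> R[i])
    (m : 'rV[R]_n -> R[i]) (q1 q2 W1 W2 : 'rV[R]_n -> R) :
  Q *m Q^T = 1%:M -> open D -> (leb n D < +oo)%E -> H20C D u ->
  helmholtz D k (fun x => 1 - m x) u (fun x => (k ^+ 2)%:C * m x * v x) ->
  cinf q1 -> cinf q2 -> cinf W1 -> cinf W2 ->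
  (forall z : 'rV[R]_n, cube 0 d z -> (D (z *m Q + b) <-> forall i, 0 < z ord0 i)) ->
  (forall z : 'rV[R]_n, cube 0 d z -> (forall i, 0 < z ord0 i) -> m (z *m Q + b) = (q1 z +i* q2 z)) ->
  {ae leb n, forall z : 'rV[R]_n, cube 0 d z -> (forall i, 0 < z ord0 i) -> v (z *m Q + b) = (W1 z +i* W2 z)} ->
  exists u1 u2 : 'rV[R]_n -> R, [/\ L1 u1, L1 u2, (forall z : 'rV[R]_n, ~ (forall i, 0 < z ord0 i) -> u1 z = 0 /\ u2 z = 0),
    (forall psi, tst (cube 0 d) psi ->
      Rint (fun z => u1 z * laplacian psi z) + k ^+ 2 *
        (Rint (fun z => u1 z * ((1 - q1 z) * psi z)) - Rint (fun z => u2 z * (- q2 z * psi z))) =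
      k ^+ 2 * Rint (fun z => pos z * ((q1 z * W1 z - q2 z * W2 z) * psi z))) &
    (forall psi, tst (cube 0 d) psi ->
      Rint (fun z => u2 z * laplacian psi z) + k ^+ 2 *
        (Rint (fun z => u2 z * ((1 - q1 z) * psi z)) + Rint (fun z => u1 z * (- q2 z * psi z))) =
      k ^+ 2 * Rint (fun z => pos z * ((q1 z * W2 z + q2 z * W1 z) * psi z)))].
Proof.
move=> oQ oD fD [hu1 hu2] [e1 e2] cq1 cq2 cW1 cW2 hD hm hv.
have [i1 j1 E1] := H20_extend oD fD hu1 e1.
have [i2 j2 E2] := H20_extend oD fD hu2 e2.
have pT := preserving_rigid b oQ.
(* The extension by zero is cut to the cube, the region where [D] is known to be the orthant; test
   functions supported in the cube do not see the cut. *)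
pose u1 z := ((fun x => Re (u x)) \_ D) (z *m Q + b) * \1_(cube 0 d) z.
pose u2 z := ((fun x => Im (u x)) \_ D) (z *m Q + b) * \1_(cube 0 d) z.
have mI : measurable_fun setT (\1_(cube 0 d) : 'rV[R]_n -> R) by apply: measurable_indic; exact: measurable_cube.
have bI (z : 'rV[R]_n) : `|\1_(cube 0 d) z : R| <= 1.
  by rewrite indicE; case: (_ \in _); rewrite ?normr1 ?normr0.
have iu1 : L1 u1 := L1_mul (integrable_preserving pT i1) mI bI.
have iu2 : L1 u2 := L1_mul (integrable_preserving pT i2) mI bI.
have u0 (z : 'rV[R]_n) : ~ (forall i, 0 < z ord0 i) -> u1 z = 0 /\ u2 z = 0.
  move=> nz; rewrite /u1 /u2 indicE; have [zd|nd] := pselect (cube 0 d z).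
    have nD : ~ D (z *m Q + b) by move=> /(hD z zd).
    by rewrite !patchE memNset// !mul0r.
  by rewrite [z \in _]memNset// !mulr0.
have f1 : true%:R = 1 :> R by [].
have uin (z : 'rV[R]_n) : cube 0 d z -> (forall i, 0 < z ord0 i) -> u1 z = Re (u (z *m Q + b)) /\ u2 z = Im (u (z *m Q + b)).
  move=> zd z0; have Dz := (hD z zd).2 z0.
  by rewrite /u1 /u2 indicE [z \in _]mem_set// f1 !mulr1 !patchE mem_set.
have lap (f : 'rV[R]_n -> R) psi : tst (cube 0 d) psi ->
    Rint (fun z => (f \_ D) (z *m Q + b) * \1_(cube 0 d) z * laplacian psi z) =
    Rint (fun z => (f \_ D) (z *m Q + b) * laplacian psi z).
  move=> tp; apply: eq_Rintegral => z _; rewrite indicE; have [zd|nd] := pselect (cube 0 d z).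
    by rewrite [z \in _]mem_set// f1 mulr1.
  by rewrite (tst_out (tst_laplacian tp) nd) !mulr0.
(* Shared by both parts: [G] is the right-hand side of the equation for [u], [F] the real or
   imaginary part of q W, and [h] the same part of (1 - q) u. *)
have main (h G : 'rV[R]_n -> R) F psi : tst (cube 0 d) psi -> cinf F -> L1 (fun z => h z * psi z) -> L1 (G \_ D) ->
    (forall z : 'rV[R]_n, ~ (forall i, 0 < z ord0 i) -> h z = 0) ->
    {ae leb n, forall z : 'rV[R]_n, cube 0 d z -> (forall i, 0 < z ord0 i) -> G (z *m Q + b) = k ^+ 2 * (F z - h z)} ->
    Rint (fun z => (G \_ D) (z *m Q + b) * psi z) =
    k ^+ 2 * (Rint (fun z => pos z * (F z * psi z)) - Rint (fun z => h z * psi z)).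
  move=> tp cF ih iG h0 hG.
  have tF : tst (cube 0 d) (fun z => F z * psi z).
    by have := tst_mul tp cF; congr tst; apply/funext => z; rewrite mulrC.
  have p1 := pos_L1 tF.
  rewrite -RintB// -RintZ; last exact: L1B.
  apply: ae_Rint.
  - exact: L1_measurable (L1_tst (integrable_preserving pT iG) tp).
  - by apply: L1_measurable; apply: L1Z; exact: L1B.
  apply: filterS hG => z hz; have [zd|nd] := pselect (cube 0 d z); last first.
    by rewrite (tst_out tp nd) !mulr0 subr0 mulr0.
  rewrite /pos indicE; have [z0|nz] := pselect (forall i, 0 < z ord0 i).
    rewrite [z \in _]mem_set// f1 patchE mem_set; last exact/hD.
    by rewrite hz//; ring.
  by rewrite [z \in _]memNset// h0// patchE memNset ?mul0r ?subr0 ?mulr0// => /(hD z zd).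
have tm (psi g : 'rV[R]_n -> R) : tst (cube 0 d) psi -> cinf g -> tst (cube 0 d) (fun z => g z * psi z).
  by move=> tp cg; have := tst_mul tp cg; congr tst; apply/funext => z; rewrite mulrC.
have cp1 : cinf (fun z => 1 - q1 z) := smoothB (@smooth_cst _ _ 1) cq1.
have cp2 : cinf (fun z => - q2 z) := smoothN cq2.
exists u1, u2; split => // psi tp.
- have l1 := L1_tst iu1 (tm _ _ tp cp1); have l2 := L1_tst iu2 (tm _ _ tp cp2).
  rewrite (lap (fun x => Re (u x)) psi tp) (weak_rigid b oQ i1 j1 E1 tp).
  rewrite (main (fun z => u1 z * (1 - q1 z) - u2 z * (- q2 z)) _ (fun z => q1 z * W1 z - q2 z * W2 z) psi tp).
  + rewrite -(RintB l1 l2) mulrBr; set X := Rint (fun z => _ * psi z); set Y := Rint (fun z => _ - _).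
    have -> : X = Y by apply: eq_Rintegral => z _; ring.
    by rewrite subrK.
  + exact: smoothB (smoothM cq1 cW1) (smoothM cq2 cW2).
  + by have := L1B l1 l2; congr L1; apply/funext => z; ring.
  + exact: j1.
  + by move=> z /u0[-> ->]; rewrite !mul0r subrr.
  apply: filterS hv => z hz zd z0; have [-> ->] := uin z zd z0.
  by rewrite (hm z zd z0) (hz zd z0) !reim /=; ring.
have l1 := L1_tst iu2 (tm _ _ tp cp1); have l2 := L1_tst iu1 (tm _ _ tp cp2).
rewrite (lap (fun x => Im (u x)) psi tp) (weak_rigid b oQ i2 j2 E2 tp).
rewrite (main (fun z => u2 z * (1 - q1 z) + u1 z * (- q2 z)) _ (fun z => q1 z * W2 z + q2 z * W1 z) psi tp).
- rewrite -(RintD l1 l2) mulrBr; set X := Rint (fun z => _ * psi z); set Y := Rint (fun z => _ + _).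
  have -> : X = Y by apply: eq_Rintegral => z _; ring.
  by rewrite subrK.
- exact: smoothD (smoothM cq1 cW2) (smoothM cq2 cW1).
- by have := L1D l1 l2; congr L1; apply/funext => z; ring.
- exact: j2.
- by move=> z /u0[-> ->]; rewrite !mul0r addr0.
apply: filterS hv => z hz zd z0; have [-> ->] := uin z zd z0.
by rewrite (hm z zd z0) (hz zd z0) !reim /=; ring.
Qed.

End transmission.

Theorem theorem3p1 (R : realType) (n : nat) (k : R) (K : rectangle R n)
  (x0 : 'rV[R]_n) (phi m u v : 'rV[R]_n -> R[i])
  (hk : k != 0)
  (hn : (2 <= n)%N)
  (hphi : smoothC phi)
  (hx0 : corner K x0)
  (hphix0 : phi x0 != 0)
  (hm : forall x, m x = (\1_(rect_set K) x)%:C * phi x)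
  (huv : transmission_eigenfunctions k m (supp m) u v) :
  ~ exists (U : set 'rV[R]_n) (w : 'rV[R]_n -> R[i]),
      [/\ open U, U x0,
          helmholtz U k (fun=> 1) w (fun=> 0) &
          ae_eq_on (U `&` interior (supp m)) w v].
Proof.
(* The dimension becomes n + 2, which provides the two coordinates transverse to the edge. *)
case: n => [//|[//|n]] in K x0 phi m u v hn hphi hx0 hphix0 hm huv *.
move=> [U [w [oU Ux0 hw hwv]]].
have [hu _ hv hHu [_ ntv]] := huv.
set D := interior (supp m) in hu hv hHu ntv hwv.
have oD : open D := @open_interior _ (supp m).
have cK := @rect_compact R n.+2 K.
have sD : D `<=` rect_set K by apply: subset_trans (supp_rect hm); exact: interior_subset.
have fD : (lebesgue_rV n.+2 D < +oo :> \bar R)%E.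
  apply: le_lt_trans (compact_lt_pinfty cK); apply: le_measure => //; rewrite inE.
    exact: open_measurable_rV.
  exact: compact_measurable_rV.
have cphi1 : cinf (fun x => complex.Re (phi x)) by have [/Cinf] := hphi.
have cphi2 : cinf (fun x => complex.Im (phi x)) by have [_ /Cinf] := hphi.
have [Q [d0 [oQ d00 hK0]]] := corner_chart hx0.
pose T (z : 'rV[R]_n.+2) := z *m Q + x0.
have cT : continuous T := @affine_continuous R n.+2 n.+2 Q x0.
have T0 : T 0 = x0 by rewrite /T mul0mx add0r.
have [hw1 hw2] := helmholtz_real hw.
(* The two parts of [w] get smooth representatives, each on its own cube about the corner. *)
have [r1 r10 [V1 [_ cV1 sV1 wV1]]] := weak_laplacian_rep hw1 Ux0.
have [r2 r20 [V2 [_ cV2 sV2 wV2]]] := weak_laplacian_rep hw2 Ux0.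
have nphi : nbhs x0 [set x | phi x != 0].
  have nz (f : 'rV[R]_n.+2 -> R) : cinf f -> f x0 != 0 -> nbhs x0 [set x | f x != 0].
    move=> cf f0; apply: open_nbhs_nbhs; split => //.
    have cf' := cinf_continuous cf.
    apply: (@open_comp _ _ f [set t : R | t != 0]); first by move=> x _; exact: cf'.
    exact: open_neq.
  case: (eqVneq (complex.Re (phi x0)) 0) => [re0|re0]; last first.
    by apply: filterS (nz _ cphi1 re0) => x /=; apply: contra_neq => ->.
  have im0 : complex.Im (phi x0) != 0.
    by apply: contra_neq hphix0 => im0; apply: complex_ext.
  by apply: filterS (nz _ cphi2 im0) => x /=; apply: contra_neq => ->.
have nbx x r : 0 < r -> nbhs x (cube x r).
  by move=> r0; apply: open_nbhs_nbhs; split; [exact: open_cube|exact: cube_center].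
(* [d] is small enough that the chart sees only the corner, that [phi] stays nonzero, and that
   points stay in [U] and where both representatives are valid. *)
have [d d_gt0 hd] : exists2 d : R, 0 < d & cube 0 d `<=` cube 0 d0 `&` (T @^-1` ([set x | phi x != 0] `&` U `&` cube x0 r1 `&` cube x0 r2)).
  apply: nbhs_cube; apply: filterI; first exact: nbx.
  by apply: cT; rewrite T0; do 3 (apply: filterI; last by [exact: nbx|exact: open_nbhs_nbhs]).
have hK z : cube 0 d z -> (rect_set K (T z) <-> forall i, 0 <= z ord0 i) by move=> /hd[zd _]; exact: hK0.
have hph z : cube 0 d z -> phi (T z) != 0 by move=> /hd[_ [[[]]]].
have hD := interior_supp_corner oQ hm hK hph.
pose q1 z := complex.Re (phi (T z)); pose q2 z := complex.Im (phi (T z)).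
pose W1 z := V1 (T z); pose W2 z := V2 (T z).
have cq1 : cinf q1 := smooth_affine Q x0 cphi1.
have cq2 : cinf q2 := smooth_affine Q x0 cphi2.
have cW1 : cinf W1 := smooth_affine Q x0 cV1.
have cW2 : cinf W2 := smooth_affine Q x0 cV2.
have sW1 : csol (cube 0 d) (k ^+ 2) W1.
  by apply: csol_sub (csol_rigid oQ cV1 sV1) => z /hd[_ [[_]]].
have sW2 : csol (cube 0 d) (k ^+ 2) W2.
  by apply: csol_sub (csol_rigid oQ cV2 sV2) => z /hd[_ []].
(* Inside the support [v] agrees almost everywhere with [w], hence with the smooth
   representatives. *)
have vV : {ae (lebesgue_rV n.+2 : {measure set 'rV[R]_n.+2 -> \bar R}), forall x,
    U x -> cube x0 r1 x -> cube x0 r2 x -> D x -> v x = V1 x +i* V2 x}.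
  apply: filterS3 hwv wV1 wV2 => x h h1 h2 Ux x1 x2 Dx.
  by rewrite -(h (conj Ux Dx)); apply: complex_ext; [exact: h1|exact: h2].
have vW : {ae (lebesgue_rV n.+2 : {measure set 'rV[R]_n.+2 -> \bar R}), forall z : 'rV[R]_n.+2,
    cube 0 d z -> (forall i, 0 < z ord0 i) -> v (T z) = W1 z +i* W2 z}.
  apply: filterS (ae_preserving (preserving_rigid x0 oQ) vV) => z h zd z0.
  by have [_ [[[_ Uz] z1] z2]] := hd _ zd; apply: h => //; exact/hD.
have mq z : cube 0 d z -> (forall i, 0 < z ord0 i) -> m (T z) = q1 z +i* q2 z.
  move=> zd z0; rewrite hm indicE mem_set; last by apply/hK => // i; exact: ltW.
  by have f1 : true%:R = 1 :> R; rewrite ?f1 ?mul1r //; apply: complex_ext.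
have [u1 [u2 [iu1 iu2 u0 H1 H2]]] :=
  corner_equations oQ oD fD hu hHu cq1 cq2 cW1 cW2 hD mq vW.
have q0 z : cube 0 d z -> q1 z +i* q2 z != 0.
  move=> zd; have -> : q1 z +i* q2 z = phi (T z) by apply: complex_ext.
  exact: hph.
have flat := corner_flat d_gt0 hk iu1 iu2 cq1 cq2 cW1 cW2 sW1 sW2 u0 q0 H1 H2.
have [c [r [r0 hc vc]]] := @flat_vanish R n d d_gt0.
have Z1 := vc k W1 cW1 sW1 (fun N => (flat N).1).
have Z2 := vc k W2 cW2 sW2 (fun N => (flat N).2).
pose S x : 'rV[R]_n.+2 := x *m Q^T - x0 *m Q^T.
have cS : continuous S := @affine_continuous R n.+2 n.+2 Q^T (- (x0 *m Q^T)).
have ST : cancel T S := rigidK x0 oQ.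
have TS : cancel S T := rigidVK x0 oQ.
have crd z : cube c r z -> cube 0 d z.
  by move=> zc i; rewrite mxE subr0; have /andP[h1 h2] := hc z zc i; rewrite gtr0_norm.
have Dc z : cube c r z -> D (T z).
  by move=> zc; apply/hD; [exact: crd|move=> i; have /andP[] := hc z zc i].
have [s s0 hs] : exists2 s : R, 0 < s & cube (T c) s `<=` S @^-1` (cube c r).
  by apply: nbhs_cube; apply: cS; rewrite ST; exact: nbx.
(* Both representatives vanish on an open cube of the orthant, hence so does [v] almost everywhere
   near the image of its centre. *)
have v0 : {ae (lebesgue_rV n.+2 : {measure set 'rV[R]_n.+2 -> \bar R}), forall x, cube (T c) s x -> v x = 0}.
  apply: filterS vV => x h xc; have Sx := hs _ xc.
  have [_ [[[_ Ux] x1] x2]] := hd _ (crd _ Sx); rewrite TS in Ux x1 x2.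
  have Dx : D x by rewrite -(TS x); exact: Dc.
  rewrite (h Ux x1 x2 Dx); apply: complex_ext => /=.
    by rewrite -(TS x); exact: Z1.
  by rewrite -(TS x); exact: Z2.
have [hv1 hv2] := helmholtz_real hv.
have DTc : D (T c) by apply: Dc; exact: cube_center.
(* Nontriviality is contradicted on the component of [T c], an interior point of supp m near the
   corner. *)
apply: (ntv _ DTc).
have a1 : {ae (lebesgue_rV n.+2 : {measure set 'rV[R]_n.+2 -> \bar R}), forall x, cube (T c) s x -> complex.Re (v x) = 0}.
  by apply: filterS v0 => x h /h ->.
have a2 : {ae (lebesgue_rV n.+2 : {measure set 'rV[R]_n.+2 -> \bar R}), forall x, cube (T c) s x -> complex.Im (v x) = 0}.
  by apply: filterS v0 => x h /h ->.
apply: filterS2 (weak_unique_continuation hv1 s0 a1) (weak_unique_continuation hv2 s0 a2).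
by move=> x h1 h2 Cx; apply: complex_ext; [exact: h1|exact: h2].
Qed.
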